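(* Let $G$ be a fullerene graph on $n$ vertices, and let $\tau_{\mathrm{odd}}(G)$ denote the minimum number of edges whose removal from $G$ results in a bipartite graph. Then $\tau_{\mathrm{odd}}(G) \leq \sqrt{\tfrac{12}{5}n}$. Moreover, equality holds if and only if $n = 60k^2$ for some positive integer $k$ and the automorphism group $\mathrm{Aut}(G)$ is isomorphic to the full icosahedral group $I_h$.
   Context: A fullerene graph is a cubic, bridgeless, plane graph (simple, with a fixed planar embedding) all of whose faces have size $5$ or $6$. $\mathrm{Aut}(G)$ is the group of permutations of $V(G)$ preserving adjacency. The full icosahedral group $I_h \cong A_5 \times C_2$ is the group of all symmetries (including reflections) of the regular icosahedron. *)

(* Defs.v *)
From mathcomp Require Import all_boot all_order all_algebra all_fingroup all_solvable algC.
From mathcomp Require Import alt.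
Set Implicit Arguments. Unset Strict Implicit. Unset Printing Implicit Defensive.

Section Graphs.
Variable V : finType.
Variable adj : rel V.

Definition simple_graph := irreflexive adj /\ symmetric adj.

Definition edges : {set {set V}} :=
  [set e : {set V} | [exists u, exists v, adj u v && (e == [set u; v])]].

Definition cubic := forall u : V, #|[set v | adj u v]| = 3.

Definition connected_graph := forall u v : V, connect adj u v.

Definition bridgeless := forall u v : V, adj u v ->
  connect [rel x y | adj x y && ([set x; y] != [set u; v])] u v.

Definition arc := {p : V * V | adj p.1 p.2}.

(* reversal of an arc (correct when adj is symmetric) *)
Definition arc_rev (a : arc) : arc := insubd a ((val a).2, (val a).1).

Definition rotation_system (rho : {perm arc}) :=
  forall a b : arc, (val b).1 = (val a).1 <-> fconnect rho a b.

(* face-tracing permutation: follow an arc and turn at its head *)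
Definition face_perm (rho : {perm arc}) (a : arc) : arc := rho (arc_rev a).

Definition face_of (rho : {perm arc}) (a : arc) : {set arc} :=
  [set b | fconnect (face_perm rho) a b].

Definition faces (rho : {perm arc}) : {set {set arc}} :=
  [set face_of rho a | a : arc].

Definition face_size (rho : {perm arc}) (a : arc) : nat :=
  fingraph.order (face_perm rho) a.

(* a rotation system of a connected graph is a plane (spherical) embedding
   iff Euler's formula V - E + F = 2 holds *)
Definition plane_embedding (rho : {perm arc}) :=
  rotation_system rho /\ #|V| + #|faces rho| = #|edges| + 2.

Definition fullerene :=
  [/\ simple_graph, cubic, connected_graph, bridgeless &
      exists rho : {perm arc}, plane_embedding rho /\
        forall a : arc, face_size rho a = 5 \/ face_size rho a = 6].

Definition bipartite_minus (F : {set {set V}}) : bool :=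
  [exists c : {ffun V -> bool}, [forall u, forall v,
     (adj u v && ([set u; v] \notin F)) ==> (c u != c v)]].

Definition tau_odd : nat :=
  \big[minn/#|edges|]_(F in powerset edges | bipartite_minus F) #|F|.

Definition Aut_graph : {set {perm V}} :=
  [set p : {perm V} | [forall u, forall v, adj (p u) (p v) == adj u v]].

End Graphs.

Definition Ih : {set {perm 'I_5} * 'Z_2} := setX (Alt 'I_5) [set: 'Z_2].

(* Main.v *)
From mathcomp Require Import all_boot all_order all_algebra all_fingroup all_solvable algC zify.
Require Import Defs.
Set Implicit Arguments. Unset Strict Implicit. Unset Printing Implicit Defensive.

(* In the dual triangulation, whose vertices are the faces, an edge set of the fullerene makes it bipartite on removal iff it
   is a join of the 12 pentagons (Euler's formula identifies even edge sets with cuts). Subdivide every edge: a minimum join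
   has 2 tau darts and, the subdivided graph being bipartite, it is matched by a laminar packing of 2 tau disjoint odd cuts
   (Seymour; the proof contracts a star, after Sebo). Replace each cut by its side with at most 5 pentagons. A region with
   k <= 5 pentagons and b boundary triangles has at most b^2 / (6 - k) triangles, by peeling off layers; a nested family of s
   regions therefore covers an area of at least 5 s^2 / k cells. The regions around the 12 pentagons are disjoint and there
   are 4 n cells, so Cauchy's inequality gives 5 (2 tau)^2 <= 12 * 4 n.

   In case of equality n = 60 k^2, every region contains one pentagon and each pentagon is surrounded by 2 k of them. They
   are the balls of radius < k, so the sphere is tiled by 12 hexagonal discs with one sector removed. Around a point of the
   common boundary of several discs the angles force sides to match sides, hence the position of a dart relative to the
   pentagons is defined in Z^2 modulo the lattice k sqrt(-3) Z[omega]. Two darts of pentagons define a component of the product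
   of the map with itself, where positions agree; it is an unbranched covering of the sphere, so Euler's formula makes it the
   graph of an automorphism. The same argument with the Cayley map of A5 identifies the rotation group, and
   one of the reflections is a central inversion.

   Conversely, automorphisms of the graph preserve faces because a bond of at most 6 edges in the dual isolates a single
   face, so a group of order 120 is simply transitive on the flags at pentagons. The quotient of the map by the rotations
   is a quotient of the hexagonal lattice by a sublattice of index 3 k^2 with full dihedral symmetry, which must be k sqrt(-3) Z[omega]. So
   balls of radius < k around the pentagons contain no other pentagon, and their boundaries are 24 k disjoint odd cuts. *)

(** * Joins and cuts in graphs *)

(** No topology of the sphere is used: counting plays the role of the Jordan curve theorem. A
    connected set of w vertices with m inner edges carries at most 2^(m-w+1) even edge sets. Applied
    to cuts of the graph inside its dual, this bounds Euler characteristics of regions, underlies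
    the exactness of cuts and even sets, and gives the genus inequality behind the coverings.
    Curvature enters through Gauss-Bonnet, nA - nB = 6 chi - k, whence the factor 6 - k; regions
    hold an odd number k of pentagons, and k (6 - k) >= 5 for k = 1, 3, 5 is the origin of the
    constant 5. Subdivision also has a metric purpose: each cut of the packing has its inner ends of
    one colour, so a region ends either at faces or at midpoints, and cuts without a common edge are
    separated by a full layer of cells, four to a triangle. The equality case has to recover
    geometry from numbers alone. For this the isoperimetric inequality is made strict for two or
    more pentagons, and its equality for one pentagon fixes the size of every ball, which excludes
    any irregularity of the layers. *)

Section SymDiff.
Variable T : finType.
Implicit Types A B C : {set T}.

Definition symd A B : {set T} := [set x | (x \in A) (+) (x \in B)].

Lemma in_symd A B x : (x \in symd A B) = (x \in A) (+) (x \in B).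
Proof. by rewrite inE. Qed.

Lemma symdA A B C : symd A (symd B C) = symd (symd A B) C.
Proof. by apply/setP=> x; rewrite !in_symd addbA. Qed.

Lemma symdC A B : symd A B = symd B A.
Proof. by apply/setP=> x; rewrite !in_symd addbC. Qed.

Lemma symdK A B : symd A (symd A B) = B.
Proof. by apply/setP=> x; rewrite !in_symd addKb. Qed.

Lemma symdv A : symd A A = set0.
Proof. by apply/setP=> x; rewrite in_symd addbb inE. Qed.

Lemma symd0 A : symd A set0 = A.
Proof. by apply/setP=> x; rewrite in_symd inE addbF. Qed.

Lemma card_symd A B : #|symd A B| + (#|A :&: B|).*2 = #|A| + #|B|.
Proof.
have -> : symd A B = (A :\: B) :|: (B :\: A).
  by apply/setP=> x; rewrite in_symd !inE; case: (x \in A); case: (x \in B).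
have h : [disjoint A :\: B & B :\: A].
  rewrite -setI_eq0; apply/eqP/setP=> x.
  by rewrite !inE; case: (x \in A); case: (x \in B).
rewrite (eqP (_ : #|A :\: B :|: (B :\: A)| == #|A :\: B| + #|B :\: A|)); last first.
  by rewrite (leq_card_setU _ _).
have := cardsID B A; have := cardsID A B; rewrite (setIC B A) => <- <-.
rewrite -addnn; lia.
Qed.

Lemma odd_symd A B : odd #|symd A B| = odd #|A| (+) odd #|B|.
Proof. by have := congr1 odd (card_symd A B); rewrite !oddD odd_double addbF. Qed.

Lemma odd_card_big A : odd #|A| = \big[addb/false]_(x in A) true.
Proof.
rewrite -sum1_card (big_morph odd oddD (erefl : odd 0 = false)).
by apply: eq_bigr.
Qed.

Lemma set_other A u : 1 < #|A| -> exists v, v \in A :\ u.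
Proof.
move=> h; apply/set0Pn; rewrite -cards_eq0.
by have := cardsD1 u A; case: (u \in A); lia.
Qed.

End SymDiff.

Section Graph.
Variables (W E : finType) (s t : E -> W).
Implicit Types (X Y S T : {set W}) (K J Q : {set E}) (x y u v w b : W) (g : E).

Definition inc g w := (s g == w) (+) (t g == w).
Definition bd K w := \big[addb/false]_g ((g \in K) && inc g w).
Definition cut X g := (s g \in X) (+) (t g \in X).
Definition within X g := (s g \in X) && (t g \in X).
(** Connectedness of the induced subgraph, phrased by cuts instead of paths, which suits
    contractions, complements and hulls. *)
Definition cset X := forall S, S \subset X -> S != set0 -> S != X ->
  exists2 g, cut S g & within X g.
Definition isj K T := [forall w, bd K w == (w \in T)].

Lemma isjP K T : reflect (forall w, bd K w = (w \in T)) (isj K T).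
Proof. by apply: (iffP forallP) => h w; apply/eqP. Qed.

Lemma bd_symd K J w : bd (symd K J) w = bd K w (+) bd J w.
Proof.
rewrite /bd -big_split; apply: eq_bigr => g _ /=.
by rewrite in_symd andb_addl.
Qed.

Lemma isj_symd K J S T : isj K S -> isj J T -> isj (symd K J) (symd S T).
Proof. by move=> /isjP h1 /isjP h2; apply/isjP=> w; rewrite bd_symd in_symd h1 h2. Qed.

Lemma bd0 w : bd set0 w = false.
Proof. by rewrite /bd big1 // => g _; rewrite inE. Qed.

Lemma bd1 g w : bd [set g] w = inc g w.
Proof.
rewrite /bd (bigD1 g) //= inE eqxx /= big1 ?addbF // => h /negbTE.
by rewrite inE => ->.
Qed.

Lemma isj1 g : isj [set g] (symd [set s g] [set t g]).
Proof. by apply/isjP=> w; rewrite bd1 in_symd !inE /inc ![_ == w]eq_sym. Qed.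

Lemma big_inc X g : \big[addb/false]_(w in X) inc g w = cut X g.
Proof.
rewrite /inc big_split /=; congr (_ (+) _);
rewrite big_mkcond /=.
- rewrite (bigD1 (s g)) //= eqxx big1 ?addbF; first by case: (_ \in _).
  by move=> w /negbTE; rewrite eq_sym => ->; case: ifP.
- rewrite (bigD1 (t g)) //= eqxx big1 ?addbF; first by case: (_ \in _).
  by move=> w /negbTE; rewrite eq_sym => ->; case: ifP.
Qed.

Lemma bd_cut K X :
  \big[addb/false]_(w in X) bd K w = odd #|[set g in K | cut X g]|.
Proof.
rewrite odd_card_big /bd exchange_big /= [RHS]big_mkcond; apply: eq_bigr => g _.
rewrite inE; case: (g \in K) => /=; last by rewrite big1.
by rewrite -big_inc; case: (\big[_/_]_(_ in _) _).
Qed.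

Lemma isj_cut K T X : isj K T -> odd #|[set g in K | cut X g]| = odd #|X :&: T|.
Proof.
move=> /isjP h; rewrite -bd_cut odd_card_big big_mkcond [RHS]big_mkcond /=.
by apply: eq_bigr => w _; rewrite h inE; case: (w \in X); case: (w \in T).
Qed.

Lemma isj_even K T : isj K T -> ~~ odd #|T|.
Proof.
move=> h; rewrite -(setTI T) -(isj_cut setT h).
have -> : [set g in K | cut setT g] = set0 by apply/setP=> g; rewrite !inE /cut !inE andbF.
by rewrite cards0.
Qed.

Lemma cut_setC X g : cut (~: X) g = cut X g.
Proof. by rewrite /cut !inE; case: (_ \in X); case: (_ \in X). Qed.

(** The vertices of [X] that can be joined to [u] form a set left by no edge within [X]. *)
Lemma cset_join2 X u v : cset X -> u \in X -> v \in X ->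
  exists2 K, isj K (symd [set u] [set v]) & {in K, forall g, within X g}.
Proof.
move=> cX uX vX.
pose R := [set w in X | [exists K : {set E}, isj K (symd [set u] [set w]) && [forall g in K, within X g]]].
have [eR|nR] := eqVneq R X.
  have : v \in R by rewrite eR.
  rewrite inE => /andP[_ /existsP[K /andP[h1 /forall_inP h2]]].
  by exists K.
have sR : R \subset X by apply/subsetP=> w; rewrite inE => /andP[].
have uR : u \in R.
  rewrite inE uX /=; apply/existsP; exists set0; rewrite symdv.
  by apply/andP; split; [apply/isjP=> w; rewrite bd0 inE | apply/forall_inP=> g; rewrite inE].
have R0 : R != set0 by apply/set0Pn; exists u.
have [g cg wg] := cX R sR R0 nR.
have key a c K : isj K (symd [set u] [set a]) -> symd [set a] [set c] = symd [set s g] [set t g] ->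
   isj (symd K [set g]) (symd [set u] [set c]).
  move=> h1 h2; have := isj_symd h1 (isj1 g); rewrite -h2.
  by rewrite -symdA symdK.
have fin a c : a \in R -> c \in X -> symd [set a] [set c] = symd [set s g] [set t g] -> c \in R.
  rewrite inE => /andP[aX /existsP[K /andP[h1 /forall_inP h2]]] cX' h3.
  rewrite inE cX' /=; apply/existsP; exists (symd K [set g]); rewrite (key a c) //=.
  apply/forall_inP=> h; rewrite in_symd inE; case: (eqVneq h g) => [->//|_].
  by rewrite addbF; apply: h2.
have /andP[sX tX] := wg.
move: cg; rewrite /cut; case hs: (s g \in R); case ht: (t g \in R) => //= _.
- by rewrite (fin _ _ hs tX) in ht.
- by rewrite (fin _ _ ht sX (symdC _ _)) in hs.
Qed.

Lemma cset_join X T : cset X -> T \subset X -> ~~ odd #|T| ->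
  exists2 K, isj K T & {in K, forall g, within X g}.
Proof.
move=> cX; move: {2}#|T|.+1 (ltnSn #|T|) => n; elim: n T => // n IH T ltT sT eT.
have [->|/set0Pn[u uT]] := eqVneq T set0.
  by exists set0 => [|g]; [apply/isjP=> w; rewrite bd0 inE | rewrite inE].
have [e1|/set0Pn[v]] := eqVneq (T :\ u) set0.
  by move: eT; rewrite (cardsD1 u) uT e1 cards0.
rewrite !inE => /andP[vu vT].
have e2 : symd T (symd [set u] [set v]) = T :\ u :\ v.
  apply/setP=> w; rewrite !in_symd !inE.
  case: (eqVneq w u) => [->|_]; first by rewrite uT eq_sym (negbTE vu).
  by case: (eqVneq w v) => [->|_]; rewrite ?vT ?addbF.
have c2 : #|T| = (#|T :\ u :\ v|).+2.
  by rewrite (cardsD1 u) uT (cardsD1 v (T :\ u)) !inE vu vT.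
have sT' : T :\ u :\ v \subset X.
  by apply: subset_trans sT; rewrite !subDset; apply/subsetP=> w wT; rewrite !inE wT !orbT.
have h1 : #|T :\ u :\ v| < n by lia.
have h2 : ~~ odd #|T :\ u :\ v| by move: eT; rewrite c2 /= negbK.
have [K hK wK] := IH _ h1 sT' h2.
have [Q hQ wQ] := cset_join2 cX (subsetP sT _ uT) (subsetP sT _ vT).
exists (symd K Q).
  have := isj_symd hK hQ; rewrite -e2 -symdA symdv symd0 //.
move=> g; rewrite in_symd; case gK: (g \in K); first by move=> _; apply: wK.
by rewrite addFb; apply: wQ.
Qed.

(* A maximal trail of K starting at u can only get stuck at another odd vertex. *)
Lemma join_trail K T u : isj K T -> u \in T ->
  exists v Q, [/\ v \in T, v != u, Q \subset K & isj Q (symd [set u] [set v])].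
Proof.
move=> /isjP hK uT.
pose P (p : {set E} * W) := (p.1 \subset K) && isj p.1 (symd [set u] [set p.2]).
have P0 : P (set0, u).
  by rewrite /P sub0set symdv; apply/isjP=> w; rewrite bd0 inE.
case: (arg_maxnP (fun p : {set E} * W => #|p.1|) P0) => [[Q v]] /= /andP[/= sQ hQ] mx.
have main : (bd K v != bd Q v) -> False.
  move=> hne.
  have : bd (symd K Q) v by rewrite bd_symd; move: hne; case: (bd K v); case: (bd Q v).
  have [/existsP[g]|] := boolP [exists g, (g \in symd K Q) && inc g v]; last first.
    rewrite negb_exists => /forallP h; rewrite /bd big1 // => g _.
    exact: negbTE (h g).
  case/andP; rewrite in_symd => gK gv _.
  have gQ : g \notin Q.
    apply/negP=> gQ; move: gK; rewrite gQ (subsetP sQ _ gQ) //.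
  move: gK; rewrite (negbTE gQ) addbF => gK.
  pose z := if s g == v then t g else s g.
  have e1 : symd [set v] [set z] = symd [set s g] [set t g].
    rewrite /z; move: gv; rewrite /inc; case: eqP => [->//|_]; case: eqP => [-> _|//].
    exact: symdC.
  have := mx (g |: Q, z); rewrite /P /= cardsU1 gQ => /(_ _).
  suff -> : (g |: Q \subset K) && isj (g |: Q) (symd [set u] [set z]) by move=> /(_ isT); lia.
  rewrite subUset sub1set gK sQ /=.
  have -> : g |: Q = symd Q [set g].
    by apply/setP=> h; rewrite in_symd !inE; case: (eqVneq h g) => [->|_]; rewrite ?(negbTE gQ) ?addbF.
  by have := isj_symd hQ (isj1 g); rewrite -e1 -symdA symdK.
exists v, Q; split=> //.
- apply/negPn/negP=> vT; apply: main; move/isjP: hQ => ->; rewrite hK (negbTE vT) in_symd !inE eqxx.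
  by case: (eqVneq v u) => // e; rewrite e uT in vT.
- apply/eqP=> e; apply: main; move/isjP: hQ => ->; rewrite hK e uT in_symd !inE eqxx //.
Qed.

(** A dimension count for the boundary map: its kernel contains [F], and its image contains all even
    subsets of [X], of which there are 2^(|X|-1). Adding to a member of [F] a chosen join of each
    even vertex set is injective, because the boundary of the sum recovers the vertex set. *)
Lemma card_even_sets X w0 (F : {set {set E}}) : cset X -> w0 \in X ->
  (forall K, K \in F -> K \subset [set g | within X g] /\ isj K set0) ->
  #|F| * 2 ^ #|X|.-1 <= 2 ^ #|[set g | within X g]|.
Proof.
move=> cX wX hF.
(* Subsets of [X :\ w0] parametrise the even subsets of [X]; [w0] corrects the parity. *)
pose ev (U : {set W}) := if odd #|U| then w0 |: U else U.
pose P (U : {set W}) := [pred K : {set E} | isj K (ev U) && (K \subset [set g | within X g])].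
pose j U := odflt set0 [pick K in P U].
have hj U : U \in powerset (X :\ w0) -> P U (j U).
  rewrite inE => sU; rewrite /j; case: pickP => //= no.
  have wU : w0 \notin U by apply/negP=> /(subsetP sU); rewrite !inE eqxx.
  have sUX : U \subset X by apply: subset_trans sU (subD1set _ _).
  have sE : ev U \subset X by rewrite /ev; case: ifP => // _; rewrite subUset sub1set wX.
  have eE : ~~ odd #|ev U|.
    by rewrite /ev; case: ifP => [o|->//]; rewrite cardsU1 wU /= o.
  have [K hK wK] := cset_join cX sE eE.
  have := no K; rewrite !inE hK /=; case: subsetP => // h; case: h => g /wK.
  by rewrite inE.
have -> : #|X|.-1 = #|X :\ w0| by rewrite (cardsD1 w0 X) wX.
rewrite -!card_powerset -cardsX.
have inj : {in setX F (powerset (X :\ w0)) &, injective (fun p => symd p.1 (j p.2))}.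
  move=> [K1 U1] [K2 U2]; rewrite !in_setX => /andP[/= h1 u1] /andP[h2 u2] /= e.
  have /andP[/= j1 _] := hj _ u1; have /andP[/= j2 _] := hj _ u2.
  have [_ b1] := hF _ h1; have [_ b2] := hF _ h2.
  have eU : ev U1 = ev U2.
    apply/setP=> w; have /isjP/(_ w) p1 := isj_symd b1 j1; have /isjP/(_ w) p2 := isj_symd b2 j2.
    by move: p1; rewrite e p2 !in_symd !in_set0 !addFb => ->.
  have e12 : U1 = U2.
    have dd U : U \in powerset (X :\ w0) -> ev U :\ w0 = U.
      rewrite inE => sU; have wU : w0 \notin U by apply/negP=> /(subsetP sU); rewrite !inE eqxx.
      rewrite /ev; case: ifP => _; apply/setP=> w; rewrite !inE; case: eqVneq => [->|] //=; by rewrite (negbTE wU).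
    by rewrite -(dd _ u1) -(dd _ u2) eU.
  by move: e; rewrite e12 => e; congr (_, _); rewrite -(symdK (j U2) K1) (symdC (j U2) K1) e (symdC K2) symdK.
rewrite -(card_in_imset inj); apply: subset_leq_card; apply/subsetP=> Z /imsetP[[K U]].
rewrite in_setX => /andP[/= /hF[sK _] /hj /andP[/= _ sj]] ->.
rewrite inE; apply/subsetP=> g; rewrite in_symd; case gK: (g \in K).
  by move=> _; apply: (subsetP sK).
by rewrite addFb; apply: (subsetP sj).
Qed.

Definition lam X Y := [|| X \subset Y, Y \subset X | [disjoint X & Y]].
Definition nocom X Y := [forall g, ~~ (cut X g && cut Y g)].
(** Every edge leaving [X] starts in [X] at a vertex of colour [c]. In the subdivided dual this
    decides whether a region ends at faces or at midpoints. *)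
Definition ucol (col : W -> bool) X c := forall g,
  (s g \in X -> t g \notin X -> col (s g) = c) /\ (t g \in X -> s g \notin X -> col (t g) = c).

(** A join meets every odd cut, and cuts without common edges are met in different edges. *)
Lemma weak_duality K T (l : seq {set W}) : isj K T ->
  {in l, forall X, odd #|X :&: T|} -> pairwise nocom l -> size l <= #|K|.
Proof.
move=> hK odd_l dl.
have : \sum_(X <- l) #|[set g in K | cut X g]| <= #|K|.
  have -> : \sum_(X <- l) #|[set g in K | cut X g]| = \sum_(g in K) count (fun X => cut X g) l.
    under eq_bigr => X _ do rewrite -sum1_card big_mkcond /=.
    rewrite exchange_big /= [RHS]big_mkcond; apply: eq_bigr => g _.
    rewrite -sum1_count [in RHS]big_mkcond.
    case gK: (g \in K); last by rewrite big1 // => X _; rewrite inE gK.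
    by apply: eq_bigr => X _; rewrite inE gK.
  rewrite -sum1_card; apply: leq_sum => g _.
  elim: l dl {odd_l} => //= X l IH /andP[/allP hX /IH hl].
  case cX: (cut X g) => //=.
  rewrite (eq_in_count (a2 := pred0)) ?count_pred0 // => Y Yl /=.
  by have /forallP/(_ g) := hX Y Yl; rewrite cX /= => /negbTE.
apply: leq_trans; rewrite -sum1_size big_seq [X in _ <= X]big_seq.
apply: leq_sum => X Xl; have := isj_cut X hK; rewrite odd_l // => h.
by case: (#|_|) h.
Qed.

End Graph.

(** * Packing odd cuts *)

Section Fibers.
Variables (W W' : finType) (q : W -> W').
Definition pushp (P : pred W) (w' : W') := \big[addb/false]_(w | q w == w') P w.
Definition pusht (T : {set W}) : {set W'} := [set w' | pushp (mem T) w'].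

Lemma push_preim (P : pred W) (X' : {set W'}) :
  \big[addb/false]_(w' in X') pushp P w' = \big[addb/false]_(w in q @^-1: X') P w.
Proof.
rewrite (partition_big q (mem X')) /=; last by move=> w; rewrite inE.
apply: eq_bigr => w' w'X; apply: eq_bigl => w; rewrite inE.
by case: eqVneq => [->|]; rewrite ?w'X ?andbF.
Qed.

Lemma odd_setI_big (T1 : finType) (A B : {set T1}) :
  odd #|A :&: B| = \big[addb/false]_(w in A) (w \in B).
Proof.
rewrite odd_card_big big_mkcond [RHS]big_mkcond; apply: eq_bigr => w _.
by rewrite inE; case: (w \in A); case: (w \in B).
Qed.

Lemma odd_pusht T (X' : {set W'}) : odd #|X' :&: pusht T| = odd #|(q @^-1: X') :&: T|.
Proof.
rewrite !odd_setI_big -push_preim.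
by apply: eq_bigr => w' _; rewrite inE.
Qed.

End Fibers.

(** * Contraction of a star in a bipartite graph *)

Section Contract.
Variables (W E : finType) (s t : E -> W) (col : W -> bool).
Hypothesis colP : forall g, col (s g) != col (t g).
Implicit Types (X Y S T R : {set W}) (K J Q : {set E}) (x y u v w b : W) (g : E).

(** Each edge crosses from one colour class to the other, so the size of a join has the parity of a
    colour class of [T]. *)
Lemma join_parity K T : isj s t K T -> odd #|K| = odd #|[set w in T | col w]|.
Proof.
move=> hK; have := isj_cut [set w | col w] hK.
have -> : [set g in K | cut s t [set w | col w] g] = K.
  apply/setP=> g; rewrite !inE /cut !inE; have := colP g.
  by case: (col (s g)); case: (col (t g)) => //= _; rewrite andbT.
by move=> ->; congr (odd #|pred_of_set _|); apply/setP=> w; rewrite !inE andbC.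
Qed.

Variables (T : {set W}) (x b : W) (J : {set E}).
Hypothesis xb : x != b.
Hypothesis hJ : isj s t J (symd T (symd [set x] [set b])).
Hypothesis minJ : forall y z K, isj s t K (symd T (symd [set y] [set z])) -> #|J| <= #|K|.

Definition nb w := [exists g, ((s g == b) && (t g == w)) || ((t g == b) && (s g == w))].
Definition atb g := (s g == b) || (t g == b).

Lemma other_end g : atb g -> exists v, [/\ nb v, v != b, symd [set s g] [set t g] = symd [set b] [set v] & cut s t [set b] g].
Proof.
have := colP g => cg.
case/orP=> /eqP e.
- exists (t g); rewrite e; split=> //.
  + by apply/existsP; exists g; rewrite e !eqxx.
  + by apply/eqP=> e2; move: cg; rewrite e e2 eqxx.
  + by rewrite /cut !inE e eqxx; case: eqP => // e2; move: cg; rewrite e e2 eqxx.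
- exists (s g); rewrite e; split=> //.
  + by apply/existsP; exists g; rewrite e !eqxx orbT.
  + by apply/eqP=> e2; move: cg; rewrite e e2 eqxx.
  + exact: symdC.
  + by rewrite /cut !inE e eqxx; case: eqP => // e2; move: cg; rewrite e e2 eqxx.
Qed.

Lemma nbP v : nb v -> exists2 g, atb g & symd [set s g] [set t g] = symd [set b] [set v].
Proof.
case/existsP=> g /orP[] /andP[/eqP e1 /eqP e2]; exists g; rewrite /atb ?e1 ?e2 ?eqxx ?orbT //.
exact: symdC.
Qed.

Lemma nb_col v : nb v -> col v = ~~ col b.
Proof.
case/existsP=> g /orP[] /andP[/eqP <- /eqP <-]; have := colP g;
by case: (col (s g)); case: (col (t g)).
Qed.

Lemma nb_neq v : nb v -> v != b.
Proof. by move/nb_col=> h; apply/eqP=> e; move: h; rewrite e; case: (col b). Qed.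

(** Deleting from [J] an edge from [b] to v leaves a join for the pair [x], v, smaller than the
    minimum over all pairs. *)
Lemma J_atb g : g \in J -> ~~ atb g.
Proof.
move=> gJ; apply/negP=> /other_end[v [_ _ e _]].
have h := isj_symd hJ (isj1 s t g); rewrite e in h.
have := minJ (y := x) (z := v) (K := symd J [set g]).
rewrite -!symdA symdK in h => /(_ h).
have := card_symd J [set g]; rewrite cards1.
have -> : J :&: [set g] = [set g] by apply/setIidPr; rewrite sub1set.
rewrite cards1; lia.
Qed.

Lemma bd_atb K : {in K, forall g, ~~ atb g} -> bd s t K b = false.
Proof.
move=> h; rewrite /bd big1 // => g _; apply/negbTE/negP=> /andP[/h].
by rewrite /inc /atb; case: (s g == b); case: (t g == b).
Qed.

Lemma b_in_T : b \in T.
Proof.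
have /isjP/(_ b) := hJ; rewrite bd_atb; last exact: J_atb.
by rewrite !in_symd !inE eqxx (eq_sym b) (negbTE xb); case: (b \in T).
Qed.

Lemma swap_nonneg u v Q : nb u -> nb v -> {in Q, forall g, ~~ atb g} ->
  isj s t Q (symd [set u] [set v]) -> #|J| <= #|symd J Q|.
Proof.
move=> nu nv aQ hQ; have [g ag eg] := nbP nu.
have h1 := isj_symd (isj_symd hJ hQ) (isj1 s t g); rewrite eg in h1.
have e : symd (symd (symd T (symd [set x] [set b])) (symd [set u] [set v])) (symd [set b] [set u])
   = symd T (symd [set x] [set v]).
  apply/setP=> w; rewrite !in_symd; case: (w \in T); case: (w \in [set x]);
  by case: (w \in [set b]); case: (w \in [set u]); case: (w \in [set v]).
rewrite e in h1; have l1 := minJ h1.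
have c1 : #|symd (symd J Q) [set g]| = #|symd J Q|.+1.
  have := card_symd (symd J Q) [set g]; rewrite cards1.
  have -> : symd J Q :&: [set g] = set0.
    apply/setP=> h; rewrite !inE; case: (eqVneq h g) => [->|]; rewrite ?andbF //.
    have -> : g \in J = false by apply/negP=> /J_atb; rewrite ag.
    by have -> : g \in Q = false by apply/negP=> /aQ; rewrite ag.
  by rewrite cards0; lia.
have p1 := join_parity h1; have p2 := join_parity hJ.
have p3 : odd #|[set w in symd T (symd [set x] [set v]) | col w]| =
   ~~ odd #|[set w in symd T (symd [set x] [set b]) | col w]|.
  have -> : [set w in symd T (symd [set x] [set v]) | col w] =
     symd [set w in symd T (symd [set x] [set b]) | col w] [set w in symd [set b] [set v] | col w].
    apply/setP=> w; rewrite !in_symd !inE; case: (w \in T); case: (w == x);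
    by case: (w == b); case: (w == v); case: (col w).
  rewrite odd_symd; have -> : [set w in symd [set b] [set v] | col w] = [set if col b then b else v].
    apply/setP=> w; rewrite !inE; have := nb_col nv; have := nb_neq nv.
    case: (eqVneq w b) => [->|wb]; case: (eqVneq _ v) => [e1|wv] /=.
    - by rewrite /=.
    - by case: (col b); rewrite ?eqxx ?(negbTE wv).
    - by rewrite e1; case: (col b) => _ -> //; rewrite ?eqxx ?(negbTE _) //; apply/esym/negbTE; rewrite -e1.
    - by case: (col b); rewrite ?(negbTE wb) ?(negbTE wv).
  by rewrite cards1 addbT.
move: p1; rewrite p3 -p2 c1 /= => /negb_inj p4.
move: l1; rewrite c1 leq_eqVlt => /orP[/eqP e1|//].
by move: p4; rewrite e1 /=; case: (odd _).
Qed.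

Hypothesis evT : ~~ odd #|T|.

(** [symd K J] is a join of {x} + R. A trail in it from a vertex of [R] may end at [x]; then [x] is
    not in [R], and the rest is a join of [R] without that vertex, which yields another pair. *)
Lemma pair_in_R R K : 1 < #|R| -> isj s t K (symd T (b |: R)) -> b \notin R ->
  exists u v Q, [/\ u \in R, v \in R, u != v, Q \subset symd K J & isj s t Q (symd [set u] [set v])].
Proof.
move=> cR hK bR.
have hZ : isj s t (symd K J) (symd [set x] R).
  have := isj_symd hK hJ; congr (isj _ _ _ _); apply/setP=> w; rewrite !in_symd !inE.
  by case: (eqVneq w b) => [->|_]; rewrite ?(negbTE bR) /=; case: (_ \in T); case: (_ == x); case: (_ \in R).
have [u0] := set_other x cR.
rewrite !inE => /andP[u0x u0R].
have u0U : u0 \in symd [set x] R by rewrite in_symd inE (negbTE u0x).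
have [v [Q [vU vu sQ hQ]]] := join_trail hZ u0U.
have [vx|vx] := eqVneq v x; last first.
  exists u0, v, Q; split=> //; last by rewrite eq_sym.
  by move: vU; rewrite in_symd inE (negbTE vx).
have xR : x \notin R by move: vU; rewrite vx in_symd inE eqxx; case: (x \in R).
have h2 : isj s t (symd (symd K J) Q) (R :\ u0).
  have := isj_symd hZ hQ; congr (isj _ _ _ _); apply/setP=> w; rewrite vx !in_symd !inE.
  case: (eqVneq w x) => [->|_]; first by rewrite eq_sym (negbTE u0x) (negbTE xR).
  by case: (eqVneq w u0) => [->|]; rewrite ?u0R //= ?addbF.
have [u1 u1R] := set_other u0 cR.
have [v1 [Q1 [v1R v1u sQ1 hQ1]]] := join_trail h2 u1R.
exists u1, v1, Q1; split=> //; try by rewrite eq_sym.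
- by move: u1R; rewrite inE => /andP[].
- by move: v1R; rewrite inE => /andP[].
- apply: (subset_trans sQ1); apply/subsetP=> g; rewrite (in_symd _ Q).
  by case gQ: (g \in Q); rewrite ?addbF // (subsetP sQ _ gQ).
Qed.

(** A join lifted from the contracted graph has the wrong parity on a set [R] of neighbours of [b].
    Since Q is split between K and J and |J + Q| >= |J|, at least half of Q lies in K, so K + Q is
    no longer than K. Pairs of [R] are removed in this way until a single vertex is left, which its
    edge to [b] repairs at cost 1. *)
Lemma fix_join n R K : #|R| <= n -> {in R, forall v, nb v} -> {in K, forall g, ~~ atb g} ->
  isj s t K (symd T (b |: R)) -> exists2 K2, isj s t K2 T & #|K2| <= #|K|.+1.
Proof.
elim: n R K => [|n IH] R K ltR nR aK hK.
all: have bR : b \notin R by apply/negP=> /nR /nb_neq; rewrite eqxx.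
all: have oR : odd #|R| by have := isj_even hK; rewrite odd_symd (negbTE evT) /= cardsU1 bR /= negbK.
  by move: oR ltR; case: #|R|.
have [cR|cR] := leqP #|R| 1.
  have /cards1P[v eR] : #|R| == 1 by case: #|R| oR cR => [|[|]].
  have [|g ag eg] := @nbP v; first by apply: nR; rewrite eR set11.
  have h := isj_symd hK (isj1 s t g); exists (symd K [set g]).
    move: h; rewrite eR eg; congr (isj _ _ _ _).
    apply/setP=> w; rewrite !in_symd !inE; case: (eqVneq w b) => [->|_].
      have := bR; rewrite eR inE => /negbTE ->; by case: (b \in T).
    by case: (w == v); case: (w \in T).
  by have := card_symd K [set g]; rewrite cards1; lia.
have [u [v [Q [uR vR uv sQ hQ]]]] := pair_in_R cR hK bR.
have aQ : {in Q, forall g, ~~ atb g}.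
  move=> g /(subsetP sQ); rewrite in_symd; case gK: (g \in K); first by move=> _; apply: aK.
  exact: J_atb.
have le1 := swap_nonneg (nR _ uR) (nR _ vR) aQ hQ.
have hK2 : isj s t (symd K Q) (symd T (b |: (R :\ u :\ v))).
  have := isj_symd hK hQ; congr (isj _ _ _ _); apply/setP=> w; rewrite !in_symd !inE.
  case: (eqVneq w u) => [->|wu].
    by rewrite uR (negbTE uv) /=; case: eqP uR => [->|_ _]; [rewrite (negbTE bR)|case: (u \in T)].
  case: (eqVneq w v) => [->|wv].
    by rewrite vR /=; case: eqP vR => [->|_ _]; [rewrite (negbTE bR)|case: (v \in T)].
  by rewrite /= addbF.
have [|||K2 hK2' le2] := IH _ _ _ _ _ hK2.
- apply: (@leq_trans #|R :\ u|); first by rewrite subset_leq_card // subD1set.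
  by have := cardsD1 u R; rewrite uR => h; move: ltR; rewrite h.
- by move=> w; rewrite !inE => /and3P[_ _]; apply: nR.
- move=> g; rewrite in_symd; case gK: (g \in K); first by move=> _; apply: aK.
  exact: aQ.
exists K2 => //; apply: (leq_trans le2); rewrite ltnS.
have c1 := card_symd K Q; have c2 := card_symd J Q.
have c3 : #|K :&: Q| + #|J :&: Q| = #|Q|.
  rewrite -(cardsID K Q) (setIC Q K); congr (_ + _); apply: eq_card => g; rewrite !inE.
  case gQ: (g \in Q); rewrite ?andbF // !andbT.
  by have := subsetP sQ _ gQ; rewrite in_symd; case: (g \in K); case: (g \in J).
move: c1 c2 c3 le1; clear; lia.
Qed.

(** The vertex [b] represents its contracted star; its neighbours leave the vertex type and are sent
    to [b] by [cq]. *)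
Definition cW := {w : W | ~~ nb w}.
Definition cE := {g : E | ~~ atb g}.
Lemma bb : ~~ nb b. Proof. by apply/negP=> /nb_neq; rewrite eqxx. Qed.
Definition cb : cW := exist _ b bb.
Definition cq (w : W) : cW := insubd cb w.
Definition cs (g : cE) := cq (s (val g)).
Definition ct (g : cE) := cq (t (val g)).
(** Edges leaving the star start at neighbours of [b], so the contracted vertex takes the colour
    opposite to that of [b] and the graph stays bipartite. *)
Definition ccol (w : cW) := if w == cb then ~~ col b else col (val w).

Lemma cqE w : val (cq w) = if nb w then b else w.
Proof. by rewrite /cq val_insubd; case: (nb w). Qed.

Lemma cq_b w : (cq w == cb) = (w == b) || nb w.
Proof.
rewrite -val_eqE cqE /=; case: ifP => h; first by rewrite eqxx orbT.
by rewrite orbF.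
Qed.

Lemma cq_val (w' : cW) : cq (val w') = w'.
Proof. by apply: val_inj; rewrite cqE (negbTE (valP w')). Qed.

Lemma ccol_q w : w != b -> ccol (cq w) = col w.
Proof.
move=> wb; rewrite /ccol cq_b (negbTE wb) /=; case: ifP => h; first by rewrite (nb_col h).
by rewrite cqE h.
Qed.

Lemma ends_b (g : cE) : (s (val g) != b) && (t (val g) != b).
Proof. by have := valP g; rewrite /atb negb_or. Qed.

Lemma ccolP (g : cE) : ccol (cs g) != ccol (ct g).
Proof. by have /andP[h1 h2] := ends_b g; rewrite !ccol_q. Qed.

Lemma atb_q g : atb g -> cq (s g) = cb /\ cq (t g) = cb.
Proof.
move=> h; have [v [nv _ _ _]] := other_end h.
have q1 : nb (s g) || (s g == b).
  case/orP: h => /eqP e; first by rewrite e eqxx orbT.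
  by apply/orP; left; apply/existsP; exists g; rewrite e !eqxx orbT.
have q2 : nb (t g) || (t g == b).
  case/orP: h => /eqP e; last by rewrite e eqxx orbT.
  by apply/orP; left; apply/existsP; exists g; rewrite e !eqxx.
by split; apply/eqP; rewrite cq_b orbC.
Qed.

Lemma cut_preim (X' : {set cW}) g : cut s t (cq @^-1: X') g = (if insub g is Some g' then cut cs ct X' g' else false).
Proof.
case: insubP => [g' ag eg|]; first by rewrite /cut !inE /cs /ct eg.
by rewrite negbK => /atb_q[h1 h2]; rewrite /cut !inE h1 h2 addbb.
Qed.

Lemma ccset : cset s t setT -> cset cs ct setT.
Proof.
move=> h S' _ S0 ST.
have [||g cg _] := h (cq @^-1: S') (subsetT _).
- by case/set0Pn: S0 => w' w'S; apply/set0Pn; exists (val w'); rewrite inE cq_val.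
- apply: contra ST => /eqP e; apply/eqP/setP=> w'; rewrite !inE.
  by have := in_setT (val w'); rewrite -e inE cq_val.
by move: cg; rewrite cut_preim; case: insubP => // g' _ _ h'; exists g'; rewrite // /within !inE.
Qed.

(** A subset that separates [b] from one of its neighbours is cut by the edge between them; any
    other subset is itself a preimage. *)
Lemma cset_preim (X' : {set cW}) : cset cs ct X' -> cset s t (cq @^-1: X').
Proof.
move=> hX S sS S0 SX.
have [/existsP[w /andP[nw hw]]|] := boolP [exists w, nb w && ((w \in S) (+) (b \in S))].
  have cbX : cb \in X'.
    move: hw; case wS: (w \in S) => /=.
      by have := subsetP sS _ wS; rewrite inE (eqP (_ : cq w == cb)) // cq_b nw orbT.
    by move=> bS; have := subsetP sS _ bS; rewrite inE (eqP (_ : cq b == cb)) // cq_b eqxx.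
  have hwX : cq w \in X' by rewrite (eqP (_ : cq w == cb)) // cq_b nw orbT.
  have hbX : cq b \in X' by rewrite (eqP (_ : cq b == cb)) // cq_b eqxx.
  case/existsP: nw => g /orP[] /andP[/eqP e1 /eqP e2]; exists g; rewrite /cut /within ?inE e1 e2 ?inE ?hwX ?hbX //.
  by rewrite addbC.
rewrite negb_exists => /forallP hS.
have hS' w : nb w -> (w \in S) = (b \in S).
  by move=> nw; have := hS w; rewrite nw /=; case: (w \in S); case: (b \in S).
pose S' := [set w' : cW | val w' \in S].
have eS : cq @^-1: S' = S.
  by apply/setP=> w; rewrite !inE cqE; case: ifP => // /hS'.
have [|||g cg wg] := hX S'.
- by apply/subsetP=> w'; rewrite inE => /(subsetP sS); rewrite inE cq_val.
- case/set0Pn: S0 => w wS; apply/set0Pn; exists (cq w); by move: wS; rewrite -{1}eS inE.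
- by apply: contra SX => /eqP <-; rewrite eS.
exists (val g); first by rewrite -eS cut_preim valK.
by move: wg; rewrite /within !inE.
Qed.

Lemma ucol_preim (X' : {set cW}) c : ucol cs ct ccol X' c -> ucol s t col (cq @^-1: X') c.
Proof.
move=> h g; rewrite !inE; have [ag|ag] := boolP (atb g).
  by have [-> ->] := atb_q ag; split=> -> .
have [h1 h2] := h (exist _ g ag).
move: h1 h2; rewrite /cs /ct /= => h1 h2.
have /andP[/= n1 n2] := ends_b (exist _ g ag).
by split=> p1 p2; [rewrite -h1 // ccol_q|rewrite -h2 // ccol_q].
Qed.

Lemma nocom_preim (X' Y' : {set cW}) : nocom cs ct X' Y' -> nocom s t (cq @^-1: X') (cq @^-1: Y').
Proof.
move=> /forallP h; apply/forallP=> g; rewrite !cut_preim; case: insubP => // g' _ _; exact: h.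
Qed.

Lemma lam_preim (X' Y' : {set cW}) : lam X' Y' -> lam (cq @^-1: X') (cq @^-1: Y').
Proof.
case/or3P=> h; apply/or3P.
- by apply: Or31; apply: preimsetS.
- by apply: Or32; apply: preimsetS.
- apply: Or33; rewrite -setI_eq0 -preimsetI.
  by move: h; rewrite -setI_eq0 => /eqP ->; rewrite preimset0.
Qed.

Lemma b_nocom (X' : {set cW}) : nocom s t [set b] (cq @^-1: X').
Proof.
apply/forallP=> g; rewrite cut_preim; case: insubP => [g' ag _|]; last by rewrite andbF.
apply/negP=> /andP[]; rewrite /cut !inE; move: ag; rewrite /atb.
by case: (s g == b); case: (t g == b).
Qed.

Lemma b_lam (X' : {set cW}) : lam [set b] (cq @^-1: X').
Proof.
case h: (b \in cq @^-1: X'); apply/or3P; [apply: Or31|apply: Or33]; first by rewrite sub1set.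
by rewrite disjoints1 h.
Qed.

Lemma bd_c (K' : {set cE}) (w' : cW) : bd cs ct K' w' = pushp cq (bd s t (val @: K')) w'.
Proof.
have := bd_cut cs ct K' [set w']; rewrite big_set1 => ->.
have := push_preim cq (bd s t (val @: K')) [set w']; rewrite big_set1 bd_cut => ->.
rewrite -(card_imset _ val_inj); congr (odd _); apply: eq_card => g; rewrite inE.
apply/imsetP/andP=> [[g']|[/imsetP[g' gK ->]]].
  by rewrite inE => /andP[gK cg] ->; rewrite imset_f // cut_preim valK.
by rewrite cut_preim valK => cg; exists g'; rewrite // inE gK.
Qed.

Lemma pushp_nnb (P : pred W) w : w != b -> ~~ nb w -> pushp cq P (cq w) = P w.
Proof.
move=> wb nw; rewrite /pushp (big_pred1 w) // => v /=.
rewrite -val_eqE !cqE (negbTE nw); case: ifP => // nv.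
by rewrite eq_sym (negbTE wb); apply/esym/negbTE/eqP=> e; rewrite -e nv in nw.
Qed.

(** Parities agree away from the star. At [b] the lift has no edge although [b] belongs to [T], so
    [b] always appears in the error set. *)
Lemma contract_join (K' : {set cE}) : isj cs ct K' (pusht cq T) ->
  exists2 R : {set W}, {in R, forall v, nb v} & isj s t (val @: K') (symd T (b |: R)).
Proof.
move=> /isjP h; exists [set w | nb w && (bd s t (val @: K') w != (w \in T))].
  by move=> w; rewrite inE => /andP[].
apply/isjP=> w; rewrite in_symd !inE.
have [->|wb] := eqVneq w b.
  rewrite b_in_T bd_atb // => g /imsetP[g' _ ->]; exact: (valP g').
have [nw|nw] /= := boolP (nb w).
  by case: (bd _ _ _ _); case: (w \in T).
by rewrite addbF; have := h (cq w); rewrite bd_c inE !pushp_nnb.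
Qed.

End Contract.

Definition packing (W E : finType) (s t : E -> W) (col : W -> bool) (T : {set W}) (l : seq {set W}) :=
  [/\ {in l, forall X, [/\ cset s t X, odd #|X :&: T| & exists c, ucol s t col X c]},
      pairwise (@lam W) l & pairwise (nocom s t) l].

(** The cut of {b} is added to the packing pulled back from the contracted graph. [fix_join] gives a
    join at most one longer than the contracted one, and weak duality gives the converse
    inequality. *)
Theorem join_packing (W E : finType) (s t : E -> W) (col : W -> bool) (T : {set W}) :
  (forall g, col (s g) != col (t g)) -> cset s t setT -> ~~ odd #|T| ->
  exists K l, [/\ isj s t K T, size l = #|K| & packing s t col T l].
Proof.
move: {2}#|W|.+1 (ltnSn #|W|) => n.
elim: n W E s t col T => // n IH W E s t col T ltW colP cT evT.
have [T0|/set0Pn[w wT]] := eqVneq T set0.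
  exists set0, [::]; split=> //; last by rewrite cards0.
  by apply/isjP=> w; rewrite bd0 T0 inE.
have [K0 hK0 _] := cset_join cT (subsetT T) evT.
(* The minimum runs over all pairs of ends, equal ones included; both exchange arguments compare [J]
   with joins for other pairs. *)
pose P (p : W * W * {set E}) := isj s t p.2 (symd T (symd [set p.1.1] [set p.1.2])).
have P0 : P (w, w, K0) by rewrite /P /= symdv symd0.
case: (arg_minnP (fun p : W * W * {set E} => #|p.2|) P0) => [[[x b] J]] hJ mJ.
rewrite /P /= in hJ.
have minJ y z K : isj s t K (symd T (symd [set y] [set z])) -> #|J| <= #|K|.
  by move=> h; apply: (mJ (y, z, K)).
(* Otherwise [J] is a join of the nonempty [T], and deleting one of its edges gives a smaller join
   for the ends of that edge. *)
have xb : x != b.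
  apply/eqP=> e; move: hJ; rewrite e symdv symd0 => hJ.
  have [/existsP[g gJ]|] := boolP [exists g, g \in J]; last first.
    rewrite negb_exists => /forallP h; have /isjP/(_ w) := hJ; rewrite wT /bd big1 // => g _.
    by rewrite (negbTE (h g)).
  have := minJ _ _ _ (isj_symd hJ (isj1 s t g)).
  have := card_symd J [set g]; have -> : J :&: [set g] = [set g] by apply/setIidPr; rewrite sub1set.
  rewrite !cards1; lia.
pose cs := @cs W E s t col colP b; pose ct := @ct W E s t col colP b.
have [v nv] : exists v, nb s t b v.
  have [||g cg _] := cT [set b] (subsetT _).
  - by apply/set0Pn; exists b; rewrite inE.
  - by apply: contra xb => /eqP e; have := in_setT x; rewrite -e inE.
  have [|v [nv _ _ _]] := @other_end _ _ s t col colP b g; last by exists v.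
  by move: cg; rewrite /cut !inE /atb; case: (s g == b); case: (t g == b).
have ltc : #|{: cW s t b}| < n.
  apply: leq_trans (ltW : #|W| <= n); rewrite card_sig -(cardC (nb s t b)).
  have : 0 < #|nb s t b| by apply/card_gt0P; exists v.
  have -> : #|[pred w0 | ~~ nb s t b w0]| = #|[predC nb s t b]| by apply: eq_card.
  by move=> h; rewrite -add1n leq_add2r.
have evc : ~~ odd #|pusht (cq colP b) T|.
  rewrite -(setTI (pusht _ _)) odd_pusht.
  have -> : cq colP b @^-1: setT = setT by apply/setP=> z; rewrite !inE.
  by rewrite setTI.
have [K' [l' [hK' szl' [hl' laml' nocl']]]] :=
  IH _ _ cs ct (ccol colP (b:=b)) _ ltc (@ccolP _ _ s t col colP b) (@ccset _ _ s t col colP b cT) evc.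
have [R nR hR] := contract_join xb hJ minJ hK'.
have [|K2 hK2 leK2] := fix_join colP xb hJ minJ evT (leqnn #|R|) nR _ hR.
  by move=> g /imsetP[g' _ ->]; exact: (valP g').
rewrite card_imset in leK2; last exact: val_inj.
have bT := b_in_T colP xb hJ minJ.
exists K2, ([set b] :: [seq (cq colP b) @^-1: X' | X' : {set cW s t b} <- l']).
have pk : packing s t col T ([set b] :: [seq (cq colP b) @^-1: X' | X' : {set cW s t b} <- l']).
  split.
  - move=> X; rewrite inE => /orP[/eqP->|/mapP[X' X'l ->]].
      split.
      + move=> S; rewrite subset1 => /orP[/eqP->|/eqP->]; first by move=> _; rewrite eqxx.
        by rewrite eqxx.
      + by have /setIidPl -> : [set b] \subset T; rewrite ?sub1set ?cards1.
      + by exists (col b) => g; rewrite !inE; split=> /eqP->.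
    have [h1 h2 [c h3]] := hl' _ X'l; split; [exact: cset_preim|by rewrite -odd_pusht|].
    by exists c; apply: ucol_preim.
  - rewrite pairwise_cons; apply/andP; split; first by apply/allP=> X /mapP[X' _ ->]; apply: b_lam.
    rewrite pairwise_map; apply: sub_pairwise laml' => X' Y'; exact: lam_preim.
  - rewrite pairwise_cons; apply/andP; split; first by apply/allP=> X /mapP[X' _ ->]; apply: b_nocom.
    rewrite pairwise_map; apply: sub_pairwise nocl' => X' Y'; exact: nocom_preim.
split=> //; apply/eqP; rewrite eqn_leq /= size_map.
case: pk => h1 _ h3; have := weak_duality hK2 (fun X h => let: And3 _ o _ := h1 X h in o) h3.
by rewrite /= size_map => -> ; rewrite szl'.
Qed.

(** * Plane cubic maps with faces of size 5 and 6 *)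

(* [rot] turns around the tail [vt] of a dart and [rot \o rev] walks around its face [fc]. In the dual triangulation
   of the sphere the vertices are the faces and the triangles are the [vert]. *)
Record fmap := Fmap {
  dart : finType; vert : finType; face : finType; edge : finType;
  rev : dart -> dart; rot : dart -> dart;
  vt : dart -> vert; fc : dart -> face; ed : dart -> edge;
  revK : involutive rev;
  rev_neq : forall a, rev a != a;
  rot3 : forall a, rot (rot (rot a)) = a;
  rot_neq : forall a, rot a != a;
  vt_eq : forall a b, (vt a == vt b) = [|| b == a, b == rot a | b == rot (rot a)];
  ed_eq : forall a b, (ed a == ed b) = (b == a) || (b == rev a);
  fc_eq : forall a b, (fc a == fc b) = fconnect (fun c => rot (rev c)) a b;
  vt_surj : forall v, exists a, vt a = v;
  ed_surj : forall x, exists a, ed a = x;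
  fc_surj : forall x, exists a, fc a = x;
  fc_size : forall x, (#|[set a | fc a == x]| == 5) || (#|[set a | fc a == x]| == 6);
  map_conn : forall S : {set vert}, S != set0 ->
    (forall a, vt a \in S -> vt (rev a) \in S) -> S = setT;
  map_euler : #|vert| + #|face| = #|edge| + 2 }.

Lemma card_fibers (A B : finType) (p : A -> B) (P : pred B) c :
  (forall x, P x -> #|[set a | p a == x]| = c) -> #|[set a | P (p a)]| = c * #|[set x | P x]|.
Proof.
move=> h; rewrite -sum1_card (partition_big p P) /=; last by move=> a; rewrite inE.
rewrite (eq_bigr (fun=> c)) => [|x Px].
  by rewrite sum_nat_const mulnC; congr (_ * _); apply: eq_card => x; rewrite inE.
rewrite -(h x Px) -sum1_card; apply: eq_bigl => a; rewrite !inE.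
by case: eqP => [->|]; rewrite ?Px ?andbF.
Qed.

Lemma card_preim_bij (A : finType) (h k : A -> A) (P Q : pred A) : cancel h k -> cancel k h ->
  (forall a, P (h a) = Q a) -> #|[set a | P a]| = #|[set a | Q a]|.
Proof.
move=> hk kh e; rewrite -(card_imset [set a | Q a] (can_inj hk)).
apply: eq_card => a; rewrite inE; apply/idP/imsetP=> [Pa|[b]].
  by exists (k a); rewrite ?kh // inE -e kh.
by rewrite inE -e => Pb ->.
Qed.

Section Map.
Variable M : fmap.
Local Notation D := (dart M).
Implicit Types (a c d : D) (x : face M) (X Y : {set face M}) (S : {set vert M}).

Definition fnext a := rot (rev a).
Definition rot' a := rot (rot a).
Definition fprev a := rev (rot' a).

Lemma rotK : cancel (@rot M) rot'. Proof. move=> a; exact: rot3. Qed.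
Lemma rot'K : cancel rot' (@rot M). Proof. move=> a; exact: rot3. Qed.
Lemma fnextK : cancel fnext fprev.
Proof. by move=> a; rewrite /fnext /fprev /rot' rot3 revK. Qed.
Lemma fprevK : cancel fprev fnext.
Proof. by move=> a; rewrite /fnext /fprev /rot' revK rot3. Qed.

Lemma fc_next a : fc (fnext a) = fc a.
Proof. by apply/eqP; rewrite eq_sym fc_eq; apply: fconnect1. Qed.

Lemma fc_rev a : fc (rev a) = fc (rot a).
Proof. by rewrite -(fc_next (rev a)) /fnext revK. Qed.

Lemma vt_rot a : vt (rot a) = vt a.
Proof. by apply/eqP; rewrite eq_sym vt_eq eqxx orbT. Qed.

Lemma vt_next a : vt (fnext a) = vt (rev a).
Proof. exact: vt_rot. Qed.

Lemma ed_rev a : ed (rev a) = ed a.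
Proof. by apply/eqP; rewrite eq_sym ed_eq eqxx orbT. Qed.

Lemma rot2_neq a : rot (rot a) != a.
Proof. by apply/eqP=> e; have := rot_neq (rot (rot a)); rewrite rot3 e eqxx. Qed.

Lemma card_vfiber (v : vert M) : #|[set a | vt a == v]| = 3.
Proof.
have [a <-] := vt_surj v.
have -> : [set c | vt c == vt a] = [set a; rot a; rot (rot a)].
  by apply/setP=> c; rewrite !inE eq_sym vt_eq orbA.
rewrite setUC cardsU1 cards2 !inE negb_or rot2_neq rot_neq /=.
by rewrite eq_sym rot_neq.
Qed.

Lemma card_efiber (x : edge M) : #|[set a | ed a == x]| = 2.
Proof.
have [a <-] := ed_surj x.
have -> : [set c | ed c == ed a] = [set a; rev a].
  by apply/setP=> c; rewrite !inE eq_sym ed_eq.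
by rewrite cards2 eq_sym rev_neq.
Qed.

Lemma card_dartV : #|D| = 3 * #|vert M|.
Proof.
have := @card_fibers _ _ (@vt M) predT 3 (fun v _ => card_vfiber v).
by rewrite !cardsE.
Qed.

Lemma card_dartE : #|D| = 2 * #|edge M|.
Proof.
have := @card_fibers _ _ (@ed M) predT 2 (fun v _ => card_efiber v).
by rewrite !cardsE.
Qed.

Definition pent x := #|[set a | fc a == x]| == 5.
Definition pents := [set x | pent x].
(* the triangles of the dual with three, two and one corners in [Y] are counted by [nT], [nB] and [nA] *)
Definition nT Y := #|[set v | [forall a, (vt a == v) ==> (fc a \in Y)]]|.
Definition nE Y := #|[set x | [forall a, (ed a == x) ==> (fc a \in Y)]]|.
Definition nA Y := #|[set a | [&& fc a \in Y, fc (rot a) \notin Y & fc (rot' a) \notin Y]]|.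
Definition nB Y := #|[set a | [&& fc a \in Y, fc (rot a) \in Y & fc (rot' a) \notin Y]]|.
Definition nK Y := #|Y :&: pents|.
Definition dY Y := #|[set a | fc a \in Y]|.

Lemma insideVP Y a : [forall c, (vt c == vt a) ==> (fc c \in Y)] = [&& fc a \in Y, fc (rot a) \in Y & fc (rot' a) \in Y].
Proof.
apply/forallP/and3P=> [h|[h1 h2 h3] c].
  by split; [have := h a|have := h (rot a)|have := h (rot' a)]; rewrite /rot' ?vt_rot eqxx.
by apply/implyP; rewrite eq_sym vt_eq => /or3P[] /eqP->.
Qed.

Lemma insideEP Y a : [forall c, (ed c == ed a) ==> (fc c \in Y)] = (fc a \in Y) && (fc (rot a) \in Y).
Proof.
apply/forallP/andP=> [h|[h1 h2] c].
  by split; [have := h a; rewrite eqxx|have := h (rev a); rewrite ed_rev eqxx fc_rev].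
by apply/implyP; rewrite eq_sym ed_eq => /orP[] /eqP->; rewrite ?fc_rev.
Qed.

Lemma nT3 Y : #|[set a | [&& fc a \in Y, fc (rot a) \in Y & fc (rot' a) \in Y]]| = 3 * nT Y.
Proof.
rewrite /nT -(@card_fibers _ _ (@vt M) _ 3 (fun v _ => card_vfiber v)).
by apply: eq_card => a; rewrite !inE insideVP.
Qed.

Lemma nE2 Y : #|[set a | (fc a \in Y) && (fc (rot a) \in Y)]| = 2 * nE Y.
Proof.
rewrite /nE -(@card_fibers _ _ (@ed M) _ 2 (fun v _ => card_efiber v)).
by apply: eq_card => a; rewrite !inE insideEP.
Qed.

Lemma card_split (P Q : pred D) :
  #|[set a | P a]| = #|[set a | P a && Q a]| + #|[set a | P a && ~~ Q a]|.
Proof.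
rewrite -(cardsID [set a | Q a]); congr (_ + _); apply: eq_card => a; rewrite !inE //.
by rewrite andbC.
Qed.

Lemma nB_rot Y : #|[set a | [&& fc a \in Y, fc (rot a) \notin Y & fc (rot' a) \in Y]]| = nB Y.
Proof.
apply: (card_preim_bij rotK rot'K) => a; rewrite /rot' rot3.
by case: (fc a \in Y); case: (fc (rot a) \in Y); case: (fc (rot (rot a)) \in Y).
Qed.

(** Count pairs of an edge inside [Y] and a triangle on it: a triangle with three corners in [Y] has
    three such edges, one with two corners has one. *)
Lemma nE_eq Y : 2 * nE Y = 3 * nT Y + nB Y.
Proof.
rewrite -nE2 (card_split _ (fun a => fc (rot' a) \in Y)) -nT3.
by congr (_ + _); apply: eq_card => a; rewrite !inE andbA.
Qed.

Lemma dY_eq Y : dY Y = 3 * nT Y + 2 * nB Y + nA Y.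
Proof.
rewrite /dY (card_split _ (fun a => fc (rot a) \in Y)) nE2 nE_eq.
rewrite (card_split _ (fun a => fc (rot' a) \in Y)).
have -> : #|[set a | (fc a \in Y) && (fc (rot a) \notin Y) && (fc (rot' a) \in Y)]| = nB Y.
  by rewrite -nB_rot; apply: eq_card => a; rewrite !inE andbA.
have -> : #|[set a | (fc a \in Y) && (fc (rot a) \notin Y) && (fc (rot' a) \notin Y)]| = nA Y.
  by apply: eq_card => a; rewrite !inE andbA.
lia.
Qed.

Lemma dY_deg Y : dY Y + nK Y = 6 * #|Y|.
Proof.
rewrite /dY -sum1_card (partition_big (@fc M) (mem Y)) /=; last by move=> a; rewrite inE.
have -> : nK Y = \sum_(x in Y) pent x.
  rewrite /nK -sum1_card big_mkcond [RHS]big_mkcond; apply: eq_bigr => x _.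
  by rewrite !inE; case: (x \in Y); case: (pent x).
rewrite -big_split /= (eq_bigr (fun=> 6)) ?sum_nat_const 1?mulnC // => x xY.
have -> : \sum_(i in [set a | fc a \in Y] | fc i == x) 1 = #|[set a | fc a == x]|.
  rewrite -sum1_card; apply: eq_bigl => a; rewrite !inE.
  by case: eqP => [->|]; rewrite ?xY ?andbF.
by have := fc_size x; rewrite /pent => /orP[] /eqP ->.
Qed.

(** Discrete Gauss-Bonnet: with chi = |Y| - nE + nT it reads nA - nB = 6 chi - nK, the turning of
    the boundary against the curvature, which sits at the pentagons. *)
Lemma nAB_chi Y : nA Y + nK Y + 6 * nE Y = nB Y + 6 * #|Y| + 6 * nT Y.
Proof. have := nE_eq Y; have := dY_eq Y; have := dY_deg Y; lia. Qed.

Lemma nA_setC Y : nA (~: Y) = nB Y.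
Proof.
apply: (card_preim_bij rot'K rotK) => a; rewrite !inE /rot' !rot3 ?negbK.
by case: (fc a \in Y); case: (fc (rot a) \in Y); case: (fc (rot (rot a)) \in Y).
Qed.

Lemma nB_setC Y : nB (~: Y) = nA Y.
Proof. by rewrite -(nA_setC (~: Y)) setCK. Qed.

(** Complementation exchanges [nA] and [nB], so only the Euler characteristic of the sphere remains
    in the sum. *)
Lemma chi_setC Y : #|Y| + nT Y + (#|~: Y| + nT (~: Y)) = nE Y + nE (~: Y) + 2.
Proof.
have := nE_eq Y; have := nE_eq (~: Y); have := dY_eq Y; have := dY_eq (~: Y).
rewrite nA_setC nB_setC.
have h1 : dY Y + dY (~: Y) = #|D|.
  rewrite /dY -cardsT (card_split xpredT (fun a => fc a \in Y)) /=.
  by congr (_ + _); apply: eq_card => a; rewrite !inE.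
have h2 := cardsC Y; have h3 := @map_euler M.
have := card_dartV; have := card_dartE; lia.
Qed.

(** * Cuts, even sets and Euler characteristics *)

Definition vcut S := [set a | (vt a \in S) (+) (vt (rev a) \in S)].
Definition fcut X := [set a | (fc a \in X) (+) (fc (rev a) \in X)].

(** A dart becomes a half edge. [hs], [ht] describe the subdivided dual, [gs], [gt] the subdivided
    graph itself. *)
Definition hs a : face M + edge M := inl (fc a).
Definition ht a : face M + edge M := inr (ed a).
Definition gs a : vert M + edge M := inl (vt a).

Definition gt a : vert M + edge M := inr (ed a).

Lemma big_addb_perm (P : pred D) (h k : D -> D) (Q : pred D) : cancel h k -> cancel k h ->
  (forall a, Q (h a) = Q a) ->
  \big[addb/false]_(a | Q a) P (h a) = \big[addb/false]_(a | Q a) P a.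
Proof.
move=> hk kh e; rewrite [RHS](reindex h) /=; last by exists k => a _; rewrite ?hk ?kh.
by apply: eq_bigl.
Qed.

Lemma bd_inl (B : finType) (p : D -> B) (q : D -> edge M) (K : {set D}) (x : B) :
  bd (inl \o p) (inr \o q) K (inl x) = \big[addb/false]_(a | p a == x) (a \in K).
Proof.
rewrite /bd [RHS]big_mkcond; apply: eq_bigr => a _; rewrite /inc /=.
have -> : (inl (p a) == inl x :> B + edge M) = (p a == x) by [].
have -> : (inr (q a) == inl x :> B + edge M) = false by [].
by rewrite addbF; case: (p a == x); case: (a \in K).
Qed.

Lemma bd_inr (B : finType) (p : D -> B) (K : {set D}) a :
  bd (inl \o p) (inr \o @ed M) K (inr (ed a)) = (a \in K) (+) (rev a \in K).
Proof.
rewrite /bd (bigD1 a) // (bigD1 (rev a)) /=; last exact: rev_neq.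
have inr1 c : inc (inl \o p) (inr \o @ed M) c (inr (ed a)) = (ed c == ed a) by [].
rewrite !inr1 ed_rev eqxx !andbT big1 ?addbF // => c /andP[c1 c2].
by rewrite inr1 eq_sym ed_eq (negbTE c1) (negbTE c2) andbF.
Qed.

(** A walk once around a face enters and leaves [S] equally often. *)
Lemma vcut_even S : isj hs ht (vcut S) set0.
Proof.
apply/isjP=> -[x|x]; rewrite [RHS]inE.
  rewrite (bd_inl (@fc M) (@ed M)).
  under eq_bigr => a _ do rewrite inE -vt_next.
  rewrite big_split /= (big_addb_perm (fun a => vt a \in S) fnextK fprevK) ?addbb // => a.
  by rewrite fc_next.
have [a <-] := ed_surj x; rewrite (bd_inr (@fc M)) !inE revK.
by case: (vt a \in S); case: (vt (rev a) \in S).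
Qed.

Lemma fcut_even X : isj gs gt (fcut X) set0.
Proof.
apply/isjP=> -[v|x]; rewrite [RHS]inE.
  rewrite (bd_inl (@vt M) (@ed M)).
  under eq_bigr => a _ do rewrite inE fc_rev.
  rewrite big_split /= (big_addb_perm (fun a => fc a \in X) rotK rot'K) ?addbb // => a.
  by rewrite vt_rot.
have [a <-] := ed_surj x; rewrite (bd_inr (@vt M)) !inE revK.
by case: (fc a \in X); case: (fc (rev a) \in X).
Qed.

Lemma vcut_symd S S' : vcut (symd S S') = symd (vcut S) (vcut S').
Proof.
apply/setP=> a; rewrite !inE; case: (vt a \in S); case: (vt a \in S');
by case: (vt (rev a) \in S); case: (vt (rev a) \in S').
Qed.

Lemma vcut0 S : vcut S = set0 -> (S == set0) || (S == setT).
Proof.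
move=> e; have [//|S0] := eqVneq S set0; apply/eqP/map_conn=> // a aS.
by have := in_set0 a; rewrite -e inE aS /=; case: (_ \in S).
Qed.

Definition fcset Y := forall X, X \subset Y -> X != set0 -> X != Y ->
  exists a, [/\ fc a \in X, fc (rev a) \in Y & fc (rev a) \notin X].

(** The faces of [Y] with the midpoints of the edges between them: the subdivided dual graph induced
    by [Y]. *)
Definition hull Y : {set face M + edge M} :=
  [set w | match w with inl x => x \in Y | inr x => [forall a, (ed a == x) ==> (fc a \in Y)] end].

Lemma hull_inr Y a : (inr (ed a) \in hull Y) = (fc a \in Y) && (fc (rot a) \in Y).
Proof. by rewrite inE insideEP. Qed.

Lemma hull_cset Y : fcset Y -> Y != set0 -> cset hs ht (hull Y).
Proof.
move=> cY /set0Pn[y0 y0Y] S sS S0 SX.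
have [/existsP[a /andP[h1 h2]]|] := boolP [exists a, ((hs a \in S) (+) (ht a \in S)) && (ht a \in hull Y)].
  exists a => //; rewrite /within h2 andbT inE /=.
  by move: h2; rewrite hull_inr => /andP[].
rewrite negb_exists => /forallP hS.
have hS' a : inr (ed a) \in hull Y -> (inl (fc a) \in S) = (inr (ed a) \in S).
  by move=> h; have := hS a; rewrite h andbT /hs /ht; case: (inl _ \in S); case: (inr _ \in S).
pose X := [set x | inl x \in S].
have [||| a [aX raY raX]] := cY X.
- by apply/subsetP=> x; rewrite inE => /(subsetP sS); rewrite inE.
- apply/set0Pn; case/set0Pn: S0 => -[x|x] xS; first by exists x; rewrite inE.
  have [a ea] := ed_surj x; exists (fc a); rewrite inE hS' ea //; exact: (subsetP sS).
- apply: contra SX => /eqP eX; apply/eqP/setP=> -[x|x].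
    by rewrite [RHS]inE -eX inE.
  apply/idP/idP=> [|xY]; first exact: (subsetP sS).
  have [a ea] := ed_surj x; move: xY; rewrite -ea => xY; rewrite -hS' //.
  by move: xY; rewrite hull_inr => /andP[]; rewrite -{1}eX inE.
have aY : fc a \in Y by move: aX; rewrite inE => /(subsetP sS); rewrite inE.
have hY : inr (ed a) \in hull Y by rewrite hull_inr aY -fc_rev raY.
move: aX raX; rewrite !inE hS' // -ed_rev -hS' ?ed_rev //.
by move=> ->.
Qed.

Lemma card_hull Y : #|hull Y| = #|Y| + nE Y.
Proof.
rewrite /nE -!sum1_card.
have := @big_sumType _ 0 addn (face M) (edge M) (mem (hull Y)) (fun=> 1).
rewrite /= => ->; congr (_ + _); apply: eq_bigl => x; by rewrite !inE.
Qed.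

Lemma card_within_hull Y : #|[set a | within hs ht (hull Y) a]| = 2 * nE Y.
Proof.
rewrite -nE2; apply: eq_card => a; rewrite !inE /within hull_inr inE /hs /=.
by case: (fc a \in Y).
Qed.

(** The cuts of sets of triangles inside [Y] are even sets inside the hull, pairwise different
    because not all triangles lie in [Y]. Counting even sets gives nT <= 2 nE - (|Y| + nE) + 1. *)
Lemma chi_le1 Y : fcset Y -> Y != set0 -> Y != setT -> #|Y| + nT Y <= nE Y + 1.
Proof.
move=> cY Y0 YT; case/set0Pn: (Y0) => y yY.
pose Sv := [set v | [forall a, (vt a == v) ==> (fc a \in Y)]].
have SvT : Sv != setT.
  have [x xY] : exists x, x \notin Y.
    by apply/existsP; rewrite -negb_forall; apply: contra YT => /forallP h; apply/eqP/setP=> x; rewrite h inE.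
  have [a ea] := fc_surj x; apply/eqP=> e; have := in_setT (vt a); rewrite -e inE insideVP ea.
  by rewrite (negbTE xY).
have inj : {in powerset Sv &, injective vcut}.
  move=> S1 S2; rewrite !inE => s1 s2 e.
  have : vcut (symd S1 S2) = set0 by rewrite vcut_symd e symdv.
  move/vcut0=> /orP[/eqP e0|/eqP eT].
    by rewrite -(symdK S2 S1) (symdC S2 S1) e0 symd0.
  case/eqP: SvT; apply/eqP; rewrite eqEsubset subsetT /= -eT.
  apply/subsetP=> v; rewrite in_symd; case h: (v \in S1); first by move=> _; apply: (subsetP s1).
  by rewrite addFb; apply: (subsetP s2).
have := @card_even_sets _ _ hs ht (hull Y) (inl y) (vcut @: powerset Sv) (hull_cset cY Y0).
rewrite card_in_imset // card_powerset card_hull card_within_hull -expnD leq_exp2l //.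
have -> : #|Sv| = nT Y by [].
move=> h; have cY0 : 0 < #|Y| by apply/card_gt0P; exists y.
suff : nT Y + (#|Y| + nE Y).-1 <= 2 * nE Y by move: cY0; clear; lia.
apply: h; first by rewrite inE.
move=> K /imsetP[S]; rewrite inE => sS ->; split; last exact: vcut_even.
apply/subsetP=> a; rewrite !inE => ha.
have : [&& fc a \in Y & fc (rot a) \in Y].
  move: ha; case h1: (vt a \in S) => /=.
    by have := subsetP sS _ h1; rewrite inE insideVP => /and3P[-> ->].
  by move=> h2; have := subsetP sS _ h2; rewrite inE insideVP fc_rev => /and3P[-> ]; rewrite -/(fnext a) fc_next => ->.
by rewrite /within hull_inr inE /hs => /andP[-> ->].
Qed.

Lemma chi_ge1 Y : fcset (~: Y) -> Y != set0 -> Y != setT -> nE Y + 1 <= #|Y| + nT Y.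
Proof.
move=> cY Y0 YT; have := chi_setC Y; have := chi_le1 cY.
have -> : ~: Y != set0 by apply: contra YT => /eqP e; rewrite -(setCK Y) e setC0.
have -> : ~: Y != setT by apply: contra Y0 => /eqP e; rewrite -(setCK Y) e setCT.
move=> /(_ isT isT); lia.
Qed.

(* Both even-subset spaces have the dimension that Euler's formula leaves to the cuts. *)
Lemma face_conn : fcset setT.
Proof.
move=> X _ X0 XT; have [/existsP[a /andP[h1 h2]]|/existsPn h] := boolP [exists a, (fc a \in X) && (fc (rev a) \notin X)].
  by exists a; rewrite inE.
have cl a : fc a \in X -> fc (rev a) \in X.
  by move=> aX; have := h a; rewrite aX /= negbK.
pose S := [set v | [forall a, (vt a == v) ==> (fc a \in X)]].
have inS a : (vt a \in S) = (fc a \in X).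
  rewrite inE insideVP; case aX: (fc a \in X) => //=.
  have r1 : fc (rot a) \in X by rewrite -fc_rev cl.
  by rewrite r1 /rot' -fc_rev cl.
have eS : S = setT.
  apply: map_conn.
    by case/set0Pn: X0 => x xX; have [a ea] := fc_surj x; apply/set0Pn; exists (vt a); rewrite inS ea.
  by move=> a; rewrite !inS; apply: cl.
case/eqP: XT; apply/setP=> x; have [a <-] := fc_surj x; by rewrite -inS eS !inE.
Qed.

Lemma dart_ex : exists a : D, true.
Proof.
case: (pickP (@predT D)) => [a _|no]; first by exists a.
have d0 : #|D| = 0 by apply: eq_card0.
have := @map_euler M; have := card_dartV; have := card_dartE; rewrite d0.
have -> : #|face M| = 0.
  by apply: eq_card0 => x; have [a] := fc_surj x; have := no a.
by lia.
Qed.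

Lemma bip_cset (B : finType) (p : D -> B) : (forall z, exists a, p a = z) ->
  (forall X : {set B}, X != set0 -> (forall a, p a \in X -> p (rev a) \in X) -> X = setT) ->
  cset (inl \o p : D -> B + edge M) (inr \o @ed M) setT.
Proof.
move=> psurj pconn S _ S0 ST.
have [/existsP[a ha]|] := boolP [exists a, cut (inl \o p : D -> B + edge M) (inr \o @ed M) S a].
  by exists a; rewrite // /within !inE.
move=> /existsPn h; case/eqP: ST.
have hS a : (inl (p a) \in S) = (inr (ed a) \in S).
  by have := h a; rewrite /cut /=; case: (inl _ \in S); case: (inr _ \in S).
have eX : [set x | inl x \in S] = setT.
  apply: pconn.
    apply/set0Pn; case/set0Pn: S0 => -[x|x] xS; first by exists x; rewrite inE.
    by have [a ea] := ed_surj x; exists (p a); rewrite inE hS ea.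
  by move=> a; rewrite !inE !hS ed_rev.
have hl z : inl z \in S by have := in_setT z; rewrite -eX inE.
apply/setP=> -[x|x]; rewrite [RHS]inE ?hl //.
by have [a <-] := ed_surj x; rewrite -hS hl.
Qed.

(** There are 2^(|C|-1) cuts, and by Euler's formula this is also the upper bound for the number of
    even sets. Abstracting [p] and [q] lets the graph and its dual share the argument. *)
Lemma exact_gen (B C : finType) (p : D -> B) (q : D -> C) : #|C| + #|B| = #|edge M| + 2 ->
  (forall z, exists a, p a = z) -> (forall z, exists a, q a = z) ->
  (forall X : {set B}, X != set0 -> (forall a, p a \in X -> p (rev a) \in X) -> X = setT) ->
  (forall X : {set C}, X != set0 -> (forall a, q a \in X -> q (rev a) \in X) -> X = setT) ->
  let s : D -> B + edge M := inl \o p in let t : D -> B + edge M := inr \o @ed M in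
  let qc (S : {set C}) := [set a | (q a \in S) (+) (q (rev a) \in S)] in
  (forall S : {set C}, isj s t (qc S) set0) ->
  forall K, isj s t K set0 -> exists S : {set C}, K = qc S.
Proof.
move=> eul psurj qsurj pconn qconn s t qc qev K hK.
have [a0 _] := dart_ex; pose c0 := q a0.
pose F0 := [set K' | isj s t K' set0].
have F0P K' : K' \in F0 -> K' \subset [set a | within s t setT a] /\ isj s t K' set0.
  by rewrite inE => h; split=> //; apply/subsetP=> a _; rewrite !inE /within !inE.
have := @card_even_sets _ _ s t setT (inl (p a0)) F0 (bip_cset psurj pconn) (in_setT _) F0P.
have -> : #|[set a | within s t setT a]| = #|D|.
  by rewrite -cardsT; apply: eq_card => a; rewrite !inE /within !inE.
have qcs (S S' : {set C}) : qc (symd S S') = symd (qc S) (qc S').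
  apply/setP=> a; rewrite !inE; case: (q a \in S); case: (q a \in S');
  by case: (q (rev a) \in S); case: (q (rev a) \in S').
have inj : {in powerset (setT :\ c0) &, injective qc}.
  move=> S1 S2; rewrite !inE => s1 s2 e.
  have e0 : qc (symd S1 S2) = set0 by rewrite qcs e symdv.
  have [e1|S0] := eqVneq (symd S1 S2) set0.
    by rewrite -(symdK S2 S1) (symdC S2 S1) e1 symd0.
  have eT : symd S1 S2 = setT.
    apply: qconn => // a aS.
    by have := in_set0 a; rewrite -e0 inE aS /=; case: (_ \in symd _ _).
  have := in_setT c0; rewrite -eT in_symd.
  have -> : c0 \in S1 = false by apply/negP=> /(subsetP s1); rewrite !inE eqxx.
  by have -> : c0 \in S2 = false by apply/negP=> /(subsetP s2); rewrite !inE eqxx.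
have sub : qc @: powerset (setT :\ c0) \subset F0.
  by apply/subsetP=> Z /imsetP[S _ ->]; rewrite inE; apply: qev.
rewrite cardsT card_sum card_dartE => hle.
have cB : 0 < #|B| by apply/card_gt0P; exists (p a0).
have cC : 0 < #|C| by apply/card_gt0P; exists (q a0).
have le2 : #|F0| <= 2 ^ #|C|.-1.
  have : #|F0| * 2 ^ (#|B| + #|edge M|).-1 <= 2 ^ #|C|.-1 * 2 ^ (#|B| + #|edge M|).-1.
    rewrite -expnD; apply: (leq_trans hle); rewrite leq_exp2l //.
    by move: eul cB cC; clear; lia.
  by rewrite leq_pmul2r // expn_gt0.
have eF : qc @: powerset (setT :\ c0) = F0.
  apply/eqP; rewrite eqEcard sub card_in_imset // card_powerset.
  by have := cardsD1 c0 [set: C]; rewrite inE cardsT => h; rewrite h in le2.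
have : K \in F0 by rewrite inE.
by rewrite -eF => /imsetP[S _ ->]; exists S.
Qed.

Lemma fconn X : X != set0 -> (forall a, fc a \in X -> fc (rev a) \in X) -> X = setT.
Proof.
move=> X0 h; apply/eqP/negPn/negP=> XT.
by have [a [h1 _]] := face_conn (subsetT X) X0 XT; rewrite h.
Qed.

Lemma hcset : cset hs ht setT.
Proof. exact: (bip_cset (@fc_surj M) fconn). Qed.

Lemma vcut_exact K : isj hs ht K set0 -> exists S, K = vcut S.
Proof.
exact: (@exact_gen _ _ (@fc M) (@vt M) (@map_euler M) (@fc_surj M) (@vt_surj M) fconn (@map_conn M) vcut_even).
Qed.

Lemma fcut_exact K : isj gs gt K set0 -> exists X, K = fcut X.
Proof.
have e : #|face M| + #|vert M| = #|edge M| + 2 by rewrite addnC map_euler.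
exact: (@exact_gen _ _ (@vt M) (@fc M) e (@vt_surj M) (@fc_surj M) (@map_conn M) fconn fcut_even).
Qed.

Lemma card_pents : #|pents| = 12.
Proof.
have := dY_deg setT; rewrite /nK setTI /dY cardsT.
have -> : #|[set a : D | fc a \in [set: face M]]| = #|D|.
  by rewrite -cardsT; apply: eq_card => a; rewrite !inE.
have := card_dartV; have := card_dartE; have := @map_euler M; lia.
Qed.

End Map.

(** * An isoperimetric inequality *)

Section Iso.
Variable M : fmap.
Local Notation D := (dart M).
Implicit Types (a c d : D) (x : face M) (X Y Z : {set face M}).

Lemma fcset_grow Z Z2 : fcset Z -> Z != set0 -> Z \subset Z2 ->
  (forall x, x \in Z2 -> x \notin Z -> exists2 a, fc a = x & fc (rev a) \in Z) -> fcset Z2.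
Proof.
move=> cZ Z0 sZ hx S sS S0 SZ2.
have [h1|/set0Pn[z]] := eqVneq (S :&: Z) set0.
  case/set0Pn: S0 => x xS.
  have nZ y : y \in Z -> y \notin S.
    by move=> yZ; apply/negP=> yS; have := in_set0 y; rewrite -h1 inE yS yZ.
  have xZ : x \notin Z by apply/negP=> /nZ; rewrite xS.
  have [a ea ra] := hx x (subsetP sS _ xS) xZ.
  by exists a; rewrite ea xS (subsetP sZ _ ra) nZ.
rewrite inE => /andP[zS zZ].
have [h2|h2] := eqVneq (S :&: Z) Z.
  have sZS : Z \subset S by rewrite -h2 subsetIl.
  have [x xZ2 xS] : exists2 x, x \in Z2 & x \notin S.
    apply/subsetPn; apply: contra SZ2 => h; by rewrite eqEsubset sS h.
  have xZ : x \notin Z by apply: contra xS => /(subsetP sZS).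
  have [a ea ra] := hx x xZ2 xZ.
  by exists (rev a); rewrite revK ea (subsetP sZS _ ra) xZ2 xS.
have SZ0 : S :&: Z != set0 by apply/set0Pn; exists z; rewrite inE zS.
have [a [h3 h4 h5]] := cZ (S :&: Z) (subsetIr _ _) SZ0 h2.
move: h3 h5; rewrite !inE h4 andbT => /andP[h3 _] h5.
by exists a; rewrite h3 (subsetP sZ _ h4) h5.
Qed.

Definition inner Y := [set x in Y | [forall a, (fc a == x) ==> (fc (rev a) \in Y)]].
Definition rim Y := Y :\: inner Y.

Lemma in_rim Y x : (x \in rim Y) = (x \in Y) && (x \notin inner Y).
Proof. by rewrite in_setD andbC. Qed.

Lemma inner_sub Y : inner Y \subset Y.
Proof. by apply/subsetP=> x; rewrite inE => /andP[]. Qed.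

Lemma inner_nb Y a : fc a \in inner Y -> fc (rot a) \in Y /\ fc (rot' a) \in Y.
Proof.
rewrite inE => /andP[aY /forallP h]; split; first by have := h a; rewrite eqxx fc_rev.
have := h (rev (rot' a)); rewrite fc_rev revK /rot' rot3 eqxx; exact.
Qed.

Lemma rimP Y x : x \in rim Y -> x \in Y /\ exists2 a, fc a = x & fc (rev a) \notin Y.
Proof.
rewrite inE => /andP[h xY]; split=> //; move: h; rewrite inE xY /= negb_forall.
by case/existsP=> a; rewrite negb_imply => /andP[/eqP ea h]; exists a.
Qed.

Lemma fcset_inner Y : fcset (~: Y) -> Y != setT -> fcset (~: inner Y).
Proof.
move=> cY YT; apply: (fcset_grow cY).
- by apply: contra YT => /eqP e; rewrite -(setCK Y) e setC0.
- by rewrite setCS inner_sub.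
- move=> x; rewrite !(in_setC) negbK => h xY.
  have [|_ [a ea ra]] := @rimP Y x; first by rewrite in_setD h.
  by exists a; rewrite // inE.
Qed.

Lemma sum_rot (g : D -> nat) : \sum_a g (rot a) = \sum_a g a.
Proof. by rewrite [RHS](reindex (@rot M)) //; exists (@rot' M) => a _; [exact: rotK|exact: rot'K]. Qed.

Lemma card_sum_pred (P : pred D) : #|[set a | P a]| = \sum_a P a.
Proof. by rewrite -sum1_card big_mkcond; apply: eq_bigr => a _; rewrite inE; case: (P a). Qed.

(** The third corner of a triangle with two corners in the rim is outside [Y] or interior; an
    interior face has no neighbour outside [Y], so the two counts do not mix. *)
Lemma peel_nB Y : nB (rim Y) = nB Y + nA (inner Y).
Proof.
have -> : nA (inner Y) = \sum_a [&& fc (rot' a) \in inner Y, fc a \notin inner Y & fc (rot a) \notin inner Y].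
  rewrite /nA card_sum_pred -[LHS]sum_rot -[LHS](sum_rot (fun a => _ : nat)).
  by apply: eq_bigr => a _; rewrite /rot' !rot3.
rewrite /nB !card_sum_pred -big_split; apply: eq_bigr => a _ /=.
have h1 := @inner_nb Y a; have h2 := @inner_nb Y (rot a); have h3 := @inner_nb Y (rot' a).
have s1 := subsetP (inner_sub Y) (fc a); have s2 := subsetP (inner_sub Y) (fc (rot a)).
have s3 := subsetP (inner_sub Y) (fc (rot' a)).
move: h1 h2 h3 s1 s2 s3; rewrite /rot' rot3 !in_rim.
case: (fc a \in inner Y); case: (fc (rot a) \in inner Y); case: (fc (rot (rot a)) \in inner Y);
case: (fc a \in Y); case: (fc (rot a) \in Y); case: (fc (rot (rot a)) \in Y) => //=; intuition.
Qed.

Lemma peel_nT Y : nT Y = nT (inner Y) + nA (inner Y) + nB (inner Y) + nT (rim Y).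
Proof.
suff : 3 * nT Y = 3 * nT (inner Y) + 3 * nA (inner Y) + 3 * nB (inner Y) + 3 * nT (rim Y) by lia.
have sym (P : pred D) : 3 * #|[set a | P a]| = \sum_a (P a + P (rot a) + P (rot' a)).
  rewrite !big_split /= (sum_rot (fun a => P a : nat)) (sum_rot (fun a => P (rot a) : nat)).
  rewrite (sum_rot (fun a => P a : nat)) card_sum_pred; lia.
rewrite -!nT3 /nA /nB !sym !card_sum_pred -!big_split; apply: eq_bigr => a _ /=.
have h1 := @inner_nb Y a; have h2 := @inner_nb Y (rot a); have h3 := @inner_nb Y (rot' a).
have s1 := subsetP (inner_sub Y) (fc a); have s2 := subsetP (inner_sub Y) (fc (rot a)).
have s3 := subsetP (inner_sub Y) (fc (rot' a)).
move: h1 h2 h3 s1 s2 s3; rewrite /rot' !rot3 !in_rim.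
case: (fc a \in inner Y); case: (fc (rot a) \in inner Y); case: (fc (rot (rot a)) \in inner Y);
case: (fc a \in Y); case: (fc (rot a) \in Y); case: (fc (rot (rot a)) \in Y) => //=; intuition.
Qed.

Definition noiso Y := forall x, x \in Y -> exists2 a, fc a = x & fc (rev a) \in Y.

Lemma face_walk (P : pred D) a c : fc a = fc c -> P a ->
  (forall d, fc d = fc a -> P d -> P (fnext d)) -> P c.
Proof.
move=> /eqP; rewrite fc_eq => /iter_findex <- Pa h.
elim: (findex _ _ _) => //= n IH; apply: h => //.
elim: n {IH} => //= n IH; rewrite -IH; exact: fc_next.
Qed.

(** Around a face of the rim there are neighbours in [Y] and outside [Y], so somewhere they change;
    the triangle at that place has two corners in [Y]. *)
Lemma card_rim Y : noiso Y -> #|rim Y| <= nB Y.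
Proof.
move=> hY; rewrite -nB_rot.
apply: leq_trans (leq_imset_card (@fc M) _); apply: subset_leq_card.
apply/subsetP=> x xR; have [xY [c ec rc]] := rimP xR; have [a ea ra] := hY x xY.
have [/existsP[d /and3P[/eqP ed hd1 hd2]]|/existsPn h] :=
  boolP [exists d, [&& fc d == x, fc (rev (fprev d)) \in Y & fc (rev d) \notin Y]].
  apply/imsetP; exists d; last by rewrite ed.
  by rewrite inE ed xY -fc_rev hd2 /=; move: hd1; rewrite /fprev revK.
have := @face_walk (fun d => fc (rev d) \in Y) a c; rewrite ea ec (negbTE rc) => H.
suff : false by []; apply: H => // d ed hd.
by have := h (fnext d); rewrite fc_next ed eqxx fnextK hd /= negbK.
Qed.

Lemma peel_nE Y : nE Y = nE (inner Y) + nA (inner Y) + nB (inner Y) + nE (rim Y).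
Proof.
have := peel_nT Y; have := peel_nB Y; have := nE_eq Y; have := nE_eq (inner Y); have := nE_eq (rim Y).
lia.
Qed.

Lemma card_peel Y : #|Y| = #|inner Y| + #|rim Y|.
Proof. by rewrite /rim cardsD (setIidPr (inner_sub Y)) subnKC // subset_leq_card ?inner_sub. Qed.

(* [nA' <= 2 chi' + nB - t - 2], where [t] is the number of triangles inside the rim *)
Lemma peel_bound Y : fcset (~: Y) -> Y != set0 -> Y != setT -> noiso Y ->
  nA (inner Y) + nT (rim Y) + 2 + 2 * nE (inner Y) <= 2 * #|inner Y| + 2 * nT (inner Y) + nB Y.
Proof.
move=> cY Y0 YT nY.
have := chi_ge1 cY Y0 YT; have := card_rim nY; have := peel_nT Y; have := peel_nE Y; have := card_peel Y.
have := peel_nB Y; have := nE_eq (rim Y); lia.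
Qed.

Lemma nK_sub X Y : X \subset Y -> nK X <= nK Y.
Proof. by move=> h; apply: subset_leq_card; apply: setSI. Qed.

Lemma noisoP Y : noiso Y \/ exists2 x, x \in Y & forall a, fc a = x -> fc (rev a) \notin Y.
Proof.
have [/forall_inP h|] := boolP [forall x in Y, [exists a, (fc a == x) && (fc (rev a) \in Y)]].
  by left=> x /h /existsP[a /andP[/eqP ea ra]]; exists a.
rewrite negb_forall => /existsP[x]; rewrite negb_imply => /andP[xY /existsPn h].
by right; exists x => // a ea; have := h a; rewrite ea eqxx.
Qed.

Lemma remove_iso Y x : x \in Y -> (forall a, fc a = x -> fc (rev a) \notin Y) ->
  nT (Y :\ x) = nT Y /\ nB (Y :\ x) = nB Y.
Proof.
move=> xY hx.
have h1 a : fc a = x -> fc (rot a) \notin Y by move=> ea; rewrite -fc_rev hx.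
have h2 a : fc a = x -> fc (rot' a) \notin Y.
  by move=> ea; have := hx (rev (rot' a)); rewrite revK fc_rev /rot' rot3; apply.
split.
  apply/eqP; rewrite -(eqn_pmul2l (isT : 0 < 3)) -!nT3; apply/eqP; apply: eq_card => a; rewrite !inE.
  have := h1 a; have := h2 a; have := h1 (rot a).
  case: (eqVneq (fc a) x) => [e|_]; first by move=> _ /(_ e) /negbTE -> /(_ e) /negbTE ->; rewrite !andbF.
  case: (eqVneq (fc (rot a)) x) => [e /(_ e) /negbTE h _ _|_ _ _ _]; first by rewrite /rot' h !andbF.
  case: (eqVneq (fc (rot' a)) x) => [e|//].
  by have := h1 _ e; rewrite /rot' rot3 => /negbTE ->.
apply: eq_card => a; rewrite !inE.
have := h1 a; have := h2 (rot a); rewrite {1}/rot' rot3.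
case: (eqVneq (fc a) x) => [e _ /(_ e) /negbTE ->|_]; first by rewrite !andbF.
case: (eqVneq (fc (rot a)) x) => [e /(_ e) /negbTE -> _|_ _ _] //.
case: (eqVneq (fc (rot' a)) x) => [e|//].
by have := h1 _ e; rewrite /rot' rot3 => /negbTE ->.
Qed.

(** Peeling off the rim, with c = 6 - k' for k' pentagons in the interior, shortens the boundary by
    at least c and removes at most 2 b - c triangles; (b - c)^2 + c (2 b - c) = b^2 closes the
    induction. The extra summand excludes equality for two or more pentagons, on which the study of
    extremal packings rests. *)
Theorem isoperimetry Y : fcset (~: Y) -> Y != setT -> nK Y <= 5 ->
  (6 - nK Y) * nT Y + ((2 <= nK Y) && (0 < nB Y)) <= nB Y ^ 2.
Proof.
move: {2}#|Y|.+1 (ltnSn #|Y|) => n; elim: n Y => // n IH Y ltY cY YT kY.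
have [Y0|Y0] := eqVneq Y set0.
  have e := nAB_chi Y; have e2 := nE_eq Y; have e3 := dY_eq Y; have e4 := dY_deg Y.
  have K0 : nK Y = 0 by rewrite /nK Y0 set0I cards0.
  have c0 : #|Y| = 0 by rewrite Y0 cards0.
  have T0 : nT Y = 0 by move: e e2 e3 e4; rewrite K0 c0; clear; lia.
  by rewrite K0 T0 muln0.
have [nY|[x xY hx]] := noisoP Y; last first.
  have [eT eB] := remove_iso xY hx.
  have cY' : fcset (~: (Y :\ x)).
    apply: (fcset_grow cY); first by apply: contra YT => /eqP e; rewrite -(setCK Y) e setC0.
      by rewrite setCS subD1set.
    move=> z; rewrite !inE negb_and !negbK => /orP[/eqP ->|/negbTE ->] //.
    by move=> _; have [a ea] := fc_surj x; exists a; rewrite // inE hx.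
  have lt' : #|Y :\ x| < n by have := cardsD1 x Y; rewrite xY; move: ltY; clear; lia.
  have YT' : Y :\ x != setT by apply/eqP=> e; have := in_setT x; rewrite -e !inE eqxx.
  have k' : nK (Y :\ x) <= nK Y by apply: nK_sub; apply: subD1set.
  have := IH _ lt' cY' YT' (leq_trans k' kY); rewrite eT eB.
  have [ek|nk] := eqVneq (nK (Y :\ x)) (nK Y); first by rewrite ek.
  move: k' kY; rewrite leq_eqVlt (negbTE nk) /=; clear.
  move: (nK _) (nK _) (nT Y) (nB Y) => k1 k2 t b; case: b => [|b]; first by nia.
  by case: t => [|t]; nia.
have cI := fcset_inner cY YT.
have IT : inner Y != setT.
  by apply: contra YT => /eqP e; rewrite eqEsubset subsetT -e inner_sub.
have kI : nK (inner Y) <= nK Y by apply: nK_sub; apply: inner_sub.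
have h1 := peel_bound cY Y0 YT nY; have h2 := nAB_chi (inner Y); have h3 := peel_nT Y.
have h4 := nE_eq (inner Y).
have [I0|I0] := eqVneq (inner Y) set0.
  have e3 := dY_eq (inner Y); have e4 := dY_deg (inner Y).
  have K0 : nK (inner Y) = 0 by rewrite /nK I0 set0I cards0.
  have c0 : #|inner Y| = 0 by rewrite I0 cards0.
  have T0 : nT (inner Y) = 0 by move: e3 e4; rewrite K0 c0; clear; lia.
  have T1 : nT Y + 2 <= nB Y by move: h1 h2 h3 h4 e3 e4; rewrite K0 c0 T0; clear; lia.
  move: T1; clear; move: (nT Y) (nB Y) (nK Y) => t b k T1.
  have l1 : (6 - k) * t <= 6 * t by rewrite leq_mul2r leq_subr orbT.
  have l2 : 6 * t + 1 <= b ^ 2.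
    apply: (@leq_trans ((t + 2) ^ 2)); last by rewrite leq_exp2r.
    by clear; case: t => [|[|t]] //; nia.
  by apply: leq_trans l2; apply: leq_add l1 _; case: (_ && _).
have g1 := chi_ge1 cI I0 IT.
have lt' : #|inner Y| < n.
  have r0 : 0 < #|rim Y|.
    rewrite lt0n cards_eq0; apply/eqP=> r0.
    have e : inner Y = Y by apply/eqP; rewrite eqEsubset inner_sub -setD_eq0 -/(rim Y) r0 eqxx.
    case/eqP: YT; apply: fconn => // a; rewrite -{1}e inE => /andP[_ /forallP/(_ a)].
    by rewrite eqxx.
  by have := card_peel Y; move: ltY r0; clear; lia.
have := IH _ lt' cI IT (leq_trans kI kY).
have s1 : nB (inner Y) + (6 - nK (inner Y)) <= nB Y by move: h1 h2 g1 kI kY; clear; lia.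
have s2 : nT Y + (6 - nK (inner Y)) <= nT (inner Y) + 2 * nB Y by move: h1 h2 h3 g1 kI kY; clear; lia.
have s3 : nB (inner Y) = 0 -> nT (inner Y) = 0 -> 2 <= nK (inner Y) ->
   nT Y + (6 - nK (inner Y)) + 2 <= nT (inner Y) + 2 * nB Y.
  move=> b0 t0 k2; have : nK (inner Y) <= #|inner Y| by apply: subset_leq_card; apply: subsetIl.
  by move: h1 h2 h3 h4 g1 kI kY b0 t0 k2; clear; lia.
move: s1 s2 s3 kI kY; clear.
move: (nB _) (nT _) (nK _) (nB Y) (nT Y) (nK Y) => b' t' k' b t k s1 s2 s3 kI kY IH.
have IH1 : (6 - k') * t' <= b' ^ 2 by move: IH; case: (_ && _); clear; lia.
have main : (6 - k') * t <= b ^ 2.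
  have : (6 - k') * (t + (6 - k')) <= (6 - k') * (t' + 2 * b) by rewrite leq_mul2l s2 orbT.
  by move: s1 IH1; move: (6 - k') => c; clear; nia.
case ib: ((2 <= k) && (0 < b)); last first.
  by rewrite addn0; apply: leq_trans main; rewrite leq_mul2r; apply/orP; right; move: kI; clear; lia.
case/andP: ib => k2 b0.
have [t0|t0] := posnP t; first by rewrite t0 muln0 add0n; nia.
have [kk|kk] := ltnP k' k.
  apply: leq_trans main; have -> : 6 - k' = (6 - k) + (k - k') by move: kI kY; clear; lia.
  rewrite mulnDl leq_add2l; move: kk t0; clear; nia.
have ek : k' = k by apply/eqP; rewrite eqn_leq kI kk.
rewrite -ek in k2 *.
have [b'0|b'0] := posnP b'; last first.
  have IH2 : (6 - k') * t' + 1 <= b' ^ 2 by move: IH; rewrite k2 b'0.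
  have : (6 - k') * (t + (6 - k')) <= (6 - k') * (t' + 2 * b) by rewrite leq_mul2l s2 orbT.
  by move: s1 IH2; move: (6 - k') => c; clear; nia.
have t'0 : t' = 0 by move: IH1 kI kY ek; rewrite b'0; clear; case: t' => // t'; nia.
have s4 := s3 b'0 t'0 k2.
have c1 : 1 <= 6 - k' by move: kI kY; clear; lia.
have : (6 - k') * (t + (6 - k') + 2) <= (6 - k') * (t' + 2 * b) by rewrite leq_mul2l s4 orbT.
rewrite t'0 add0n; move: c1; move: (6 - k') => c c1 h; have [q _] := nat_Cauchy b c.
by move: c1 h q; clear; nia.
Qed.

End Iso.

(** * Packing odd bonds *)

Lemma seq_choice (A B : eqType) (b0 : B) (l : seq A) (P : A -> B -> Prop) :
  (forall x, x \in l -> exists y, P x y) -> exists h : A -> B, forall x, x \in l -> P x (h x).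
Proof.
elim: l => [|x l IH] h; first by exists (fun=> b0).
have [y Py] := h x (mem_head _ _).
have [|k hk] := IH; first by move=> z zl; apply: h; rewrite inE zl orbT.
exists (fun z => if z == x then y else k z) => z; rewrite inE.
by case: eqVneq => [->|_ /hk].
Qed.

Section Bonds.
Variables (W E : finType) (s t : E -> W).
Local Notation cset := (cset s t).
Local Notation cut := (cut s t).
Local Notation within := (within s t).
Hypothesis gconn : cset setT.
Implicit Types (X Y Z S C T : {set W}) (g : E).

Lemma cut_ex Z : Z != set0 -> Z != setT -> exists g, cut Z g.
Proof. by move=> Z0 ZT; have [g cg _] := gconn (subsetT Z) Z0 ZT; exists g. Qed.

(** A union of components left by the removal of [X], if [C] avoids [X]: every edge leaving [C] ends
    in [X]. *)
Definition closedin X C := forall g, (s g \in C -> (t g \in C) || (t g \in X)) /\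
  (t g \in C -> (s g \in C) || (s g \in X)).
Definition closedinb X C := [forall g, ((s g \in C) ==> ((t g \in C) || (t g \in X))) &&
  ((t g \in C) ==> ((s g \in C) || (s g \in X)))].

Lemma closedinP X C : reflect (closedin X C) (closedinb X C).
Proof.
by apply: (iffP forallP) => h g; have := h g; [case/andP=> /implyP ? /implyP ?|case=> /implyP -> /implyP ->].
Qed.

Definition bond X C := [/\ [disjoint X & C], cset C, cset (~: C) & closedin X C].

Lemma closedin_cut X C g : [disjoint X & C] -> closedin X C -> cut C g -> cut X g.
Proof.
move=> d h; have [h1 h2] := h g; rewrite /cut.
have d1 z : z \in C -> z \notin X.
  by move=> zC; apply/negP=> zX; have := disjointFr d zX; rewrite zC.
case sC: (s g \in C); case tC: (t g \in C) => //= _.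
  by move: (h1 sC); rewrite tC /= => ->; rewrite (negbTE (d1 _ sC)).
by move: (h2 tC); rewrite sC /= => ->; rewrite (negbTE (d1 _ tC)).
Qed.

Lemma card_setCI T Z : #|Z :&: T| + #|~: Z :&: T| = #|T|.
Proof. by rewrite setIC [~: Z :&: T]setIC -setDE cardsID. Qed.

Lemma odd_setCI T Z : ~~ odd #|T| -> odd #|Z :&: T| -> odd #|~: Z :&: T|.
Proof.
move=> eT oZ; move: eT; rewrite -(card_setCI T Z) oddD oZ /=.
by rewrite negbK.
Qed.

(** The complement of [X] meets [T] oddly. A smallest union of its components with this property is
    a single component [C], and the complement of [C] is connected because all other components hang
    on the connected [X]. *)
Lemma bond_ex X T : cset X -> odd #|X :&: T| -> ~~ odd #|T| ->
  exists C, bond X C /\ odd #|C :&: T|.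
Proof.
move=> cX oX eT.
pose P C := [&& [disjoint X & C], closedinb X C & odd #|C :&: T|].
have P0 : P (~: X).
  apply/and3P; split.
  - by rewrite disjoints_subset setCK.
  - by apply/closedinP=> g; rewrite !inE; split=> _; case: (_ \in X).
  - exact: odd_setCI.
case: (arg_minnP (fun C : {set W} => #|C|) P0) => C /and3P[dC /closedinP clC oC] mC.
have X0 : X != set0 by apply: contraTneq oX => ->; rewrite set0I cards0.
exists C; split=> //; split=> //.
  move=> S sS S0 SC.
  have [/existsP[g /andP[h1 h2]]|/existsPn h] := boolP [exists g, cut S g && within C g]; first by exists g.
  have cl S' : S' \subset C -> (forall g, within C g -> ~~ cut S' g) -> closedinb X S'.
    move=> sS' hS'; apply/closedinP=> g; have [c1 c2] := clC g; split=> gS.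
      have gC := subsetP sS' _ gS; have := c1 gC; case tX: (t g \in X); rewrite ?orbT // !orbF => tC.
      by have := hS' g; rewrite /within /cut gC tC gS => /(_ isT) /=; rewrite negbK.
    have gC := subsetP sS' _ gS; have := c2 gC; case tX: (s g \in X); rewrite ?orbT // !orbF => tC.
    by have := hS' g; rewrite /within /cut gC tC gS addbT negbK => /(_ isT).
  have dS S' : S' \subset C -> [disjoint X & S'].
    by move=> sS'; rewrite disjoint_sym; apply: (disjointWl sS'); rewrite disjoint_sym.
  have ltS : #|S| < #|C| by apply: proper_card; rewrite properEneq SC.
  have ltD : #|C :\: S| < #|C|.
    have := cardsID S C; rewrite (setIidPr sS); have : 0 < #|S| by rewrite card_gt0.
    by move=> ? ?; lia.
  have n1 : ~~ odd #|S :&: T|.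
    apply/negP=> o1; have := mC S; rewrite /P dS // cl // ?o1 => [/(_ isT)|g wg]; first by rewrite leqNgt ltS.
    by have := h g; rewrite wg andbT.
  have n2 : ~~ odd #|(C :\: S) :&: T|.
    have sD : C :\: S \subset C by apply: subsetDl.
    apply/negP=> o1; have := mC (C :\: S); rewrite /P dS // cl // ?o1 => [/(_ isT)|g wg]; first by rewrite leqNgt ltD.
    have := h g; rewrite wg andbT /cut !inE; case/andP: wg => -> ->; rewrite !andbT.
    by case: (s g \in S); case: (t g \in S).
  move: oC; have -> : C :&: T = (S :&: T) :|: ((C :\: S) :&: T).
    apply/setP=> w; rewrite !inE; case wS: (w \in S) => //=.
    by rewrite (subsetP sS _ wS) orbF.
  have dd : [disjoint S :&: T & (C :\: S) :&: T].
    by rewrite -setI_eq0; apply/eqP/setP=> w; rewrite !inE; case: (w \in S); rewrite ?andbF.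
  have := leq_card_setU (S :&: T) ((C :\: S) :&: T); rewrite dd => /leqifP /eqP ->.
  by rewrite oddD (negbTE n1) (negbTE n2).
have key S : S \subset ~: C -> S != set0 -> [disjoint X & S] -> exists2 g, cut S g & within (~: C) g.
  move=> sS S0 dS.
  have ST : S != setT.
    case/set0Pn: X0 => x xX; apply/eqP=> e; have := disjointFr dS xX; by rewrite e inE.
  have [g cg] := cut_ex S0 ST; exists g => //.
  have nC z : z \in S -> z \notin C by move=> /(subsetP sS); rewrite inE.
  have nX z : z \in S -> z \notin X.
    by move=> zS; apply/negP=> zX; have := disjointFr dS zX; rewrite zS.
  have [c1 c2] := clC g; move: cg; rewrite /cut /within !inE.
  case sgS: (s g \in S); case tgS: (t g \in S) => //= _.
    rewrite (nC _ sgS) /=; apply/negP=> tC; have := c2 tC.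
    by rewrite (negbTE (nC _ sgS)) (negbTE (nX _ sgS)).
  rewrite (nC _ tgS) andbT; apply/negP=> sC; have := c1 sC.
  by rewrite (negbTE (nC _ tgS)) (negbTE (nX _ tgS)).
have XC : X \subset ~: C by rewrite -disjoints_subset.
move=> S sS S0 SC.
have [e0|n0] := eqVneq (S :&: X) set0.
  by apply: key => //; rewrite -setI_eq0 setIC e0.
have [eX|nX] := eqVneq (S :&: X) X.
  have [|||g cg wg] := key (~: C :\: S).
  - exact: subsetDl.
  - by apply: contra SC; rewrite setD_eq0 => h; rewrite eqEsubset sS h.
  - rewrite -setI_eq0; apply/eqP/setP=> w; rewrite !inE -eX !inE.
    by case: (w \in S); rewrite /= ?andbF.
  exists g => //; move: cg wg; rewrite /cut /within !inE.
  by case/(fun x => x): (s g \in C); case: (t g \in C); case: (s g \in S); case: (t g \in S).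
have [g cg wg] := cX _ (subsetIr S X) n0 nX; exists g.
  by move: cg wg; rewrite /cut /within !inE => h /andP[h1 h2]; move: h; rewrite h1 h2 !andbT.
by case/andP: wg => h1 h2; rewrite /within (subsetP XC _ h1) (subsetP XC _ h2).
Qed.

(** Cross-free sets: unlike laminarity, this is preserved by complementation. *)
Definition xfree X Y := [|| X \subset Y, Y \subset X, [disjoint X & Y] | ~: X \subset Y].

Lemma xfreeCl X Y : xfree X Y -> xfree (~: X) Y.
Proof.
rewrite /xfree setCK (disjoints_subset (~: X)) setCS => /or4P[]; try by move=> ->; rewrite ?orbT.
by rewrite disjoint_sym disjoints_subset => ->; rewrite ?orbT.
Qed.

Lemma xfree_sym X Y : xfree X Y -> xfree Y X.
Proof.
rewrite /xfree => /or4P[]; try by move=> ->; rewrite ?orbT.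
  by rewrite disjoint_sym => ->; rewrite ?orbT.
by rewrite subCset => ->; rewrite ?orbT.
Qed.

Lemma xfreeCr X Y : xfree X Y -> xfree X (~: Y).
Proof. by move=> h; apply/xfree_sym/xfreeCl/xfree_sym. Qed.

Lemma cset_side X C (A0 : {set W}) : closedin X C -> cset A0 -> [disjoint A0 & X] ->
  (A0 \subset C) || [disjoint A0 & C].
Proof.
move=> clC cA dA; rewrite -setI_eq0; have [e|n0] := boolP (A0 :&: C == set0); first by rewrite orbT.
have [e|n1] := eqVneq (A0 :&: C) A0; first by rewrite -e subsetIr.
have [g] := cA _ (subsetIl A0 C) n0 n1; rewrite /cut /within !inE => h /andP[h1 h2].
have [c1 c2] := clC g; move: h c1 c2; rewrite h1 h2 /=.
have -> : s g \in X = false by rewrite (disjointFr dA).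
have -> : t g \in X = false by rewrite (disjointFr dA).
by rewrite !orbF; case: (s g \in C); case: (t g \in C) => //= _; [move/(_ isT)|move=> _ /(_ isT)].
Qed.

(** A connected set that avoids [X] lies on one side of a union of components outside [X]. When
    neither component avoids the other set, [X2] lies in [C1] and [X1] in [C2], and the connected
    complement of [C1] avoids [X2]. *)
Lemma bond_xfree X1 C1 X2 C2 : cset X1 -> cset X2 -> X1 != set0 -> bond X1 C1 -> bond X2 C2 -> lam X1 X2 -> xfree C1 C2.
Proof.
move=> cX1 cX2 X10 [d1 k1 kc1 cl1] [d2 k2 kc2 cl2] /or3P[sub|sub|dis].
- have : [disjoint C2 & X1] by rewrite disjoint_sym; apply: (disjointWl sub).
  by move/(cset_side cl1 k2); rewrite /xfree => /orP[->|]; rewrite ?orbT // disjoint_sym => ->; rewrite ?orbT.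
- have : [disjoint C1 & X2] by rewrite disjoint_sym; apply: (disjointWl sub).
  by move/(cset_side cl2 k1); rewrite /xfree => /orP[->|->]; rewrite ?orbT.
have [a1|a1] := boolP [disjoint C1 & X2].
  by have := cset_side cl2 k1 a1; rewrite /xfree => /orP[->|->]; rewrite ?orbT.
have [a2|a2] := boolP [disjoint C2 & X1].
  by have := cset_side cl1 k2 a2; rewrite /xfree => /orP[->|]; rewrite ?orbT // disjoint_sym => ->; rewrite ?orbT.
have s2 : X2 \subset C1.
  have dis' : [disjoint X2 & X1] by rewrite disjoint_sym.
  by have /orP[//|] := cset_side cl1 cX2 dis'; rewrite disjoint_sym (negbTE a1).
have s1 : X1 \subset C2.
  by have /orP[//|] := cset_side cl2 cX1 dis; rewrite disjoint_sym (negbTE a2).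
have : [disjoint ~: C1 & X2] by rewrite disjoint_sym disjoints_subset setCK.
move/(cset_side cl2 kc1); rewrite /xfree => /orP[->|]; rewrite ?orbT //.
case/set0Pn: X10 => x xX d; have := disjointFr d (_ : x \in ~: C1).
rewrite (subsetP s1 _ xX) inE (disjointFr d1 xX) => /(_ isT) //.
Qed.

Variable col : W -> bool.
Hypothesis colP : forall g, col (s g) != col (t g).

Definition side T X Z := [/\ cset Z, cset (~: Z), odd #|Z :&: T|, (#|Z :&: T|.*2 < #|T|) /\ (exists c, ucol s t col Z c)
  & (forall g, cut Z g -> cut X g) /\ exists C, bond X C /\ (Z = C \/ Z = ~: C)].

(** Half of |T| is even, so an odd part is never exactly half and one of [C], [~: C] has less than
    half of [T]. The colour flips on passing from [X] to [C], since the inner ends of the cut become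
    its outer ends. *)
Lemma side_ex T X c : cset X -> odd #|X :&: T| -> ~~ odd #|T| -> ~~ odd #|T|./2 -> ucol s t col X c -> exists Z, side T X Z.
Proof.
move=> cX oX eT eT2 uX; have [C [bC oC]] := bond_ex cX oX eT.
have [dC kC kC' clC] := bC.
have cc : #|C :&: T| + #|~: C :&: T| = #|T| by exact: card_setCI.
have d1 z : z \in C -> z \notin X by move=> zC; apply/negP=> zX; have := disjointFr dC zX; rewrite zC.
have uC : ucol s t col C (~~ c).
  move=> g; have [c1 c2] := clC g; have [u1 u2] := uX g; have := colP g.
  split=> h1 h2.
    move: (c1 h1); rewrite (negbTE h2) /= => tX.
    by move: (u2 tX (d1 _ h1)) H; case: (col (s g)); case: (col (t g)) => // <-.
  move: (c2 h1); rewrite (negbTE h2) /= => tX.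
  by move: (u1 tX (d1 _ h1)) H; case: (col (s g)); case: (col (t g)) => // <-.
have uC' : ucol s t col (~: C) c.
  move=> g; rewrite !inE !negbK; have [v1 v2] := uC g; have := colP g.
  split=> h1 h2; [move: (v2 h2 h1) H|move: (v1 h2 h1) H]; by case: (c) => /=; case: (col (s g)); case: (col (t g)).
have ct g : cut C g -> cut X g by apply: closedin_cut.
have [lt|ge] := ltnP (#|C :&: T|.*2) #|T|.
  exists C; split=> //; first by split=> //; exists (~~ c).
  by split=> //; exists C; split=> //; left.
exists (~: C); split=> //.
- by rewrite setCK.
- exact: odd_setCI.
- split; last by exists c.
  have ne : #|C :&: T|.*2 != #|T|.
    apply/eqP=> e; move: eT2; rewrite -e doubleK oC //.
  have : #|T| < #|C :&: T|.*2 by rewrite ltn_neqAle eq_sym ne.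
  by rewrite -cc -!addnn; lia.
- split; first by move=> g; rewrite cut_setC; apply: ct.
  by exists C; split=> //; right.
Qed.

(** Both sides of every cut become connected, which makes regions into discs. Nothing is lost in
    number: cuts are nonempty, so two equal sides would have a common edge. *)
Theorem bond_packing T (l : seq {set W}) : ~~ odd #|T| -> ~~ odd #|T|./2 ->
  {in l, forall X, [/\ cset X, odd #|X :&: T| & exists c, ucol s t col X c]} ->
  pairwise (@lam W) l -> pairwise (nocom s t) l ->
  exists F : {set {set W}}, [/\ #|F| = size l,
    {in F, forall Z, [/\ cset Z, cset (~: Z), odd #|Z :&: T|, (#|Z :&: T|.*2 < #|T|) & exists c, ucol s t col Z c]} &
    {in F &, forall Z1 Z2, Z1 != Z2 -> lam Z1 Z2 && nocom s t Z1 Z2}].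
Proof.
move=> eT eT2 hl laml nocl.
have [|h hP] := @seq_choice _ _ set0 l (side T).
  by move=> X /hl[cX oX [c uX]]; apply: side_ex cX oX eT eT2 uX.
have lamh X Y : X \in l -> Y \in l -> lam X Y -> lam (h X) (h Y).
  move=> Xl Yl lXY; have [_ _ o1 [lt1 _] [_ [C1 [b1 e1]]]] := hP X Xl; have [_ _ o2 [lt2 _] [_ [C2 [b2 e2]]]] := hP Y Yl.
  have [cX oX _] := hl _ Xl; have [cY _ _] := hl _ Yl.
  have X0 : X != set0 by apply: contraTneq oX => ->; rewrite set0I cards0.
  have x := bond_xfree cX cY X0 b1 b2 lXY.
  have : xfree (h X) (h Y) by case: e1 => ->; case: e2 => ->; rewrite ?xfreeCl // ?xfreeCr // xfreeCl.
  case/or4P=> q; apply/or3P; [exact: Or31|exact: Or32|exact: Or33|].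
  (* The fourth case of cross-freeness would cover [T] by two sets with less than half of it
     each. *)
  exfalso; have : T \subset (h X :&: T) :|: (h Y :&: T).
    by apply/subsetP=> w wT; rewrite !inE wT !andbT; case wX: (w \in h X) => //=; apply: (subsetP q); rewrite inE wX.
  move/subset_leq_card; rewrite cardsU; move: lt1 lt2; rewrite -!addnn; clear; lia.
have noch X Y : X \in l -> Y \in l -> nocom s t X Y -> nocom s t (h X) (h Y).
  move=> Xl Yl /forallP n; apply/forallP=> g; apply: contra (n g) => /andP[c1 c2].
  by have [_ _ _ _ [q1 _]] := hP X Xl; have [_ _ _ _ [q2 _]] := hP Y Yl; rewrite q1 ?q2.
pose l2 := map h l.
have lam2 : pairwise (@lam W) l2.
  rewrite pairwise_map; apply: (sub_in_pairwise (P := mem l)) laml; last by apply/allP.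
  by move=> X Y; apply: lamh.
have noc2 : pairwise (nocom s t) l2.
  rewrite pairwise_map; apply: (sub_in_pairwise (P := mem l)) nocl; last by apply/allP.
  by move=> X Y; apply: noch.
have prop2 : {in l2, forall Z, [/\ cset Z, cset (~: Z), odd #|Z :&: T|, (#|Z :&: T|.*2 < #|T|) & exists c, ucol s t col Z c]}.
  by move=> Z /mapP[X Xl ->]; have [? ? ? [? ?] _] := hP X Xl.
have cutZ Z : Z \in l2 -> exists g, cut Z g.
  move=> Zl; have [_ _ o lt _] := prop2 Z Zl; apply: cut_ex.
    by apply: contraTneq o => ->; rewrite set0I cards0.
  by apply: contraTneq lt => ->; rewrite setTI -addnn -leqNgt leq_addr.
have irr Z : Z \in l2 -> ~~ nocom s t Z Z.
  by move=> /cutZ[g cg]; apply/forallP=> /(_ g); rewrite cg.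
have uq : uniq l2.
  elim: (l2) noc2 irr => //= Z l' IH /andP[/allP h1 h2] irr; rewrite IH //; last first.
    by move=> Y Yl; apply: irr; rewrite inE Yl orbT.
  by rewrite andbT; apply/negP=> /h1; rewrite (negbTE (irr _ (mem_head _ _))).
have lam_sym X Y : lam X Y = lam Y X by rewrite /lam orbCA disjoint_sym.
have noc_sym X Y : nocom s t X Y = nocom s t Y X by apply: eq_forallb => g; rewrite andbC.
have pw (r : rel {set W}) : (forall X Y, r X Y = r Y X) -> forall l' : seq {set W}, pairwise r l' -> {in l' &, forall X Y, X != Y -> r X Y}.
  move=> rs; elim=> //= Z l' IH /andP[/allP h1 h2] X Y; rewrite !inE => /orP[/eqP->|Xl] /orP[/eqP->|Yl].
  - by rewrite eqxx.
  - by move=> _; apply: h1.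
  - by move=> _; rewrite rs; apply: h1.
  - exact: IH.
exists [set Z in l2]; split.
- by rewrite cardsE (card_uniqP uq) size_map.
- by move=> Z; rewrite inE; apply: prop2.
- move=> Z1 Z2; rewrite !inE => z1 z2 ne.
  by rewrite (pw _ lam_sym _ lam2) // (pw _ noc_sym _ noc2).
Qed.

End Bonds.

(** * The area bound *)

Section Area.
Variable M : fmap.
Local Notation D := (dart M).
Local Notation W := (face M + edge M)%type.
Implicit Types (a c d : D) (x : face M) (Y : {set face M}) (Z : {set W}).

Definition isface (w : W) := if w is inl _ then true else false.
Definition tf : {set W} := [set inl x | x in pents M].
Definition fpart Z : {set face M} := [set x | inl x \in Z].

Lemma card_tf : #|tf| = 12.
Proof. by rewrite card_imset ?card_pents // => x y []. Qed.

Lemma in_tf x : (inl x \in tf) = pent x.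
Proof.
apply/imsetP/idP=> [[y]|h]; first by rewrite inE => h [->].
by exists x; rewrite ?inE.
Qed.

Lemma card_tfI Z : #|Z :&: tf| = nK (fpart Z).
Proof.
rewrite /nK -(card_imset (fpart Z :&: pents M) (inl_inj : injective (@inl _ (edge M)))).
apply: eq_card => w; rewrite inE; apply/andP/imsetP=> [[h1 /imsetP[y yp e]]|[y]].
  by exists y; rewrite // inE yp inE -e h1.
by rewrite !inE => /andP[h1 h2] ->; rewrite in_tf.
Qed.

Definition good Z := [/\ cset (@hs M) (@ht M) Z, cset (@hs M) (@ht M) (~: Z), odd #|Z :&: tf|,
  (#|Z :&: tf|.*2 < #|tf|) & exists u : bool, ucol (@hs M) (@ht M) isface Z u].

Lemma good_k Z : good Z -> odd (nK (fpart Z)) /\ nK (fpart Z) <= 5.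
Proof.
case=> _ _ o lt _; move: o lt; rewrite card_tfI card_tf; split=> //.
by move: lt; rewrite -addnn; move: o; case: (nK _) => [|[|[|[|[|[|n]]]]]] //=; lia.
Qed.

Lemma good_in Z : good Z -> exists2 x, pent x & inl x \in Z.
Proof.
move=> /good_k[o _]; have : 0 < nK (fpart Z) by case: (nK _) o.
by rewrite card_gt0 => /set0Pn[x]; rewrite !inE => /andP[h1 h2]; exists x.
Qed.

Lemma good_out Z : good Z -> exists2 x, pent x & inl x \notin Z.
Proof.
move=> g; have [_ k5] := good_k g.
have [/existsP[x /andP[h1 h2]]|/existsPn h] := boolP [exists x, pent x && (inl x \notin Z)]; first by exists x.
suff : 12 <= nK (fpart Z) by move=> h'; move: (leq_trans h' k5).
rewrite -(card_pents M); apply: subset_leq_card; apply/subsetP=> x; rewrite !inE => px.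
by have := h x; rewrite px /= negbK => ->.
Qed.

Lemma fpart_fcset Z : cset (@hs M) (@ht M) Z -> fcset (fpart Z).
Proof.
move=> cZ S sS S0 SY.
pose S2 := [set w in Z | match w with inl x => x \in S | inr x => [exists a, (ed a == x) && (fc a \in S)] end].
have inS2 a : (inr (ed a) \in S2) = (inr (ed a) \in Z) && ((fc a \in S) || (fc (rev a) \in S)).
  rewrite inE; congr (_ && _); apply/existsP/orP=> [[c]|[h|h]].
  - by rewrite eq_sym ed_eq => /andP[/orP[] /eqP -> h]; [left|right].
  - by exists a; rewrite eqxx.
  - by exists (rev a); rewrite ed_rev eqxx.
have inlS x : (inl x \in S2) = (x \in S).
  by rewrite inE; case xS: (x \in S); rewrite ?andbF ?andbT //; have := subsetP sS _ xS; rewrite inE.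
have [|||g cg wg] := cZ S2.
- by apply/subsetP=> w; rewrite inE => /andP[].
- by case/set0Pn: S0 => x xS; apply/set0Pn; exists (inl x); rewrite inlS.
- by apply: contra SY => /eqP e; apply/eqP/setP=> x; rewrite inE -e inlS.
have /andP[z1 z2] := wg; rewrite /hs /ht in z1 z2.
move: cg; rewrite /cut /hs /ht inlS inS2 z2 /=.
case gS: (fc g \in S) => //=; case rS: (fc (rev g) \in S) => //= _.
by exists (rev g); rewrite revK rS inE z1 gS.
Qed.

(** If the inner ends of the cut are faces, no midpoint of the region has an outer face; if they are
    midpoints, no face of the region has an outer midpoint. Connectedness of both sides excludes
    midpoints separated from both their faces. *)
Lemma good_shape Z : good Z -> exists al : bool, forall a,
  (inr (ed a) \in Z) = if al then (fc a \in fpart Z) || (fc (rev a) \in fpart Z)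
                        else (fc a \in fpart Z) && (fc (rev a) \in fpart Z).
Proof.
move=> gZ; have [x px xZ] := good_in gZ; have [y py yZ] := good_out gZ.
case: gZ => cZ cZ' _ _ [c uZ].
have u a : (inl (fc a) \in Z -> inr (ed a) \notin Z -> c = true) /\ (inr (ed a) \in Z -> inl (fc a) \notin Z -> c = false).
  by have [h1 h2] := uZ a; split=> p q; [rewrite -(h1 p q)|rewrite -(h2 p q)].
have iso (Z' : {set W}) a z : cset (@hs M) (@ht M) Z' -> inl z \in Z' -> inr (ed a) \in Z' ->
    (inl (fc a) \in Z') || (inl (fc (rev a)) \in Z').
  move=> cZ1 zZ aZ; have [|||g cg] := cZ1 [set inr (ed a)].
  - by rewrite sub1set.
  - by apply/set0Pn; exists (inr (ed a)); rewrite inE.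
  - by apply/eqP=> e; move: zZ; rewrite -e inE.
  rewrite /within => /andP[h1 _]; move: cg; rewrite /cut !inE /= => /eqP[e].
  have : ed a == ed g by rewrite e.
  by rewrite ed_eq => /orP[] /eqP e2; move: h1; rewrite /hs e2 => ->; rewrite ?orbT.
exists (~~ c) => a; rewrite !inE; have [u1 u2] := u a; have [u3 u4] := u (rev a); rewrite ed_rev in u3 u4.
case: c u uZ u1 u2 u3 u4 => /= _ _ u1 u2 u3 u4.
  case mZ: (inr (ed a) \in Z).
    case h1: (inl (fc a) \in Z); last by have := u2 mZ; rewrite h1 => /(_ isT).
    by case h2: (inl (fc (rev a)) \in Z) => //; have := u4 mZ; rewrite h2 => /(_ isT).
  have := iso (~: Z) a y cZ'; rewrite !inE mZ yZ => /(_ isT isT).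
  by case: (inl (fc a) \in Z) => //= /negbTE ->.
case mZ: (inr (ed a) \in Z); first by rewrite (iso Z a x cZ xZ mZ).
case h1: (inl (fc a) \in Z); first by have := u1 h1; rewrite mZ => /(_ isT).
by case h2: (inl (fc (rev a)) \in Z) => //; have := u3 h2; rewrite mZ => /(_ isT).
Qed.

(* The four cells of a triangle of the dual: one corner per dart and one center. *)
Definition cells := (D + vert M)%type.
(** Cells that meet [Z]; [Ic] collects the cells with all vertices in [Z]. A corner cell has as
    vertices the face of its dart and the midpoints of the two edges of the triangle at that face, a
    central cell the three midpoints. *)
Definition Mc Z : {set cells} := [set k | match k with
  | inl a => [|| inl (fc a) \in Z, inr (ed a) \in Z | inr (ed (rot' a)) \in Z]
  | inr v => [exists a, (vt a == v) && (inr (ed a) \in Z)] end].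
Definition Ic Z : {set cells} := [set k | match k with
  | inl a => [&& inl (fc a) \in Z, inr (ed a) \in Z & inr (ed (rot' a)) \in Z]
  | inr v => [forall a, (vt a == v) ==> (inr (ed a) \in Z)] end].

Lemma McV Z a : (inr (vt a) \in Mc Z) = [|| inr (ed a) \in Z, inr (ed (rot a)) \in Z | inr (ed (rot' a)) \in Z].
Proof.
rewrite inE; apply/existsP/or3P=> [[c]|].
  by rewrite eq_sym vt_eq => /andP[/or3P[] /eqP ->]; [apply: Or31|apply: Or32|apply: Or33].
by case=> h; [exists a|exists (rot a)|exists (rot' a)]; rewrite /rot' ?vt_rot eqxx.
Qed.

Lemma IcV Z a : (inr (vt a) \in Ic Z) = [&& inr (ed a) \in Z, inr (ed (rot a)) \in Z & inr (ed (rot' a)) \in Z].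
Proof.
rewrite inE; apply/forallP/and3P=> [h|[h1 h2 h3] c].
  by split; [have := h a|have := h (rot a)|have := h (rot' a)]; rewrite /rot' ?vt_rot eqxx.
by apply/implyP; rewrite eq_sym vt_eq => /or3P[] /eqP->.
Qed.

Lemma card_cells (Q : {set cells}) (P : pred D) (R : pred D) m :
  (forall a, (inl a \in Q) = P a) -> (forall a, (inr (vt a) \in Q) = R a) ->
  #|[set a | R a]| = 3 * m -> #|Q| = #|[set a | P a]| + m.
Proof.
move=> hP hR hm; rewrite -sum1_card.
have := @big_sumType _ 0 addn D (vert M) (mem Q) (fun=> 1); rewrite /= => ->.
rewrite !sum1_card; congr (_ + _); first by apply: eq_card => a; rewrite [LHS]hP inE.
have := @card_fibers _ _ (@vt M) (fun v => inr v \in Q) 3 (fun v _ => card_vfiber v).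
have -> : #|[set a | inr (vt a) \in Q]| = #|[set a | R a]| by apply: eq_card => a; rewrite !inE hR.
rewrite hm cardsE => /eqP; rewrite eqn_pmul2l // => /eqP ->.
by [].
Qed.

Lemma card_atleast2 Y : #|[set a | [|| (fc a \in Y) && (fc (rot a) \in Y),
   (fc (rot a) \in Y) && (fc (rot' a) \in Y) | (fc (rot' a) \in Y) && (fc a \in Y)]]| = 3 * (nT Y + nB Y).
Proof.
have sym (P : pred D) : 3 * #|[set a | P a]| = \sum_a (P a + P (rot a) + P (rot' a)).
  rewrite !big_split /= (sum_rot (fun a => P a : nat)) (sum_rot (fun a => P (rot a) : nat)).
  rewrite (sum_rot (fun a => P a : nat)) card_sum_pred; lia.
rewrite mulnDr -nT3 /nB sym !card_sum_pred -big_split; apply: eq_bigr => a _ /=.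
rewrite /rot' !rot3.
by case: (fc a \in Y); case: (fc (rot a) \in Y); case: (fc (rot (rot a)) \in Y).
Qed.

Lemma card_atleast1 Y : #|[set a | [|| fc a \in Y, fc (rot a) \in Y | fc (rot' a) \in Y]]| = 3 * (nT Y + nB Y + nA Y).
Proof.
have sym (P : pred D) : 3 * #|[set a | P a]| = \sum_a (P a + P (rot a) + P (rot' a)).
  rewrite !big_split /= (sum_rot (fun a => P a : nat)) (sum_rot (fun a => P (rot a) : nat)).
  rewrite (sum_rot (fun a => P a : nat)) card_sum_pred; lia.
rewrite !mulnDr -nT3 /nB /nA !sym !card_sum_pred -!big_split; apply: eq_bigr => a _ /=.
rewrite /rot' !rot3.
by case: (fc a \in Y); case: (fc (rot a) \in Y); case: (fc (rot (rot a)) \in Y).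
Qed.

Definition shape Z (al : bool) := forall a,
  (inr (ed a) \in Z) = if al then (fc a \in fpart Z) || (fc (rot a) \in fpart Z)
                        else (fc a \in fpart Z) && (fc (rot a) \in fpart Z).

Lemma shapeP Z : good Z -> exists al, shape Z al.
Proof. by move=> /good_shape[al h]; exists al => a; rewrite h fc_rev. Qed.

Lemma card_McIc Z al : shape Z al -> let Y := fpart Z in
  #|Ic Z| = 4 * nT Y + (if al then 3 * nB Y + nA Y else 0) /\
  #|Mc Z| = if al then 4 * nT Y + 4 * nB Y + 4 * nA Y else 4 * nT Y + 3 * nB Y + nA Y.
Proof.
move=> hm Y.
have inY a : (inl (fc a) \in Z) = (fc a \in Y) by rewrite [RHS]inE.
have i0 a : (inl a \in Ic Z) = [&& inl (fc a) \in Z, inr (ed a) \in Z & inr (ed (rot' a)) \in Z] by rewrite [LHS]inE.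
have j0 a : (inl a \in Mc Z) = [|| inl (fc a) \in Z, inr (ed a) \in Z | inr (ed (rot' a)) \in Z] by rewrite [LHS]inE.
have dd := dY_eq Y; rewrite /dY in dd.
case: al hm => hm.
  have e1 := @card_cells (Ic Z) (fun a => fc a \in Y) _ (nT Y + nB Y) _ _ (card_atleast2 Y).
  have e2 := @card_cells (Mc Z) (fun a => [|| fc a \in Y, fc (rot a) \in Y | fc (rot' a) \in Y]) _ _ _ _ (card_atleast1 Y).
  rewrite e1 ?e2 ?dd ?card_atleast1; first by lia.
  - by move=> a; rewrite j0 !hm inY /rot' rot3; case: (fc a \in Y); case: (fc (rot a) \in Y); case: (fc (rot (rot a)) \in Y).
  - by move=> a; rewrite McV !hm /rot' !rot3; case: (fc a \in Y); case: (fc (rot a) \in Y); case: (fc (rot (rot a)) \in Y).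
  - by move=> a; rewrite i0 !hm inY /rot' rot3; case: (fc a \in Y); case: (fc (rot a) \in Y); case: (fc (rot (rot a)) \in Y).
  - by move=> a; rewrite IcV !hm /rot' !rot3; case: (fc a \in Y); case: (fc (rot a) \in Y); case: (fc (rot (rot a)) \in Y).
have e1 := @card_cells (Ic Z) (fun a => [&& fc a \in Y, fc (rot a) \in Y & fc (rot' a) \in Y]) _ (nT Y) _ _ (nT3 Y).
have e2 := @card_cells (Mc Z) (fun a => fc a \in Y) _ _ _ _ (card_atleast2 Y).
rewrite e1 ?e2 ?dd ?nT3; first by lia.
- by move=> a; rewrite j0 !hm inY /rot' rot3; case: (fc a \in Y); case: (fc (rot a) \in Y); case: (fc (rot (rot a)) \in Y).
- by move=> a; rewrite McV !hm /rot' !rot3; case: (fc a \in Y); case: (fc (rot a) \in Y); case: (fc (rot (rot a)) \in Y).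
- by move=> a; rewrite i0 !hm inY /rot' rot3; case: (fc a \in Y); case: (fc (rot a) \in Y); case: (fc (rot (rot a)) \in Y).
- by move=> a; rewrite IcV !hm /rot' !rot3; case: (fc a \in Y); case: (fc (rot a) \in Y); case: (fc (rot (rot a)) \in Y).
Qed.

Section TwoCuts.
Variables (Z1 Z2 : {set W}) (al1 al2 : bool).
Hypotheses (sh1 : shape Z1 al1) (sh2 : shape Z2 al2).
Hypothesis noc : nocom (@hs M) (@ht M) Z1 Z2.

Lemma noc_dart a : ~~ (((fc a \in fpart Z1) (+) (inr (ed a) \in Z1)) && ((fc a \in fpart Z2) (+) (inr (ed a) \in Z2))).
Proof. by have /forallP/(_ a) := noc; rewrite /cut /hs /ht !inE. Qed.

Lemma noc_rev a : ~~ (((fc (rot a) \in fpart Z1) (+) (inr (ed a) \in Z1)) && ((fc (rot a) \in fpart Z2) (+) (inr (ed a) \in Z2))).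
Proof. by have := noc_dart (rev a); rewrite ed_rev fc_rev. Qed.

(** Inside one triangle everything is determined by the corners lying in the two regions and by the
    two shapes; a cell met by [Z1] but not inside [Z2] would leave a half edge in both cuts. The
    check is finite. *)
Lemma nested_cells : Z1 \subset Z2 -> Mc Z1 \subset Ic Z2.
Proof.
move=> sub.
have sf a : (fc a \in fpart Z1) ==> (fc a \in fpart Z2) by apply/implyP; rewrite !inE; apply: (subsetP sub).
have sm a : (inr (ed a) \in Z1) ==> (inr (ed a) \in Z2) by apply/implyP; apply: (subsetP sub).
apply/subsetP=> -[a|v].
  rewrite !inE -![inl (fc a) \in _]/(inl (fc a) \in _).
  have -> : (inl (fc a) \in Z1) = (fc a \in fpart Z1) by rewrite inE.
  have -> : (inl (fc a) \in Z2) = (fc a \in fpart Z2) by rewrite inE.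
  have := noc_dart a; have := noc_dart (rot a); have := noc_dart (rot' a).
  have := noc_rev a; have := noc_rev (rot a); have := noc_rev (rot' a).
  have := sf a; have := sf (rot a); have := sf (rot' a); have := sm a; have := sm (rot a); have := sm (rot' a).
  rewrite !sh1 !sh2 /rot' !rot3; move: (fc a \in _) (fc (rot a) \in _) (fc (rot (rot a)) \in _) (fc a \in _) (fc (rot a) \in _) (fc (rot (rot a)) \in _).
  by case: al1; case: al2; do 6!case.
have [a <-] := vt_surj v; rewrite McV IcV.
have := noc_dart a; have := noc_dart (rot a); have := noc_dart (rot' a).
have := noc_rev a; have := noc_rev (rot a); have := noc_rev (rot' a).
have := sf a; have := sf (rot a); have := sf (rot' a); have := sm a; have := sm (rot a); have := sm (rot' a).
rewrite !sh1 !sh2 /rot' !rot3; move: (fc a \in _) (fc (rot a) \in _) (fc (rot (rot a)) \in _) (fc a \in _) (fc (rot a) \in _) (fc (rot (rot a)) \in _).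
by case: al1; case: al2; do 6!case.
Qed.

Lemma disjoint_cells : [disjoint Z1 & Z2] -> [disjoint Mc Z1 & Mc Z2].
Proof.
move=> dis.
have sf a : ~~ ((fc a \in fpart Z1) && (fc a \in fpart Z2)).
  by rewrite !inE; apply/negP=> /andP[h]; rewrite (disjointFr dis h).
have sm a : ~~ ((inr (ed a) \in Z1) && (inr (ed a) \in Z2)).
  by apply/negP=> /andP[h]; rewrite (disjointFr dis h).
rewrite -setI_eq0; apply/eqP/setP=> k; rewrite [RHS]inE; apply/negbTE; rewrite inE; case: k => [a|v].
  have inMc Z : (inl a \in Mc Z) = [|| inl (fc a) \in Z, inr (ed a) \in Z | inr (ed (rot' a)) \in Z] by rewrite [LHS]inE.
  rewrite !inMc.
  have -> : (inl (fc a) \in Z1) = (fc a \in fpart Z1) by rewrite inE.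
  have -> : (inl (fc a) \in Z2) = (fc a \in fpart Z2) by rewrite inE.
  have := noc_dart a; have := noc_dart (rot a); have := noc_dart (rot' a).
  have := noc_rev a; have := noc_rev (rot a); have := noc_rev (rot' a).
  have := sf a; have := sf (rot a); have := sf (rot' a); have := sm a; have := sm (rot a); have := sm (rot' a).
  rewrite !sh1 !sh2 /rot' !rot3; move: (fc a \in _) (fc (rot a) \in _) (fc (rot (rot a)) \in _) (fc a \in _) (fc (rot a) \in _) (fc (rot (rot a)) \in _).
  by case: al1; case: al2; do 6!case.
have [a <-] := vt_surj v; rewrite !McV.
have := noc_dart a; have := noc_dart (rot a); have := noc_dart (rot' a).
have := noc_rev a; have := noc_rev (rot a); have := noc_rev (rot' a).
have := sf a; have := sf (rot a); have := sf (rot' a); have := sm a; have := sm (rot a); have := sm (rot' a).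
rewrite !sh1 !sh2 /rot' !rot3; move: (fc a \in _) (fc (rot a) \in _) (fc (rot (rot a)) \in _) (fc a \in _) (fc (rot a) \in _) (fc (rot (rot a)) \in _).
by case: al1; case: al2; do 6!case.
Qed.

End TwoCuts.

Lemma good_chi Z : good Z -> let Y := fpart Z in
  [/\ nA Y + nK Y = nB Y + 6, #|Y| + nT Y = nE Y + 1 & (6 - nK Y) * nT Y + (2 <= nK Y) <= nB Y ^ 2].
Proof.
move=> gZ Y; have [o k5] := good_k gZ.
have [x px xZ] := good_in gZ; have [y py yZ] := good_out gZ.
case: gZ => cZ cZ' _ _ _; rewrite -/Y in o k5.
have Y0 : Y != set0 by apply/set0Pn; exists x; rewrite inE.
have YT : Y != setT by apply/eqP=> e; have := in_setT y; rewrite -e inE (negbTE yZ).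
have eC : fpart (~: Z) = ~: Y by apply/setP=> z; rewrite !inE.
have c1 := fpart_fcset cZ; have := fpart_fcset cZ'; rewrite eC => c2.
have l1 := chi_le1 c1 Y0 YT; have l2 := chi_ge1 c2 Y0 YT; have l3 := nAB_chi Y.
have e1 : #|Y| + nT Y = nE Y + 1 by rewrite -/Y in l1; lia.
split=> //; first by lia.
have := isoperimetry c2 YT k5; rewrite -/Y.
have [b0|b0] := posnP (nB Y); last by rewrite andbT.
rewrite b0 andbF addn0 exp0n // leqn0 muln_eq0 => /orP[/eqP h|/eqP t0]; first by move: h k5; clear; lia.
have := nE_eq Y; rewrite t0 b0 => e2.
have : nK Y <= #|Y| by apply: subset_leq_card; apply: subsetIl.
by rewrite muln0 add0n; case: (leqP 2 (nK Y)) => //; move: e1 e2; rewrite t0; clear; lia.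
Qed.

(** One more cut around a region: [I0] is the enclosed area, [L] the length of its boundary, [S] the
    number of earlier cuts. As k (6 - k) >= 5, the hypotheses give 5 S <= k L, and the new layer has
    2 L + (6 - k) cells. The remaining terms on the left keep track of the slack for the equality
    case. *)
Lemma grow_num k I0 L S : odd k -> k <= 5 -> (6 - k) * I0 + (2 <= k) <= L ^ 2 -> 5 * S ^ 2 <= k * I0 ->
  5 * (S + 1) ^ 2 + (2 <= k) + (k * I0 - 5 * S ^ 2) <= k * (I0 + 2 * L + (6 - k)).
Proof.
move=> ok k5 h1 h2.
have kc : 5 <= k * (6 - k) by case: k ok k5 {h1 h2} => [|[|[|[|[|[|]]]]]].
have h3 : (5 * S) ^ 2 + (2 <= k) <= (k * L) ^ 2.
  rewrite !expnMn; apply: (@leq_trans (k ^ 2 * ((6 - k) * I0 + (2 <= k)))); last by rewrite leq_mul2l h1 orbT.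
  rewrite mulnDr leq_add //; last by case: leqP => //; rewrite muln1; case: (k) => // n; rewrite expn_gt0.
  have -> : k ^ 2 * ((6 - k) * I0) = (k * (6 - k)) * (k * I0) by rewrite !mulnA; nia.
  by apply: (@leq_trans (5 * (5 * S ^ 2))); [rewrite mulnA|apply: leq_mul].
have h4 : 5 * S + (2 <= k) <= k * L.
  by rewrite leqNgt; apply/negP=> lt; move: h3; case: (1 < k) lt => /= lt; nia.
have e : 5 * (S + 1) ^ 2 = 5 * S ^ 2 + 10 * S + 5 by clear; nia.
have e2 : k * (I0 + 2 * L + (6 - k)) = k * I0 + 2 * (k * L) + k * (6 - k) by move: (6 - k) => c; clear; nia.
rewrite e e2; move: h2 h4 kc; clear.
move: (k * I0) (k * L) (k * (6 - k)) (5 * S ^ 2) => p q r z; case: (1 < k) => /=; lia.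
Qed.

(** In half edges the boundary has length 2 nB for a region ending at faces and 2 nB + 6 - k for one
    ending at midpoints; with either length the isoperimetric inequality passes from triangles to
    cells. *)
Lemma grow_good Z S : good Z -> 5 * S ^ 2 <= nK (fpart Z) * #|Ic Z| ->
  5 * (S + 1) ^ 2 + (2 <= nK (fpart Z)) + (nK (fpart Z) * #|Ic Z| - 5 * S ^ 2) <= nK (fpart Z) * #|Mc Z|.
Proof.
move=> gZ; have [o k5] := good_k gZ; have [al sh] := shapeP gZ.
have [e1 _ e3] := good_chi gZ; have [-> ->] := card_McIc sh.
set k := nK _ in o k5 e1 e3 *; set t := nT _ in e1 e3 *; set b := nB _ in e1 e3 *; set a := nA _ in e1 e3 *.
have ea : a = b + (6 - k) by lia.
clearbody k t b a; case: al {sh} => h.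
  have := @grow_num k (4 * t + (3 * b + a)) (2 * b + (6 - k)) S o k5 _ h.
  have -> : 4 * t + 4 * b + 4 * a = 4 * t + (3 * b + a) + 2 * (2 * b + (6 - k)) + (6 - k) by lia.
  apply; rewrite ea; move: e3; move: (6 - k) => c; case: (1 < k) => /=; clear; nia.
have := @grow_num k (4 * t + 0) (2 * b) S o k5 _ h.
have -> : 4 * t + 3 * b + a = 4 * t + 0 + 2 * (2 * b) + (6 - k) by lia.
apply; rewrite addn0; move: e3; move: (6 - k) => c; case: (1 < k) => /=; clear; nia.
Qed.

Section Family.
Variable F : {set {set W}}.
Hypothesis goodF : {in F, forall Z, good Z}.
Hypothesis lamF : {in F &, forall Z1 Z2, Z1 != Z2 -> lam Z1 Z2 && nocom (@hs M) (@ht M) Z1 Z2}.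
Implicit Types (A : {set {set W}}).

Definition KA A0 := #|cover A0 :&: tf|.
Definition MA A0 := #|\bigcup_(Z in A0) Mc Z|.
Definition below A0 Z := #|[set Z' in A0 | Z' \subset Z]|.
Definition through A0 (p : W) := #|[set Z' in A0 | p \in Z']|.

(** The cross terms K1 M2 and K2 M1 have product at least (5 S1 S2)^2, hence sum at least 10 S1
    S2. *)
Lemma cauchy2 K1 M1 S1 K2 M2 S2 : 5 * S1 ^ 2 <= K1 * M1 -> 5 * S2 ^ 2 <= K2 * M2 ->
  5 * (S1 + S2) ^ 2 <= (K1 + K2) * (M1 + M2).
Proof.
move=> h1 h2; suff h3 : 10 * (S1 * S2) <= K1 * M2 + K2 * M1.
  have -> : 5 * (S1 + S2) ^ 2 = 5 * S1 ^ 2 + 5 * S2 ^ 2 + 10 * (S1 * S2) by clear; nia.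
  by move: h1 h2 h3; rewrite mulnDl !mulnDr; clear; lia.
have h4 : (5 * (S1 * S2)) ^ 2 <= (K1 * M2) * (K2 * M1).
  have := leq_mul h1 h2; clear; nia.
move: h4; move: (K1 * M2) (K2 * M1) (S1 * S2) => u v w; clear => h4.
rewrite leqNgt; apply/negP=> lt; have [q _] := nat_AGM2 u v.
have : (u + v) ^ 2 < (10 * w) ^ 2 by rewrite ltn_sqr.
by move: q h4; clear; nia.
Qed.

Lemma cauchy2_eq K1 M1 S1 K2 M2 S2 : 5 * S1 ^ 2 <= K1 * M1 -> 5 * S2 ^ 2 <= K2 * M2 -> 0 < S1 -> 0 < S2 ->
  5 * (S1 + S2) ^ 2 = (K1 + K2) * (M1 + M2) ->
  [/\ 5 * S1 ^ 2 = K1 * M1, 5 * S2 ^ 2 = K2 * M2 & K1 * S2 = K2 * S1].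
Proof.
move=> h1 h2 p1 p2.
have -> : 5 * (S1 + S2) ^ 2 = 5 * S1 ^ 2 + 5 * S2 ^ 2 + 10 * (S1 * S2) by clear; nia.
rewrite mulnDl !mulnDr => e.
have h4 : (5 * (S1 * S2)) ^ 2 <= (K1 * M2) * (K2 * M1).
  have := leq_mul h1 h2; clear; nia.
have h3 : 10 * (S1 * S2) <= K1 * M2 + K2 * M1.
  move: h4; move: (K1 * M2) (K2 * M1) (S1 * S2) => u v w; clear => h4.
  rewrite leqNgt; apply/negP=> lt; have [q _] := nat_AGM2 u v.
  have : (u + v) ^ 2 < (10 * w) ^ 2 by rewrite ltn_sqr.
  by move: q h4; clear; nia.
have e1 : 5 * S1 ^ 2 = K1 * M1 by move: h1 h2 h3 e; clear; lia.
have e2 : 5 * S2 ^ 2 = K2 * M2 by move: h1 h2 h3 e; clear; lia.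
have e3 : K1 * M2 + K2 * M1 = 10 * (S1 * S2) by move: e e1 e2; clear; lia.
have e4 : K1 * M2 = 5 * (S1 * S2).
  move: h4 e3; move: (K1 * M2) (K2 * M1) (S1 * S2) => u v w; clear => h4 e3.
  have [lt|lt|//] := ltngtP u (5 * w).
    have ev : v = 10 * w - u by lia.
    by exfalso; move: h4; rewrite ev; nia.
  have ev : v = 10 * w - u by lia.
  by exfalso; move: h4; rewrite ev; nia.
split=> //.
have M20 : 0 < M2 by case: M2 e2 {h2 e h4 h3 e3 e4} => //; rewrite muln0; nia.
apply/eqP; rewrite -(eqn_pmul2r M20); apply/eqP.
have -> : K1 * S2 * M2 = K1 * M2 * S2 by rewrite mulnAC.
have -> : K2 * S1 * M2 = K2 * M2 * S1 by rewrite mulnAC.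
by rewrite e4 -e2; clear; nia.
Qed.

Lemma Ic_Mc Z : Ic Z \subset Mc Z.
Proof.
apply/subsetP=> -[a|v]; first by rewrite !inE => /and3P[-> _ _].
by have [a <-] := vt_surj v; rewrite McV IcV => /and3P[-> _ _].
Qed.

Lemma F_nested Z1 Z2 : Z1 \in F -> Z2 \in F -> Z1 != Z2 -> Z1 \subset Z2 -> Mc Z1 \subset Ic Z2.
Proof.
move=> z1 z2 ne sub; have /andP[_ nc] := lamF z1 z2 ne.
have [al1 s1] := shapeP (goodF z1); have [al2 s2] := shapeP (goodF z2).
exact: (nested_cells s1 s2 nc sub).
Qed.

Lemma F_disj Z1 Z2 : Z1 \in F -> Z2 \in F -> [disjoint Z1 & Z2] -> [disjoint Mc Z1 & Mc Z2].
Proof.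
move=> z1 z2 d.
have ne : Z1 != Z2.
  have [x _ xZ] := good_in (goodF z1); apply/eqP=> e; have := disjointFr d xZ; by rewrite -e xZ.
have /andP[_ nc] := lamF z1 z2 ne.
have [al1 s1] := shapeP (goodF z1); have [al2 s2] := shapeP (goodF z2).
exact: (disjoint_cells s1 s2 nc d).
Qed.

(** [below] counts [Z] itself, so the i-th region around a pentagon meets 5 i^2 cells. The last
    clause says that all covered pentagons have equally many cuts around them. *)
Definition tight A0 := [/\ {in A0, forall Z, [/\ #|Z :&: tf| = 1, #|Mc Z| = 5 * (below A0 Z) ^ 2 &
     #|Ic Z| = 5 * (below A0 Z).-1 ^ 2]} &
   forall p, p \in cover A0 :&: tf -> KA A0 * through A0 p = #|A0|].

Lemma cover_sub A1 A0 : A1 \subset A0 -> cover A1 \subset cover A0.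
Proof. by move=> sub; apply/bigcupsP=> Z ZA; apply: bigcup_sup; apply: (subsetP sub). Qed.

Lemma in_cover (A0 : {set {set W}}) Z w : Z \in A0 -> w \in Z -> w \in cover A0.
Proof. by move=> ZA wZ; apply/bigcupP; exists Z. Qed.

(** Either all members lie in a largest one, which is then a step of [grow_good], or the family
    splits into two disjoint ones, where [KA] and [MA] are additive and Cauchy's inequality applies;
    its equality case makes the numbers of cuts proportional to the numbers of pentagons. *)
Theorem area A0 : A0 \subset F ->
  5 * #|A0| ^ 2 <= KA A0 * MA A0 /\ (5 * #|A0| ^ 2 = KA A0 * MA A0 -> tight A0).
Proof.
move: {2}#|A0|.+1 (ltnSn #|A0|) => n; elim: n A0 => // n IH A0 ltA sA.
have [->|/set0Pn[Z0 Z0A]] := eqVneq A0 set0.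
  rewrite cards0; split=> // _; split=> [Z|p]; first by rewrite inE.
  by rewrite inE => /andP[/bigcupP[Z]]; rewrite inE.
(* By laminarity every other member lies inside a member of largest size or is disjoint from it. *)
case: (arg_maxnP (fun Z : {set W} => #|Z|) Z0A) => Z ZA maxZ.
have mx Q : Q \in A0 -> #|Q| <= #|Z| by apply: maxZ.
have {}ZA : Z \in A0 by [].
have ZF := subsetP sA _ ZA.
pose A1 := [set Z' in A0 | Z' \subset Z]; pose A2 := A0 :\: A1.
have dis2 Z2 : Z2 \in A2 -> [disjoint Z & Z2].
  rewrite !inE negb_and => /andP[/orP[/negbTE->//|n2] z2].
  have ne : Z != Z2 by apply: contraNneq n2 => ->.
  have /andP[/or3P[s|s|//] _] := lamF ZF (subsetP sA _ z2) ne; last by rewrite s in n2.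
  by move: ne; rewrite eqEcard s mx.
have d12 Z1 Z2 : Z1 \in A1 -> Z2 \in A2 -> [disjoint Z1 & Z2].
  by rewrite inE => /andP[_ s1] /dis2; apply: disjointWl.
have cA : #|A0| = #|A1| + #|A2|.
  by rewrite /A2 cardsD (setIidPr (_ : A1 \subset A0)) ?subnKC //; [apply: subset_leq_card|]; apply/subsetP=> Q; rewrite inE => /andP[].
have s1 : A1 \subset F by apply: subset_trans sA; apply/subsetP=> Q; rewrite inE => /andP[].
have s2 : A2 \subset F by apply: subset_trans sA; apply: subsetDl.
have A1n : 0 < #|A1| by apply/card_gt0P; exists Z; rewrite inE ZA subxx.
have [A20|A20] := posnP #|A2|; last first.
  have [||le1 eq1] := IH A1; [by move: ltA cA A20; clear; lia|by []|].
  have [||le2 eq2] := IH A2; [by move: ltA cA A1n; clear; lia|by []|].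
  have U : A0 = A1 :|: A2 by rewrite setUC; apply/setP=> Q; rewrite !inE; case: (Q \in A0) => //=; rewrite ?andbT ?orNb.
  have eK : KA A0 = KA A1 + KA A2.
    rewrite /KA U /cover bigcup_setU setIUl; apply/eqP.
    have := leq_card_setU (\bigcup_(B0 in A1) B0 :&: tf) (\bigcup_(B0 in A2) B0 :&: tf).
    have -> : [disjoint \bigcup_(B0 in A1) B0 :&: tf & \bigcup_(B0 in A2) B0 :&: tf]; last by move/leqifP.
    rewrite -setI_eq0; apply/eqP/setP=> w; rewrite !inE; apply/negP=> /andP[/andP[/bigcupP[Z1 z1 w1] _] /andP[/bigcupP[Z2 z2 w2] _]].
    by have := disjointFr (d12 _ _ z1 z2) w1; rewrite w2.
  have eM : MA A0 = MA A1 + MA A2.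
    rewrite /MA U bigcup_setU; apply/eqP.
    have := leq_card_setU (\bigcup_(B0 in A1) Mc B0) (\bigcup_(B0 in A2) Mc B0).
    have -> : [disjoint \bigcup_(B0 in A1) Mc B0 & \bigcup_(B0 in A2) Mc B0]; last by move/leqifP.
    rewrite -setI_eq0; apply/eqP/setP=> w; rewrite !inE; apply/negP=> /andP[/bigcupP[Z1 z1 w1] /bigcupP[Z2 z2 w2]].
    have := disjointFr (F_disj (subsetP s1 _ z1) (subsetP s2 _ z2) (d12 _ _ z1 z2)) w1.
    by rewrite w2.
  rewrite eK eM cA; split; first exact: cauchy2.
  move=> /(cauchy2_eq le1 le2 A1n A20)[/eq1[t1 p1] /eq2[t2 p2] ee].
  have inA w Q : Q \in A0 -> w \in Q -> w \in cover A1 -> Q \in A1.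
    move=> QA wQ /bigcupP[Z1 z1 w1]; apply/negPn/negP=> nQ.
    have q2 : Q \in A2 by rewrite inE nQ.
    by have := disjointFr (d12 _ _ z1 q2) w1; rewrite wQ.
  have inA2 w Q : Q \in A0 -> w \in Q -> w \in cover A2 -> Q \in A2.
    move=> QA wQ /bigcupP[Z1 z1 w1]; rewrite inE QA andbT; apply/negP=> q1.
    by have := disjointFr (d12 _ _ q1 z1) wQ; rewrite w1.
  have b1 Q : Q \in A1 -> below A0 Q = below A1 Q.
    move=> q1; apply: eq_card => Q'; rewrite !inE; case q': (Q' \in A0) => //=.
    case qs: (Q' \subset Q); rewrite ?andbF //; apply/esym; rewrite andbT.
    by apply: (subset_trans qs); move: q1; rewrite inE => /andP[].
  have b2 Q : Q \in A2 -> below A0 Q = below A2 Q.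
    move=> q2; apply: eq_card => Q'; rewrite [LHS]inE [RHS]inE; case qs: (Q' \subset Q); rewrite ?andbF // !andbT.
    apply/idP/idP=> [q'|]; last by rewrite inE => /andP[].
    have [x _ xQ] := good_in (goodF (subsetP sA _ q')).
    by apply: (inA2 _ _ q' xQ); apply: in_cover q2 (subsetP qs _ xQ).
  split.
    move=> Q QA; have [q1|q1] := boolP (Q \in A1); first by rewrite b1 //; apply: t1.
    have q2 : Q \in A2 by rewrite inE q1.
    by rewrite b2 //; apply: t2.
  move=> p; rewrite inE => /andP[pc pt]; rewrite eK cA.
  have K1p : 0 < KA A1.
    have [x px xZ] := good_in (goodF ZF); apply/card_gt0P; exists (inl x).
    by rewrite inE in_tf px andbT; apply: (in_cover (Z := Z)) => //; rewrite inE ZA subxx.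
  have K2p : 0 < KA A2.
    case/card_gt0P: A20 => Q Q2; have [x px xZ] := good_in (goodF (subsetP s2 _ Q2)); apply/card_gt0P; exists (inl x).
    by rewrite inE in_tf px andbT; apply: (in_cover (Z := Q)).
  case/bigcupP: pc => Q QA pQ; have [q1|q1] := boolP (Q \in A1).
    have pc1 : p \in cover A1 by apply: in_cover q1 pQ.
    have -> : through A0 p = through A1 p.
      apply: eq_card => Q'; rewrite [LHS]inE [RHS]inE; case pq: (p \in Q'); rewrite ?andbF // !andbT.
      by apply/idP/idP=> [q'|]; [apply: inA q' pq pc1|rewrite inE => /andP[]].
    have hp := p1 p; rewrite inE pc1 pt in hp; have {}hp := hp isT.
    rewrite mulnDl hp; congr (_ + _); apply/eqP; rewrite -(eqn_pmul2l K1p) mulnCA hp; apply/eqP.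
    by rewrite ee.
  have q2 : Q \in A2 by rewrite inE q1.
  have pc1 : p \in cover A2 by apply: in_cover q2 pQ.
  have -> : through A0 p = through A2 p.
    apply: eq_card => Q'; rewrite [LHS]inE [RHS]inE; case pq: (p \in Q'); rewrite ?andbF // !andbT.
    by apply/idP/idP=> [q'|]; [apply: inA2 q' pq pc1|rewrite inE => /andP[]].
  have hp := p2 p; rewrite inE pc1 pt in hp; have {}hp := hp isT.
  rewrite mulnDl hp; congr (_ + _); apply/eqP; rewrite -(eqn_pmul2l K2p) mulnCA hp; apply/eqP.
  by rewrite ee.
have subZ Q : Q \in A0 -> Q \subset Z.
  move=> QA; have : Q \notin A2 by rewrite (cards0_eq A20) inE.
  by rewrite !inE QA andbT negbK.
pose B0 := A0 :\ Z.
have cB : #|A0| = #|B0|.+1 by rewrite (cardsD1 Z) ZA.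
have sB : B0 \subset F by apply: subset_trans sA; apply: subD1set.
have [||leB eqB] := IH B0; [by move: ltA; rewrite cB|by []|].
have McB : \bigcup_(Q in B0) Mc Q \subset Ic Z.
  apply/bigcupsP=> Q; rewrite !inE => /andP[ne QA].
  exact: (F_nested (subsetP sA _ QA) ZF ne (subZ _ QA)).
have MB : MA B0 <= #|Ic Z| by apply: subset_leq_card.
have eC : cover A0 = Z.
  apply/eqP; rewrite eqEsubset; apply/andP; split; first by apply/bigcupsP=> Q /subZ.
  by apply: bigcup_sup.
have eK : KA A0 = nK (fpart Z) by rewrite /KA eC card_tfI.
have KB : KA B0 <= nK (fpart Z).
  by rewrite -eK; apply: subset_leq_card; apply: setSI; apply: cover_sub; apply: subD1set.
have h0 : 5 * #|B0| ^ 2 <= nK (fpart Z) * #|Ic Z| by apply: (leq_trans leB); apply: leq_mul.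
have g := grow_good (goodF ZF) h0.
have eM : MA A0 = #|Mc Z|.
  apply: eq_card; apply/setP; apply/eqP; rewrite eqEsubset; apply/andP; split; last by apply: bigcup_sup.
  apply/bigcupsP=> Q QA; have [->//|ne] := eqVneq Q Z.
  apply: subset_trans (Ic_Mc Z); exact: (F_nested (subsetP sA _ QA) ZF ne (subZ _ QA)).
rewrite eK eM cB -addn1; split; first by move: g; clear; lia.
move=> e; rewrite -e in g.
(* For three or five pentagons the strict term of [grow_good] is incompatible with equality. *)
have k1 : nK (fpart Z) = 1.
  have [o _] := good_k (goodF ZF); move: g o; case: (nK _) => [|[|k]] //=; clear; lia.
rewrite k1 !mul1n in g h0 e.
have eI : #|Ic Z| = 5 * #|B0| ^ 2 by move: g h0; clear; lia.
have eB : 5 * #|B0| ^ 2 = KA B0 * MA B0.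
  apply/eqP; rewrite eqn_leq leB /= -eI -[X in _ <= X]mul1n; apply: leq_mul => //; by rewrite -k1.
have [tB _] := eqB eB.
have bZ : below A0 Z = #|A0| by apply: eq_card => Q; rewrite inE; case QA: (Q \in A0) => //=; apply: subZ.
split.
  move=> Q QA; have [->|ne] := eqVneq Q Z.
    by rewrite bZ cB card_tfI k1 eI /= -e addn1.
  have QB : Q \in B0 by rewrite !inE ne.
  have -> : below A0 Q = below B0 Q; last exact: tB.
  apply: eq_card => Q'; rewrite !inE; case: (eqVneq Q' Z) => [->|//] /=.
  apply/negbTE/negP=> /andP[_ zq]; case/eqP: ne; apply/eqP; rewrite eqEsubset zq andbT; exact: subZ.
move=> p; rewrite eC => pZ; rewrite eK k1 mul1n; apply: eq_card => Q; rewrite inE; case QA: (Q \in A0) => //=.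
have /cards1P[p0 ep] : #|Z :&: tf| == 1 by rewrite card_tfI k1.
have [x px xQ] := good_in (goodF (subsetP sA _ QA)).
have : inl x \in Z :&: tf by rewrite inE in_tf px andbT; apply: (subsetP (subZ _ QA)).
by move: pZ; rewrite ep !inE => /eqP-> /eqP<-.
Qed.

End Family.

Theorem map_packing : exists (S : {set vert M}) (F : {set {set W}}), [/\ #|~: vcut S| = #|F|,
  {in F, forall Z, good Z} & {in F &, forall Z1 Z2, Z1 != Z2 -> lam Z1 Z2 && nocom (@hs M) (@ht M) Z1 Z2}].
Proof.
have colP a : isface (hs a) != isface (ht a) by [].
have eT : ~~ odd #|tf| by rewrite card_tf.
have [K [l [hK sz [h1 h2 h3]]]] := join_packing colP (@hcset M) eT.
have [|F [cF gF lF]] := bond_packing (@hcset M) colP eT _ h1 h2 h3; first by rewrite card_tf.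
(* Degrees are 5 on [tf] and 6 at the other faces, so the complement of a join is even, and
   therefore a cut. *)
have : isj (@hs M) (@ht M) (~: K) set0.
  apply/isjP=> -[x|y]; rewrite [RHS]inE.
    have /isjP/(_ (inl x)) := hK; rewrite in_tf !(bd_inl (@fc M) (@ed M)) => e.
    under eq_bigr => a _ do rewrite inE -[~~ _]addbT.
    rewrite big_split /= e.
    have -> : \big[addb/false]_(a | fc a == x) true = odd #|[set a | fc a == x]|.
      by rewrite odd_card_big; apply: eq_bigl => a; rewrite inE.
    by rewrite /pent; have /orP[/eqP ->|/eqP ->] := fc_size x.
  have [a <-] := ed_surj y; have /isjP/(_ (inr (ed a))) := hK.
  rewrite !(bd_inr (@fc M)) !inE => e.
  have : inr (ed a) \notin tf by apply/imsetP=> -[].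
  by move=> /negbTE e2; move: e; rewrite e2; case: (a \in K); case: (rev a \in K).
move=> /vcut_exact[S eS]; exists S, F; rewrite -eS setCK; split=> //.
by rewrite cF sz.
Qed.

Lemma card_cells_all : #|{: cells}| = 4 * #|vert M|.
Proof. by rewrite card_sum card_dartV; lia. Qed.

Lemma KA_le F : KA F <= 12.
Proof. by rewrite -card_tf; apply: subset_leq_card; apply: subsetIr. Qed.

Lemma MA_le F : MA F <= 4 * #|vert M|.
Proof. by rewrite -card_cells_all; apply: max_card. Qed.

End Area.

(** * Graph automorphisms preserve faces *)

Section Whitney.
Variable M : fmap.
Local Notation D := (dart M).
Implicit Types (a c d : D) (x z : face M) (X Y S : {set face M}).

Lemma small_num k t b e n : k <= 5 -> 2 * b <= k -> (6 - k) * t + ((2 <= k) && (0 < b)) <= b ^ 2 ->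
  n + t = e + 1 -> 2 * e = 3 * t + b -> k <= n -> n = 1.
Proof.
move=> k5 bk h1 h2 h3 h4.
have : b <= 2 by lia.
case: b bk h1 h3 => [|[|[|b]]] // bk h1 h3 _; rewrite ?andbF ?andbT in h1.
- have t0 : t = 0 by case: t h1 {h2 h3} => // t; nia.
  lia.
- have k2 : 2 <= k by lia.
  rewrite k2 /= in h1; have t0 : t = 0 by case: t h1 {h2 h3} => // t; nia.
  lia.
- have k2 : 2 <= k by lia.
  rewrite k2 /= in h1.
  have [k4|k4] : k = 4 \/ k = 5 by lia.
    by rewrite k4 in h1 h4; lia.
  by rewrite k4 in h1 h4; lia.
Qed.

Lemma fcset_remove Y x : fcset (~: Y) -> Y != setT -> x \in Y ->
  (forall a, fc a = x -> fc (rev a) \notin Y) -> fcset (~: (Y :\ x)).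
Proof.
move=> cY YT xY hx.
apply: (fcset_grow cY); first by apply: contra YT => /eqP e; rewrite -(setCK Y) e setC0.
  by rewrite setCS subD1set.
move=> z; rewrite !inE negb_and !negbK => /orP[/eqP ->|/negbTE ->] //.
by move=> _; have [a ea] := fc_surj x; exists a; rewrite // inE hx.
Qed.

(** With six pentagons the factor 6 - k vanishes, as on the cap of a nanotube. Peeling keeps chi = 1
    and gives nB + 3 <= nK for the interior; so either the six pentagons and a boundary of at most 3
    survive, or a pentagon is lost and [small_num] leaves one face with too many pentagons. *)
Lemma no_short_tube Y : fcset (~: Y) -> Y != setT -> nK Y = 6 -> #|Y| + nT Y = nE Y + 1 -> nB Y <= 3 -> False.
Proof.
move: {2}#|Y|.+1 (ltnSn #|Y|) => n; elim: n Y => // n IH Y ltY cY YT k6 chi b3.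
have kn : nK Y <= #|Y| by apply: subset_leq_card; apply: subsetIl.
have Y0 : Y != set0 by rewrite -card_gt0; move: kn; rewrite k6; clear; lia.
have eE := nE_eq Y.
have [nY|[x xY hx]] := noisoP Y; last first.
  have [eT eB] := remove_iso xY hx; have cY' := fcset_remove cY YT xY hx.
  have YT' : Y :\ x != setT by apply/eqP=> e; have := in_setT x; rewrite -e !inE eqxx.
  have cc := cardsD1 x Y; rewrite xY in cc.
  have Y0' : Y :\ x != set0 by rewrite -card_gt0; move: cc kn; rewrite k6; clear; lia.
  have := chi_ge1 cY' Y0' YT'; have := nE_eq (Y :\ x); rewrite eT eB; move: cc chi eE; clear; lia.
have cI := fcset_inner cY YT.
have IT : inner Y != setT.
  by apply: contra YT => /eqP e; rewrite eqEsubset subsetT -e inner_sub.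
have h1 := peel_bound cY Y0 YT nY; have h2 := nAB_chi (inner Y); have h3 := peel_nT Y.
have h4 := nE_eq (inner Y).
have [I0|I0] := eqVneq (inner Y) set0.
  have e3 := dY_eq (inner Y); have e4 := dY_deg (inner Y).
  have K0 : nK (inner Y) = 0 by rewrite /nK I0 set0I cards0.
  have c0 : #|inner Y| = 0 by rewrite I0 cards0.
  by move: h1 h2 h3 h4 e3 e4 chi eE b3 kn; rewrite K0 c0 k6; clear; lia.
have g1 := chi_ge1 cI I0 IT.
have kI : nK (inner Y) <= 6 by rewrite -k6; apply: nK_sub; apply: inner_sub.
have chiI : #|inner Y| + nT (inner Y) = nE (inner Y) + 1 by move: h1 h2 g1 kI b3; clear; lia.
have bI : nB (inner Y) + 3 <= nK (inner Y) by move: h1 h2 chiI b3; clear; lia.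
have lt' : #|inner Y| < #|Y|.
  have r0 : 0 < #|rim Y|.
    rewrite lt0n cards_eq0; apply/eqP=> r0.
    have e : inner Y = Y by apply/eqP; rewrite eqEsubset inner_sub -setD_eq0 -/(rim Y) r0 eqxx.
    case/eqP: YT; apply: fconn => // a; rewrite -{1}e inE => /andP[_ /forallP/(_ a)].
    by rewrite eqxx.
  by have := card_peel Y; move: r0; clear; lia.
have [k5|k5] := leqP (nK (inner Y)) 5; last first.
  have k6' : nK (inner Y) = 6 by move: kI k5; clear; lia.
  by apply: (IH _ _ cI IT k6' chiI); [move: lt' ltY|move: bI kI]; clear; lia.
have kn' : nK (inner Y) <= #|inner Y| by apply: subset_leq_card; apply: subsetIl.
have := small_num k5 _ (isoperimetry cI IT k5) chiI h4 kn'.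
by move=> h; have := h (ltac:(move: bI k5; clear; lia)); move: bI kn'; clear; lia.
Qed.

(** Gauss-Bonnet gives nA = nB + 6 - k, so at most six boundary edges mean 2 nB <= k. *)
Lemma small_bond Y : fcset Y -> fcset (~: Y) -> Y != set0 -> Y != setT -> nK Y <= 6 -> nA Y + nB Y <= 6 -> #|Y| = 1.
Proof.
move=> c1 c2 Y0 YT k6 ab.
have l1 := chi_le1 c1 Y0 YT; have l2 := chi_ge1 c2 Y0 YT; have l3 := nAB_chi Y.
have chi : #|Y| + nT Y = nE Y + 1 by move: l1 l2; clear; lia.
have bk : 2 * nB Y <= nK Y by move: l3 chi ab; clear; lia.
have kn : nK Y <= #|Y| by apply: subset_leq_card; apply: subsetIl.
have [k5|k5] := leqP (nK Y) 5; first exact: small_num k5 bk (isoperimetry c2 YT k5) chi (nE_eq Y) kn.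
exfalso; apply: (no_short_tube c2 YT _ chi); move: k5 k6 bk; clear; lia.
Qed.

Lemma card_fcut X : #|fcut X| = 2 * (nA X + nB X).
Proof.
have -> : #|fcut X| = #|[set a | (fc a \in X) && (fc (rot a) \notin X)]| + #|[set a | (fc a \notin X) && (fc (rot a) \in X)]|.
  rewrite /fcut !card_sum_pred -big_split; apply: eq_bigr => a _ /=; rewrite fc_rev.
  by case: (fc a \in X); case: (fc (rot a) \in X).
have h Y : #|[set a | (fc a \in Y) && (fc (rot a) \notin Y)]| = nA Y + nB Y.
  have := card_split (fun a => fc a \in Y) (fun a => fc (rot a) \in Y).
  by rewrite nE2 -/(dY Y) dY_eq nE_eq; clear; lia.
rewrite h; have -> : #|[set a | (fc a \notin X) && (fc (rot a) \in X)]| = nA (~: X) + nB (~: X).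
  by rewrite -h; apply: eq_card => a; rewrite !inE negbK.
rewrite nA_setC nB_setC; clear; lia.
Qed.

Lemma fcut_setC X : fcut (~: X) = fcut X.
Proof. by apply/setP=> a; rewrite !inE; case: (fc a \in X); case: (fc (rev a) \in X). Qed.

Lemma fcut_rev X a : (rev a \in fcut X) = (a \in fcut X).
Proof. by rewrite !inE revK addbC. Qed.

Lemma fcut_ex X : X != set0 -> X != setT -> fcut X != set0.
Proof.
move=> X0 XT; have [a [h1 _ h2]] := face_conn (subsetT X) X0 XT.
by apply/set0Pn; exists a; rewrite inE h1 (negbTE h2).
Qed.

Lemma min_cut_fcset Y : Y != set0 -> Y != setT ->
  (forall S, S != set0 -> S != setT -> fcut S \subset fcut Y -> #|fcut Y| <= #|fcut S|) -> fcset Y.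
Proof.
move=> Y0 YT mY S sS S0 SY.
have [/existsP[a /and3P[h1 h2 h3]]|/existsPn h] := boolP [exists a, [&& fc a \in S, fc (rev a) \in Y & fc (rev a) \notin S]].
  by exists a.
have hS a : fc a \in S -> fc (rev a) \in Y -> fc (rev a) \in S.
  by move=> p q; have := h a; rewrite p q /= negbK.
have hS' a : fc (rev a) \in S -> fc a \in Y -> fc a \in S.
  by move=> p q; have := hS (rev a); rewrite revK; apply.
pose S' := Y :\: S.
have S'0 : S' != set0 by rewrite setD_eq0; apply: contra SY => q; rewrite eqEsubset sS q.
have nT' (Q : {set face M}) : Q \subset Y -> Q != setT.
  by move=> q; apply: contra YT => /eqP e; rewrite eqEsubset subsetT -e q.
have s1 : fcut S \subset fcut Y.
  apply/subsetP=> a; rewrite !inE; have := hS a; have := hS' a; have := subsetP sS (fc a); have := subsetP sS (fc (rev a)).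
  case: (fc a \in S); case: (fc (rev a) \in S) => //=; case: (fc a \in Y); case: (fc (rev a) \in Y) => //=; intuition.
have s2 : fcut S' \subset fcut Y.
  apply/subsetP=> a; rewrite !inE; have := hS a; have := hS' a; have := subsetP sS (fc a); have := subsetP sS (fc (rev a)).
  case: (fc a \in S); case: (fc (rev a) \in S) => //=; case: (fc a \in Y); case: (fc (rev a) \in Y) => //=; intuition.
have e1 : fcut S = fcut Y by apply/eqP; rewrite eqEcard s1 mY // nT'.
have e2 : fcut S' = fcut Y by apply/eqP; rewrite eqEcard s2 mY // nT' // subsetDl.
case/set0Pn: (fcut_ex Y0 YT) => a aY.
have := aY; rewrite -{1}e1; have := aY; rewrite -{1}e2; move: aY; rewrite !inE.
have := hS a; have := hS' a; have := subsetP sS (fc a); have := subsetP sS (fc (rev a)).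
case: (fc a \in S); case: (fc (rev a) \in S) => //=; case: (fc a \in Y); case: (fc (rev a) \in Y) => //=; intuition; done.
Qed.

(** A smallest cut inside [fcut X] has both sides connected, and one side holds at most six of the
    twelve pentagons. Twelve darts are six edges. *)
Lemma face_inside_cut X : X != set0 -> X != setT -> #|fcut X| <= 12 -> exists z, fcut [set z] \subset fcut X.
Proof.
move=> X0 XT c12.
pose P Y := [&& Y != set0, Y != setT & fcut Y \subset fcut X].
have PX : P X by rewrite /P X0 XT subxx.
case: (arg_minnP (fun Y : {set face M} => #|fcut Y|) PX) => Y /and3P[Y0 YT sY] mY.
have mY' S : S != set0 -> S != setT -> fcut S \subset fcut Y -> #|fcut Y| <= #|fcut S|.
  by move=> S0 ST sS; apply: mY; rewrite /P S0 ST (subset_trans sS).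
have Y0' : ~: Y != set0 by apply: contra YT => /eqP e; rewrite -(setCK Y) e setC0.
have YT' : ~: Y != setT by apply: contra Y0 => /eqP e; rewrite -(setCK Y) e setCT.
have c1 := min_cut_fcset Y0 YT mY'.
have c2 : fcset (~: Y) by apply: min_cut_fcset => // S S0 ST; rewrite !fcut_setC; apply: mY'.
have ab : nA Y + nB Y <= 6.
  have := leq_trans (subset_leq_card sY) c12; rewrite card_fcut; clear; lia.
have kk : nK Y + nK (~: Y) = 12 by rewrite /nK (card_setCI (pents M) Y) card_pents.
have [k6|k6] := leqP (nK Y) 6.
  by have /eqP/cards1P[z ez] := small_bond c1 c2 Y0 YT k6 ab; exists z; rewrite -ez.
have := @small_bond (~: Y) c2; rewrite setCK nA_setC nB_setC => /(_ c1 Y0' YT').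
move=> h; have /eqP/cards1P[z ez] : #|~: Y| = 1 by apply: h; move: kk k6 ab; clear; lia.
by exists z; rewrite -ez fcut_setC.
Qed.

Lemma fnext_neq a : fnext a != a.
Proof.
apply/eqP=> e; have h c : fc c == fc a -> c = a.
  rewrite eq_sym fc_eq => /iter_findex <-; elim: (findex _ _ _) => //= n ->; exact: e.
have : #|[set c | fc c == fc a]| <= #|[set a]|.
  by apply: subset_leq_card; apply/subsetP=> c; rewrite !inE => /h ->.
by rewrite cards1; have := fc_size (fc a) => /orP[] /eqP ->.
Qed.

(** A single edge is an even set only if it is a loop, which would bound a face of size 1. *)
Lemma even_pair K b : isj (@gs M) (@gt M) K set0 -> b \in K -> K \subset [set b; rev b] -> False.
Proof.
move=> /isjP h bK sK; have := h (inl (vt b)); rewrite (bd_inl (@vt M) (@ed M)) inE.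
rewrite (bigD1 b) //= bK big1 // => c /andP[/eqP e nb]; apply/negbTE/negP=> cK.
have := subsetP sK _ cK; rewrite !inE (negbTE nb) /= => /eqP ec.
have : vt b == vt (rev b) by rewrite -ec e.
rewrite vt_eq => /or3P[/eqP e1|/eqP e1|/eqP e1].
- by move: nb; rewrite ec e1 eqxx.
- by have := fnext_neq (rev b); rewrite /fnext revK e1 eqxx.
- by have := fnext_neq b; rewrite /fnext e1 rot3 eqxx.
Qed.

Hypothesis noloop : forall a, fc (rot a) != fc a.

Lemma in_fcut1 x a : (a \in fcut [set x]) = (fc a == x) || (fc (rot a) == x).
Proof.
rewrite !inE fc_rev; have := noloop a; case: (eqVneq (fc a) x) => [->|_] //= /negbTE ->.
Qed.

Lemma card_fcut1 x : #|fcut [set x]| = 2 * #|[set a | fc a == x]|.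
Proof.
have -> : fcut [set x] = [set a | fc a == x] :|: [set a | fc (rev a) == x].
  by apply/setP=> a; rewrite in_fcut1 !inE fc_rev.
have := leq_card_setU [set a | fc a == x] [set a | fc (rev a) == x].
have -> : [disjoint [set a | fc a == x] & [set a | fc (rev a) == x]].
  rewrite -setI_eq0; apply/eqP/setP=> a; rewrite !inE fc_rev; apply/negP=> /andP[/eqP e1 /eqP e2].
  by have := noloop a; rewrite e1 e2 eqxx.
move/leqifP/eqP=> ->; have -> : #|[set a | fc (rev a) == x]| = #|[set a | fc a == x]|; last by clear; lia.
by apply: (card_preim_bij (@revK M) (@revK M)) => a; rewrite revK.
Qed.

Variable p : D -> D.
Hypothesis p_inj : injective p.
Hypothesis p_rev : forall a, p (rev a) = rev (p a).
Hypothesis p_vt : forall a c, (vt (p a) == vt (p c)) = (vt a == vt c).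

Lemma p_even K : isj (@gs M) (@gt M) K set0 -> isj (@gs M) (@gt M) (p @: K) set0.
Proof.
have [q pq qp] := injF_bij p_inj.
have inpK a : (a \in p @: K) = (q a \in K) by rewrite -{1}(qp a) mem_imset.
move=> /isjP h; apply/isjP=> -[v|y]; rewrite inE.
  have [a <-] := vt_surj v; rewrite (bd_inl (@vt M) (@ed M)).
  have := h (inl (vt (q a))); rewrite inE (bd_inl (@vt M) (@ed M)) => e; apply: (etrans _ e).
  rewrite [LHS](reindex p) /=; last by exists q => c _; rewrite ?pq ?qp.
  apply: eq_big => c; first by rewrite -{1}(qp a) p_vt.
  by rewrite mem_imset.
have [a <-] := ed_surj y; rewrite (bd_inr (@vt M)) !inpK.
have := h (inr (ed (q a))); rewrite inE (bd_inr (@vt M)) => <-.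
by have -> : q (rev a) = rev (q a) by apply: p_inj; rewrite p_rev !qp.
Qed.

(** The image of a face boundary is even, hence of the form [fcut X], and has at most six edges. It
    contains a face boundary, and the difference is an even set of at most one edge, so it is
    empty. *)
Lemma p_face x : exists z, p @: fcut [set x] = fcut [set z].
Proof.
have [X eX] := fcut_exact (p_even (fcut_even [set x])).
have cX : #|fcut X| = 2 * #|[set a | fc a == x]| by rewrite -eX card_imset // card_fcut1.
have sz (y : face M) : 5 <= #|[set a | fc a == y]| <= 6 by have /orP[/eqP ->|/eqP ->] := fc_size y.
have fX0 : fcut X != set0 by rewrite -card_gt0 cX; have := sz x; clear; lia.
have X0 : X != set0 by apply: contra fX0 => /eqP->; apply/eqP/setP=> a; rewrite !inE.
have XT : X != setT by apply: contra fX0 => /eqP->; apply/eqP/setP=> a; rewrite !inE.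
have [|z sz1] := face_inside_cut X0 XT; first by rewrite cX; have := sz x; clear; lia.
exists z; rewrite eX; apply/eqP; rewrite eq_sym eqEsubset sz1 /=.
have ev := isj_symd (fcut_even X) (fcut_even [set z]); rewrite symdv in ev.
have eD : symd (fcut X) (fcut [set z]) = fcut X :\: fcut [set z].
  by apply/setP=> a; rewrite in_symd in_setD; case h: (a \in fcut [set z]); [rewrite (subsetP sz1 _ h)|rewrite addbF].
rewrite -setD_eq0 -eD; apply/negPn/negP=> /set0Pn[b bK].
apply: (even_pair ev bK); have rK : rev b \in symd (fcut X) (fcut [set z]) by move: bK; rewrite !in_symd !fcut_rev.
have cb : #|[set b; rev b]| = 2 by rewrite cards2 eq_sym rev_neq.
have s2 : [set b; rev b] \subset symd (fcut X) (fcut [set z]) by rewrite subUset !sub1set bK rK.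
suff : [set b; rev b] == symd (fcut X) (fcut [set z]) by move/eqP=> <-.
rewrite eqEcard s2 cb eD cardsD (setIidPr sz1) cX card_fcut1; have := sz x; have := sz z; clear; lia.
Qed.

Lemma at_vertex z c d : vt c = vt d -> d \in fcut [set z] -> fc c = z -> (d == c) || (d == rot' c).
Proof.
move=> /eqP; rewrite vt_eq => /or3P[/eqP->|/eqP->|/eqP->]; rewrite ?eqxx ?orbT // => h ec.
move: h; rewrite in_fcut1 -ec (negbTE (noloop c)) /=; have := noloop (rot' c).
by rewrite /rot' rot3 eq_sym => /negbTE ->.
Qed.

(** The edges before and after [a] on its face go to a face boundary through [p a], which lies on
    one of the two sides of [p a]. The side decides the orientation at both ends at once. *)
Lemma p_sign a : (p (rot a) = rot (p a) /\ p (rot (rev a)) = rot (rev (p a))) \/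
  (p (rot a) = rot' (p a) /\ p (rot (rev a)) = rot' (rev (p a))).
Proof.
have [z ez] := p_face (fc a).
have im c : (p c \in fcut [set z]) = (c \in fcut [set fc a]) by rewrite -ez mem_imset.
have h0 : p a \in fcut [set z] by rewrite im in_fcut1 eqxx.
have h1 : p (rot' a) \in fcut [set z] by rewrite im in_fcut1 /rot' rot3 eqxx orbT.
have h2 : p (rot (rev a)) \in fcut [set z] by rewrite im in_fcut1 -/(fnext a) fc_next eqxx.
have v1 c d : vt c = vt d -> vt (p c) = vt (p d) by move=> e; apply/eqP; rewrite p_vt e.
have vr c : vt (rot' c) = vt c by rewrite /rot' !vt_rot.
have rr c : rot' (rot c) = c by rewrite /rot' rot3.
have ne1 c : p (rot' c) != p c by rewrite (inj_eq p_inj) /rot' rot2_neq.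
have ne2 c : p (rot c) != p c by rewrite (inj_eq p_inj) rot_neq.
have third c (P : p (rot' c) = rot' (p c)) : p (rot c) = rot (p c).
  have := v1 (rot c) c (vt_rot c) => /eqP; rewrite eq_sym vt_eq (negbTE (ne2 c)) /= => /orP[/eqP //|/eqP e].
  by have := inj_eq p_inj (rot c) (rot' c); rewrite P e eqxx => /esym/eqP e2; have := rot_neq (rot c); rewrite -/(rot' c) -e2 eqxx.
have third' c (P : p (rot' c) = rot (p c)) : p (rot c) = rot' (p c).
  have := v1 (rot c) c (vt_rot c) => /eqP; rewrite eq_sym vt_eq (negbTE (ne2 c)) /= => /orP[/eqP e|/eqP //].
  by have := inj_eq p_inj (rot c) (rot' c); rewrite P e eqxx => /esym/eqP e2; have := rot_neq (rot c); rewrite -/(rot' c) -e2 eqxx.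
move: (h0); rewrite in_fcut1 => /orP[/eqP e|/eqP e].
  left; split.
    apply: third; have := at_vertex (v1 a (rot' a) (esym (vr a))) h1 e.
    by rewrite (negbTE (ne1 a)) => /eqP.
  have ef : fc (rot (rev (p a))) = z by rewrite -/(fnext (p a)) fc_next.
  have vv : vt (rot (rev (p a))) = vt (p (rot (rev a))).
    by rewrite vt_rot -p_rev; apply: v1; rewrite vt_rot.
  have := at_vertex vv h2 ef; rewrite rr -p_rev.
  by rewrite (negbTE (ne2 _)) orbF => /eqP.
right; split.
  apply: third'; have vv : vt (rot (p a)) = vt (p (rot' a)) by rewrite vt_rot; apply: v1; rewrite vr.
  have := at_vertex vv h1 e; rewrite rr (negbTE (ne1 a)) orbF => /eqP //.
have ef : fc (rev (p a)) = z by rewrite fc_rev.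
have vv : vt (rev (p a)) = vt (p (rot (rev a))) by rewrite -p_rev; apply: v1; rewrite vt_rot.
have := at_vertex vv h2 ef; rewrite -p_rev (negbTE (ne2 _)) => /eqP //.
Qed.

Theorem graph_aut_map_aut : (forall a, p (rot a) = rot (p a)) \/ (forall a, p (rot a) = rot' (p a)).
Proof.
pose sg a := p (rot a) == rot (p a).
have rn c : rot c != rot' c by rewrite eq_sym; exact: rot_neq.
have sgE a : ~~ sg a -> p (rot a) = rot' (p a) by have [[h _]|[h _]] := p_sign a; rewrite /sg h ?eqxx.
have sg_rev a : sg (rev a) = sg a.
  rewrite /sg p_rev; have [[-> ->]|[-> ->]] := p_sign a; first by rewrite !eqxx.
  by rewrite ![rot' _ == _]eq_sym !(negbTE (rn _)).
have sg_rot1 a : sg a -> sg (rot a).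
  move=> h; apply/negPn/negP=> /sgE; rewrite (eqP h) /rot' rot3 => /p_inj e.
  by have := rot2_neq a; rewrite e eqxx.
have sg_rot a : sg (rot a) = sg a.
  by apply/idP/idP=> [/sg_rot1/sg_rot1|/sg_rot1 //]; rewrite rot3.
pose S := [set v | [forall a, (vt a == v) ==> sg a]].
have inS a : (vt a \in S) = sg a.
  rewrite inE; apply/forallP/idP=> [/(_ a)|h c]; first by rewrite eqxx.
  by apply/implyP; rewrite eq_sym vt_eq => /or3P[] /eqP->; rewrite ?sg_rot.
have [S0|S0] := eqVneq S set0.
  by right=> a; apply: sgE; rewrite -inS S0 inE.
left=> a; apply/eqP; rewrite -/(sg a) -inS (map_conn S0) ?inE // => c.
by rewrite !inS sg_rev.
Qed.

End Whitney.

(** * Extremal packings *)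

Section Chain.
Variables (M : fmap) (k : nat).
Local Notation D := (dart M).
Local Notation W := (face M + edge M)%type.
Variable F : {set {set W}}.
Hypothesis goodF : {in F, forall Z, good Z}.
Hypothesis lamF : {in F &, forall Z1 Z2, Z1 != Z2 -> lam Z1 Z2 && nocom (@hs M) (@ht M) Z1 Z2}.
Hypothesis k0 : 0 < k.
Hypothesis cardV : #|vert M| = 60 * k ^ 2.
Hypothesis cardF : #|F| = 24 * k.
Implicit Types (p q x : face M) (Z : {set W}) (a : D).

Lemma F_tight : [/\ tight F, KA F = 12 & MA F = 240 * k ^ 2].
Proof.
have [le eq] := area goodF lamF (subxx F).
have := KA_le F; have := MA_le F; move: le eq; rewrite cardV cardF => le eq m1 m2.
have e : 5 * (24 * k) ^ 2 = KA F * MA F.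
  by apply/eqP; rewrite eqn_leq le; apply: leq_trans (leq_mul m2 m1) _; clear; nia.
split; first exact: eq.
- by move: e m1 m2 k0; clear; nia.
- by move: e m1 m2 k0; clear; nia.
Qed.

Definition chain p := [set Z in F | inl p \in Z].

Lemma card_chain p : pent p -> #|chain p| = 2 * k.
Proof.
move=> pp; have [[_ t2] e1 e2] := F_tight; have ptf : inl p \in tf M by rewrite in_tf.
have cov : tf M \subset cover F.
  apply/setIidPr/eqP; rewrite eqEcard subsetIr card_tf -e1; exact: leqnn.
have := t2 (inl p); rewrite inE (subsetP cov _ ptf) ptf => /(_ isT); rewrite e1 cardF /through /chain.
move: #|_|; clear; lia.
Qed.

Lemma chain_only p q Z : pent p -> pent q -> Z \in chain p -> inl q \in Z -> q = p.
Proof.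
move=> pp pq; rewrite inE => /andP[ZF pZ] qZ.
have [[t1 _] _ _] := F_tight; have [/eqP/cards1P[w ew] _ _] := t1 Z ZF.
have : inl p \in Z :&: tf M by rewrite inE pZ in_tf.
have : inl q \in Z :&: tf M by rewrite inE qZ in_tf.
by rewrite ew => /set1P h1 /set1P h2; move: h1; rewrite -h2 => -[].
Qed.

Lemma chain_nK p Z : pent p -> Z \in chain p -> nK (fpart Z) = 1.
Proof.
move=> pp; rewrite inE => /andP[ZF pZ]; have [[t1 _] _ _] := F_tight.
by have [h _ _] := t1 Z ZF; rewrite -card_tfI.
Qed.

Lemma chain_total p Z1 Z2 : Z1 \in chain p -> Z2 \in chain p -> (Z1 \subset Z2) || (Z2 \subset Z1).
Proof.
rewrite !inE => /andP[F1 p1] /andP[F2 p2]; have [->|ne] := eqVneq Z1 Z2; first by rewrite subxx.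
have /andP[l _] := lamF F1 F2 ne; move: l; rewrite /lam => /or3P[->//|->|d]; first by rewrite orbT.
by have := disjointFr d p1; rewrite p2.
Qed.

Lemma chain_below p Z : pent p -> Z \in chain p -> below F Z = #|[set Z' in chain p | Z' \subset Z]|.
Proof.
move=> pp Zc; apply: eq_card => Z'; rewrite !inE; case Z'F: (Z' \in F) => //=.
case sub: (Z' \subset Z); rewrite ?andbF // andbT.
have [q pq qZ] := good_in (goodF Z'F).
by rewrite -(chain_only pp pq Zc (subsetP sub _ qZ)) qZ.
Qed.

(** Members of a chain are nested, so [below] is injective on them and its 2 k values fill the
    interval. *)
Lemma chain_ex p i : pent p -> 0 < i <= 2 * k -> exists2 Z, Z \in chain p & below F Z = i.
Proof.
move=> pp ii.
have rng Z : Z \in chain p -> 0 < below F Z <= 2 * k.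
  move=> Zc; rewrite (chain_below pp Zc) -(card_chain pp); apply/andP; split.
    by apply/card_gt0P; exists Z; rewrite inE Zc subxx.
  by apply: subset_leq_card; apply/subsetP=> Z'; rewrite inE => /andP[].
have inj : {in chain p &, injective (below F)}.
  have key Z1 Z2 : Z1 \in chain p -> Z2 \in chain p -> Z1 \subset Z2 -> below F Z1 = below F Z2 -> Z1 = Z2.
    move=> c1 c2 sub; rewrite (chain_below pp c1) (chain_below pp c2) => e.
    have es : [set Z' in chain p | Z' \subset Z1] = [set Z' in chain p | Z' \subset Z2].
      apply/eqP; rewrite eqEcard e leqnn andbT; apply/subsetP=> Z'; rewrite !inE => /andP[-> h].
      exact: subset_trans h sub.
    have : Z2 \in [set Z' in chain p | Z' \subset Z1] by rewrite es inE c2 subxx.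
    by rewrite inE => /andP[_ h]; apply/eqP; rewrite eqEsubset sub.
  move=> Z1 Z2 c1 c2 e; case/orP: (chain_total c1 c2) => sub; first exact: key.
  by apply/esym/key.
have : {subset map (below F) (enum (chain p)) <= iota 1 (2 * k)}.
  move=> j /mapP[Z]; rewrite mem_enum => /rng h ->; rewrite mem_iota; move: h; clear; lia.
have un : uniq (map (below F) (enum (chain p))).
  by rewrite map_inj_in_uniq ?enum_uniq // => Z1 Z2; rewrite !mem_enum; apply: inj.
move=> sb; have [_ h] := uniq_min_size un sb ltac:(by rewrite size_iota size_map -cardE card_chain).
have : i \in iota 1 (2 * k) by rewrite mem_iota; move: ii; clear; lia.
by rewrite -h => /mapP[Z]; rewrite mem_enum => hZ ->; exists Z.
Qed.

(** Parity of areas: [Mc Z] has 5 (2 j + 1)^2 cells, an odd number, while a region ending at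
    midpoints meets entire triangles, a multiple of four cells. *)
Lemma shape_odd p Z j : pent p -> Z \in chain p -> below F Z = j.*2.+1 ->
  [/\ shape Z false, nT (fpart Z) = 5 * j ^ 2 & nB (fpart Z) = 5 * j].
Proof.
move=> pp Zc e; have ZF : Z \in F by move: Zc; rewrite inE => /andP[].
have [[t1 _] _ _] := F_tight; have [_ m1 m2] := t1 Z ZF.
have [al sh] := shapeP (goodF ZF); have [c1 _ _] := good_chi (goodF ZF).
rewrite (chain_nK pp Zc) in c1; have [i1 i2] := card_McIc sh.
have q1 : j.*2 ^ 2 = 4 * j ^ 2 by clear; nia.
have q2 : j.*2.+1 ^ 2 = 4 * j ^ 2 + 4 * j + 1 by clear; nia.
move: m1 m2; rewrite e [_.-1]/= q1 q2; case: al sh i1 i2 => sh -> -> m1 m2; first by exfalso; move: c1 m1 m2; clear; lia.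
have eT : nT (fpart Z) = 5 * j ^ 2 by move: m2; clear; lia.
by split=> //; move: eT c1 m1; clear; lia.
Qed.

Lemma shape_even p Z j : pent p -> Z \in chain p -> below F Z = j.*2.+2 -> shape Z true.
Proof.
move=> pp Zc e; have ZF : Z \in F by move: Zc; rewrite inE => /andP[].
have [[t1 _] _ _] := F_tight; have [_ m1 m2] := t1 Z ZF.
have [al sh] := shapeP (goodF ZF); have [c1 _ _] := good_chi (goodF ZF).
rewrite (chain_nK pp Zc) in c1; have [i1 i2] := card_McIc sh.
have q2 : j.*2.+1 ^ 2 = 4 * j ^ 2 + 4 * j + 1 by clear; nia.
by move: m2; rewrite e [_.-1]/= q2; case: al sh i1 i2 => // sh -> _ m2; exfalso; move: m2; clear; lia.
Qed.

Lemma chain_next p Z1 Z2 i : pent p -> Z1 \in chain p -> Z2 \in chain p -> below F Z1 = i -> below F Z2 = i.+1 ->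
  Mc Z1 = Ic Z2.
Proof.
move=> pp c1 c2 e1 e2; have F1 : Z1 \in F by move: c1; rewrite inE => /andP[].
have F2 : Z2 \in F by move: c2; rewrite inE => /andP[].
have ne : Z1 != Z2 by apply/eqP=> e; move: e1; rewrite e e2; clear; lia.
have [[t1 _] _ _] := F_tight; have [_ m1 _] := t1 Z1 F1; have [_ _ m2] := t1 Z2 F2.
have sub : Z1 \subset Z2.
  case/orP: (chain_total c1 c2) => // sub.
  have : below F Z2 <= below F Z1.
    apply: subset_leq_card; apply/subsetP=> Z'; rewrite !inE => /andP[-> h]; exact: subset_trans h sub.
  by rewrite e1 e2 ltnn.
by apply/eqP; rewrite eqEcard (F_nested goodF lamF F1 F2 ne sub) m1 m2 e1 e2 /=.
Qed.

Lemma fpart_setC Z : fpart (~: Z) = ~: fpart Z.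
Proof. by apply/setP=> x; rewrite !inE. Qed.

(** The face sets of the odd members of a chain. The numbers are those of a ball of radius j around
    a pentagon in the hexagonal lattice with one sector removed; the last clause says that no
    triangle is left between consecutive sets. *)
Definition disc p (Y : nat -> {set face M}) :=
  (forall j, j < k -> [/\ p \in Y j, nK (Y j) = 1, nT (Y j) = 5 * j ^ 2, nB (Y j) = 5 * j & 
     [/\ fcset (Y j), fcset (~: Y j) & Y j != setT]]) /\
  (forall j a, j.+1 < k -> [|| fc a \in Y j, fc (rot a) \in Y j | fc (rot' a) \in Y j] =
     [&& fc a \in Y j.+1, fc (rot a) \in Y j.+1 & fc (rot' a) \in Y j.+1]).

Definition meets (Y : {set face M}) a := [|| fc a \in Y, fc (rot a) \in Y | fc (rot' a) \in Y].

Lemma Mc_even Z a : shape Z true -> (inr (vt a) \in Mc Z) = meets (fpart Z) a.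
Proof.
move=> sh; rewrite McV !sh /rot' rot3 /meets; case: (fc a \in _); case: (fc (rot a) \in _);
by case: (fc (rot (rot a)) \in _).
Qed.

Lemma chain_discs p : pent p -> exists Y Zt, [/\ disc p Y, Zt \in chain p, forall Z, Z \in chain p -> Z \subset Zt &
  forall a, (inr (vt a) \in Mc Zt) = meets (Y k.-1) a].
Proof.
move=> pp.
have exZ (j : 'I_k) : exists Z : {set W} * {set W}, [/\ Z.1 \in chain p, below F Z.1 = j.*2.+1, Z.2 \in chain p & below F Z.2 = j.*2.+2].
  have jk := ltn_ord j.
  have [|Z1 h1 h2] := @chain_ex p j.*2.+1 pp; first by move: jk; clear; lia.
  have [|Z2 h3 h4] := @chain_ex p j.*2.+2 pp; first by move: jk; clear; lia.
  by exists (Z1, Z2).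
have [f hf] := fin_all_exists exZ.
pose Zb j := if insub j is Some i then (f i).1 else set0.
pose Za j := if insub j is Some i then (f i).2 else set0.
have hZ j : j < k -> [/\ Zb j \in chain p, below F (Zb j) = j.*2.+1, Za j \in chain p & below F (Za j) = j.*2.+2].
  by move=> jk; rewrite /Zb /Za; case: insubP => [i _ <-|]; [exact: hf|rewrite jk].
pose Y j := fpart (Zb j).
(* Members 2 j + 1 and 2 j + 2 of a chain have the same faces and differ in midpoints only. *)
have eY j : j < k -> fpart (Za j) = Y j.
  move=> jk; have [c1 b1 c2 b2] := hZ j jk.
  have sa := shape_even pp c2 b2; have [sb _ _] := shape_odd pp c1 b1.
  have /setP eM := chain_next pp c1 c2 b1 b2.
  apply/setP=> x; have [a <-] := fc_surj x; have := eM (inl a); rewrite !inE.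
  rewrite !sa !sb /rot' !rot3 !inE.
  by case: (inl (fc a) \in Za j); case: (inl (fc a) \in Zb j); rewrite //= ?andbF ?orbT.
have k1 : k.-1 < k by move: k0; clear; lia.
exists Y, (Za k.-1); have [c1 b1 c2 b2] := hZ _ k1.
split=> //; last first.
- by move=> a; rewrite Mc_even ?eY //; exact: shape_even pp c2 b2.
- move=> Z Zc; case/orP: (chain_total Zc c2) => // sub.
  have e : [set Z' in chain p | Z' \subset Za k.-1] = chain p.
    apply/eqP; rewrite eqEcard; apply/andP; split; first by apply/subsetP=> Z'; rewrite inE => /andP[].
    rewrite -(chain_below pp c2) b2 (card_chain pp); move: k0; clear; lia.
  by move: Zc; rewrite -e inE => /andP[].
split=> [j jk|j a jk].
- have [c b _ _] := hZ j jk; have [sb tb bb] := shape_odd pp c b.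
  have ZF : Zb j \in F by move: c; rewrite inE => /andP[].
  have [g1 g2 _ _ _] := goodF ZF; have [y py yZ] := good_out (goodF ZF).
  split=> //; first by rewrite inE; move: c; rewrite inE => /andP[].
    exact: chain_nK pp c.
  split; [exact: fpart_fcset|by rewrite -fpart_setC; exact: fpart_fcset|].
  by apply/eqP=> /setP/(_ y); rewrite !inE (negbTE yZ).
- have jk' := ltnW jk; have [_ _ c2' b2'] := hZ j jk'; have [c1' b1' _ _] := hZ _ jk.
  have /setP/(_ (inr (vt a))) := chain_next pp c2' c1' b2' b1'.
  rewrite Mc_even ?eY //; last exact: shape_even pp c2' b2'.
  have [sb _ _] := shape_odd pp c1' b1'.
  rewrite /meets IcV !sb /rot' rot3 -/(Y j.+1) => ->.
  by case: (fc a \in Y j.+1); case: (fc (rot a) \in Y j.+1); case: (fc (rot (rot a)) \in Y j.+1).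
Qed.

(** The cells met by all regions number 240 k^2, which is all of them, and each region lies in the
    outermost one of its chain; outermost regions of different pentagons are disjoint. *)
Theorem disc_decomposition : exists Y : face M -> nat -> {set face M},
  [/\ forall p, pent p -> disc p (Y p), forall a, exists2 p, pent p & meets (Y p k.-1) a &
      forall a p q, pent p -> pent q -> meets (Y p k.-1) a -> meets (Y q k.-1) a -> p = q].
Proof.
have [[t1 _] e1 e2] := F_tight.
have ex p : exists Y : (nat -> {set face M}) * {set W}, pent p -> [/\ disc p Y.1, Y.2 \in chain p,
   forall Z, Z \in chain p -> Z \subset Y.2 & forall a, (inr (vt a) \in Mc Y.2) = meets (Y.1 k.-1) a].
  have [pp|np] := boolP (pent p); last by exists (fun=> set0, set0).
  by have [Y [Zt h]] := chain_discs pp; exists (Y, Zt) => _.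
have [f hf] := fin_all_exists ex; exists (fun p => (f p).1); split=> [p pp|a|a p q pp pq].
- by have [] := hf p pp.
- have full : \bigcup_(Z in F) Mc Z = setT.
    apply/eqP; rewrite eqEcard subsetT cardsT card_cells_all cardV -/(MA F) e2; clear; lia.
  have : inr (vt a) \in \bigcup_(Z in F) Mc Z by rewrite full inE.
  case/bigcupP=> Z ZF aZ; have [p pp pZ] := good_in (goodF ZF).
  exists p => //; have [_ tc tmax tm] := hf p pp; rewrite -tm.
  have Zc : Z \in chain p by rewrite inE ZF.
  have tF : (f p).2 \in F by move: tc; rewrite inE => /andP[].
  have [<-//|ne] := eqVneq Z (f p).2.
  exact: (subsetP (Ic_Mc _)) (subsetP (F_nested goodF lamF ZF tF ne (tmax _ Zc)) _ aZ).
- have [_ tc _ tm] := hf p pp; have [_ tc' _ tm'] := hf q pq; rewrite -tm -tm' => m1 m2.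
  have tF : (f p).2 \in F by move: tc; rewrite inE => /andP[].
  have tF' : (f q).2 \in F by move: tc'; rewrite inE => /andP[].
  have pZ : inl p \in (f p).2 by move: tc; rewrite inE => /andP[].
  have qZ : inl q \in (f q).2 by move: tc'; rewrite inE => /andP[].
  have [e|ne] := eqVneq (f p).2 (f q).2.
    by apply: (chain_only pq pp tc'); rewrite -e.
  have /andP[l _] := lamF tF tF' ne; move: l; rewrite /lam => /or3P[sub|sub|d].
  + by apply: (chain_only pq pp tc'); apply: (subsetP sub).
  + by apply/esym/(chain_only pp pq tc)/(subsetP sub).
  + by have := disjointFr (F_disj goodF lamF tF tF' d) m1; rewrite m2.
Qed.

End Chain.

(** * Coverings of spherical maps *)

Section Euler.
Variables (A B C E : finType) (p : A -> B) (q : A -> C) (ed : A -> E) (r e : A -> A).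
Hypothesis psurj : forall z, exists a, p a = z.
Hypothesis qsurj : forall z, exists a, q a = z.
Hypothesis esurj : forall z, exists a, ed a = z.
Hypothesis p_f : forall a, p (r (e a)) = p a.
Hypothesis q_r : forall a, q (r a) = q a.
Hypothesis ed_eq : forall a b, (ed a == ed b) = (b == a) || (b == e a).
Hypothesis rr : forall a, r (r (r a)) = a.
Hypothesis ee : involutive e.
Hypothesis e_neq : forall a, e a != a.
Hypothesis conn : forall P : A -> Prop, (exists a, P a) -> (forall a, P a -> P (e a)) ->
  (forall a, P a -> P (r a)) -> forall a, P a.

Let s a : B + E := inl (p a).
Let t a : B + E := inr (ed a).
Let qc (S : {set C}) := [set a | (q a \in S) (+) (q (e a) \in S)].

Let ed_e a : ed (e a) = ed a.
Proof. by apply/eqP; rewrite eq_sym ed_eq eqxx orbT. Qed.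

Lemma euler_card_dart : #|A| = 2 * #|E|.
Proof.
have := @card_fibers _ _ ed predT 2; rewrite !cardsE; apply=> z _.
have [a <-] := esurj z; have -> : [set b | ed b == ed a] = [set a; e a].
  by apply/setP=> b; rewrite !inE eq_sym ed_eq.
by rewrite cards2 eq_sym e_neq.
Qed.

Lemma euler_cset : cset s t setT.
Proof.
move=> S _ S0 ST; have [/existsP[a ha]|/existsPn h] := boolP [exists a, cut s t S a].
  by exists a; rewrite // /within !inE.
case/eqP: ST; have hS a : (inl (p a) \in S) = (inr (ed a) \in S).
  by have := h a; rewrite /cut /s /t; case: (inl _ \in S); case: (inr _ \in S).
have all a : inl (p a) \in S.
  apply: (conn (P := fun a => inl (p a) \in S)) a => [|a|a].
  - case/set0Pn: S0 => -[x|x] xS; first by have [a ea] := psurj x; exists a; rewrite ea.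
    by have [a ea] := esurj x; exists a; rewrite hS ea.
  - by rewrite !hS ed_e.
  - by rewrite -(ee a) p_f ee !hS ed_e.
apply/setP=> -[x|x]; rewrite [RHS]inE; first by have [a <-] := psurj x; rewrite all.
by have [a <-] := esurj x; rewrite -hS all.
Qed.

Lemma euler_even S : isj s t (qc S) set0.
Proof.
apply/isjP=> -[x|x]; rewrite [RHS]inE /bd.
  have qf a : q (e a) = q (r (e a)) by rewrite q_r.
  have -> : \big[addb/false]_g ((g \in qc S) && inc s t g (inl x)) =
     \big[addb/false]_(g | p g == x) ((q g \in S) (+) (q (r (e g)) \in S)).
    rewrite [RHS]big_mkcond; apply: eq_bigr => a _; rewrite inE -qf /inc /s /t.
    have -> : (inl (p a) == inl x :> B + E) = (p a == x) by [].
    have -> : (inr (ed a) == inl x :> B + E) = false by [].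
    by rewrite addbF; case: (p a == x); rewrite ?andbT ?andbF.
  rewrite big_split /=; have bij : {on [pred a | p a == x], bijective (fun a => r (e a))}.
    by exists (fun a => e (r (r a))) => a _; rewrite ?rr ?ee ?rr.
  rewrite [X in X (+) _](reindex (fun a => r (e a))) //=.
  under eq_bigl => a do rewrite p_f.
  exact: addbb.
have [a <-] := esurj x; rewrite (bigD1 a) // (bigD1 (e a)) /=; last exact: e_neq.
have inr1 c : inc s t c (inr (ed a)) = (ed c == ed a) by [].
rewrite !inr1 ed_e eqxx !andbT big1 ?addbF => [|c /andP[c1 c2]].
  by rewrite !inE ee; case: (q a \in S); case: (q (e a) \in S).
by rewrite inr1 eq_sym ed_eq (negbTE c1) (negbTE c2) andbF.
Qed.

(** The genus inequality for a connected map, with no planarity assumed: the 2^(|C|-1) cuts are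
    distinct even sets, of which there are at most 2^(2 |E| - |B| - |E| + 1). *)
Lemma euler_le : #|C| + #|B| <= #|E| + 2.
Proof.
case: (pickP (@predT A)) => [a0 _|no]; last first.
  have -> : #|C| = 0 by apply: eq_card0 => x; have [a] := qsurj x; have := no a.
  by have -> : #|B| = 0 by apply: eq_card0 => x; have [a] := psurj x; have := no a.
pose c0 := q a0; pose F0 := qc @: powerset (setT :\ c0).
have F0P K' : K' \in F0 -> K' \subset [set a | within s t setT a] /\ isj s t K' set0.
  by case/imsetP=> S _ ->; split; [apply/subsetP=> a _; rewrite !inE /within !inE|exact: euler_even].
have := @card_even_sets _ _ s t setT (inl (p a0)) F0 euler_cset (in_setT _) F0P.
have -> : #|[set a | within s t setT a]| = #|A|.
  by rewrite -cardsT; apply: eq_card => a; rewrite !inE /within !inE.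
have qcs (S S' : {set C}) : qc (symd S S') = symd (qc S) (qc S').
  apply/setP=> a; rewrite !inE; case: (q a \in S); case: (q a \in S');
  by case: (q (e a) \in S); case: (q (e a) \in S').
have inj : {in powerset (setT :\ c0) &, injective qc}.
  move=> S1 S2; rewrite !inE => s1 s2 e1.
  have e0 : qc (symd S1 S2) = set0 by rewrite qcs e1 symdv.
  have [e2|/set0Pn[z zS]] := eqVneq (symd S1 S2) set0.
    by rewrite -(symdK S2 S1) (symdC S2 S1) e2 symd0.
  have all a : q a \in symd S1 S2.
    apply: (conn (P := fun a => q a \in symd S1 S2)) a => [|a aS|a].
    - by have [a ea] := qsurj z; exists a; rewrite ea.
    - by have := in_set0 a; rewrite -e0 inE aS /=; case: (_ \in symd _ _).
    - by rewrite q_r.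
  have := all a0; rewrite -/c0 in_symd.
  have -> : c0 \in S1 = false by apply/negP=> /(subsetP s1); rewrite !inE eqxx.
  by have -> : c0 \in S2 = false by apply/negP=> /(subsetP s2); rewrite !inE eqxx.
have cB : 0 < #|B| by apply/card_gt0P; exists (p a0).
have cC : 0 < #|C| by apply/card_gt0P; exists (q a0).
rewrite /F0 card_in_imset // card_powerset cardsT card_sum euler_card_dart -expnD leq_exp2l //.
have := cardsD1 c0 [set: C]; rewrite inE cardsT => h; move: h cB cC; clear; lia.
Qed.

End Euler.

Section OrbitType.
Variables (A : finType) (h : A -> A).
Hypothesis hinj : injective h.
Let hsym := fconnect_sym hinj.

Definition orbt := {x : A | froots h x}.
Lemma cls_subproof a : froots h (froot h a). Proof. exact: (roots_root hsym). Qed.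
Definition cls a : orbt := exist _ (froot h a) (cls_subproof a).

Lemma cls_eq a b : (cls a == cls b) = fconnect h a b.
Proof. by rewrite -val_eqE /= (root_connect hsym). Qed.

Lemma cls_h a : cls (h a) = cls a.
Proof. by apply/eqP; rewrite cls_eq hsym fconnect1. Qed.

Lemma cls_surj z : exists a, cls a = z.
Proof. by exists (val z); apply: val_inj => /=; apply/eqP; exact: (valP z). Qed.

Lemma cls_fiber n a : 0 < n -> iter n h a = a -> #|[set b | cls b == cls a]| <= n.
Proof.
move=> n0 en; apply: leq_trans (_ : size (traject h a n) <= n); last by rewrite size_traject.
apply: leq_trans (card_size _); apply: subset_leq_card; apply/subsetP=> b.
rewrite inE eq_sym cls_eq => /iter_findex <-; move: (findex _ _ _) => j.
have -> : iter j h a = iter (j %% n) h a.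
  rewrite {1}(divn_eq j n) addnC iterD; congr iter; elim: (j %/ n) => // i IH.
  by rewrite mulSn iterD IH.
by apply/trajectP; exists (j %% n); rewrite // ltn_mod.
Qed.

End OrbitType.

Lemma card_fibers_le (A B : finType) (p : A -> B) (P : pred B) c :
  (forall x, P x -> #|[set a | p a == x]| <= c) -> #|[set a | P (p a)]| <= c * #|[set x | P x]|.
Proof.
move=> h; rewrite -sum1_card (partition_big p P) /=; last by move=> a; rewrite inE.
rewrite mulnC -sum_nat_const (eq_bigl (fun x => x \in [set x | P x])) => [|x]; last by rewrite inE.
apply: leq_sum => x; rewrite inE => Px; apply: leq_trans (h x Px).
rewrite -sum1_card; rewrite big_mkcond [X in _ <= X]big_mkcond; apply: leq_sum => a _; rewrite !inE.
by case: (P _); case: (p a == x).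
Qed.

(** Vertices minus edges amount to - c / 6 and there are at least n5 / 5 + n6 / 6 faces, so the
    genus inequality leaves n5 / 30 <= 2. *)
Lemma covering_num c v x f n5 n6 o5 o6 : c = 3 * v -> n5 <= 5 * o5 -> n6 <= 6 * o6 -> c = n5 + n6 -> f = o5 + o6 ->
  c = 2 * x -> v + f <= x + 2 -> n5 <= 60.
Proof. lia. Qed.

(* Spherical maps have no nontrivial unbranched coverings; the covering here is the component of
   a point in the product of two maps, and its Euler characteristic is twice its degree. *)
Section Product.
Variables (A1 A2 : finType) (r1 e1 : A1 -> A1) (r2 e2 : A2 -> A2) (P5 : pred A1) (a0 : A1) (b0 : A2).
Hypothesis rr1 : forall a, r1 (r1 (r1 a)) = a.
Hypothesis ee1 : involutive e1.
Hypothesis rr2 : forall a, r2 (r2 (r2 a)) = a.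
Hypothesis ee2 : involutive e2.
Hypothesis r_neq : forall a, r1 a != a.
Hypothesis e_neq : forall a, e1 a != a.
Hypothesis conn1 : forall (P : A1 -> Prop) a, P a -> (forall a, P a -> P (e1 a)) ->
  (forall a, P a -> P (r1 a)) -> forall a, P a.
Hypothesis card5 : #|[set a | P5 a]| = 60.
Hypothesis P5f : forall a, P5 (r1 (e1 a)) = P5 a.
Variable Inv : A1 -> A2 -> Prop.
Hypothesis Inv0 : Inv a0 b0.
Hypothesis Inve : forall a b, Inv a b -> Inv (e1 a) (e2 b).
Hypothesis Invr : forall a b, Inv a b -> Inv (r1 a) (r2 b).
Hypothesis Inv5 : forall a b, Inv a b -> P5 a ->
  iter 5 (fun x => r1 (e1 x)) a = a /\ iter 5 (fun x => r2 (e2 x)) b = b.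
Hypothesis Inv6 : forall a b, Inv a b -> ~~ P5 a ->
  iter 6 (fun x => r1 (e1 x)) a = a /\ iter 6 (fun x => r2 (e2 x)) b = b.

Let ep (x : A1 * A2) := (e1 x.1, e2 x.2).
Let rp (x : A1 * A2) := (r1 x.1, r2 x.2).
Let R := [rel x y : A1 * A2 | (y == ep x) || (y == rp x)].
Let inK x := connect R (a0, b0) x.

Let inK_e x : inK x -> inK (ep x).
Proof. by move=> h; apply: connect_trans h (connect1 _); rewrite /= eqxx. Qed.
Let inK_r x : inK x -> inK (rp x).
Proof. by move=> h; apply: connect_trans h (connect1 _); rewrite /= eqxx orbT. Qed.

Let inK_ind (P : A1 * A2 -> Prop) : P (a0, b0) -> (forall x, P x -> P (ep x)) -> (forall x, P x -> P (rp x)) ->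
  forall x, inK x -> P x.
Proof.
move=> P0 Pe Pr x /connectP[q pq ->]; elim: q (a0, b0) P0 pq => //= y q IH x0 P0 /andP[/orP[]/eqP-> pq];
by apply: IH pq; first [exact: Pe | exact: Pr].
Qed.

Let K := {x | inK x}.
Let eK (x : K) : K := exist _ (ep (val x)) (inK_e (valP x)).
Let rK (x : K) : K := exist _ (rp (val x)) (inK_r (valP x)).

Let eKK : involutive eK.
Proof. by move=> x; apply: val_inj; rewrite /= /ep /= ee1 ee2; case: (sval x). Qed.
Let rK3 x : rK (rK (rK x)) = x.
Proof. by apply: val_inj; rewrite /= /rp /= rr1 rr2; case: (sval x). Qed.
Let eK_neq x : eK x != x.
Proof. by apply/eqP=> /(congr1 (fun y => (val y).1)) /= h; have := e_neq (sval x).1; rewrite h eqxx. Qed.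
Let rK_neq x : rK x != x.
Proof. by apply/eqP=> /(congr1 (fun y => (val y).1)) /= h; have := r_neq (sval x).1; rewrite h eqxx. Qed.

Let x0 : K := exist _ (a0, b0) (connect0 R (a0, b0)).

Let K_ind (P : K -> Prop) : P x0 -> (forall x, P x -> P (eK x)) -> (forall x, P x -> P (rK x)) -> forall x, P x.
Proof.
move=> P0 Pe Pr [x hx]; suff : forall h : inK x, P (exist _ x h) by apply.
apply: (@inK_ind (fun x => forall h : inK x, P (exist _ x h))) hx => [h|y Py h|y Py h].
- by have -> : exist _ (a0, b0) h = x0 by apply: val_inj.
- have hy : inK y.
    by have := inK_e h; rewrite /ep /= ee1 ee2; case: (y).
  have -> : exist _ (ep y) h = eK (exist _ y hy) by apply: val_inj.
  exact/Pe/Py.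
- have hy : inK y.
    by have := inK_r (inK_r h); rewrite /rp /= rr1 rr2; case: (y).
  have -> : exist _ (rp y) h = rK (exist _ y hy) by apply: val_inj.
  exact/Pr/Py.
Qed.

Let rK_inj : injective rK. Proof. by apply: (can_inj (g := fun x => rK (rK x))) => x; exact: rK3. Qed.
Let eK_inj : injective eK. Proof. exact: inv_inj eKK. Qed.
Let fK x := rK (eK x).
Let fK_inj : injective fK. Proof. by move=> x y /rK_inj/eK_inj. Qed.

Let K_conn (P : K -> Prop) : (exists a, P a) -> (forall a, P a -> P (eK a)) -> (forall a, P a -> P (rK a)) -> forall a, P a.
Proof.
case=> y Py Pe Pr; suff P0 : P x0 by exact: K_ind.
apply: (@K_ind (fun y => P y -> P x0) _ _ _ y) => // x IH Px; apply: IH.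
  by rewrite -(eKK x); apply: Pe.
by rewrite -(rK3 x); apply: (Pr); apply: (Pr).
Qed.

(** [Inv] holds on the whole component and closes up both coordinates after five or six steps, so no
    face orbit is longer than the face below it. *)
Lemma product_pentagons : #|[set x : K | P5 (val x).1]| <= 60.
Proof.
have he : forall a b : K, (cls eK_inj a == cls eK_inj b) = (b == a) || (b == eK a).
  move=> a b; rewrite cls_eq; apply/idP/orP=> [/iter_findex <-|[]/eqP->]; last exact: fconnect1; last exact: connect0.
  elim: (findex _ _ _) => /= [|n [/eqP IH|/eqP IH]]; first by left.
    by right; rewrite IH.
  by left; rewrite IH eKK.
have hr a : cls rK_inj (rK a) = cls rK_inj a by exact: cls_h.
have hf a : cls fK_inj (rK (eK a)) = cls fK_inj a by exact: (cls_h fK_inj).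
have := @euler_le _ _ _ _ (cls fK_inj) (cls rK_inj) (cls eK_inj) rK eK (@cls_surj _ _ fK_inj)
  (@cls_surj _ _ rK_inj) (@cls_surj _ _ eK_inj) hf hr he rK3 eKK eK_neq K_conn.
have := euler_card_dart (@cls_surj _ _ eK_inj) he eK_neq.
have c3 : #|{: K}| = 3 * #|{: orbt rK}|.
  have := @card_fibers _ _ (cls rK_inj) predT 3; rewrite !cardsE; apply=> z _.
  have [a <-] := cls_surj rK_inj z; have -> : [set b | cls rK_inj b == cls rK_inj a] = [set a; rK a; rK (rK a)].
    apply/setP=> b; rewrite !inE eq_sym cls_eq; apply/idP/idP=> [/iter_findex <-|].
      elim: (findex _ _ _) => /= [|n /orP[/orP[]|] /eqP->]; rewrite ?eqxx ?orbT //.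
      by rewrite rK3 eqxx.
    by move=> /orP[/orP[]|] /eqP->; rewrite ?connect0 ?fconnect1 // -[rK (rK a)]/(iter 2 rK a) fconnect_iter.
  have n1 := rK_neq a; have n2 : rK (rK a) != a by apply/eqP=> h; have := rK_neq (rK (rK a)); rewrite rK3 h eqxx.
  by rewrite -setUA cardsU1 cards2 !inE negb_or eq_sym n1 (eq_sym a) n2 eq_sym (rK_neq (rK a)).
have P5K x : P5 (val (fK x)).1 = P5 (val x).1 by rewrite /= P5f.
pose P5o (z : orbt fK) := P5 (val (val z)).1.
have P5c a : P5o (cls fK_inj a) = P5 (val a).1.
  rewrite /P5o; have : fconnect fK a (froot fK a) by exact: connect_root.
  change (fconnect fK a (froot fK a) -> P5 (val (froot fK a)).1 = P5 (val a).1).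
  by move=> /iter_findex <-; elim: (findex _ _ _) => // n <-; rewrite iterS P5K.
have iK (j : nat) (x : K) : val (iter j fK x) = (iter j (fun x => r1 (e1 x)) (val x).1, iter j (fun x => r2 (e2 x)) (val x).2).
  by elim: j => [|j IH]; [case: (val x)|rewrite !iterS /= /rp /ep /=; have /= -> := IH].
have InvK (x : K) : Inv (val x).1 (val x).2.
  by apply: (@K_ind (fun x => Inv (val x).1 (val x).2)) => // y; [exact: Inve|exact: Invr].
have b5 : #|[set a : K | P5o (cls fK_inj a)]| <= 5 * #|[set z | P5o z]|.
  apply: card_fibers_le => z; have [a <-] := cls_surj fK_inj z; rewrite P5c => Pa.
  by apply: cls_fiber => //; apply: val_inj; rewrite iK; have [-> ->] := Inv5 (InvK a) Pa; case: (val a).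
have b6 : #|[set a : K | ~~ P5o (cls fK_inj a)]| <= 6 * #|[set z | ~~ P5o z]|.
  apply: (@card_fibers_le _ _ _ (fun z => ~~ P5o z)) => z; have [a <-] := cls_surj fK_inj z; rewrite P5c => Pa.
  by apply: cls_fiber => //; apply: val_inj; rewrite iK; have [-> ->] := Inv6 (InvK a) Pa; case: (val a).
have e5 : #|[set x : K | P5 (val x).1]| = #|[set a : K | P5o (cls fK_inj a)]|.
  by apply: eq_card => a; rewrite !inE P5c.
have t1 : #|{: K}| = #|[set a : K | P5o (cls fK_inj a)]| + #|[set a : K | ~~ P5o (cls fK_inj a)]|.
  rewrite -cardsT -(cardsID [set a : K | P5o (cls fK_inj a)]) setTI; congr (_ + _).
  by apply: eq_card => a; rewrite !inE andbT.
have t2 : #|{: orbt fK}| = #|[set z | P5o z]| + #|[set z | ~~ P5o z]|.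
  rewrite -cardsT -(cardsID [set z | P5o z]) setTI; congr (_ + _).
  by apply: eq_card => a; rewrite !inE andbT.
rewrite e5; exact: covering_num c3 b5 b6 t1 t2.
Qed.

(** The component projects onto the 60 pentagon darts of the first map and has at most 60 darts
    above them, so it is single-valued there; this spreads along [e1] and [r1] to all darts. *)
Theorem product_graph : exists g : A1 -> A2, [/\ g a0 = b0, forall a, g (e1 a) = e2 (g a) & forall a, g (r1 a) = r2 (g a)].
Proof.
have surj a : exists b, inK (a, b).
  apply: (@conn1 (fun a => exists b, inK (a, b)) a0) => [|a' [b h]|a' [b h]]; first by exists b0; exact: connect0.
    by exists (e2 b); exact: (inK_e h).
  by exists (r2 b); exact: (inK_r h).
have [g hg] := fin_all_exists surj.
have fun5 a b : P5 a -> inK (a, b) -> b = g a.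
  move=> Pa h; have : #|[set x : K | P5 (val x).1]| <= #|[set a | P5 a]| by rewrite card5 product_pentagons.
  have im : (fun x : K => (val x).1) @: [set x : K | P5 (val x).1] = [set a | P5 a].
    apply/setP=> c; apply/imsetP/idP=> [[x]|]; first by rewrite inE => h' ->; rewrite inE.
    by rewrite inE => Pc; exists (exist _ (c, g c) (hg c)); rewrite ?inE.
  rewrite -{1}im => le; have /imset_injP inj : #|(fun x : K => (val x).1) @: [set x : K | P5 (val x).1]| == #|[set x : K | P5 (val x).1]|.
    by rewrite eqn_leq leq_imset_card.
  have := inj (exist _ (a, b) h) (exist _ (a, g a) (hg a)); rewrite !inE /= Pa => /(_ isT isT erefl).
  by move/(congr1 (fun x : K => (val x).2)).
have funK a : forall b, inK (a, b) -> b = g a.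
  have [c Pc] : exists c, P5 c.
    have : 0 < #|[set a | P5 a]| by rewrite card5.
    by case/card_gt0P=> c; rewrite inE; exists c.
  suff h : forall b b', inK (a, b) -> inK (a, b') -> b = b' by move=> b hb; apply: h hb (hg a).
  apply: (@conn1 (fun a => forall b b', inK (a, b) -> inK (a, b') -> b = b') c) => [b b' h h'|a' IH b b' h h'|a' IH b b' h h'].
  - by rewrite (fun5 _ _ Pc h) (fun5 _ _ Pc h').
  - have := inK_e h; have := inK_e h'; rewrite /ep /= ee1 => k1 k2; exact: (can_inj ee2 (IH _ _ k2 k1)).
  - have := inK_r (inK_r h); have := inK_r (inK_r h'); rewrite /rp /= rr1 => k1 k2.
    by have := congr1 r2 (IH _ _ k2 k1); rewrite !rr2.
exists g; split=> [|a|a]; first by apply/esym/funK; exact: connect0.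
- exact/esym/funK/(inK_e (hg a)).
- exact/esym/funK/(inK_r (hg a)).
Qed.

End Product.

(** * The map of a fullerene graph *)

Lemma loop_isj (M : fmap) (a : dart M) : fc (rot a) = fc a -> isj (@hs M) (@ht M) [set a; rev a] set0.
Proof.
move=> e; have inr2 c : (c \in [set a; rev a]) = (c == a) || (c == rev a) by rewrite !inE.
apply/isjP=> -[x|y]; rewrite [RHS]inE.
  rewrite (bd_inl (@fc M) (@ed M)) big_mkcond (bigD1 a) // (bigD1 (rev a)) /=; last exact: rev_neq.
  rewrite (fc_rev a) e !inr2 !eqxx orbT big1 => [|c /andP[c1 c2]]; first by case: (fc a == x).
  by rewrite inr2 (negbTE c1) (negbTE c2); case: ifP.
have [c <-] := ed_surj y; rewrite (bd_inr (@fc M)) !inr2.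
rewrite -[rev c == rev a](inj_eq (can_inj (@revK M))) !revK.
by rewrite -[rev c == a](inj_eq (can_inj (@revK M))) !revK; case: (c == a); case: (c == rev a).
Qed.

Section Build.
Variables (V : finType) (adj : rel V).
Hypothesis irr : irreflexive adj.
Hypothesis sym : symmetric adj.
Hypothesis cub : cubic adj.
Hypothesis con : connected_graph adj.
Variable rho : {perm arc adj}.
Hypothesis rs : rotation_system rho.
Hypothesis eul : #|V| + #|faces rho| = #|edges adj| + 2.
Hypothesis fsz : forall a, face_size rho a = 5 \/ face_size rho a = 6.
Local Notation D := (arc adj).
Implicit Types (a b : D).

Lemma val_rev a : val (arc_rev a) = ((val a).2, (val a).1).
Proof. by rewrite /arc_rev val_insubd /= sym (valP a). Qed.

Lemma arc_revK : involutive (@arc_rev V adj).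
Proof. by move=> a; apply: val_inj; rewrite !val_rev /=; case: (val a). Qed.

Lemma arc_rev_neq a : arc_rev a != a.
Proof.
apply/eqP=> /(congr1 val); rewrite val_rev; have := valP a; case: (val a) => u v /= h [e _].
by move: h; rewrite e irr.
Qed.

Lemma card_at (u : V) : #|[set b : D | (val b).1 == u]| = 3.
Proof.
rewrite -(cub u) -(card_imset _ (val_inj : injective (val : D -> V * V))).
have inj : injective (fun v : V => (u, v)) by move=> v w [].
rewrite -(card_imset _ inj); apply: eq_card => -[x y]; apply/imsetP/imsetP.
  case=> b; rewrite inE => /eqP e eb; have := valP b; move: e; rewrite -eb /= => -> h.
  by exists y; rewrite ?inE.
case=> w; rewrite inE => h [-> ->].
by exists (exist (fun p => adj p.1 p.2) (u, w) h); rewrite // inE /=.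
Qed.

Lemma rho_order a : fingraph.order rho a = 3.
Proof.
rewrite -(card_at (val a).1); apply: eq_card => b; rewrite [RHS]inE; change (fconnect rho a b = ((val b).1 == (val a).1)).
by apply/idP/eqP=> [h|h]; [apply/rs|apply/rs].
Qed.

Lemma rho3 a : rho (rho (rho a)) = a.
Proof. by have := iter_order (@perm_inj _ rho) a; rewrite rho_order. Qed.

Lemma rho_neq a : rho a != a.
Proof.
apply/eqP=> e; have := rho_order a; rewrite /fingraph.order.
suff -> : #|fconnect rho a| = 1 by [].
rewrite -(card1 a); apply: eq_card => b; rewrite [RHS]inE; apply/idP/eqP=> [/iter_findex <-|->]; last exact: connect0.
by elim: (findex _ _ _) => //= n ->.
Qed.

Lemma src_eq a b : ((val a).1 == (val b).1) = [|| b == a, b == rho a | b == rho (rho a)].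
Proof.
have -> : ((val a).1 == (val b).1) = fconnect rho a b by apply/eqP/idP=> [h|h]; [apply/rs|apply/esym/rs].
by rewrite fconnect_orbit /fingraph.orbit rho_order /= !inE.
Qed.

Definition aface := {F : {set D} | F \in faces rho}.
Definition aedge := {e : {set V} | e \in edges adj}.

Lemma afc_subproof a : face_of rho a \in faces rho.
Proof. by apply/imsetP; exists a. Qed.
Definition afc a : aface := exist _ (face_of rho a) (afc_subproof a).

Lemma aed_subproof a : [set (val a).1; (val a).2] \in edges adj.
Proof.
rewrite inE; apply/existsP; exists (val a).1; apply/existsP; exists (val a).2.
by rewrite (valP a) eqxx.
Qed.
Definition aed a : aedge := exist _ [set (val a).1; (val a).2] (aed_subproof a).

Lemma aed_eq a b : (aed a == aed b) = (b == a) || (b == arc_rev a).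
Proof.
rewrite -val_eqE /=; apply/eqP/orP=> [|[/eqP->|/eqP->]] //; last first.
  by rewrite val_rev /= setUC.
have ha := valP a; have hb := valP b.
have ea : b == a = (val b == val a) by [].
have eb : b == arc_rev a = (val b == val (arc_rev a)) by [].
rewrite ea eb val_rev => e; move: ha hb e {ea eb}; rewrite -!/(val _) /=; case: (sval a) => u v; case: (sval b) => w z /= ha hb e.
have hu : u \in [set w; z] by rewrite -e !inE eqxx.
have hv : v \in [set w; z] by rewrite -e !inE eqxx orbT.
have nuv : u != v by apply: contraTneq ha => ->; rewrite irr.
move: hu hv; rewrite !inE => /orP[/eqP e1|/eqP e1] /orP[/eqP e2|/eqP e2].
- by move: nuv; rewrite e1 e2 eqxx.
- by left; rewrite e1 e2.
- by right; rewrite e1 e2.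
- by move: nuv; rewrite e1 e2 eqxx.
Qed.

Lemma fperm_inj : injective (face_perm rho).
Proof. by move=> a b /perm_inj/(can_inj arc_revK). Qed.

Lemma afc_eq a b : (afc a == afc b) = fconnect (fun c => rho (arc_rev c)) a b.
Proof.
rewrite -val_eqE /= /face_of; apply/eqP/idP=> [/setP/(_ b)|h].
  by rewrite !inE connect0.
apply/setP=> c; rewrite !inE; exact: (same_connect (fconnect_sym fperm_inj) h).
Qed.

Lemma afc_size x : (#|[set a | afc a == x]| == 5) || (#|[set a | afc a == x]| == 6).
Proof.
case: x => F hF; have /imsetP[a _ eF] := hF.
have -> : #|[set b | afc b == exist _ F hF]| = face_size rho a.
  rewrite /face_size /fingraph.order; apply: eq_card => b; rewrite inE.
  have -> : exist _ F hF = afc a by apply: val_inj; rewrite /= eF.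
  by rewrite eq_sym afc_eq.
by case: (fsz a) => ->; rewrite eqxx ?orbT.
Qed.

Lemma a_conn (S : {set V}) : S != set0 -> (forall a, (val a).1 \in S -> (val (arc_rev a)).1 \in S) -> S = setT.
Proof.
move=> /set0Pn[u uS] h; apply/setP=> v; rewrite inE.
have /connectP[p pth ->] := con u v; elim: p u uS pth => //= w p IH u uS /andP[uw pth].
apply: IH pth; have := h (exist (fun p => adj p.1 p.2) (u, w) uw); rewrite val_rev /=; exact.
Qed.

Lemma a_euler : #|V| + #|{: aface}| = #|{: aedge}| + 2.
Proof.
rewrite !card_sig; have -> : #|[pred F | F \in faces rho]| = #|faces rho| by apply: eq_card.
by have -> : #|[pred e | e \in edges adj]| = #|edges adj| by apply: eq_card.
Qed.

Lemma src_surj (v : V) : exists a : D, (val a).1 = v.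
Proof.
have : 0 < #|[set b : D | (val b).1 == v]| by rewrite card_at.
by case/card_gt0P=> a; rewrite inE => /eqP; exists a.
Qed.

Lemma aed_surj (x : aedge) : exists a, aed a = x.
Proof.
case: x => e he; have := he; rewrite inE => /existsP[u /existsP[v /andP[uv /eqP ee]]].
by exists (exist (fun p => adj p.1 p.2) (u, v) uv); apply: val_inj; rewrite /= ee.
Qed.

Lemma afc_surj (x : aface) : exists a, afc a = x.
Proof. by case: x => F hF; have /imsetP[a _ eF] := hF; exists a; apply: val_inj; rewrite /= eF. Qed.

Definition the_map : fmap :=
  @Fmap D V aface aedge (@arc_rev V adj) rho (fun a => (val a).1) afc aed
    arc_revK arc_rev_neq rho3 rho_neq src_eq aed_eq afc_eq src_surj aed_surj afc_surj afc_size a_conn a_euler.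

(** An edge with one face on both sides is an even set of the dual, hence a cut by exactness: a
    bridge. *)
Lemma the_noloop : bridgeless adj -> forall a : dart the_map, fc (rot a) != fc a.
Proof.
move=> br a; apply/eqP=> e.
have := loop_isj e.
move=> /vcut_exact[S eS].
have cl u v : adj u v -> [set u; v] != [set (val a).1; (val a).2] -> (u \in S) = (v \in S).
  move=> uv ne; pose b : dart the_map := exist (fun p => adj p.1 p.2) (u, v) uv.
  have : b \notin vcut S.
    rewrite -eS !inE negb_or; apply/andP; split; apply/eqP=> eb; case/eqP: ne.
      by rewrite -eb.
    have := congr1 val eb; rewrite val_rev /= => -[-> ->]; exact: setUC.
  by rewrite inE /= val_rev /=; case: (u \in S); case: (v \in S).
have : a \in vcut S by rewrite -eS !inE eqxx.
rewrite inE /= val_rev /=.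
have : (val a).1 \in S = ((val a).2 \in S).
  have /connectP[p pth ep] := br _ _ (valP a); rewrite [in RHS]ep.
  have gen : forall u q, path [rel x y | adj x y && ([set x; y] != [set (val a).1; (val a).2])] u q -> (u \in S) = (last u q \in S).
    move=> u q; elim: q u => //= w q IH u /andP[/andP[uw ne] pq].
    by rewrite (cl _ _ uw ne); apply: IH.
  exact: gen pth.
by move=> ->; rewrite addbb.
Qed.

Lemma bigminn_le (I : eqType) (l : seq I) (P : pred I) (g : I -> nat) m j : j \in l -> P j ->
  \big[minn/m]_(i <- l | P i) g i <= g j.
Proof.
elim: l => // i l IH; rewrite inE big_cons => /orP[/eqP <-|jl] Pj; first by rewrite Pj geq_minl.
by case: ifP => _; [apply: leq_trans (geq_minr _ _) _|]; apply: IH.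
Qed.

Lemma bigminn_ex (I : eqType) (l : seq I) (P : pred I) (g : I -> nat) m :
  \big[minn/m]_(i <- l | P i) g i = m \/ exists2 j, P j & \big[minn/m]_(i <- l | P i) g i = g j.
Proof.
elim: l => [|i l IH]; first by rewrite big_nil; left.
rewrite big_cons; case: ifP => Pi //.
case: (leqP (g i) (\big[minn/m]_(i <- l | P i) g i)) => h.
  by right; exists i.
exact: IH.
Qed.

(** The edges that a two-colouring with classes [S] and its complement has to give up. *)
Definition mono_edges (S : {set V}) : {set {set V}} := [set val (aed a) | a in ~: @vcut the_map S].

Lemma card_mono S : 2 * #|mono_edges S| = #|~: @vcut the_map S|.
Proof.
pose P (x : aedge) := [forall a : D, (aed a == x) ==> (a \notin @vcut the_map S)].
have Pa a : P (aed a) = (a \notin @vcut the_map S).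
  apply/forallP/idP=> [/(_ a)|h c]; first by rewrite eqxx.
  apply/implyP; rewrite eq_sym aed_eq => /orP[/eqP->//|/eqP->].
  by move: h; rewrite !inE /= arc_revK addbC.
have := @card_fibers _ _ aed P 2 (fun x _ => card_efiber (M := the_map) x).
have -> : #|[set a | P (aed a)]| = #|~: @vcut the_map S| by apply: eq_card => a; rewrite !inE Pa inE.
move=> ->; congr (2 * _); rewrite -(card_imset [set x | P x] val_inj); apply: eq_card => e.
apply/imsetP/imsetP=> [[a]|[x]].
  by rewrite inE => h ->; exists (aed a) => //; rewrite inE Pa.
by rewrite inE; have [a <-] := aed_surj x; rewrite Pa => h ->; exists a => //; rewrite inE.
Qed.

Lemma mono_bip S : bipartite_minus adj (mono_edges S).
Proof.
apply/existsP; exists [ffun v => v \in S]; apply/forallP=> u; apply/forallP=> v; apply/implyP=> /andP[uv ne].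
rewrite !ffunE; pose a : D := exist (fun p => adj p.1 p.2) (u, v) uv.
have : a \in @vcut the_map S.
  by apply: contraNT ne => h; apply/imsetP; exists a => //; rewrite inE.
by rewrite inE /= val_rev /=; case: (u \in S); case: (v \in S).
Qed.

Lemma tau_le S : 2 * tau_odd adj <= #|~: @vcut the_map S|.
Proof.
rewrite -card_mono leq_mul2l /=; apply: (@bigminn_le _ _ _ (fun F : {set {set V}} => #|F|)); first exact: mem_index_enum.
rewrite mono_bip andbT inE; apply/subsetP=> e /imsetP[a _ ->]; exact: valP.
Qed.

Lemma bip_mono (F : {set {set V}}) : bipartite_minus adj F -> exists S, mono_edges S \subset F.
Proof.
case/existsP=> c h; exists [set v | c v]; apply/subsetP=> e /imsetP[a].
rewrite !inE /= val_rev /= => hc ->; have /forallP/(_ (val a).1)/forallP/(_ (val a).2) := h.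
rewrite (valP a) /=; move: hc; case: (c _); case: (c _) => //= _; case: (_ \in F) => //.
Qed.

Lemma tau_ge : exists S, 2 * tau_odd adj = #|~: @vcut the_map S|.
Proof.
suff [S hS] : exists S, #|~: @vcut the_map S| <= 2 * tau_odd adj.
  by exists S; apply/eqP; rewrite eqn_leq tau_le hS.
have [e|[F /andP[_ hF] e]] := @bigminn_ex _ (index_enum {set {set V}})
   (fun F => (F \in powerset (edges adj)) && bipartite_minus adj F) (fun F => #|F|) #|edges adj|.
  (* The default value of the minimum, the number of all edges, is dealt with by the empty [S]. *)
  exists set0; rewrite /tau_odd e -card_mono leq_mul2l /=; apply: subset_leq_card.
  by apply/subsetP=> x /imsetP[a _ ->]; exact: valP.
have [S sS] := bip_mono hF; exists S; rewrite /tau_odd e -card_mono leq_mul2l /=; exact: subset_leq_card.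
Qed.

End Build.

(** * Symmetric sublattices of the hexagonal lattice *)

Import GRing.Theory.

Lemma int_ind1 (P : int -> Prop) : P 0%R -> (forall x, P x -> P (x + 1)%R) -> (forall x, P x -> P (x - 1)%R) -> forall x, P x.
Proof.
move=> h0 hp hm; elim/int_rect => // n IH.
- by rewrite -addn1 PoszD; apply: hp.
- by rewrite -addn1 PoszD opprD; apply: hm.
Qed.

Lemma int_ind2 (P : int -> int -> Prop) : P 0%R 0%R ->
  (forall x y, P x y -> P (x + 1)%R y) -> (forall x y, P x y -> P (x - 1)%R y) ->
  (forall x y, P x y -> P x (y + 1)%R) -> (forall x y, P x y -> P x (y - 1)%R) -> forall x y, P x y.
Proof.
move=> h0 h1 h2 h3 h4 x y; elim/int_ind1: x => [|x|x]; [|exact: h1|exact: h2].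
by elim/int_ind1: y => [//|y|y]; [exact: h3|exact: h4].
Qed.

(** The hexagonal norm, that is the graph distance from the origin in the triangular lattice. *)
Definition hn (x y : int) : nat := maxn `|x|%N (maxn `|y|%N `|(x + y)%R|%N).

Lemma hnP x y : [/\ `|x| <= hn x y, `|y| <= hn x y & `|(x + y)%R| <= hn x y]%N.
Proof. by rewrite /hn !leq_max !leqnn !orbT. Qed.

Lemma hn_sub x y x' y' : hn (x - x') (y - y') <= hn x y + hn x' y'.
Proof.
have [a1 a2 a3] := hnP x y; have [b1 b2 b3] := hnP x' y'.
rewrite [X in X <= _]/hn !geq_max; move: (hn x y) (hn x' y') a1 a2 a3 b1 b2 b3; clear => p q *.
by apply/and3P; split; lia.
Qed.

Lemma hnM n x y : hn (Posz n * x) (Posz n * y) = n * hn x y.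
Proof. by rewrite /hn -mulrDr !abszM /= !maxnMr. Qed.

Module HexLattice.
Section Lattice.
Variables (Q : finType) (e f k : Q -> Q) (o : Q).
Hypothesis ee : forall q, e (e q) = q.
Hypothesis f6 : forall q, f (f (f (f (f (f q))))) = q.
Hypothesis fe3 : forall q, f (e (f (e (f (e q))))) = q.
Hypothesis fo : f o = o.
Hypothesis ko : k o = o.
Hypothesis kf : forall q, k (f q) = f (f (f (f (f (k q))))).
Hypothesis ke : forall q, k (e q) = e (k q).
Hypothesis trans : forall P : Q -> Prop, P o -> (forall q, P q -> P (e q)) -> (forall q, P q -> P (f q)) -> forall q, P q.
Variable m : nat.
Hypothesis m0 : 0 < m.
Hypothesis cardQ : #|Q| = 3 * m ^ 2.

Let f5 q := f (f (f (f (f q)))).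

Lemma efe q : e (f (e q)) = f5 (e (f5 q)).
Proof.
have h := fe3 (e (f5 q)); rewrite ee /f5 f6 in h.
by rewrite /f5 -h f6.
Qed.

(** Translations as words: [e] is a half-turn about the midpoint of an edge and f^3 one about a
    face, so [U] is a translation; [V] is its conjugate by [f]. *)
Let U q := f (f (f (e q))).
Let U' q := e (f (f (f q))).
Let V q := f (f (e (f q))).
Let V' q := f5 (e (f (f (f (f q))))).

Lemma UK q : U (U' q) = q. Proof. by rewrite /U /U' ee f6. Qed.
Lemma U'K q : U' (U q) = q. Proof. by rewrite /U /U' f6 ee. Qed.
Lemma VK q : V (V' q) = q. Proof. by rewrite /V /V' /f5 f6 ee f6. Qed.
Lemma V'K q : V' (V q) = q. Proof. by rewrite /V /V' /f5 f6 ee f6. Qed.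

Lemma f5f5 q : f5 (f5 q) = f (f (f (f q))).
Proof. by rewrite /f5 f6. Qed.

Lemma ef2e q : e (f (f (e q))) = f5 (e (f (f (f (f (e (f5 q))))))).
Proof.
have -> : f (e q) = e (e (f (e q))) by rewrite ee.
by rewrite efe efe f5f5.
Qed.

Lemma ef5e q : e (f5 (e q)) = f (e (f q)).
Proof.
have h := efe (f q); have -> : f5 (e q) = e (f (e (f q))) by rewrite h /f5 f6.
by rewrite ee.
Qed.

Lemma UV q : U (V q) = V (U q).
Proof. by rewrite /U /V ef2e /f5 !f6. Qed.

Lemma fV q : f (V q) = U (f q).
Proof. by []. Qed.

Definition itz (g g' : Q -> Q) (x : int) q := match x with Posz n => iter n g q | Negz n => iter n.+1 g' q end.

Lemma itzS g g' x q : cancel g' g -> itz g g' (x + 1)%R q = g (itz g g' x q).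
Proof.
move=> h; case: x => n; first by rewrite -PoszD addn1.
case: n => [|n]; first by rewrite /= h.
by have -> : (Negz n.+1 + 1)%R = Negz n; [lia|rewrite /= h].
Qed.

Lemma itzP g g' x q : cancel g g' -> cancel g' g -> itz g g' (x - 1)%R q = g' (itz g g' x q).
Proof. by move=> h1 h2; rewrite -{2}(subrK 1%R x) itzS // h1. Qed.

Definition T (x y : int) := itz U U' x (itz V V' y o).

Lemma T0 : T 0 0 = o. Proof. by []. Qed.
Lemma TU x y : T (x + 1) y = U (T x y). Proof. exact: itzS UK. Qed.
Lemma TU' x y : T (x - 1) y = U' (T x y). Proof. exact: itzP U'K UK. Qed.

Lemma U'V q : U' (V q) = V (U' q).
Proof. by rewrite -{1}(UK q) -UV U'K. Qed.

Lemma TV x y : T x (y + 1) = V (T x y).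
Proof.
rewrite /T (itzS _ _ VK); move: (itz V V' y o) => q; elim/int_ind1: x => [//|x IH|x IH].
- by rewrite !(itzS _ _ UK) IH UV.
- by rewrite !(itzP _ _ U'K UK) IH U'V.
Qed.

Lemma TV' x y : T x (y - 1) = V' (T x y).
Proof. by rewrite -{2}(subrK 1%R y) TV V'K. Qed.

Lemma UV' q : U (V' q) = V' (U q).
Proof. by rewrite -{2}(VK q) UV V'K. Qed.

Lemma fU q : f (U q) = U (V' (f q)).
Proof. by rewrite UV' -[LHS]V'K; congr V'; rewrite /V /U -[f (f (f (f (f _))))]/(f5 _) ef5e. Qed.

Lemma fU' q : f (U' q) = U' (V (f q)).
Proof. by have h := fU (U' q); rewrite UK in h; rewrite h -UV U'K VK. Qed.

Lemma fV' q : f (V' q) = U' (f q).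
Proof. by rewrite -{2}(VK q) fV U'K. Qed.

Lemma fT x y : f (T x y) = T (x + y) (- x).
Proof.
move: x y; apply: int_ind2 => [|x y IH|x y IH|x y IH|x y IH]; first by rewrite T0 fo.
- rewrite TU fU IH; have -> : (x + 1 + y = x + y + 1)%R by lia.
  by have -> : (- (x + 1) = - x - 1)%R; [lia|rewrite TU TV'].
- rewrite TU' fU' IH; have -> : (x - 1 + y = x + y - 1)%R by lia.
  by have -> : (- (x - 1) = - x + 1)%R; [lia|rewrite TU' TV].
- by rewrite TV fV IH; have -> : (x + (y + 1) = x + y + 1)%R; [lia|rewrite TU].
- by rewrite TV' fV' IH; have -> : (x + (y - 1) = x + y - 1)%R; [lia|rewrite TU'].
Qed.

Lemma eT x y : e (T x y) = T (- x - 1) (- y).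
Proof.
have -> : e (T x y) = f (f (f (T (x + 1) y))) by rewrite TU /U f6.
by rewrite !fT; congr T; lia.
Qed.

Lemma kU q : k (U q) = U (k q).
Proof. by rewrite /U !kf ke !f6. Qed.

Lemma kV q : k (V q) = U (V' (k q)).
Proof. by rewrite /V kf kf ke kf f6 /U /V' ef5e. Qed.

Lemma kU' q : k (U' q) = U' (k q).
Proof. by rewrite -{2}(UK q) kU U'K. Qed.

Lemma kV' q : k (V' q) = U' (V (k q)).
Proof. by have h := kV (V' q); rewrite VK in h; rewrite h -UV U'K VK. Qed.

Lemma kT x y : k (T x y) = T (x + y) (- y).
Proof.
move: x y; apply: int_ind2 => [|x y IH|x y IH|x y IH|x y IH]; first by rewrite T0 ko.
- by rewrite TU kU IH; have -> : (x + 1 + y = x + y + 1)%R; [lia|rewrite TU].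
- by rewrite TU' kU' IH; have -> : (x - 1 + y = x + y - 1)%R; [lia|rewrite TU'].
- rewrite TV kV IH; have -> : (x + (y + 1) = x + y + 1)%R by lia.
  by have -> : (- (y + 1) = - y - 1)%R; [lia|rewrite TU TV'].
- rewrite TV' kV' IH; have -> : (x + (y - 1) = x + y - 1)%R by lia.
  by have -> : (- (y - 1) = - y + 1)%R; [lia|rewrite TU' TV].
Qed.

Lemma Thom x y x' y' : T x y = T x' y' -> forall a b, T (x + a) (y + b) = T (x' + a) (y' + b).
Proof.
move=> h; apply: int_ind2 => [|a b IH|a b IH|a b IH|a b IH]; first by rewrite !addr0.
- by rewrite !addrA !TU IH.
- by rewrite !addrA !TU' IH.
- by rewrite !addrA !TV IH.
- by rewrite !addrA !TV' IH.
Qed.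

Lemma Tsurj q : exists x y, q = T x y.
Proof.
move: q; apply: trans; first by exists 0%R, 0%R.
- by move=> q [x [y ->]]; rewrite eT; exists (- x - 1)%R, (- y)%R.
- by move=> q [x [y ->]]; rewrite fT; exists (x + y)%R, (- x)%R.
Qed.

(** The periods of the quotient. Stability under [Lrot] and [Lconj] is the dihedral symmetry that
    classifies the lattice. *)
Definition L (x y : int) := T x y = o.

Lemma Tdiff x y x' y' : T x y = T x' y' <-> L (x - x') (y - y').
Proof.
split=> h; first by rewrite /L (Thom h (- x') (- y')) !subrr.
have : T (x - x') (y - y') = T 0 0 by rewrite h T0.
by move/Thom=> /(_ x' y'); rewrite !subrK !add0r.
Qed.

Lemma LD x y x' y' : L x y -> L x' y' -> L (x + x') (y + y').
Proof.
move=> h h'; have := @Thom x y 0%R 0%R; rewrite T0 => /(_ h x' y').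
by rewrite !add0r /L h'.
Qed.

Lemma LN x y : L x y -> L (- x) (- y).
Proof.
by move=> h; have := (Tdiff 0 0 x y).1; rewrite T0 !sub0r; apply; rewrite h.
Qed.

Lemma LB x y x' y' : L x y -> L x' y' -> L (x - x') (y - y').
Proof. by move=> h h'; apply: LD h (LN h'). Qed.

Lemma LM x y c : L x y -> L (c * x) (c * y).
Proof.
move=> h; elim/int_ind1: c => [|c IH|c IH]; first by rewrite !mul0r.
- by rewrite !mulrDl !mul1r; apply: LD.
- by rewrite !mulrBl !mul1r; apply: LB.
Qed.

Lemma Lrot x y : L x y -> L (x + y) (- x).
Proof. by rewrite /L => h; rewrite -fT h fo. Qed.

Lemma Lconj x y : L x y -> L (x + y) (- y).
Proof. by rewrite /L => h; rewrite -kT h ko. Qed.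

(** A period plus its mirror image is real; the second claim is the same for the rotated period. *)
Lemma Ltrace x y : L x y -> L (2 * x + y) 0 /\ L (x + 2 * y) 0.
Proof.
move=> h; split.
  by have := LD h (Lconj h); congr L; lia.
by have := LD (Lrot h) (Lconj (Lrot h)); congr L; lia.
Qed.

Lemma Lper : exists r, (0 < r) && (T (Posz r) 0 == o).
Proof.
have Uinj : injective U by apply: (can_inj U'K).
exists (fingraph.order U o); rewrite fingraph.order_gt0 /=; apply/eqP; exact: (iter_order Uinj o).
Qed.

Definition r := ex_minn Lper.

Lemma rP : 0 < r /\ L (Posz r) 0.
Proof. by rewrite /r; case: ex_minnP => n /andP[h /eqP h'] _. Qed.

Lemma r_min n : 0 < n -> L (Posz n) 0 -> r <= n.
Proof. by move=> n0 h; rewrite /r; case: ex_minnP => n' _; apply; rewrite n0; apply/eqP. Qed.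

Lemma Lreal x : L x 0 -> exists c, x = (c * Posz r)%R.
Proof.
have [r0 hr] := rP; move=> h; exists (x %/ Posz r)%Z.
have h2 : L (x %% Posz r)%Z 0.
  have := LB h (LM (x %/ Posz r)%Z hr); congr L; lia.
have ge := modz_ge0 x (_ : Posz r != 0); have lt := ltz_pmod x (_ : (0 < Posz r)%R).
have dq := divz_eq x (Posz r); suff e0 : (x %% Posz r)%Z = 0%R by rewrite {1}dq e0 addr0.
clear dq; case: (x %% Posz r)%Z ge lt h2 => n ge lt h2; last by have := ge (ltac:(lia)); lia.
case: (posnP n) => [->//|n0]; have := r_min n0 h2; have := lt (ltac:(lia)); lia.
Qed.

Lemma mulz_small (c : int) n : `|(c * Posz n)%R|%N < n -> c = 0%R.
Proof. by rewrite abszM /=; case: n => // n; nia. Qed.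

Lemma L0r : L 0 (Posz r).
Proof. by have [_ h] := rP; have := LB h (Lrot h); congr L; lia. Qed.

(** The 3-adic valuation is even on the left and odd on the right. *)
Lemma sq3 n : n ^ 2 = 3 * m ^ 2 -> False.
Proof.
move=> h; have n0 : 0 < n by case: n h => //; nia.
have := congr1 (logn 3) h; rewrite lognX lognM // ?expn_gt0 ?m0 // lognX.
have -> : logn 3 3 = 1 by [].
lia.
Qed.

(* the lattice cannot be [r Lambda], whose index is a square *)
Lemma not_scalar : (forall x y, L x y -> (exists c, x = (c * Posz r)%R) /\ (exists c, y = (c * Posz r)%R)) -> False.
Proof.
move=> hL; have [r0 hr] := rP; apply: (@sq3 r); rewrite -cardQ.
pose h (p : 'I_r * 'I_r) := T (Posz p.1) (Posz p.2).
have inj : injective h.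
  move=> [i j] [i' j'] /(Tdiff _ _ _ _).1 /hL[[c hc] [c' hc']].
  have ii := ltn_ord i; have ii' := ltn_ord i'; have jj := ltn_ord j; have jj' := ltn_ord j'.
  rewrite /= in hc hc'.
  have c0 : c = 0%R by apply: (@mulz_small _ r); rewrite -hc; lia.
  have c'0 : c' = 0%R by apply: (@mulz_small _ r); rewrite -hc'; lia.
  by congr (_, _); apply: val_inj => /=; move: hc hc'; rewrite c0 c'0 /=; lia.
have -> : #|Q| = #|{: 'I_r * 'I_r}|; last by rewrite card_prod card_ord; nia.
rewrite -(card_codom inj); apply/esym/eq_card => q; rewrite inE; apply/codomP.
have [x [y ->]] := Tsurj q.
have lx := ltz_pmod x (ltac:(lia) : (0 < Posz r)%R); have ly := ltz_pmod y (ltac:(lia) : (0 < Posz r)%R).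
have gx := modz_ge0 x (ltac:(lia) : Posz r != 0); have gy := modz_ge0 y (ltac:(lia) : Posz r != 0).
have ix : `|(x %% Posz r)%Z|%N < r by lia.
have iy : `|(y %% Posz r)%Z|%N < r by lia.
have ex : Posz `|(x %% Posz r)%Z|%N = (x %% Posz r)%Z by lia.
have ey : Posz `|(y %% Posz r)%Z|%N = (y %% Posz r)%Z by lia.
exists (Ordinal ix, Ordinal iy); change (T x y = T (Posz `|(x %% Posz r)%Z|%N) (Posz `|(y %% Posz r)%Z|%N)); rewrite ex ey.
apply/Tdiff.
have := LD (LM (x %/ Posz r)%Z hr) (LM (y %/ Posz r)%Z L0r); congr L.
  by have := divz_eq x (Posz r); lia.
by have := divz_eq y (Posz r); lia.
Qed.

Lemma Lmod3 x y : L x y -> exists a b, [/\ (3 * x = Posz r * (2 * a - b))%R, (3 * y = Posz r * (2 * b - a))%R & (x - y = Posz r * (a - b))%R].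
Proof.
move=> h; have [h1 h2] := Ltrace h; have [a ea] := Lreal h1; have [b eb] := Lreal h2.
by exists a, b; split; lia.
Qed.

(** The traces are multiples of the least real period r. If 3 does not divide r, all periods are
    multiples of r, and the index would be a square. So r = 3 s and the periods are s (c1, c2) with
    c1 = c2 modulo 3. Either (s, s) is a period, and the index 3 s^2 gives s = m, or c1 is always
    divisible by 3, which is again the excluded scalar lattice. *)
Theorem L_class x y : L x y -> exists a b, [/\ x = (Posz m * a)%R, y = (Posz m * b)%R & exists c, (a - b = 3 * c)%R].
Proof.
have [r0 hr] := rP.
have [s es] : exists s, r = 3 * s.
  have [/eqP d|nd] := boolP (r %% 3 == 0); first by exists (r %/ 3); lia.
  exfalso; apply: not_scalar => x' y' h; have [a [b [h1 h2 _]]] := Lmod3 h.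
  have [r1 er] : exists r1, r = 3 * r1 + 1 \/ r = 3 * r1 + 2 by exists (r %/ 3); lia.
  have key z c : (3 * z = Posz r * c)%R -> exists c', z = (c' * Posz r)%R.
    move=> e1; have [c' ec] : exists c', c = (3 * c')%R.
      case: er => er; rewrite er in e1.
        by exists (z - Posz r1 * c)%R; move: e1; rewrite PoszD PoszM; nia.
      by exists (Posz r1 * c + c - z)%R; move: e1; rewrite PoszD PoszM; nia.
    by exists c'; move: e1; rewrite ec; nia.
  by split; [apply: key h1|apply: key h2].
have s0 : 0 < s by lia.
have Lform x' y' : L x' y' -> exists c1 c2 d, [/\ x' = (Posz s * c1)%R, y' = (Posz s * c2)%R & (c1 - c2 = 3 * d)%R].
  move=> h; have [a [b [h1 h2 _]]] := Lmod3 h; rewrite es PoszM in h1 h2.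
  by exists (2 * a - b)%R, (2 * b - a)%R, (a - b)%R; split; [nia|nia|lia].
have [Lss|nLss] : L (Posz s) (Posz s) \/ ~ L (Posz s) (Posz s).
  by rewrite /L; case: (T (Posz s) (Posz s) =P o); [left|right].
- have em : s = m; last by move=> /Lform[c1 [c2 [d [h1 h2 h3]]]]; rewrite -em; exists c1, c2; split=> //; exists d.
  suff : #|Q| = 3 * s ^ 2 by rewrite cardQ => /eqP; rewrite eqn_pmul2l // eqn_exp2r // => /eqP.
  pose h (p : 'I_(3 * s) * 'I_s) := T (Posz p.1) (Posz p.2).
  have inj : injective h.
    move=> [i j] [i' j'] /(Tdiff _ _ _ _).1 /Lform[c1 [c2 [d [e1 e2 e3]]]].
    have ii := ltn_ord i; have ii' := ltn_ord i'; have jj := ltn_ord j; have jj' := ltn_ord j'.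
    rewrite /= in e1 e2.
    have c20 : c2 = 0%R by apply: (@mulz_small _ s); rewrite mulrC -e2; lia.
    have d0 : d = 0%R.
      apply: (@mulz_small _ (3 * s)); have -> : (d * Posz (3 * s) = Posz s * c1)%R by move: e3; rewrite c20 PoszM; nia.
      by rewrite -e1; lia.
    have c10 : c1 = 0%R by lia.
    by congr (_, _); apply: val_inj => /=; move: e1 e2; rewrite c10 c20 /=; lia.
  have -> : #|Q| = #|{: 'I_(3 * s) * 'I_s}|; last by rewrite card_prod !card_ord; nia.
  rewrite -(card_codom inj); apply/esym/eq_card => q; rewrite inE; apply/codomP.
  have [x' [y' ->]] := Tsurj q.
  pose q2 := (y' %/ Posz s)%Z; pose x2 := (x' - Posz s * q2)%R.
  have lx := ltz_pmod x2 (ltac:(lia) : (0 < Posz (3 * s))%R); have ly := ltz_pmod y' (ltac:(lia) : (0 < Posz s)%R).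
  have gx := modz_ge0 x2 (ltac:(lia) : Posz (3 * s) != 0); have gy := modz_ge0 y' (ltac:(lia) : Posz s != 0).
  have ix : `|(x2 %% Posz (3 * s))%Z|%N < 3 * s by lia.
  have iy : `|(y' %% Posz s)%Z|%N < s by lia.
  have ex : Posz `|(x2 %% Posz (3 * s))%Z|%N = (x2 %% Posz (3 * s))%Z by lia.
  have ey : Posz `|(y' %% Posz s)%Z|%N = (y' %% Posz s)%Z by lia.
  exists (Ordinal ix, Ordinal iy); change (T x' y' = T (Posz `|(x2 %% Posz (3 * s))%Z|%N) (Posz `|(y' %% Posz s)%Z|%N)); rewrite ex ey.
  apply/Tdiff.
  rewrite es in hr; have := LD (LM (x2 %/ Posz (3 * s))%Z hr) (LM q2 Lss); congr L.
    by have := divz_eq x2 (Posz (3 * s)); rewrite {1}/x2; lia.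
  by have := divz_eq y' (Posz s); rewrite -/q2; lia.
- move=> _; exfalso; apply: not_scalar => x' y' h.
  have [c1 [c2 [d [e1 e2 e3]]]] := Lform _ _ h.
  have h1 : L (Posz s * c1)%R (Posz s * c1)%R.
    have := LD h (LM d L0r); congr L; rewrite ?es ?PoszM; nia.
  have h33 : L (3 * Posz s)%R (3 * Posz s)%R.
    by have := LD hr L0r; rewrite es PoszM; congr L; lia.
  have hq := LB h1 (LM (c1 %/ 3)%Z h33).
  have d3 : (c1 %% 3)%Z = 0%R.
    have dq := divz_eq c1 3; have g3 := modz_ge0 c1 (isT : (3 : int) != 0); have l3 := ltz_pmod c1 (isT : (0 < (3 : int))%R).
    have [//|[h'|h']] : (c1 %% 3)%Z = 0%R \/ (c1 %% 3)%Z = 1%R \/ (c1 %% 3)%Z = 2%R by lia.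
      by exfalso; apply: nLss; move: hq; congr L; nia.
    exfalso; apply: nLss; have := LB h33 hq; congr L; nia.
  have dq := divz_eq c1 3; rewrite d3 in dq.
  have ec2 : c2 = (c1 - 3 * d)%R by lia.
  by split; [exists (c1 %/ 3)%Z|exists ((c1 %/ 3)%Z - d)%R]; rewrite es PoszM ?e1 ?e2 ?ec2; move: dq; move: (c1 %/ 3)%Z => t; clear; nia.
Qed.

(** Nonzero pairs with a = b modulo 3 have hexagonal norm at least 2. *)
Theorem T_small x y x' y' : T x y = T x' y' -> hn x y + hn x' y' < 2 * m -> x = x' /\ y = y'.
Proof.
move=> /Tdiff/L_class[a [b [ea eb [c ec]]]] h.
have h2 := leq_ltn_trans (hn_sub x y x' y') h.
have h3 : hn a b < 2 by move: h2; rewrite ea eb hnM mulnC ltn_pmul2r.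
have [q1 q2 q3] := hnP a b; move: q1 q2 q3 h3 ec ea eb; move: (hn a b); clear => n q1 q2 q3 h3 ec ea eb.
have a0 : a = 0%R by lia.
have b0 : b = 0%R by lia.
by subst a b; rewrite !mulr0 in ea eb; lia.
Qed.

End Lattice.

End HexLattice.

(** * Hexagonal coordinates around a pentagon *)

Definition pt := (int * int)%type.
(* A label is the position of a point of the hexagonal lattice in the frame of a dart; [zf] and [ze] change the frame from
   a dart to the next one of its face and to its reverse. *)
Definition zf (z : pt) : pt := ((z.1 + z.2)%R, (- z.1)%R).
Definition ze (z : pt) : pt := ((- z.1 - 1)%R, (- z.2)%R).
Definition hz (z : pt) : nat := hn z.1 z.2.

Ltac zlia := rewrite ?/hz ?/hn ?/ze ?/zf /=; lia.
Ltac zeq := rewrite /ze /zf /=; congr pair; lia.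

Lemma zf6 z : iter 6 zf z = z. Proof. by case: z => x y; zeq. Qed.
Lemma ze2 z : ze (ze z) = z. Proof. by case: z => x y; zeq. Qed.
Lemma zfe3 z : zf (ze (zf (ze (zf (ze z))))) = z. Proof. by case: z => x y; zeq. Qed.
Lemma zefe z : ze (zf (ze (zf z))) = iter 5 zf (ze z).
Proof. by case: z => x y; zeq. Qed.
Lemma hz_f z : hz (zf z) = hz z. Proof. by case: z => x y; zlia. Qed.
Lemma hz_iter j z : hz (iter j zf z) = hz z. Proof. by elim: j => //= j IH; rewrite hz_f. Qed.
Lemma hz0 z : hz z = 0 -> z = (0%R, 0%R).
Proof. by case: z => x y; rewrite /hz /hn /= => h; congr pair; lia. Qed.
Lemma hz_step z : hz (ze z) <= (hz z).+1 /\ hz z <= (hz (ze z)).+1.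
Proof. by case: z => x y; split; zlia. Qed.

(** The directions approaching the centre are adjacent, so two descents from one position can be
    compared across a single triangle. *)
Lemma lower_consecutive z j : j < 6 -> hz (ze z) < hz z -> hz (ze (iter j zf z)) < hz z -> [\/ j = 0, j = 1 | j = 5].
Proof.
case: z => x y; case: j => [|[|[|[|[|[|]]]]]] // _; rewrite /hz /hn /ze /zf /= => h1 h2;
by [apply: Or31|apply: Or32|apply: Or33|exfalso; lia].
Qed.

(** The two alternatives are the third corners of the triangles on either side of a sideways edge;
    one of them is nearer to the centre. *)
Lemma level_common z : 0 < hz z -> hz (ze z) = hz z ->
  (hz (ze (zf z)) < hz z) || (hz (ze (iter 5 zf z)) < hz z).
Proof. by case: z => x y; rewrite /hz /hn /ze /zf /=; lia. Qed.

Section Disc.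
Variable M : fmap.
Local Notation D := (dart M).
Variable p : face M.
Implicit Types (a b c : D) (z : pt).

Definition hexd a := iter 6 (@fnext M) a = a.

(* [p] lies at distance [n] from the face of [a], at position [z] in the frame of [a], along a path of descending distance *)
Fixpoint inC (n : nat) a z : Prop :=
  if n is n'.+1 then hz z = n /\ exists2 j, j < 6 &
    hz (ze (iter j zf z)) = n' /\ inC n' (rev (iter j (@fnext M) a)) (ze (iter j zf z))
  else fc a = p /\ z = (0%R, 0%R).

Lemma inC_hz n a z : inC n a z -> hz z = n.
Proof. by case: n => [|n] []; [move=> _ ->|]. Qed.

Lemma fprev_rev a : rev (fnext (rev (fnext a))) = fprev (rev a).
Proof. by rewrite /fnext revK /fprev /rot'. Qed.

Lemma hex_prev a : hexd a -> fprev a = iter 5 (@fnext M) a.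
Proof. by rewrite /hexd /= => h; rewrite -{1}h fnextK. Qed.

Lemma inC_up n a z : inC n a z -> hz (ze z) = n.+1 -> inC n.+1 (rev a) (ze z).
Proof. by move=> h e; split=> //; exists 0 => //=; rewrite revK ze2 (inC_hz h). Qed.

Variable m : nat.
Hypothesis hexm : forall n a z, 0 < n <= m -> inC n a z -> hexd a.

Lemma inC_f n a z : n <= m -> inC n a z -> inC n (fnext a) (zf z).
Proof.
case: n => [|n] nm h.
  by case: h => e ->; split; rewrite ?fc_next.
have hx := hexm (n := n.+1) nm h.
case: h => e [j j6 [h1 h2]]; split; first by rewrite hz_f.
case: j j6 h1 h2 => [|j] j6 h1 h2.
  exists 5 => //; rewrite -!iterSr; have -> : iter 6 (@fnext M) a = a by [].
  by rewrite zf6.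
by exists j; [exact: ltnW|rewrite -!iterSr].
Qed.

Lemma inC_fi j n a z : n <= m -> inC n a z -> inC n (iter j (@fnext M) a) (iter j zf z).
Proof. by move=> nm h; elim: j => //= j IH; apply: inC_f. Qed.

Lemma inC_fK n a z : n <= m -> inC n (fnext a) (zf z) -> inC n a z.
Proof.
case: n => [|n] nm h.
  by case: h; rewrite fc_next => e /(congr1 hz); rewrite hz_f => /hz0.
have hx := hexm (n := n.+1) nm h; have := inC_fi 5 nm h.
rewrite -hex_prev // fnextK; congr inC; rewrite -iterSr; exact: zf6.
Qed.

(** Labels do not depend on the descending path. Two descents from a position differ by a triangle
    whose far edge is sideways one level lower, where the induction applies; a sideways move is a
    descent, a turn and an ascent around the triangle of [level_common]. *)
Lemma inC_move n : n <= m ->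
  (forall a z, inC n a z -> hz (ze z) < n -> inC n.-1 (rev a) (ze z)) /\
  (forall a z, inC n a z -> hz (ze z) = n -> inC n (rev a) (ze z)).
Proof.
elim: n => [|n IH] nm.
  split=> // a z [_ ->]; by [].
have [_ IH2] := IH (ltnW nm).
have N1 a z : inC n.+1 a z -> hz (ze z) < n.+1 -> inC n (rev a) (ze z).
  move=> h lt; have hx := hexm (n := n.+1) nm h; have e := inC_hz h; case: (h) => _ [j j6 [h1 h2]].
  have hzz : hz (ze z) = n by have := hz_step z; move: lt; rewrite e; clear; lia.
  have := @lower_consecutive z j j6; rewrite e h1 => /(_ lt (ltnSn n)) [ej|ej|ej]; subst j => //.
  - have b1 := inC_f (ltnW nm) h2; rewrite /= in h1.
    have lv : hz (ze (zf (ze (iter 1 zf z)))) = n by rewrite /= zefe hz_iter.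
    have := IH2 _ _ b1 lv; rewrite /= fprev_rev zefe => b2.
    have := inC_f (ltnW nm) b2; rewrite fprevK; congr inC; exact: zf6.
  - set a5 := iter 5 (@fnext M) a in h2; have e5 : fnext a5 = a by [].
    have b0 : inC n (fprev (rev a5)) (iter 5 zf (ze (iter 5 zf z))).
      by apply: (inC_fK (ltnW nm)); rewrite fprevK -[zf _]/(iter 6 zf _) zf6.
    have lv : hz (ze (iter 5 zf (ze (iter 5 zf z)))) = n.
      by rewrite -[X in hz X]/(ze (iter 5 zf (ze (iter 5 zf z)))) -zefe -[zf (iter 5 zf z)]/(iter 6 zf z) zf6 ze2 hz_f.
    have := IH2 _ _ b0 lv; rewrite -fprev_rev revK e5 -zefe -[zf (iter 5 zf z)]/(iter 6 zf z) zf6 ze2.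
    exact: inC_fK (ltnW nm).
split=> // a z h e1; have e := inC_hz h.
have /orP[lt|lt] := level_common (z := z) ltac:(by rewrite e) ltac:(by rewrite e e1).
- have b0 := N1 _ _ (inC_f nm h) ltac:(by rewrite -e).
  have b1 := inC_f (ltnW nm) b0.
  have lv : hz (ze (zf (ze (zf z)))) = n.+1 by rewrite zefe hz_iter.
  have := inC_up b1 lv; rewrite fprev_rev zefe => b2.
  by have := inC_f nm b2; rewrite fprevK -[zf _]/(iter 6 zf _) zf6.
- have hx := hexm (n := n.+1) nm h.
  have b0 := N1 _ _ (inC_fi 5 nm h) ltac:(by rewrite -e).
  set a5 := iter 5 (@fnext M) a in b0; have e5 : fnext a5 = a by [].
  have b1 : inC n (fprev (rev a5)) (iter 5 zf (ze (iter 5 zf z))).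
    by apply: (inC_fK (ltnW nm)); rewrite fprevK -[zf _]/(iter 6 zf _) zf6.
  have ee : ze (iter 5 zf (ze (iter 5 zf z))) = zf (ze z).
    by rewrite -zefe -[zf (iter 5 zf z)]/(iter 6 zf z) zf6 ze2.
  have := inC_up b1; rewrite ee hz_f => /(_ e1); rewrite -fprev_rev revK e5.
  exact: inC_fK nm.
Qed.

Lemma inC_rev n a z : n <= m -> inC n a z -> hz (ze z) <= m -> inC (hz (ze z)) (rev a) (ze z).
Proof.
move=> nm h le; have [N1 N2] := inC_move nm; have [s1 s2] := hz_step z; rewrite (inC_hz h) in s1 s2.
have [lt|lt|e] := ltngtP (hz (ze z)) n.
- have -> : hz (ze z) = n.-1 by move: lt s2; clear; lia.
  exact: N1.
- have e : hz (ze z) = n.+1 by move: lt s1; clear; lia.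
  by rewrite e; apply: inC_up.
- by rewrite e; apply: N2.
Qed.

End Disc.

(* descend from [a] along a common path *)
Lemma inC_center (M : fmap) (p q : face M) m :
  (forall n a z, 0 < n <= m -> inC q n a z -> hexd a) ->
  forall n a z, n <= m -> inC p n a z -> inC q n a z -> p = q.
Proof.
move=> hq n; elim: n => [|n IH] a z nm h1 h2; first by case: h1 h2 => <- _ [<- _].
case: (h1) => e [j j6 [e1 h3]].
apply: IH (ltnW nm) h3 _.
have [N1 _] := inC_move hq nm; apply: N1; last by rewrite e1.
exact: (inC_fi hq).
Qed.

(** * Lower bound from icosahedral symmetry *)

Section MapBasics.
Variable M : fmap.
Local Notation D := (dart M).
Implicit Types (a b c d : D) (x : face M).

Lemma same_face_iter a b : fc a = fc b -> exists j, b = iter j (@fnext M) a.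
Proof. by move/eqP; rewrite fc_eq => h; exists (findex (@fnext M) a b); rewrite iter_findex. Qed.

Lemma fnext_inj : injective (@fnext M). Proof. exact: can_inj (@fnextK M). Qed.

Lemma order_fnext a : fingraph.order (@fnext M) a = #|[set b | fc b == fc a]|.
Proof. by apply: eq_card => b; rewrite [RHS]inE eq_sym fc_eq. Qed.

Lemma hexd_size a : ~~ pent (fc a) -> hexd a.
Proof.
move=> h; have := iter_order fnext_inj a; rewrite order_fnext.
by have /orP[e|/eqP->] := fc_size (fc a); [move: h; rewrite /pent e|].
Qed.

Lemma pent5 a : pent (fc a) -> iter 5 (@fnext M) a = a.
Proof. by move=> /eqP h; have := iter_order fnext_inj a; rewrite order_fnext h. Qed.

Lemma dart_ind (P : D -> Prop) d : P d -> (forall a, P a -> P (rev a)) -> (forall a, P a -> P (rot a)) -> forall a, P a.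
Proof.
move=> Pd Pe Pr; pose R := [rel a b : D | (b == rev a) || (b == rot a)].
have con a : connect R d a.
  pose S := [set v | [exists b, (vt b == v) && connect R d b]].
  have cr b : connect R d b -> connect R d (rot b).
    by move=> h; apply: connect_trans h (connect1 _); rewrite /= eqxx orbT.
  have ce b : connect R d b -> connect R d (rev b).
    by move=> h; apply: connect_trans h (connect1 _); rewrite /= eqxx.
  have inS b : (vt b \in S) -> connect R d b.
    by rewrite inE => /existsP[c /andP[]]; rewrite vt_eq => /or3P[] /eqP-> h; rewrite ?cr //.
  apply: (inS a); suff -> : S = setT by rewrite inE.
  apply: map_conn; first by apply/set0Pn; exists (vt d); rewrite inE; apply/existsP; exists d; rewrite eqxx connect0.
  by move=> b /inS/ce h; rewrite inE; apply/existsP; exists (rev b); rewrite eqxx.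
move=> a; have /connectP[q pq ->] := con a; elim: q d Pd pq {con} => //= b q IH d Pd /andP[/orP[]/eqP-> pq];
by apply: IH pq; first [exact: Pe | exact: Pr].
Qed.

Definition maut (g : D -> D) := (forall a, g (rot a) = rot (g a)) /\ (forall a, g (rev a) = rev (g a)).

Lemma maut_next g a : maut g -> g (fnext a) = fnext (g a).
Proof. by case=> h1 h2; rewrite /fnext h1 h2. Qed.

Lemma maut_eq g g' a : maut g -> maut g' -> g a = g' a -> g =1 g'.
Proof.
move=> [h1 h2] [h3 h4] e; apply: (@dart_ind _ a) => // b eb.
  by rewrite h2 h4 eb.
by rewrite h1 h3 eb.
Qed.

Lemma maut_inj g : maut g -> injective g.
Proof.
move=> [h1 h2]; have [d _] := dart_ex M.
have im b : b \in codom g.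
  apply: (@dart_ind (fun c => c \in codom g) (g d)); first exact: codom_f.
    by move=> a /codomP[c ->]; rewrite -h2 codom_f.
  by move=> a /codomP[c ->]; rewrite -h1 codom_f.
have /image_injP h : #|image g D| == #|D|.
  by apply/eqP/eq_card => b; rewrite im.
by move=> a b; apply: h.
Qed.

Lemma maut_comp g g' : maut g -> maut g' -> maut (g \o g').
Proof. by move=> [h1 h2] [h3 h4]; split=> a /=; rewrite ?h3 ?h4 ?h1 ?h2. Qed.

Lemma maut_inv g g' : maut g -> cancel g g' -> cancel g' g -> maut g'.
Proof.
move=> mg gK g'K; case: (mg) => h1 h2; split=> a; apply: (maut_inj mg);
by rewrite ?h1 ?h2 !g'K.
Qed.

Lemma fc_iter j a : fc (iter j (@fnext M) a) = fc a.
Proof. by elim: j => //= j; rewrite fc_next. Qed.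

Fixpoint ball (x : face M) (n : nat) : {set face M} :=
  if n is n'.+1 then ball x n' :|: [set y | [exists a : D, (fc a == y) && (fc (rev a) \in ball x n')]] else [set x].

(** The complement of any vertex cut is a join of the pentagons, and a join meets every odd cut. *)
Lemma odd_tight (S : {set vert M}) (X : {set face M}) : odd (nK X) ->
  exists a, [/\ a \in ~: vcut S, fc a \in X & fc (rev a) \notin X].
Proof.
move=> o; have jT : isj (@hs M) (@ht M) setT (tf M).
  apply/isjP=> -[x|y].
    rewrite (bd_inl (@fc M) (@ed M)) in_tf; have := @odd_card_big _ [set a | fc a == x].
    have /orP[e|e] := fc_size x; rewrite /pent (eqP e) /= => h.
      by rewrite [RHS]h; apply: eq_big => a; rewrite !inE.
    by rewrite [RHS]h; apply: eq_big => a; rewrite !inE.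
  have [a <-] := ed_surj y; rewrite (bd_inr (@fc M)) !inE /=.
  by apply/esym/negbTE/imsetP=> -[x _].
have jK : isj (@hs M) (@ht M) (~: vcut S) (tf M).
  have -> : ~: vcut S = symd setT (vcut S) by apply/setP=> a; rewrite in_symd in_setC in_setT; case: (_ \in _).
  by have := isj_symd jT (vcut_even S); rewrite symd0.
have := isj_cut (hull X) jK; rewrite card_tfI.
have -> : fpart (hull X) = X by apply/setP=> x; rewrite !inE.
rewrite o; case: (set_0Vmem [set g in ~: vcut S | cut (@hs M) (@ht M) (hull X) g]) => [->|[a]]; first by rewrite cards0.
rewrite in_set => /andP[aK]; rewrite /cut hull_inr inE /= => h _; exists a; split=> //.
  by case: (fc a \in X) h.
by rewrite fc_rev; case: (fc a \in X) h => //=; case: (_ \in X).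
Qed.

End MapBasics.

Section Ball.
Variables (M : fmap) (p : face M) (m : nat).
Hypothesis hexm : forall n a z, 0 < n <= m -> inC p n a z -> hexd a.

Lemma ball_mono n n' : n <= n' -> ball p n \subset ball p n'.
Proof.
elim: n' => [|n' IH]; first by rewrite leqn0 => /eqP->.
rewrite leq_eqVlt => /orP[/eqP->//|/IH h]; apply: (subset_trans h); exact: subsetUl.
Qed.

Lemma inC_ball n a z : inC p n a z -> fc a \in ball p n.
Proof.
elim: n a z => [|n IH] a z; first by case=> -> _; rewrite inE.
case=> _ [j _ [_ /IH h]]; rewrite in_setU in_set; apply/orP; right.
by apply/existsP; exists (iter j (@fnext M) a); rewrite h fc_iter eqxx.
Qed.

Lemma ball_inC i a : i <= m -> fc a \in ball p i -> exists2 z, hz z <= i & inC p (hz z) a z.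
Proof.
elim: i a => [|i IH] a im.
  rewrite inE => /eqP e; exists (0%R, 0%R) => //; by split.
rewrite in_setU in_set => /orP[/(IH _ (ltnW im))[z h1 h2]|/existsP[b /andP[/eqP eb /(IH _ (ltnW im))[z h1 h2]]]].
  by exists z => //; apply: leqW.
have [s1 _] := hz_step z.
have le : hz (ze z) <= i.+1 by exact: leq_trans s1 _.
have h3 := inC_rev hexm (leq_trans h1 (ltnW im)) h2 (leq_trans le im); rewrite revK in h3.
have [j ->] := same_face_iter eb; exists (iter j zf (ze z)); rewrite hz_iter //.
exact: inC_fi (leq_trans le im) h3.
Qed.

End Ball.

(** * The quotient of a symmetric map by its rotations *)

Section Symmetric.
Variables (M : fmap) (k : nat).
Local Notation D := (dart M).
Hypothesis k0 : 0 < k.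
Hypothesis cardV : #|vert M| = 60 * k ^ 2.
Variable d0 : D.
Hypothesis pd0 : pent (fc d0).
Hypothesis H1 : forall d, pent (fc d) -> exists2 g, maut g & g d0 = d.
Hypothesis H2 : exists kap : D -> D, [/\ forall a, kap (rev a) = rev (kap a), forall a, kap (fnext a) = fprev (kap a) & kap d0 = d0].
Implicit Types (a b c d : D).

(** Lying in one orbit of the rotations; finite functions make the existence boolean, as the choice
    of representatives requires. *)
Definition sim a b := [exists g : {ffun D -> D},
  [forall c, (g (rot c) == rot (g c)) && (g (rev c) == rev (g c))] && (g a == b)].

Lemma simP a b : reflect (exists2 g, maut g & g a = b) (sim a b).
Proof.
apply: (iffP existsP) => [[g /andP[/forallP h /eqP e]]|[g [h1 h2] e]].
  by exists g => //; split=> c; have /andP[/eqP h1 /eqP h2] := h c.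
by exists [ffun c => g c]; rewrite ffunE e eqxx andbT; apply/forallP=> c; rewrite !ffunE h1 h2 !eqxx.
Qed.

Lemma sim_refl a : sim a a. Proof. by apply/simP; exists id. Qed.
Lemma sim_trans : transitive sim.
Proof. by move=> b a c /simP[g mg <-] /simP[g' mg' <-]; apply/simP; exists (g' \o g) => //; apply: maut_comp. Qed.
Lemma sim_symW a b : sim a b -> sim b a.
Proof.
case/simP=> g mg e; have [g' gK g'K] := injF_bij (maut_inj mg).
by apply/simP; exists g'; [exact: maut_inv mg gK g'K|rewrite -e gK].
Qed.
Lemma sim_eq a b : sim a b -> sim a =1 sim b.
Proof. by move=> h c; apply/idP/idP; apply: sim_trans; [exact: sim_symW|]. Qed.

Definition repr a := odflt a [pick b | sim a b].

Lemma sim_repr a : sim a (repr a).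
Proof. by rewrite /repr; case: pickP => [b|/(_ a)] //; rewrite sim_refl. Qed.

Lemma repr_eq a b : sim a b -> repr a = repr b.
Proof.
move=> h; rewrite /repr (eq_pick (sim_eq h)); case: pickP => // /(_ b); by rewrite sim_refl.
Qed.

Definition Qt := {a : D | repr a == a}.
Lemma pi_subproof a : repr (repr a) == repr a.
Proof. by apply/eqP/esym/repr_eq/sim_repr. Qed.
Definition pi a : Qt := exist _ (repr a) (pi_subproof a).

Lemma piP a b : pi a = pi b <-> sim a b.
Proof.
split=> [/(congr1 val) /= e|h]; last by apply: val_inj; apply: repr_eq.
by apply: sim_trans (sim_repr a) _; rewrite e; apply/sim_symW/sim_repr.
Qed.

Lemma pi_val q : pi (val q) = q.
Proof. by apply: val_inj; rewrite /=; apply/eqP/(valP q). Qed.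

Definition eQ (q : Qt) := pi (rev (val q)).
Definition fQ (q : Qt) := pi (fnext (val q)).

Lemma eQ_pi a : eQ (pi a) = pi (rev a).
Proof.
apply/piP; have /simP[g mg e] := sim_symW (sim_repr a).
by apply/simP; exists g => //; case: (mg) => _ h; rewrite h /= e.
Qed.

Lemma fQ_pi a : fQ (pi a) = pi (fnext a).
Proof.
apply/piP; have /simP[g mg e] := sim_symW (sim_repr a).
by apply/simP; exists g => //; rewrite (maut_next _ mg) /= e.
Qed.

Lemma sim_pent d d' : pent (fc d) -> pent (fc d') -> sim d d'.
Proof.
move=> /H1[g mg <-] /H1[g' mg' <-].
by apply: (@sim_trans d0); [apply: sim_symW|]; apply/simP; [exists g|exists g'].
Qed.

Lemma eQK q : eQ (eQ q) = q. Proof. by rewrite -(pi_val q) !eQ_pi revK. Qed.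

(** At a pentagon a turn by one dart lies in the same orbit, so [fQ] fixes its class and six turns
    are the identity there too. *)
Lemma fQ6 q : fQ (fQ (fQ (fQ (fQ (fQ q))))) = q.
Proof.
rewrite -(pi_val q) !fQ_pi; have [h|/hexd_size h] := boolP (pent (fc (val q))); last by congr pi; exact: h.
by apply/piP; apply: sim_pent => //; rewrite !fc_next.
Qed.

Lemma fQe3 q : fQ (eQ (fQ (eQ (fQ (eQ q))))) = q.
Proof.
have h a : fQ (eQ (pi a)) = pi (rot a) by rewrite eQ_pi fQ_pi /fnext revK.
by rewrite -(pi_val q) (h (val q)) (h (rot _)) (h (rot (rot _))) rot3.
Qed.

Lemma fQo : fQ (pi d0) = pi d0.
Proof. by rewrite fQ_pi; apply/piP; apply: sim_pent; rewrite ?fc_next. Qed.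

Lemma pi_fprev a : pi (fprev a) = fQ (fQ (fQ (fQ (fQ (pi a))))).
Proof. by rewrite -{2}(fprevK a) -[pi (fnext _)]fQ_pi fQ6. Qed.

(** Conjugation by the reflection carries rotations to rotations, so it descends to the quotient. *)
Lemma kap_ex : exists kQ : Qt -> Qt, [/\ kQ (pi d0) = pi d0,
  (forall q, kQ (fQ q) = fQ (fQ (fQ (fQ (fQ (kQ q)))))) & forall q, kQ (eQ q) = eQ (kQ q)].
Proof.
have [kap [kr kf kd]] := H2; exists (fun q => pi (kap (val q))).
have kp a : kap (fprev a) = fnext (kap a) by rewrite -{2}(fprevK a) kf fprevK.
have krot a : kap (rot a) = rev (rot' (rev (kap a))).
  by rewrite -{1}(revK a) -[rot _]/(fnext _) kf kr.
have kinj : injective kap.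
  have h2 : maut (kap \o kap) .
    split=> a /=; last by rewrite !kr.
    have k2 c : kap (rot' c) = rev (rot (rev (kap c))) by rewrite /rot' krot krot revK /rot' rot3.
    by rewrite krot kr k2 kr !revK.
  by move=> a b e; apply: (maut_inj h2); rewrite /= e.
have [kap' kK kK'] := injF_bij kinj.
have ksim a b : sim a b -> sim (kap a) (kap b).
  case/simP=> g mg e; apply/simP; exists (kap \o g \o kap'); last by rewrite /= kK e.
  case: (mg) => g1 g2.
  have k'r a' : kap' (rev a') = rev (kap' a') by apply: kinj; rewrite kr !kK'.
  have k'f a' : kap' (fnext a') = fprev (kap' a') by apply: kinj; rewrite kp !kK'.
  have gp a' : g (fprev a') = fprev (g a') by rewrite -{2}(fprevK a') (maut_next _ mg) fnextK.
  split=> a' /=; last by rewrite k'r g2 kr.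
  by rewrite -{1}(revK a') -[rot _]/(fnext _) k'f gp kp k'r g2 kr /fnext revK.
have kQpi a : pi (kap (val (pi a))) = pi (kap a) by apply/piP/ksim/sim_symW/sim_repr.
split=> [|q|q].
- by rewrite kQpi kd.
- by rewrite -(pi_val q) fQ_pi !kQpi kf pi_fprev.
- by rewrite -(pi_val q) eQ_pi !kQpi kr eQ_pi.
Qed.

Lemma transQ (P : Qt -> Prop) : P (pi d0) -> (forall q, P q -> P (eQ q)) -> (forall q, P q -> P (fQ q)) -> forall q, P q.
Proof.
move=> P0 Pe Pf q; rewrite -(pi_val q); move: (val q); apply: (@dart_ind _ _ d0) => // a h.
  by rewrite -eQ_pi; apply: Pe.
by rewrite -(revK a) -[rot _]/(fnext _) -fQ_pi -eQ_pi; apply/Pf/Pe.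
Qed.

Lemma card_pent_darts : #|[set d : D | pent (fc d)]| = 60.
Proof.
rewrite (@card_fibers _ _ (@fc M) (@pent M) 5) => [|x /eqP//].
by rewrite -/(pents M) card_pents.
Qed.

(** A rotation is determined by the image of one dart, so each orbit is in bijection with the 60
    pentagon darts, the orbit of [d0]. *)
Lemma card_class q : #|[set a | pi a == q]| = 60.
Proof.
rewrite -card_pent_darts.
have ex (d : D) : exists g : {ffun D -> D}, pent (fc d) -> maut g /\ g d0 = d.
  have [h|h] := boolP (pent (fc d)); last by exists [ffun a => a].
  have [g [h1 h2] e] := H1 h; exists [ffun a => g a] => _; rewrite ffunE; split=> //.
  by split=> a; rewrite !ffunE.
have [G hG] := fin_all_exists ex; pose a0 := val q.
have inj : {in [set d : D | pent (fc d)] &, injective (fun d => G d a0)}.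
  move=> d d'; rewrite !inE => /hG[m1 e1] /hG[m2 e2] e.
  by rewrite -e1 -e2; apply: (maut_eq m1 m2 e).
rewrite -(card_in_imset inj); apply: eq_card => a; rewrite inE; apply/eqP/imsetP=> [e|[d]].
  have /piP/simP[g mg ea] : pi a0 = pi a by rewrite e pi_val.
  have pg : pent (fc (g d0)).
    have := @card_imset _ _ g [set b | fc b == fc d0] (maut_inj mg); rewrite (eqP pd0) => e5.
    apply/eqP/eqP; have /orP[//|e6] := fc_size (fc (g d0)).
    have h6 : hexd (g d0) by apply: hexd_size; rewrite /pent (eqP e6).
    have h5 : iter 5 (@fnext M) (g d0) = g d0.
      by rewrite -[RHS](congr1 g (pent5 pd0)) /= !(maut_next _ mg).
    move: h6; rewrite /hexd iterS h5 => h1; have := fnext_neq (g d0); by rewrite h1 eqxx.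
  exists (g d0); first by rewrite inE.
  have [m1 e1] := hG _ pg; rewrite -ea; apply: (@maut_eq _ _ _ d0 mg m1); by rewrite e1.
rewrite inE => /hG[m1 e1] ->; rewrite -(pi_val q); apply/piP/sim_symW/simP; by exists (G d).
Qed.

Lemma cardQ : #|{: Qt}| = 3 * k ^ 2.
Proof.
have := @card_fibers _ _ pi predT 60 (fun q _ => card_class q); rewrite !cardsE.
have -> : #|[pred x : D | predT (pi x)]| = #|D| by apply: eq_card.
have -> : #|[pred x : Qt | predT x]| = #|{: Qt}| by apply: eq_card.
rewrite card_dartV cardV; move: #|{: Qt}|; clear; lia.
Qed.

Definition Tz (z : pt) := HexLattice.T eQ fQ (pi d0) z.1 z.2.

Lemma Tz_f z : fQ (Tz z) = Tz (zf z). Proof. exact: (HexLattice.fT eQK fQ6 fQe3 fQo k0 cardQ). Qed.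
Lemma Tz_e z : eQ (Tz z) = Tz (ze z). Proof. exact: (HexLattice.eT eQK fQ6 fQe3 fQo k0 cardQ). Qed.
Lemma Tz_small z z' : Tz z = Tz z' -> hz z + hz z' < 2 * k -> z = z'.
Proof.
have [kQ [h1 h2 h3]] := kap_ex.
move=> e lt; have [] := HexLattice.T_small eQK fQ6 fQe3 fQo h1 h2 h3 transQ k0 cardQ e lt.
by case: z z' {e lt} => x y [x' y'] /= -> ->.
Qed.

Lemma fQ_inj : injective fQ.
Proof. by move=> q q' /(congr1 (fun q => fQ (fQ (fQ (fQ (fQ q)))))); rewrite !fQ6. Qed.

(** Labels and orbits change by the same moves and start from the same value at the pentagon. *)
Lemma inC_Tz (p : face M) n a z : pent p -> inC p n a z -> pi a = Tz z.
Proof.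
move=> pp; elim: n a z => [|n IH] a z.
  by case=> e ->; apply/piP; apply: sim_pent => //; rewrite e.
case=> _ [j _ [_ /IH]]; rewrite -Tz_e -eQ_pi => /(can_inj eQK).
elim: j a z => //= j IHj a z; rewrite -fQ_pi -Tz_f => /fQ_inj; exact: IHj.
Qed.

(** A pentagon dart has the class of the origin, which [Tz_small] excludes at a positive distance
    below k. *)
Lemma hexk (p : face M) : pent p -> forall n a z, 0 < n <= k.-1 -> inC p n a z -> hexd a.
Proof.
move=> pp n a z /andP[n0 nk] h; apply: hexd_size; apply/negP=> pa.
have e0 : Tz z = Tz (0%R, 0%R).
  by rewrite -(inC_Tz pp h); apply/piP; apply: sim_pent.
have ez := inC_hz h.
have := Tz_small e0; rewrite ez /= addn0 => h0.
have hz00 : hz (0%R, 0%R) = 0 by [].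
have z0 : z = (0%R, 0%R) by apply: h0; rewrite ?addn0; move: nk k0; clear; lia.
by move: n0; rewrite -ez z0.
Qed.

Lemma ball_pent (p : face M) i : pent p -> i < k -> nK (ball p i) = 1.
Proof.
move=> pp ik; have ik' : i <= k.-1 by move: ik; clear; lia.
rewrite /nK; suff -> : ball p i :&: pents M = [set p] by rewrite cards1.
apply/setP=> x; rewrite in_setI [x \in pents M]inE [RHS]inE.
apply/andP/eqP=> [[h px]|->]; last by split=> //; apply: (subsetP (ball_mono p (leq0n i))); rewrite inE.
have [a ea] := fc_surj x; rewrite -ea in h px *.
have [z lez hC] := ball_inC (hexk pp) ik' h.
have [z0|n0] := posnP (hz z); first by move: hC; rewrite z0 => -[].
have e0 : Tz z = Tz (0%R, 0%R) by rewrite -(inC_Tz pp hC); apply/piP; apply: sim_pent.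
have hz00 : hz (0%R, 0%R) = 0 by [].
by have := Tz_small e0; rewrite hz00 addn0 => h0; move: n0; rewrite h0 ?hz00 //; move: lez ik; clear; lia.
Qed.

(** Each of the 12 k balls of radius below k holds one pentagon, so outside the cut there is a dart
    leaving it; with the reverses this makes 24 k darts. They are distinct: the class of a dart
    determines its label, hence the radius and the direction, and a dart with its label determines
    the centre. *)
Theorem symmetric_lower_bound (S : {set vert M}) : 24 * k <= #|~: vcut S|.
Proof.
pose Ix := (face M * 'I_k * bool)%type.
pose P (t : Ix) (c : D) := pent t.1.1 -> [/\ c \in ~: vcut S, fc c \in ball t.1.1 t.1.2 & fc (rev c) \notin ball t.1.1 t.1.2].
have ex t : exists c, P t c.
  have [pp|np] := boolP (pent t.1.1); last by exists d0; rewrite /P (negbTE np).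
  have [|c h] := @odd_tight M S (ball t.1.1 t.1.2); first by rewrite ball_pent.
  by exists c => _.
have [h hP] := fin_all_exists ex.
pose g (t : Ix) := if t.2 then rev (h t) else h t.
pose Ts : {set Ix} := [set t | pent t.1.1].
have key (t : Ix) : pent t.1.1 -> exists z, [/\ hz z = t.1.2, inC t.1.1 t.1.2 (h t) z & hz (ze z) = t.1.2.+1].
  move=> pp; have [_ h1 h2] := hP t pp; have ik := ltn_ord t.1.2.
  have ik' : t.1.2 <= k.-1 by move: ik; clear; lia.
  have [z lz hC] := ball_inC (hexk pp) ik' h1; have [s1 s2] := hz_step z.
  have lt : t.1.2 < hz (ze z).
    rewrite ltnNge; apply: contra h2 => le.
    have hr := inC_rev (hexk pp) (leq_trans lz ik') hC (leq_trans le ik').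
    exact: (subsetP (ball_mono _ le)) (inC_ball hr).
  have ez : hz z = t.1.2 by move: s1 lz lt; clear; lia.
  by exists z; rewrite -{2}ez; split=> //; move: s1 lt; rewrite ez; clear; lia.
have inj : {in Ts &, injective g}.
  move=> [[p i] s] [[p' i'] s']; rewrite !inE /= => pp pp'.
  have [z [/= ez hC ezz]] := key (p, i, s) pp; have [z' [/= ez' hC' ezz']] := key (p', i', s') pp'.
  have t1 := inC_Tz pp hC; have t2 := inC_Tz pp' hC'.
  have ik := ltn_ord i; have ik' := ltn_ord i'.
  (* An outgoing dart against a reversed one: the norms are at most k - 1 and k, so their sum is
     still below 2 k. *)
  have diff (w w' : pt) (j j' : nat) : hz w = j -> hz (ze w) = j.+1 -> hz w' = j' -> hz (ze w') = j'.+1 -> j < k -> j' < k ->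
      Tz w' = Tz (ze w) -> False.
    move=> e1 e2 e3 e4 l1 l2 eT0; have := Tz_small eT0; rewrite e3 e2 => /(_ ltac:(move: l1 l2; clear; lia)) ew.
    by move: e4 e3; rewrite ew ze2 e1 e2; clear; lia.
  rewrite /g /=; case: s s' hC t1 hC' t2 {key} => -[] hC t1 hC' t2 e.
  - have eh := can_inj (@revK M) e; have ezz0 : z = z'.
      by apply: Tz_small; [rewrite -t1 -t2 eh|rewrite ez ez'; move: ik ik'; clear; lia].
    have ei : i = i' by apply: val_inj; rewrite /= -ez -ez' ezz0.
    subst i' z'; rewrite eh in hC; congr (_, _, _).
    by apply: (inC_center (hexk pp') _ hC hC'); move: ik; clear; lia.
  - exfalso; apply: (diff z z' i i') => //; by rewrite -t2 -e -Tz_e -t1 eQ_pi.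
  - exfalso; apply: (diff z' z i' i) => //; by rewrite -t1 e -Tz_e -t2 eQ_pi.
  - have ezz0 : z = z'.
      by apply: Tz_small; [rewrite -t1 -t2 e|rewrite ez ez'; move: ik ik'; clear; lia].
    have ei : i = i' by apply: val_inj; rewrite /= -ez -ez' ezz0.
    subst i' z'; rewrite e in hC; congr (_, _, _).
    by apply: (inC_center (hexk pp') _ hC hC'); move: ik; clear; lia.
have <- : #|g @: Ts| = 24 * k.
  rewrite card_in_imset //.
  have -> : #|Ts| = #|setX (setX (pents M) [set: 'I_k]) [set: bool]|.
    by apply: eq_card => -[[x i] s]; rewrite !inE /= !andbT.
  by rewrite !cardsX card_pents !cardsT card_ord card_bool; lia.
apply: subset_leq_card; apply/subsetP=> _ /imsetP[t tT ->]; rewrite inE in tT.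
have [h1 _ _] := hP t tT; rewrite /g; case: t.2 => //.
by move: h1; rewrite !in_setC !inE revK addbC.
Qed.

End Symmetric.

(** * Discs around the pentagons of an extremal map *)

Lemma hzE x y n : hz (x, y) = n <-> ((- Posz n <= x <= Posz n)%R /\ (- Posz n <= y <= Posz n)%R /\ (- Posz n <= x + y <= Posz n)%R /\
  (x = Posz n \/ x = (- Posz n)%R \/ y = Posz n \/ y = (- Posz n)%R \/ (x + y)%R = Posz n \/ (x + y)%R = (- Posz n)%R)).
Proof. by rewrite /hz /hn /=; split; lia. Qed.

Lemma hz_side x y n : hz (x, y) = n -> exists t : nat, t <= n /\ [\/ (x, y) = (Posz n, - Posz t)%R, (x, y) = (- Posz n, Posz t)%R, (x, y) = (- Posz t, Posz n)%R |
   [\/ (x, y) = (Posz t, - Posz n)%R, (x, y) = (Posz t, Posz n - Posz t)%R | (x, y) = (- Posz t, Posz t - Posz n)%R]].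
Proof.
move/hzE=> [h1 [h2 [h3 [h|[h|[h|[h|[h|h]]]]]]]].
- by exists `|y|%N; split; [lia|apply: Or41; congr pair; lia].
- by exists `|y|%N; split; [lia|apply: Or42; congr pair; lia].
- by exists `|x|%N; split; [lia|apply: Or43; congr pair; lia].
- by exists `|x|%N; split; [lia|apply: Or44; apply: Or31; congr pair; lia].
- by exists `|x|%N; split; [lia|apply: Or44; apply: Or32; congr pair; lia].
- by exists `|x|%N; split; [lia|apply: Or44; apply: Or33; congr pair; lia].
Qed.

Ltac hzl := rewrite /ze /zf /=; apply/hzE; lia.

Lemma ring_up z : exists2 i, i < 6 & hz (ze (iter i zf z)) = (hz z).+1.
Proof.
case: z => x y; move e : (hz (x, y)) => n.
have [t [tn [ez|ez|ez|[ez|ez|ez]]]] := hz_side e; rewrite ez;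
first [by exists 0 => //; hzl | by exists 1 => //; hzl | by exists 2 => //; hzl | by exists 3 => //; hzl | by exists 4 => //; hzl | by exists 5 => //; hzl].
Qed.

Ltac ringp i j := exists i, j; split=> //; split; hzl.

(** Turning from an outward direction one meets a sideways one, then the inward ones, then the other
    sideways one. [i1] is the first sideways direction and [i2] the last inward one. *)
Lemma ring_pattern z : 0 < hz z -> hz (ze z) = (hz z).+1 -> exists i1 i2, [/\ 0 < i1, i1 < i2, i2 < 5 &
  [/\ hz (ze (iter i1 zf z)) = hz z, hz (ze (iter i2 zf z)) = (hz z).-1 & hz (ze (iter i2.+1 zf z)) = hz z]].
Proof.
case: z => x y; move e : (hz (x, y)) => n n0.
have [t [tn hs]] := hz_side e.
have [t0|[t0|t0]] : t = 0 \/ t = n \/ 0 < t < n by lia.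
all: case: hs => [ez|ez|ez|[ez|ez|ez]]; rewrite ez => e1; clear e ez; (try subst t).
all: try (exfalso; move: e1; rewrite /ze /zf /= => /hzE e1; lia).
all: first [ringp 1 2 | ringp 2 3 | ringp 3 4 | ringp 1 3 | ringp 2 4].
Qed.

(** * Labels measure distances in an extremal disc *)

Section DiscLabels.
Variables (M : fmap) (k : nat) (p : face M) (Y : nat -> {set face M}).
Local Notation D := (dart M).
Hypothesis pp : pent p.
Hypothesis dY : disc k p Y.
Implicit Types (a b c : D) (z : pt) (x : face M).

Lemma Y_p j : j < k -> p \in Y j. Proof. by move=> /(dY.1)[]. Qed.

Lemma Y_tri j a : j.+1 < k -> meets (Y j) a = [&& fc a \in Y j.+1, fc (rot a) \in Y j.+1 & fc (rot' a) \in Y j.+1].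
Proof. by move=> jk; have [_ h] := dY; exact: h. Qed.

Lemma Y_nb j a : j.+1 < k -> fc a \in Y j -> fc a \in Y j.+1 /\ fc (rev a) \in Y j.+1.
Proof.
move=> jk h; have := Y_tri a jk; rewrite /meets h fc_rev /= => /esym/and3P[-> -> _]; by split.
Qed.

Lemma Y_sub j : j.+1 < k -> Y j \subset Y j.+1.
Proof. by move=> jk; apply/subsetP=> x; have [a <-] := fc_surj x => /(Y_nb jk)[]. Qed.

Lemma Y_mono i j : i <= j -> j < k -> Y i \subset Y j.
Proof.
elim: j => [|j IH]; first by rewrite leqn0 => /eqP->.
rewrite leq_eqVlt => /orP[/eqP->//|h] jk; exact: subset_trans (IH h (ltnW jk)) (Y_sub jk).
Qed.

Lemma Y_chi j : j < k -> #|Y j| + nT (Y j) = nE (Y j) + 1.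
Proof.
move=> jk; have [h1 _ _ _ [h2 h3 h4]] := dY.1 j jk.
have Y0 : Y j != set0 by apply/set0Pn; exists p.
by apply/eqP; rewrite eqn_leq chi_le1 // chi_ge1.
Qed.

Lemma Y_card j : j < k -> 2 * #|Y j| = 5 * j ^ 2 + 5 * j + 2.
Proof.
move=> jk; have [_ _ h1 h2 _] := dY.1 j jk; have := Y_chi jk; have := nE_eq (Y j).
by rewrite h1 h2; clear; lia.
Qed.

Lemma Y_nA j : j < k -> nA (Y j) = 5 * j + 5.
Proof.
move=> jk; have [_ hk h1 h2 _] := dY.1 j jk; have := nAB_chi (Y j); have := Y_chi jk.
by rewrite hk h1 h2; clear; lia.
Qed.

Lemma Y0E : 0 < k -> Y 0 = [set p].
Proof.
move=> k0; have h1 : #|Y 0| = 1 by have := Y_card k0; clear; lia.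
by apply/esym/eqP; rewrite eqEcard sub1set Y_p // h1 cards1.
Qed.

Lemma Y_pent j x : j < k -> x \in Y j -> pent x -> x = p.
Proof.
move=> jk xY px; have [h1 hk _ _ _] := dY.1 j jk.
have /cards1P[w ew] : #|Y j :&: pents M| == 1 by rewrite -/(nK _) hk.
have : x \in Y j :&: pents M by rewrite in_setI xY inE.
have : p \in Y j :&: pents M by rewrite in_setI h1 inE.
by rewrite ew => /set1P-> /set1P->.
Qed.

Lemma fc_rot'_prev a : fc (rot' a) = fc (rev (fprev a)).
Proof. by rewrite /fprev revK. Qed.

Lemma fc_prev a : fc (fprev a) = fc a.
Proof. by rewrite -{2}(fprevK a) fc_next. Qed.

(** A triangle inside [Y j.+1] meets [Y j], so a face without neighbours in [Y j] lies in no such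
    triangle. Deleting it keeps [nT] and lowers [nB] by at least 2, against the isoperimetric
    inequality, which is sharp for [Y j.+1]. *)
Lemma no_pendant j x : j.+1 < k -> x \in Y j.+1 -> x \notin Y j -> exists2 a, fc a = x & fc (rev a) \in Y j.
Proof.
move=> jk x1 x0.
have [/existsP[a /andP[/eqP ea h]]|/existsPn no] := boolP [exists a : D, (fc a == x) && (fc (rev a) \in Y j)]; first by exists a.
have no' a : fc a = x -> fc (rev a) \notin Y j by move=> ea; have := no a; rewrite ea eqxx.
have notri a : fc a = x -> ~~ ((fc (rot a) \in Y j.+1) && (fc (rot' a) \in Y j.+1)).
  move=> ea; apply/negP=> h; have := Y_tri a jk; rewrite ea x1 h /meets ea (negbTE x0) -fc_rev (negbTE (no' a ea)) /=.
  by rewrite fc_rot'_prev (negbTE (no' _ _)) // fc_prev.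
have [py hk eT eB [c1 c2 nT1]] := dY.1 _ jk.
have xp : x != p by apply: contraNneq x0 => ->; apply: Y_p; exact: ltnW.
have [b [b1 b2 b3]] : exists a, [/\ fc a \in [set x], fc (rev a) \in Y j.+1 & fc (rev a) \notin [set x]].
  apply: c1; first by rewrite sub1set.
    by apply/set0Pn; exists x; rewrite inE.
  by apply/eqP=> /setP/(_ p); rewrite !inE py eq_sym (negbTE xp).
move: b1; rewrite inE => /eqP eb.
have br : fc (rot b) \in Y j.+1 by rewrite -fc_rev.
have bn : fc (rot' b) \notin Y j.+1 by have := notri b eb; rewrite br.
pose Y' := Y j.+1 :\ x.
have inY' y : (y \in Y') = (y != x) && (y \in Y j.+1) by rewrite in_setD1.
have eT' : nT Y' = nT (Y j.+1).
  suff : 3 * nT Y' = 3 * nT (Y j.+1) by clear; lia.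
  rewrite -!nT3; apply: eq_card => a.
  transitivity ([&& fc a \in Y', fc (rot a) \in Y' & fc (rot' a) \in Y']); first by rewrite in_set.
  transitivity ([&& fc a \in Y j.+1, fc (rot a) \in Y j.+1 & fc (rot' a) \in Y j.+1]); last by rewrite in_set.
  rewrite !inY'; have [ea|na] := eqVneq (fc a) x.
    by rewrite /= ea x1 /=; apply/esym/negbTE; apply: notri.
  have [er|nr] := eqVneq (fc (rot a)) x.
    rewrite /= andbF /= er x1 /=; apply/esym/negbTE; rewrite andbC; have := notri _ er.
    by rewrite /rot' rot3.
  have [er|nr'] := eqVneq (fc (rot' a)) x; rewrite //= ?andbF //.
  apply/esym/negbTE; have := notri _ er; rewrite /rot' !rot3; apply: contra => /and3P[-> -> _]; by [].
(* Both triangles on the edge of [b] have their third corner outside, so they count in [nB] and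
   disappear with [x]. *)
have eB' : nB Y' + 2 <= nB (Y j.+1).
  pose Bs (X : {set face M}) := [set a | [&& fc a \in X, fc (rot a) \in X & fc (rot' a) \notin X]].
  have sub : Bs Y' \subset Bs (Y j.+1) :\: [set b; rev b].
    apply/subsetP=> a; rewrite in_set !inY' => /and3P[/andP[n1 y1] /andP[n2 y2] h3].
    rewrite in_setD [a \in Bs _]in_set y1 y2 /=; apply/andP; split.
      rewrite !inE; apply/norP; split; apply/eqP=> ea; first by move: n1; rewrite ea eb eqxx.
      by move: n2; rewrite ea -[rot (rev b)]/(fnext b) fc_next eb eqxx.
    apply: contra h3 => h3; rewrite h3 andbT; apply/eqP=> er.
    by have := notri _ er; rewrite /rot' !rot3 y1 y2.
  have sub2 : [set b; rev b] \subset Bs (Y j.+1).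
    apply/subsetP=> a; rewrite in_set2 => /orP[] /eqP->; rewrite in_set.
      by rewrite eb x1 br bn.
    rewrite b2 -[rot (rev b)]/(fnext b) fc_next eb x1 /=.
    have eq1 : fc (rot' (rev b)) = fc (rot (fnext b)) by [].
    rewrite eq1; have := notri (fnext b); rewrite fc_next => /(_ eb); rewrite negb_and => /orP[//|].
    have -> : rot' (fnext b) = rev b by rewrite /rot' /fnext rot3.
    by rewrite b2.
  have := subset_leq_card sub; rewrite cardsD (setIidPr sub2) cards2 eq_sym rev_neq -/(nB Y') -/(nB (Y j.+1)).
  have := subset_leq_card sub2; rewrite cards2 eq_sym rev_neq -/(nB (Y j.+1)); clear; lia.
have c2' : fcset (~: Y').
  apply: (fcset_grow c2); first by apply: contra nT1 => /eqP e; rewrite -(setCK (Y j.+1)) e setC0.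
    by rewrite setCS subsetDl.
  move=> y; rewrite !in_setC inY' negb_and !negbK => /orP[/eqP-> _|/negbTE->//].
  by exists (fprev b); rewrite ?fc_prev // in_setC -fc_rot'_prev.
have hk' : nK Y' <= 1 by rewrite -hk; apply: nK_sub; exact: subsetDl.
have nT' : Y' != setT by apply/eqP=> /setP/(_ x); rewrite inY' eqxx inE.
have := isoperimetry c2' nT' (leq_trans hk' (isT : 1 <= 5)).
move: eB'; rewrite eT' eT eB => eB' iso; exfalso.
have : 5 * (5 * j.+1 ^ 2) <= nB Y' ^ 2.
  apply: leq_trans iso; apply: leq_trans (leq_addr _ _); rewrite leq_mul2r; apply/orP; right.
  by move: hk'; clear; lia.
have : nB Y' ^ 2 <= (5 * j.+1 - 2) ^ 2 by rewrite leq_exp2r //; move: eB'; clear; lia.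
by move=> h1 h2; have := leq_trans h2 h1; clear; nia.
Qed.

Lemma ball_Y j : j < k -> ball p j = Y j.
Proof.
elim: j => [|j IH] jk; first by rewrite Y0E.
rewrite /= IH; last exact: ltnW.
apply/setP=> x; rewrite in_setU in_set; apply/orP/idP=> [[h|/existsP[a /andP[/eqP<- h]]]|h].
- exact: subsetP (Y_sub jk) _ h.
- by have [_] := Y_nb jk h; rewrite revK.
- have [h0|h0] := boolP (x \in Y j); [by left|right].
  by have [a ea ra] := no_pendant jk h h0; apply/existsP; exists a; rewrite ea eqxx.
Qed.

Section Sphere.
Variable j : nat.
Hypothesis jk : j.+1 < k.
Let Sj := Y j.+1 :\: Y j.
Let jk' : j < k := ltnW jk.

Lemma in_S x : (x \in Sj) = (x \notin Y j) && (x \in Y j.+1).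
Proof. exact: in_setD. Qed.

Lemma card_S : #|Sj| = 5 * j.+1.
Proof.
rewrite cardsD (setIidPr (Y_sub jk)); have := Y_card jk; have := Y_card jk'.
by have := subset_leq_card (Y_sub jk); clear; nia.
Qed.

Let runend := [set c : D | [&& fc c \notin Y j, fc (rot c) \notin Y j & fc (rot' c) \in Y j]].

(** [runend] marks where the neighbours of a sphere face pass from [Y j] to its outside. By
    [no_pendant] each face has such a place, and there are nA = 5 j + 5 of them, as many as faces:
    the inner neighbours form one interval. *)
Lemma run_unique : {in runend &, injective (@fc M)}.
Proof.
have cr : #|runend| = #|Sj|.
  rewrite card_S; have := Y_nA jk'; rewrite /nA.
  have -> : #|[set a | [&& fc a \in Y j, fc (rot a) \notin Y j & fc (rot' a) \notin Y j]]| = #|runend|.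
    by apply: (card_preim_bij (@rot'K M) (@rotK M)) => a; rewrite /rot' !rot3; case: (fc a \in _); case: (fc (rot a) \in _); rewrite /= ?andbT ?andbF.
  by move=> ->; clear; lia.
have im : (@fc M) @: runend = Sj.
  apply/setP=> x; apply/imsetP/idP=> [[c]|xS].
    rewrite inE => /and3P[h1 h2 h3] ->; rewrite in_S h1 /=.
    by have := Y_tri c jk; rewrite /meets h3 !orbT => /esym/and3P[].
  move: xS; rewrite in_S => /andP[x0 x1].
  have [a ea ra] := no_pendant jk x1 x0.
  have [/existsP[c hc]|/existsPn no] := boolP [exists c : D, (fc c == x) && (c \in runend)].
    by move: hc => /andP[/eqP ec hc]; exists c.
  have all c : fc c = x -> fc (rev c) \in Y j.
    move=> ec; apply: (face_walk (P := fun c => fc (rev c) \in Y j) (a := a)) ra _; first by rewrite ea ec.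
    move=> d ed rd; have := no (fnext d); rewrite fc_next ed ea eqxx /= inE fc_next ed ea x0 /=.
    have -> : rot' (fnext d) = rev d by rewrite /rot' /fnext rot3.
    by rewrite rd andbT negbK -fc_rev.
  have [_ hk _ _ [_ c2 nT1]] := dY.1 j jk'.
  have [b [b1 b2 b3]] : exists a, [/\ fc a \in [set x], fc (rev a) \in ~: Y j & fc (rev a) \notin [set x]].
    apply: c2; first by rewrite sub1set in_setC.
      by apply/set0Pn; exists x; rewrite inE.
    apply/eqP=> e; have : #|(~: Y j) :&: pents M| <= 1 by rewrite -e; apply: leq_trans (subset_leq_card (subsetIl _ _)) _; rewrite cards1.
    have := cardsID (Y j) (pents M); rewrite card_pents setIC -/(nK _) hk setDE setIC; clear; lia.
  by move: b1 b2; rewrite inE in_setC => /eqP/all ->.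
have /imset_injP : #|(@fc M) @: runend| == #|runend| by rewrite im cr.
exact.
Qed.

(** Inner edges of [Y j.+1] are those inside [Y j], those leaving it and those within the sphere. On
    average a face of the sphere has two neighbours in it. *)
Lemma count_same : #|[set a : D | (fc a \in Sj) && (fc (rev a) \in Sj)]| = 2 * #|Sj|.
Proof.
have [_ _ t1 b1 _] := dY.1 _ jk; have [_ _ t0 b0 _] := dY.1 _ jk'.
have cut1 : #|fcut (Y j)| = 2 * (10 * j + 5) by rewrite card_fcut Y_nA // b0; clear; lia.
have e1 := nE_eq (Y j.+1); have e0 := nE_eq (Y j); rewrite t1 b1 in e1; rewrite t0 b0 in e0.
have n1 := nE2 (Y j.+1); have n0 := nE2 (Y j).
have sub a : fc a \in Y j -> fc a \in Y j.+1 /\ fc (rev a) \in Y j.+1 by exact: Y_nb.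
have part : #|[set a | (fc a \in Y j.+1) && (fc (rot a) \in Y j.+1)]| =
   #|[set a | (fc a \in Y j) && (fc (rot a) \in Y j)]| + #|fcut (Y j)| + #|[set a : D | (fc a \in Sj) && (fc (rev a) \in Sj)]|.
  rewrite !card_sum_pred -!big_split /=; apply: eq_bigr => a _; rewrite !in_S fc_rev.
  have := sub a; have := sub (rev a); rewrite revK !fc_rev.
  case: (fc a \in Y j); case: (fc (rot a) \in Y j) => h1 h2.
  - by have [-> ->] := h2 isT.
  - by have [-> ->] := h2 isT.
  - by have [-> ->] := h1 isT.
  - by case: (fc a \in _); case: (fc (rot a) \in _).
rewrite card_S; move: part n1 n0 e1 e0 cut1; set A1 := #|_|; set A2 := #|_|; set A3 := #|_|; set A4 := #|_|; clear; nia.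
Qed.

End Sphere.

Definition lev n x := (x \in Y n) && ((n == 0) || (x \notin Y n.-1)).

Lemma lev_uniq n n' x : n < k -> n' < k -> lev n x -> lev n' x -> n = n'.
Proof.
have key m m' : m < m' -> m' < k -> lev m x -> lev m' x -> False.
  case: m' => // m' mm m'k /andP[h1 _] /andP[_ /= h2].
  by move: h2; rewrite (subsetP (@Y_mono m m' mm (ltnW m'k)) _ h1).
move=> nk nk' h h'; case: (ltngtP n n') => // lt; exfalso; first exact: key lt nk' h h'.
exact: key lt nk h' h.
Qed.

Lemma lev_hex n a : 0 < n < k -> lev n (fc a) -> hexd a.
Proof.
case: n => // n nk /andP[h1 /= h2]; apply: hexd_size; apply/negP=> pa.
by move: h2; rewrite (Y_pent nk h1 pa) Y_p // ltnW.
Qed.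

Lemma hex_iter_inj a i i' : hexd a -> ~~ pent (fc a) -> i < 6 -> i' < 6 -> iter i (@fnext M) a = iter i' (@fnext M) a -> i = i'.
Proof.
move=> _ np i6 i6' e; have o6 : fingraph.order (@fnext M) a = 6.
  by rewrite order_fnext; have /orP[h|/eqP->] := fc_size (fc a); [move: np; rewrite /pent h|].
by have := findex_iter (f := @fnext M) (x := a) (i := i); have := findex_iter (f := @fnext M) (x := a) (i := i'); rewrite o6 e => -> // ->.
Qed.

Section Levels.
Variable m : nat.
Hypothesis mk : m < k.
Hypothesis Hm : forall n a z, n <= m -> inC p n a z -> lev n (fc a).

Lemma hexm : forall n a z, 0 < n <= m -> inC p n a z -> hexd a.
Proof.
move=> n a z /andP[n0 nm] h; apply: (@lev_hex n); first by rewrite n0 (leq_ltn_trans nm mk).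
exact: Hm h.
Qed.

Lemma labels_ex n a : n <= m -> lev n (fc a) -> exists2 z, hz z = n & inC p n a z.
Proof.
move=> nm h; have nk := leq_ltn_trans nm mk; have /andP[h1 _] := h.
have [z le hC] : exists2 z, hz z <= n & inC p (hz z) a z by apply: (ball_inC hexm nm); rewrite ball_Y.
have e := lev_uniq (leq_ltn_trans le nk) nk (Hm (leq_trans le nm) hC) h.
by exists z; rewrite -?e.
Qed.

(** Labels already produce two sideways neighbours and an interval of inward ones. If an outward
    label stayed in [Y m], the face of [b] would have a second run of inward neighbours, against
    [run_unique], or a third sideways one, against [count_same], as every other face has at least
    two. *)
Lemma up_is_up b w : inC p m b w -> hz (ze w) = m.+1 -> fc (rev b) \notin Y m.
Proof.
move=> hC eu; have ew := inC_hz hC; have lb := Hm (leqnn m) hC.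
case: (posnP m) => [m0|m0].
  have k0 : 0 < k by rewrite -m0.
  move: lb; rewrite m0 => /andP[b1 _]; apply/negP=> b2.
  have [_ _ t0 b0 _] := dY.1 0 k0; have := nE2 (Y 0); have := nE_eq (Y 0); rewrite t0 b0.
  have : b \in [set a | (fc a \in Y 0) && (fc (rot a) \in Y 0)] by rewrite inE b1 -fc_rev.
  by move=> hb; have : 0 < #|[set a | (fc a \in Y 0) && (fc (rot a) \in Y 0)]|; [apply/card_gt0P; exists b|clear; lia].
have [j ej] : exists j, m = j.+1 by exists m.-1; move: m0; clear; lia.
have jk : j.+1 < k by rewrite -ej.
have np (c : D) : lev m (fc c) -> ~~ pent (fc c).
  rewrite ej => /andP[h1 /= h2]; apply/negP=> pc; move: h2; rewrite (Y_pent jk h1 pc) Y_p //; exact: ltnW.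
have levS x : lev m x -> x \in Y j.+1 :\: Y j by rewrite ej in_setD => /andP[-> /= ->].
(* down- and same-level labels are down- and same-level in the map *)
have lS (c : D) z : inC p m c z -> hz (ze z) = m -> fc (rev c) \in Y j.+1 :\: Y j.
  by move=> h e; apply: levS; apply: (Hm (leqnn m)); have := inC_rev hexm (leqnn m) h; rewrite e; apply.
have lD (c : D) z : inC p m c z -> hz (ze z) = j -> fc (rev c) \in Y j.
  move=> h e; have jm : j <= m by rewrite ej.
  have h2 := inC_rev hexm (leqnn m) h; rewrite e in h2.
  by have /andP[] := Hm jm (h2 jm).
have pat (c : D) z : inC p m c z -> hz (ze z) = m.+1 -> exists i1 i2, [/\ 0 < i1, i1 < i2, i2 < 5 &
   [/\ fc (rev (iter i1 (@fnext M) c)) \in Y j.+1 :\: Y j, fc (rev (iter i2 (@fnext M) c)) \in Y j &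
       fc (rev (iter i2.+1 (@fnext M) c)) \in Y j.+1 :\: Y j]].
  move=> h e; have ez := inC_hz h; have := @ring_pattern z; rewrite ez => /(_ m0 e)[i1 [i2 [q1 q2 q3 [q4 q5 q6]]]].
  exists i1, i2; split=> //; split.
  - exact: lS (inC_fi hexm i1 (leqnn m) h) q4.
  - by apply: (lD _ _ (inC_fi hexm i2 (leqnn m) h)); rewrite q5 ej.
  - exact: lS (inC_fi hexm i2.+1 (leqnn m) h) q6.
rewrite ej; apply/negP=> hb.
have [i1 [i2 [q1 q2 q3 [q4 q5 q6]]]] := pat b w hC eu.
have hx : hexd b by apply: hexm hC; rewrite m0 leqnn.
have nb := np _ lb.
have [hD|hS] := boolP (fc (rev b) \in Y j).
- have endrun i : fc (rev (iter i (@fnext M) b)) \in Y j -> fc (rev (iter i.+1 (@fnext M) b)) \notin Y j ->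
     iter i.+1 (@fnext M) b \in [set c : D | [&& fc c \notin Y j, fc (rot c) \notin Y j & fc (rot' c) \in Y j]].
    move=> d1 d2; rewrite inE fc_iter; have -> /= : fc b \notin Y j by have := levS _ lb; rewrite in_setD => /andP[].
    rewrite -fc_rev d2 /=; have -> : rot' (iter i.+1 (@fnext M) b) = rev (iter i (@fnext M) b) by rewrite /= /rot' /fnext rot3.
    exact: d1.
  have [i [ilt d1 d2]] : exists i, [/\ i < i1, fc (rev (iter i (@fnext M) b)) \in Y j & fc (rev (iter i.+1 (@fnext M) b)) \notin Y j].
    have : fc (rev (iter i1 (@fnext M) b)) \notin Y j by move: q4; rewrite in_setD => /andP[].
    elim: i1 q1 {q2 q4} => // i IH _ hi.
    have [h|h] := boolP (fc (rev (iter i (@fnext M) b)) \in Y j); first by exists i.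
    have i0 : 0 < i by case: i h {IH hi} => //=; rewrite hD.
    by have [i' [l1 l2 l3]] := IH i0 h; exists i'; split=> //; exact: ltnW.
  have r1 := endrun i d1 d2; have r2 := endrun i2 q5.
  have d3 : fc (rev (iter i2.+1 (@fnext M) b)) \notin Y j by move: q6; rewrite in_setD => /andP[].
  have := run_unique jk r1 (r2 d3); rewrite !fc_iter => /(_ erefl) /hex_iter_inj e.
  by have := e hx nb; move: ilt q2 q3; clear; lia.
- pose es x := #|[set a : D | (fc a == x) && (fc (rev a) \in Y j.+1 :\: Y j)]|.
  have ge2 x : x \in Y j.+1 :\: Y j -> 2 <= es x.
    rewrite in_setD => /andP[x0 x1]; have [c0 ec0] := fc_surj x.
    have lx : lev m (fc c0) by rewrite ec0 ej /lev x1 /= x0.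
    have [z0 ez0 hC0] := labels_ex (leqnn m) lx; have [i i6 ei] := ring_up z0.
    pose c := iter i (@fnext M) c0; have hCc := inC_fi hexm i (leqnn m) hC0; rewrite -/c in hCc.
    have [t1 [t2 [s1 s2 s3 [s4 s5 s6]]]] := pat c _ hCc ltac:(by rewrite ei ez0).
    have ec : fc c = x by rewrite fc_iter.
    have hxc : hexd c by apply: hexm hCc; rewrite m0 leqnn.
    have npc : ~~ pent (fc c) by apply: np; rewrite ec -ec0.
    have sub : [set iter t1 (@fnext M) c; iter t2.+1 (@fnext M) c] \subset [set a : D | (fc a == x) && (fc (rev a) \in Y j.+1 :\: Y j)].
      by apply/subsetP=> a; rewrite in_set2 => /orP[] /eqP->; rewrite in_set fc_iter ec eqxx.
    apply: leq_trans (subset_leq_card sub); rewrite cards2.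
    have [/hex_iter_inj e|//] := eqVneq (iter t1 (@fnext M) c) (iter t2.+1 (@fnext M) c).
    by have := e hxc npc; move: s1 s2 s3; clear; lia.
  have ge3 : 3 <= es (fc b).
    have sub : [set b; iter i1 (@fnext M) b; iter i2.+1 (@fnext M) b] \subset [set a : D | (fc a == fc b) && (fc (rev a) \in Y j.+1 :\: Y j)].
      apply/subsetP=> a; rewrite !in_setU !in_set1 => /orP[/orP[]|] /eqP->; rewrite in_set ?fc_iter eqxx //=.
      by rewrite in_setD hS hb.
    apply: leq_trans (subset_leq_card sub); rewrite -setUA cardsU1 cards2 !inE negb_or.
    have ne i i' : i < 6 -> i' < 6 -> i != i' -> iter i (@fnext M) b != iter i' (@fnext M) b.
      by move=> l1 l2; apply: contra => /eqP/hex_iter_inj e; apply/eqP; apply: e.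
    rewrite -[b == iter i1 _ b]/(iter 0 (@fnext M) b == _) -[b == iter i2.+1 _ b]/(iter 0 (@fnext M) b == _).
    by rewrite !ne //; move: q1 q2 q3; clear; lia.
  have : #|[set a : D | (fc a \in Y j.+1 :\: Y j) && (fc (rev a) \in Y j.+1 :\: Y j)]| = \sum_(x in Y j.+1 :\: Y j) es x.
    rewrite -sum1_card (partition_big (@fc M) (fun x => x \in Y j.+1 :\: Y j)) /=; last by move=> a; rewrite in_set => /andP[].
    apply: eq_bigr => x xS; rewrite /es -sum1_card; apply: eq_bigl => a.
    transitivity ((fc a \in Y j.+1 :\: Y j) && (fc (rev a) \in Y j.+1 :\: Y j) && (fc a == x)); first by rewrite in_set.
    transitivity ((fc a == x) && (fc (rev a) \in Y j.+1 :\: Y j)); last by rewrite in_set.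
    by have [->|] := eqVneq (fc a) x; rewrite ?xS ?andbT ?andbF.
  rewrite (count_same jk) (bigD1 (fc b)) /=; last exact: levS.
  have : \sum_(x in Y j.+1 :\: Y j | x != fc b) 2 <= \sum_(x in Y j.+1 :\: Y j | x != fc b) es x.
    by apply: leq_sum => x /andP[xS _]; apply: ge2.
  rewrite sum_nat_const.
  have -> : #|[pred x in Y j.+1 :\: Y j | x != fc b]| = #|Y j.+1 :\: Y j|.-1.
    have := cardsD1 (fc b) (Y j.+1 :\: Y j); rewrite (levS _ lb) => -> /=.
    by rewrite add0n; apply: eq_card => x; rewrite !inE andbC.
  have : 0 < #|Y j.+1 :\: Y j| by apply/card_gt0P; exists (fc b); apply: levS.
  move: ge3; move: (es (fc b)) (\sum_(_ in _ | _) _) #|_| => e1 e2 e3; clear; lia.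
Qed.

End Levels.

Lemma inC_lev m : m < k -> forall n a z, n <= m -> inC p n a z -> lev n (fc a).
Proof.
elim: m => [|m IH] mk n a z.
  by rewrite leqn0 => /eqP-> [-> _]; rewrite /lev Y_p.
rewrite leq_eqVlt => /orP[/eqP->|nm]; last exact: IH (ltnW mk) _ _ _ nm.
have Hm := IH (ltnW mk).
case=> e [j j6 [e1 hC]]; have := up_is_up (ltnW mk) Hm hC; rewrite ze2 hz_iter e => /(_ erefl).
rewrite revK fc_iter => h; rewrite /lev /= h andbT.
have /andP[h1 _] := Hm _ _ _ (leqnn m) hC.
by have [_] := Y_nb mk h1; rewrite revK fc_iter.
Qed.

Lemma disc_hex n a z : 0 < n <= k.-1 -> inC p n a z -> hexd a.
Proof.
move=> /andP[n0 nk] h; have k1 : k.-1 < k by move: n0 nk; clear; lia.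
apply: (@lev_hex n); first by rewrite n0; move: n0 nk; clear; lia.
exact: (inC_lev k1 nk h).
Qed.

Lemma disc_up a z : hz z < k -> inC p (hz z) a z -> fc (rev a) \in Y k.-1 -> hz (ze z) < k.
Proof.
move=> zk hC h; have k1 : k.-1 < k by move: zk; clear; lia.
have [s1 _] := hz_step z; rewrite ltnNge; apply/negP=> ge.
have e : hz z = k.-1 by move: s1 ge zk; clear; lia.
rewrite e in hC; have := up_is_up k1 (inC_lev k1) hC; rewrite h => e2.
by have := e2 ltac:(move: s1 ge zk; clear; lia).
Qed.

(** The level of the face fixes the norm of both labels. A descent for the first label is one for
    the second, since a sideways or outward step would reach a face of another level; so both follow
    one path to the centre. *)
Lemma disc_fun a z z' : hz z < k -> hz z' < k -> inC p (hz z) a z -> inC p (hz z') a z' -> z = z'.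
Proof.
move=> zk zk' hC hC'; have k1 : k.-1 < k by move: zk; clear; lia.
have l := inC_lev k1 (_ : hz z <= k.-1) hC; have l' := inC_lev k1 (_ : hz z' <= k.-1) hC'.
have le : hz z <= k.-1 by move: zk; clear; lia.
have le' : hz z' <= k.-1 by move: zk'; clear; lia.
have e := lev_uniq zk zk' (l le) (l' le'); move: hC hC'; rewrite -e => hC hC'; clear l l' le' zk'.
move: (hz z) zk le hC hC' {e} => n nk; elim: n a z z' nk => [|n IH] a z z' nk le hC hC'; first by case: hC hC' => _ -> [_ ->].
case: (hC) => e [j j6 [e1 h1]].
have Hn := inC_lev nk; have hx := hexm nk Hn.
have h2 := inC_fi hx j (leqnn n.+1) hC'.
have lv := inC_lev k1 (ltnW le) h1.
have ez' := inC_hz h2.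
have e2 : hz (ze (iter j zf z')) = n.
  have [s1 s2] := hz_step (iter j zf z'); rewrite ez' in s1 s2.
  have [lt|[eq|eq]] : hz (ze (iter j zf z')) = n \/ hz (ze (iter j zf z')) = n.+1 \/ hz (ze (iter j zf z')) = n.+2 by move: s1 s2; clear; lia.
  - by [].
  - have := inC_rev hx (leqnn n.+1) h2; rewrite eq => /(_ (leqnn _)) h3.
    have := lev_uniq (ltnW nk) nk lv (inC_lev k1 le h3); clear; lia.
  - have := up_is_up nk Hn h2 eq; have /andP[h3 _] := lv.
    by rewrite (subsetP (Y_sub nk) _ h3).
have h3 := inC_rev hx (leqnn n.+1) h2; rewrite e2 in h3.
have := IH _ _ _ (ltnW nk) (ltnW le) h1 (h3 (leqnSn n)).
move/(can_inj ze2); elim: j {h1 h2 h3 e1 ez' e2 lv j6} => //= j IHj /(congr1 (iter 5 zf)); rewrite -!iterSr !zf6; exact: IHj.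
Qed.

Lemma disc_ex a : 0 < k -> fc a \in Y k.-1 -> exists2 z, hz z < k & inC p (hz z) a z.
Proof.
move=> k0 h; have k1 : k.-1 < k by move: k0; clear; lia.
have hb : fc a \in ball p k.-1 by rewrite ball_Y.
have [z le hC] := ball_inC disc_hex (leqnn k.-1) hb.
by exists z => //; move: le k0; clear; lia.
Qed.

Lemma disc_in a z : hz z < k -> inC p (hz z) a z -> fc a \in Y k.-1.
Proof.
move=> zk hC; have k1 : k.-1 < k by move: zk; clear; lia.
have le : hz z <= k.-1 by move: zk; clear; lia.
have /andP[h _] := inC_lev k1 le hC; exact: subsetP (Y_mono le k1) _ h.
Qed.

Lemma disc_rev a z : hz z < k -> inC p (hz z) a z -> hz (ze z) < k -> inC p (hz (ze z)) (rev a) (ze z).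
Proof. by move=> zk hC zk'; apply: (inC_rev disc_hex) hC _; move: zk zk'; clear; lia. Qed.

Lemma disc_next a z : hz z < k -> inC p (hz z) a z -> inC p (hz (zf z)) (fnext a) (zf z).
Proof. by move=> zk hC; rewrite hz_f; apply: (inC_f disc_hex) hC; move: zk; clear; lia. Qed.

Lemma disc_nextK a z : hz z < k -> inC p (hz (zf z)) (fnext a) (zf z) -> inC p (hz z) a z.
Proof. by rewrite hz_f => zk; apply: (inC_fK disc_hex); move: zk; clear; lia. Qed.

End DiscLabels.

(** * Global coordinates on an extremal map *)

(** [zr] is the change of frame under [rot], [zp] the one under [fprev]. *)
Definition zr (z : pt) := zf (ze z).
Definition zp (z : pt) : pt := ((- z.2)%R, (z.1 + z.2)%R).

Lemma zr3 z : zr (zr (zr z)) = z. Proof. exact: zfe3. Qed.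
Lemma zre z : zr (ze z) = zf z. Proof. by rewrite /zr ze2. Qed.
Lemma hz_r z : hz (zr z) = hz (ze z). Proof. exact: hz_f. Qed.
Lemma zerr z : ze (zr (zr z)) = zp z. Proof. by case: z => x y; rewrite /zr /zp; zeq. Qed.
Lemma zrr_p z : zr (zr z) = ze (zp z). Proof. by rewrite -zerr ze2. Qed.

Section Labels.
Variables (M : fmap) (k : nat) (Y : face M -> nat -> {set face M}).
Local Notation D := (dart M).
Hypothesis k0 : 0 < k.
Hypothesis Yd : forall p, pent p -> disc k p (Y p).
Hypothesis Yc : forall a : D, exists2 p, pent p & meets (Y p k.-1) a.
Hypothesis Yu : forall (a : D) p q, pent p -> pent q -> meets (Y p k.-1) a -> meets (Y q k.-1) a -> p = q.
Implicit Types (a b c : D) (z : pt) (p : face M).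

Definition lab p a z := hz z < k /\ inC p (hz z) a z.

Lemma lab_rot p a z : pent p -> lab p a z -> hz (ze z) < k -> lab p (rot a) (zr z).
Proof.
move=> pp [h1 h2] h3; split; first by rewrite hz_r.
have := disc_next pp (Yd pp) h3 (disc_rev pp (Yd pp) h1 h2 h3).
by rewrite /fnext revK.
Qed.

Lemma lab_rotK p a z : pent p -> lab p (rot a) (zr z) -> hz z < k -> lab p a z.
Proof.
move=> pp [h1 h2] h3; rewrite hz_r in h1; split=> //.
have := disc_nextK pp (Yd pp) (a := rev a) h1; rewrite /fnext revK => /(_ h2) h4.
by have := disc_rev pp (Yd pp) h1 h4; rewrite ze2 revK; apply.
Qed.

Lemma lab_fun p a z z' : pent p -> lab p a z -> lab p a z' -> z = z'.
Proof. by move=> pp [h1 h2] [h3 h4]; exact: (disc_fun pp (Yd pp) h1 h3 h2 h4). Qed.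

Lemma lab_in p a z : pent p -> lab p a z -> fc a \in Y p k.-1.
Proof. by move=> pp [h1 h2]; exact: (disc_in pp (Yd pp) h1 h2). Qed.

Lemma lab_key p a z w : pent p -> lab p a z -> lab p (rot a) w -> w = zr z.
Proof.
move=> pp h1 h2; apply: (lab_fun pp h2); apply: (lab_rot pp h1).
case: (h1) => l1 l2; apply: (disc_up pp (Yd pp) l1 l2); rewrite fc_rev; exact: lab_in h2.
Qed.

(** The triangle of [a] meets exactly one outermost disc; the label is read at any corner inside
    that disc and turned back to [a]. It thus reaches norm k, one beyond the disc. *)
Definition LAB a z := exists2 p, pent p & [\/ lab p a z, lab p (rot a) (zr z) | lab p (rot' a) (zr (zr z))].

Lemma LAB_total a : exists z, LAB a z.
Proof.
have [p pp] := Yc a; rewrite /meets => /or3P[] /(disc_ex pp (Yd pp) k0)[z h1 h2].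
- by exists z; exists p => //; apply: Or31.
- by exists (zr (zr z)); exists p => //; apply: Or32; rewrite zr3.
- by exists (zr z); exists p => //; apply: Or33; rewrite zr3.
Qed.

Lemma LAB_fun a z z' : LAB a z -> LAB a z' -> z = z'.
Proof.
case=> p pp h [q pq h'].
have mp : meets (Y p k.-1) a by rewrite /meets; case: h => h; rewrite (lab_in pp h) ?orbT.
have mq : meets (Y q k.-1) a by rewrite /meets; case: h' => h'; rewrite (lab_in pq h') ?orbT.
have e := Yu pp pq mp mq; rewrite -e in h'; clear mp mq e q pq.
have r3 : rot (rot' a) = a by exact: rot3.
have zrK : injective zr by move=> u v /(congr1 (fun w => zr (zr w))); rewrite !zr3.
case: h h' => h [] h'.
- exact: lab_fun h h'.
- by apply/esym/zrK; exact: lab_key h h'.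
- by rewrite -[LHS]zr3 -[RHS]zr3; congr zr; apply: zrK; rewrite !zr3; rewrite -r3 in h; rewrite (lab_key pp h' h) zr3.
- by apply: zrK; exact: lab_key h' h.
- by apply: zrK; exact: lab_fun h h'.
- by apply/zrK/zrK; rewrite (lab_key pp h h').
- by rewrite -r3 in h'; rewrite (lab_key pp h h') zr3.
- by apply/zrK/zrK; rewrite (lab_key pp h' h).
- by apply/zrK/zrK; exact: lab_fun h h'.
Qed.

Lemma LAB_rot a z : LAB a z -> LAB (rot a) (zr z).
Proof.
case=> p pp [] h; exists p => //; [apply: Or33|apply: Or31|apply: Or32] => //.
by rewrite zr3 /rot' rot3.
Qed.

Lemma LAB_self a z : LAB a z -> hz z < k -> exists2 p, pent p & lab p a z.
Proof.
case=> p pp h zk; exists p => //; case: h => // h; first exact: lab_rotK h zk.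
have := lab_rot pp h; rewrite -hz_r zr3 => /(_ zk).
by rewrite (rot3 a).
Qed.

Lemma LAB_rev a z : LAB a z -> hz z < k \/ hz (ze z) < k -> LAB (rev a) (ze z).
Proof.
move=> h [zk|zk].
  have [p pp [h1 h2]] := LAB_self h zk; exists p => //; apply: Or32; split; first by rewrite zre hz_f.
  by rewrite zre; exact: (disc_next pp (Yd pp) h1 h2).
have [|p pp [h1 h2]] := LAB_self (LAB_rot h); first by rewrite hz_r.
exists p => //; apply: Or31; split=> //; apply: (disc_nextK pp (Yd pp)) => //.
by rewrite /fnext revK.
Qed.

Lemma LAB_next a z : LAB a z -> hz z < k \/ hz (ze z) < k -> LAB (fnext a) (zf z).
Proof. by move=> h e; have := LAB_rot (LAB_rev h e); rewrite zre. Qed.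

Lemma LAB_rot' a z : LAB a z -> LAB (rot' a) (ze (zp z)).
Proof. by move=> /LAB_rot/LAB_rot; rewrite zrr_p. Qed.

Lemma LAB_prev a z : LAB a z -> hz (ze (zp z)) < k -> LAB (fprev a) (zp z).
Proof. by move=> /LAB_rot' h e; have := LAB_rev h (or_introl e); rewrite ze2. Qed.

Lemma LAB_pent a : pent (fc a) -> LAB a (0%R, 0%R).
Proof. by move=> pa; exists (fc a) => //; apply: Or31; split. Qed.

Lemma LAB_zero a : LAB a (0%R, 0%R) -> pent (fc a).
Proof. by move=> h; have [p pp [_ [-> _]]] := LAB_self h k0. Qed.

Lemma LAB_hz a z : LAB a z -> hz z <= k.
Proof.
case=> p pp [] [h _].
- exact: ltnW.
- by rewrite hz_r in h; have [_ s] := hz_step z; exact: leq_trans s h.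
- by have [s _] := hz_step (zr (zr z)); rewrite -hz_r zr3 in s; exact: leq_trans s h.
Qed.

(* the labels of the [k] darts on a side of a disc *)
Definition bz i : pt := ((- Posz i.+1)%R, Posz k).
Definition base a i := i < k /\ LAB a (bz i).

Ltac hzk := rewrite /bz /ze /zf /zp /=; apply/hzE; lia.

Lemma bz_hz i : i < k -> hz (bz i) = k. Proof. by move=> ik; hzk. Qed.
Lemma bz_hze i : i < k -> hz (ze (bz i)) = k. Proof. by move=> ik; hzk. Qed.

Lemma boundary a z : LAB a z -> hz z = k -> hz (ze z) = k -> exists i, base a i /\ z = bz i.
Proof.
move=> h e1 e2; have e3 : hz (zr (zr z)) < k.
  by case: h => p pp [] [h _] //; [move: h; rewrite e1 ltnn|move: h; rewrite hz_r e2 ltnn].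
suff [i ik ez] : exists2 i, i < k & z = bz i by exists i; split=> //; split=> //; rewrite -ez.
case: z {h} e1 e2 e3 => x y; rewrite /zr /ze /zf /= => /hzE e1 /hzE e2 e3.
have [n [hn nk]] : exists n, hz ((- (- x - 1 + - y) - 1 - - (- x - 1))%R, (- (- (- x - 1 + - y) - 1))%R) = n /\ n < k by eexists.
move: hn => /hzE hn; exists `|(x + 1)%R|%N; first by lia.
by rewrite /bz; congr pair; lia.
Qed.

Lemma base_fun a i j : base a i -> base a j -> i = j.
Proof. by move=> [_ h1] [_ h2]; have := LAB_fun h1 h2; rewrite /bz => -[]; lia. Qed.

Lemma base_rev a i : base a i -> exists j, base (rev a) j.
Proof.
move=> [ik h]; have [z' h'] := LAB_total (rev a).
have nb : ~ (hz z' < k \/ hz (ze z') < k).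
  move=> e; have := LAB_rev h' e; rewrite revK => h2; have ez := LAB_fun h2 h.
  by move: e; rewrite ez -(ze2 z') ez bz_hz // bz_hze // ltnn => -[].
have e1 : hz z' = k by have := LAB_hz h'; move: nb; clear; case: (ltngtP (hz z') k) => // h nb _; exfalso; apply: nb; left.
have e2 : hz (ze z') = k.
  have : hz (ze z') <= k by have := LAB_hz (LAB_rot h'); rewrite hz_r.
  by move: nb; clear; case: (ltngtP (hz (ze z')) k) => // h nb _; exfalso; apply: nb; right.
by have [j [hj _]] := boundary h' e1 e2; exists j.
Qed.

Lemma base_hex a i : base a i -> hexd a.
Proof.
move=> [ik h]; apply: hexd_size; apply/negP=> /LAB_pent h0.
by have := LAB_fun h h0; rewrite /bz => -[]; move: k0; clear; lia.
Qed.

Lemma base_succ a i : base a i -> i.+1 < k -> base (rev (fprev (fprev (fprev a)))) i.+1.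
Proof.
move=> [ik h] ik1; split=> //.
have q1 : hz (ze (zp (bz i))) = k.-1 by hzk.
have h1 := LAB_prev h ltac:(rewrite q1; move: k0; clear; lia).
have q2 : hz (ze (zp (zp (bz i)))) = k.-1 by hzk.
have h2 := LAB_prev h1 ltac:(rewrite q2; move: k0; clear; lia).
have := LAB_rot' h2; rewrite {3}/fprev revK.
have -> // : ze (zp (zp (zp (bz i)))) = bz i.+1 by rewrite /bz /ze /zp /=; congr pair; lia.
Qed.

Lemma base_pred0 b i : base b i -> LAB (fnext (rot b)) ((- Posz k)%R, (Posz k - Posz i)%R).
Proof.
move=> [ik h]; have := LAB_rot h.
have -> : zr (bz i) = ((Posz i - Posz k)%R, (- Posz i)%R) by rewrite /zr /bz /ze /zf /=; congr pair; lia.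
move=> h1; have q1 : hz (ze ((Posz i - Posz k)%R, (- Posz i)%R)) = k.-1 by hzk.
have := LAB_next h1 ltac:(right; rewrite q1; move: k0; clear; lia).
by congr LAB; rewrite /zf /=; congr pair; lia.
Qed.

Lemma base_pred b i : base b i -> 0 < i -> base (fnext (fnext (fnext (rev b)))) i.-1.
Proof.
move=> hb i0; have := base_pred0 hb; case: hb => ik _ h1; split; first by move: ik; clear; lia.
have q1 : hz (ze ((- Posz k)%R, (Posz k - Posz i)%R)) = k.-1 by hzk.
have := LAB_next h1 ltac:(right; rewrite q1; move: k0; clear; lia).
have -> : rot b = fnext (rev b) by rewrite /fnext revK.
by congr LAB; rewrite /zf /bz /=; congr pair; move: i0; clear; lia.
Qed.

Lemma hex_prev3 a : hexd a -> fprev (fprev (fprev a)) = fnext (fnext (fnext a)).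
Proof. by rewrite /hexd /= => h; rewrite -{1}h !fnextK. Qed.

(* at an interior point of a side, the other three triangles belong to a single disc *)
Lemma base_key a i j : base a i -> i.+1 < k -> base (rev a) j -> 0 < j.
Proof.
move=> ha ik1 hr; case: (posnP j) => // j0; exfalso; rewrite j0 in hr; clear j0 j.
(* A corner of the second disc here would make [fnext (fnext a)] a boundary dart. So is
   [fnext (fnext (fnext a))], by continuing the side of [a]; but the reverse of the former shares a
   triangle with the latter, and a triangle has only one boundary dart. *)
have h2 : base (fnext (fnext a)) k.-1.
  have := base_pred0 hr; rewrite -[rot (rev a)]/(fnext a) => h; split; first by move: k0; clear; lia.
  by move: h; congr LAB; rewrite /bz; congr pair; move: k0; clear; lia.
have [j' hg] := base_rev (base_succ ha ik1); rewrite revK (hex_prev3 (base_hex ha)) in hg.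
have [j'' [jk hrr]] := base_rev h2.
case: hg => jk' /LAB_rot'; have -> : rot' (fnext (fnext (fnext a))) = rev (fnext (fnext a)) by rewrite {1}/fnext /rot' rot3.
move=> h3; have e := LAB_fun h3 hrr.
have q1 : hz (ze (zp (bz j'))) = k.-1 by hzk.
by move: q1; rewrite e bz_hz //; move: k0; clear; lia.
Qed.

(** Stepping back along the side of [a] steps forward along the side of [rev a]. At position 0 the
    reverse must be in the last place, since any other would contradict [base_key] read from the
    other disc. *)
Lemma base_match i : forall a j, base a i -> base (rev a) j -> i + j.+1 = k.
Proof.
elim: i => [|i IH] a j ha hr.
  case: (hr) => jk _; rewrite add0n; apply/eqP; rewrite eqn_leq jk leqNgt; apply/negP=> lt.
  by have := base_key hr lt (_ : base (rev (rev a)) 0); rewrite revK => /(_ ha).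
have hb := base_pred ha isT; set b := fnext _ in hb; rewrite /= in hb.
have ik1 : i.+1 < k by case: ha.
have [j' hrb] := base_rev hb; have j0 := base_key hb ik1 hrb.
have := base_pred hrb j0; rewrite revK.
have -> : fnext (fnext (fnext b)) = rev a by exact: (base_hex hr).
move=> /(base_fun hr) ->; have := IH _ _ hb hrb; move: j0; clear; lia.
Qed.

(** k sqrt(-3) Z[omega]: in this basis the multiples of sqrt(-3) are the pairs with equal residues
    modulo 3. *)
Definition inL (z : pt) := exists u v w, [/\ z = (Posz k * u, Posz k * v)%R & (u - v = 3 * w)%R].
Definition cong (z z' : pt) := inL ((z.1 - z'.1)%R, (z.2 - z'.2)%R).
Definition typ a z := exists2 z0, LAB a z0 & cong z z0.

Lemma cong_trans z1 z2 z3 : cong z1 z2 -> cong z2 z3 -> cong z1 z3.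
Proof.
move=> [u [v [w [[e1 e2] e3]]]] [u' [v' [w' [[e1' e2'] e3']]]]; exists (u + u')%R, (v + v')%R, (w + w')%R.
by split; [congr pair; rewrite mulrDr -?e1 -?e2 -?e1' -?e2'; lia|lia].
Qed.
Lemma cong_refl z : cong z z.
Proof. by exists 0%R, 0%R, 0%R; split=> //; rewrite !subrr !mulr0. Qed.
Lemma cong_sym z1 z2 : cong z1 z2 -> cong z2 z1.
Proof.
move=> [u [v [w [[e1 e2] e3]]]]; exists (- u)%R, (- v)%R, (- w)%R.
by split; [congr pair; rewrite mulrN -?e1 -?e2; lia|lia].
Qed.
Lemma cong_e z1 z2 : cong z1 z2 -> cong (ze z1) (ze z2).
Proof.
move=> [u [v [w [[e1 e2] e3]]]]; exists (- u)%R, (- v)%R, (- w)%R.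
by split; [rewrite /=; congr pair; rewrite mulrN -?e1 -?e2; lia|lia].
Qed.
Lemma cong_f z1 z2 : cong z1 z2 -> cong (zf z1) (zf z2).
Proof.
move=> [u [v [w [[e1 e2] e3]]]]; exists (u + v)%R, (- u)%R, (2 * w + v)%R.
by split; [rewrite /=; congr pair; rewrite ?mulrDr ?mulrN -?e1 -?e2; lia|lia].
Qed.

Lemma typ_fun a z z' : typ a z -> typ a z' -> cong z z'.
Proof.
move=> [z0 h0 c0] [z1 h1 c1]; rewrite (LAB_fun h0 h1) in c0; exact: cong_trans c0 (cong_sym c1).
Qed.

Lemma typ_rot a z : typ a z -> typ (rot a) (zr z).
Proof. by move=> [z0 h0 c0]; exists (zr z0); [exact: LAB_rot|exact/cong_f/cong_e]. Qed.

(** Unless the dart lies on the common side of two discs, one disc labels both of its directions. On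
    a common side [base_match] makes the two frames differ by k (1, -2). *)
Lemma typ_rev a z : typ a z -> typ (rev a) (ze z).
Proof.
move=> [z0 h0 c0]; have [h|h] := leqP k (hz z0); last first.
  by exists (ze z0); [exact: LAB_rev h0 (or_introl h)|exact: cong_e].
have [h'|h'] := leqP k (hz (ze z0)); last first.
  by exists (ze z0); [exact: LAB_rev h0 (or_intror h')|exact: cong_e].
have e1 : hz z0 = k by apply/eqP; rewrite eqn_leq h (LAB_hz h0).
have e2 : hz (ze z0) = k.
  by apply/eqP; rewrite eqn_leq h'; have := LAB_hz (LAB_rot h0); rewrite hz_r => ->.
have [i [hi ez]] := boundary h0 e1 e2; have [j hj] := base_rev hi; have := base_match hi hj.
case: hj => _ hj ij; exists (bz j) => //; apply: cong_trans (cong_e c0) _; rewrite ez.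
by exists 1%R, (- 2)%R, 1%R; split=> //; rewrite /bz /ze /=; congr pair; lia.
Qed.

Lemma typ_pent a : pent (fc a) -> typ a (0%R, 0%R).
Proof. by move=> h; exists (0%R, 0%R); [exact: LAB_pent|exact: cong_refl]. Qed.

(** Labels have norm at most k, nonzero points of the lattice at least 2 k. *)
Lemma typ_zero a z : typ a z -> inL z -> pent (fc a).
Proof.
move=> [z0 h0 c0] zL; suff e : z0 = (0%R, 0%R) by apply: LAB_zero; rewrite -e.
have h1 : inL z0.
  have c1 : cong z (0%R, 0%R) by rewrite /cong /= !subr0; case: (z) zL.
  by have := cong_trans (cong_sym c0) c1; rewrite /cong /= !subr0; case: (z0).
case: h1 (LAB_hz h0) => u [v [w [-> e]]]; rewrite /hz /= hnM => le.
have le1 : hn u v <= 1 by move: le; rewrite -{2}(muln1 k) leq_pmul2l.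
have [q1 q2 q3] := hnP u v.
have u0 : u = 0%R by move: q1 q2 q3 le1 e; clear; lia.
have v0 : v = 0%R by move: q1 q2 q3 le1 e; clear; lia.
by rewrite u0 v0 !mulr0.
Qed.

End Labels.

(** * Symmetries of an extremal map *)

Definition zc (z : pt) : pt := ((z.1 + z.2)%R, (- z.2)%R).

Lemma zce z : zc (ze z) = ze (zc z). Proof. by case: z => x y; rewrite /zc; zeq. Qed.
Lemma zcf z : zc (zf z) = zp (zc z).
Proof. by case: z => x y; rewrite /zc /zf /zp /=; congr pair; lia. Qed.

(** An orientation-reversing symmetry that keeps each dart with its face and so exchanges tails and
    heads; the induced action on the graph is that of [a] to [rev (g a)]. *)
Definition mrev (M : fmap) (g : dart M -> dart M) :=
  (forall a, g (rev a) = rev (g a)) /\ (forall a, g (fnext a) = fprev (g a)).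

Lemma mrev_eq (M : fmap) (g g' : dart M -> dart M) a : mrev g -> mrev g' -> g a = g' a -> g =1 g'.
Proof.
move=> [h1 h2] [h3 h4] e; apply: (@dart_ind _ _ a) => // b eb; first by rewrite h1 h3 eb.
by rewrite -(revK b) -[rot _]/(fnext _) h2 h4 h1 h3 eb.
Qed.

Lemma mrev_prev (M : fmap) (g : dart M -> dart M) a : mrev g -> g (fprev a) = fnext (g a).
Proof. by case=> _ h; rewrite -{2}(fprevK a) h fprevK. Qed.

Lemma maut_prev (M : fmap) (g : dart M -> dart M) a : maut g -> g (fprev a) = fprev (g a).
Proof. by move=> h; rewrite -{2}(fprevK a) (maut_next _ h) fnextK. Qed.

Lemma mrev_mrev (M : fmap) (g g' : dart M -> dart M) : mrev g -> mrev g' -> maut (g \o g').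
Proof.
move=> hg hg'; case: (hg) => h1 h2; case: (hg') => h3 h4; split=> a /=; last by rewrite h3 h1.
by rewrite -{1}(revK a) -[rot _]/(fnext _) h4 (mrev_prev _ hg) h3 h1 /fnext revK.
Qed.

Lemma mrev_maut (M : fmap) (g g' : dart M -> dart M) : mrev g -> maut g' -> mrev (g \o g').
Proof. by move=> [h1 h2] hg'; split=> a /=; [case: hg' => _ ->; rewrite h1|rewrite (maut_next _ hg') h2]. Qed.

Lemma maut_mrev (M : fmap) (g g' : dart M -> dart M) : maut g -> mrev g' -> mrev (g \o g').
Proof. by move=> hg [h1 h2]; split=> a /=; [rewrite h1; case: hg => _ ->|rewrite h2 (maut_prev _ hg)]. Qed.

Section Tiled.
Variables (M : fmap) (k : nat).
Local Notation D := (dart M).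
Hypothesis k0 : 0 < k.
Variable typ : D -> pt -> Prop.
Hypothesis typ_rev : forall a z, typ a z -> typ (rev a) (ze z).
Hypothesis typ_rot : forall a z, typ a z -> typ (rot a) (zr z).
Hypothesis typ_fun : forall a z z', typ a z -> typ a z' -> cong k z z'.
Hypothesis typ_pent : forall a, pent (fc a) -> typ a (0%R, 0%R).
Hypothesis typ_zero : forall a z, typ a z -> inL k z -> pent (fc a).
Implicit Types (a b c d : D) (z : pt).

Lemma typ_next' a z : typ a z -> typ (fnext a) (zf z).
Proof. by move=> h; have := typ_rot (typ_rev h); rewrite zre. Qed.

Lemma typ_prev a z : typ a z -> typ (fprev a) (zp z).
Proof. by move=> h; have := typ_rev (typ_rot (typ_rot h)); rewrite zerr. Qed.

Lemma typ_inL a z : typ a z -> pent (fc a) -> inL k z.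
Proof. by move=> h /typ_pent h0; have := typ_fun h h0; rewrite /cong /= !subr0; case: (z). Qed.

Lemma inL_c z : inL k z -> inL k (zc z).
Proof.
case=> u [v [w [-> e]]]; exists (u + v)%R, (- v)%R, (w + v)%R.
by split; [rewrite /zc /= -mulrDr mulrN|lia].
Qed.

Lemma inL_cK z : inL k (zc z) -> inL k z.
Proof. by move/inL_c; congr inL; case: z => x y; rewrite /zc /=; congr pair; lia. Qed.

Lemma prev5 a : pent (fc a) -> iter 5 (@fprev M) a = a.
Proof. by move=> /pent5 h; rewrite -{1}h /= !fnextK. Qed.

Lemma prev6 a : hexd a -> iter 6 (@fprev M) a = a.
Proof. by rewrite /hexd /= => h; rewrite -{1}h !fnextK. Qed.

(** Paired darts share a label modulo the lattice. Pentagons are exactly the faces at lattice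
    points, so paired faces have equal size and the product covering is unbranched. *)
Theorem rotation_ex d1 d2 : pent (fc d1) -> pent (fc d2) -> exists2 g, maut g & g d1 = d2.
Proof.
move=> p1 p2; pose Inv a b := exists2 z, typ a z & typ b z.
have pp a b : Inv a b -> pent (fc a) = pent (fc b).
  case=> z h1 h2; apply/idP/idP=> h; [exact: typ_zero h2 (typ_inL h1 h)|exact: typ_zero h1 (typ_inL h2 h)].
have [] := @product_graph D D (@rot M) (@rev M) (@rot M) (@rev M) (fun a => pent (fc a)) d1 d2
  (@rot3 M) (@revK M) (@rot3 M) (@revK M) (@rot_neq M) (@rev_neq M) (@dart_ind M) (card_pent_darts M) _ Inv.
- by move=> a; rewrite -[rot _]/(fnext a) fc_next.
- by exists (0%R, 0%R); exact: typ_pent.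
- by move=> a b [z h1 h2]; exists (ze z); exact: typ_rev.
- by move=> a b [z h1 h2]; exists (zr z); exact: typ_rot.
- by move=> a b h pa; split; apply: pent5; rewrite -?(pp a b).
- by move=> a b h pa; split; apply: hexd_size; rewrite -?(pp a b).
by move=> g [h1 h2 h3]; exists g.
Qed.

(** The second factor is replaced by the mirror image of the map, whose rotation is [r2], and labels
    are paired with their conjugates. *)
Theorem reflection_ex d1 d2 : pent (fc d1) -> pent (fc d2) -> exists2 g, mrev g & g d1 = d2.
Proof.
move=> p1 p2; pose Inv a b := exists2 z, typ a z & typ b (zc z).
have pp a b : Inv a b -> pent (fc a) = pent (fc b).
  case=> z h1 h2; apply/idP/idP=> h; first exact: typ_zero h2 (inL_c (typ_inL h1 h)).
  exact: typ_zero h1 (inL_cK (typ_inL h2 h)).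
pose r2 b : D := fprev (rev b).
have [] := @product_graph D D (@rot M) (@rev M) r2 (@rev M) (fun a => pent (fc a)) d1 d2
  (@rot3 M) (@revK M) _ (@revK M) (@rot_neq M) (@rev_neq M) (@dart_ind M) (card_pent_darts M) _ Inv.
- by move=> a; rewrite /r2 /fprev !revK /rot' !rot3 revK.
- by move=> a; rewrite -[rot _]/(fnext a) fc_next.
- by exists (0%R, 0%R); [exact: typ_pent|exact: (typ_pent p2)].
- by move=> a b [z h1 h2]; exists (ze z); rewrite ?zce; exact: typ_rev.
- move=> a b [z h1 h2]; exists (zr z); first exact: typ_rot.
  by rewrite /zr zcf zce; apply/typ_prev/typ_rev.
- move=> a b h pa; split; first exact: pent5.
  by have := @prev5 b; rewrite -(pp a b) // => /(_ pa); rewrite /= /r2 !revK.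
- move=> a b h pa; split; first exact: hexd_size.
  by have := @prev6 b; rewrite /= /r2 !revK; apply; apply: hexd_size; rewrite -(pp a b).
move=> g [h1 h2 h3]; exists g => //; split=> // a.
by rewrite /fnext h3 h2 /r2 revK.
Qed.

(** Straight steps: across an edge, then half around the next hexagon. They translate labels by the
    first and, for [Vs], the second basis vector; [Ub] is the inverse of [Us]. *)
Definition Us a := fnext (fnext (fnext (rev a))).
Definition Ub a := rev (fprev (fprev (fprev a))).
Definition Vs a := fnext (fnext (rev (fnext a))).

Lemma UsK : cancel Us Ub. Proof. by move=> a; rewrite /Us /Ub !fnextK revK. Qed.
Lemma UbK : cancel Ub Us. Proof. by move=> a; rewrite /Us /Ub revK !fprevK. Qed.
Lemma Us_iterK n : cancel (iter n Us) (iter n Ub).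
Proof. by elim: n => // n IH a; rewrite [iter n.+1 Us a]iterS iterSr UsK IH. Qed.
Lemma Ub_iterK n : cancel (iter n Ub) (iter n Us).
Proof. by elim: n => // n IH a; rewrite [iter n.+1 Ub a]iterS iterSr UbK IH. Qed.

Lemma dart_efe a : rev (fnext (rev a)) = fprev (rev (fprev a)).
Proof. by rewrite /fprev revK /fnext revK /rot' rot3. Qed.

Lemma dart_ef2e a : rev (fnext (fnext (rev a))) = fprev (rev (fprev (fprev (rev (fprev a))))).
Proof.
have -> : fnext (rev a) = rev (rev (fnext (rev a))) by rewrite revK.
by rewrite dart_efe dart_efe.
Qed.

Lemma Us_Vs a : hexd (rev a) -> Us (Vs a) = Vs (Us a).
Proof.
move=> hx; rewrite /Us /Vs dart_ef2e fnextK fprevK.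
by rewrite /hexd /= in hx; rewrite -{1}hx !fnextK.
Qed.

Lemma base_step a : hexd (rev a) -> rot (fnext (Vs a)) = Ub (rot (fnext (Us a))).
Proof.
move=> hx; have rt c : rot c = fnext (rev c) by rewrite /fnext revK.
have ea : rev (fnext a) = fprev (rev (fprev (rev a))) by rewrite -dart_efe revK.
rewrite !rt /Ub !fnextK /Vs /Us ea fprevK dart_ef2e fprevK.
by rewrite /hexd /= in hx; rewrite -{1}hx !fnextK.
Qed.

Lemma typ_Us a z : typ a z -> typ (Us a) ((z.1 + 1)%R, z.2).
Proof.
move=> /typ_rev/typ_next'/typ_next'/typ_next'; congr typ; rewrite /zf /ze /=; congr pair; lia.
Qed.

Lemma typ_Ub a z : typ a z -> typ (Ub a) ((z.1 - 1)%R, z.2).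
Proof.
move=> /typ_prev/typ_prev/typ_prev/typ_rev; congr typ; rewrite /zp /ze /=; congr pair; lia.
Qed.

Lemma typ_Vs a z : typ a z -> typ (Vs a) (z.1, (z.2 + 1)%R).
Proof.
move=> /typ_next'/typ_rev/typ_next'/typ_next'; congr typ; rewrite /zf /ze /=; congr pair; lia.
Qed.

Lemma typ_Us_iter n a z : typ a z -> typ (iter n Us a) ((z.1 + Posz n)%R, z.2).
Proof.
move=> h; elim: n => [|n IH]; first by move: h; congr typ; case: (z) => x y; congr pair; rewrite /=; lia.
by have := typ_Us IH; congr typ; congr pair; rewrite /=; lia.
Qed.
Lemma typ_Ub_iter n a z : typ a z -> typ (iter n Ub a) ((z.1 - Posz n)%R, z.2).
Proof.
move=> h; elim: n => [|n IH]; first by move: h; congr typ; case: (z) => x y; congr pair; rewrite /=; lia.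
by have := typ_Ub IH; congr typ; congr pair; rewrite /=; lia.
Qed.
Lemma typ_Vs_iter n a z : typ a z -> typ (iter n Vs a) (z.1, (z.2 + Posz n)%R).
Proof.
move=> h; elim: n => [|n IH]; first by move: h; congr typ; case: (z) => x y; congr pair; rewrite /=; lia.
by have := typ_Vs IH; congr typ; congr pair; rewrite /=; lia.
Qed.

Lemma typ_hex a z : typ a z -> ~ inL k z -> hexd a.
Proof. by move=> h n; apply: hexd_size; apply/negP=> pa; apply: n; exact: typ_inL h pa. Qed.

Lemma notin_L (x y : int) : (0 < `|x|%N < k) -> ~ inL k (x, y).
Proof.
move=> xk [u [v [w [[e _] _]]]]; have : `|x|%N = k * `|u|%N by rewrite e abszM.
move: xk; move: `|x|%N `|u|%N; clear => n [|m] h e; move: h; rewrite e ?mulnS; lia.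
Qed.

(** A straight walk from a pentagon to the hexagon at the corner of its disc, where three discs
    meet; this is the centre of a face of the icosahedron with the pentagons as vertices. [phi]
    turns by a third around it and walks to the next pentagon. [opp] then reverses the edge of the
    icosahedron, with [fnext] as rotation about its vertices. *)
Definition Sx a := iter k.-1 Us a.
Definition Px a := rev (Sx a).
Definition Pb a := iter k.-1 Ub (rev a).
Definition phi a := Pb (fprev (fprev (Px a))).
Definition opp a := fprev (phi a).

Lemma PxK : cancel Px Pb. Proof. by move=> a; rewrite /Px /Pb revK /Sx Us_iterK. Qed.
Lemma PbK : cancel Pb Px. Proof. by move=> a; rewrite /Px /Pb /Sx Ub_iterK revK. Qed.
Lemma Px_phi a : Px (phi a) = fprev (fprev (Px a)). Proof. by rewrite /phi PbK. Qed.
Lemma f_opp a : fnext (opp a) = phi a. Proof. exact: fprevK. Qed.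

Lemma typ_Px d : pent (fc d) -> typ (Px d) ((- Posz k)%R, 0%R).
Proof.
move=> /typ_pent h; have := typ_rev (typ_Us_iter k.-1 h); congr typ.
by rewrite /ze /=; congr pair; move: k0; clear; lia.
Qed.

Lemma hex_Px d : pent (fc d) -> hexd (Px d).
Proof.
move=> pd; apply: (typ_hex (typ_Px pd)) => -[u [v [w [[e1 e2] e3]]]].
have v0 : v = 0%R by move: e2 k0; clear; nia.
have u1 : u = (-1)%R by move: e1 k0; clear; nia.
by move: e3; rewrite v0 u1; clear; lia.
Qed.

Lemma pent_phi d : pent (fc d) -> pent (fc (phi d)).
Proof.
move=> pd; have := typ_Ub_iter k.-1 (typ_rev (typ_prev (typ_prev (typ_Px pd)))) => /typ_zero; apply.
by exists (-2)%R, 1%R, (-1)%R; split=> //; rewrite /zp /ze /=; congr pair; move: k0; clear; lia.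
Qed.

Lemma fc_fprev a : fc (fprev a) = fc a. Proof. by rewrite -{2}(fprevK a) fc_next. Qed.

Lemma pent_opp d : pent (fc d) -> pent (fc (opp d)).
Proof. by move=> pd; rewrite fc_fprev pent_phi. Qed.

Lemma phi3 d : pent (fc d) -> phi (phi (phi d)) = d.
Proof.
move=> pd; apply: (can_inj PxK); rewrite !Px_phi.
exact: prev6 (hex_Px pd).
Qed.

Lemma hexd_rev_UV i j d : pent (fc d) -> j < k.-1 -> hexd (rev (iter i Vs (iter j Us d))).
Proof.
move=> /typ_pent h jk; have := typ_rev (typ_Vs_iter i (typ_Us_iter j h)) => /typ_hex; apply.
by rewrite /ze /=; apply: notin_L; move: jk; clear; lia.
Qed.

Lemma UV_iter i j d : pent (fc d) -> j < k.-1 -> Us (iter i Vs (iter j Us d)) = iter i Vs (iter j.+1 Us d).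
Proof.
move=> pd jk; elim: i => // i IH; rewrite [in LHS]iterS Us_Vs; last exact: hexd_rev_UV.
by rewrite IH.
Qed.

Definition base0 d := rot (fnext (Sx d)).

(** The i-th boundary dart of a side is also reached by k - 1 - i steps in one direction and i in
    the other. The two translations commute along the way because only hexagons are crossed. *)
Lemma base_line d i : pent (fc d) -> i <= k.-1 -> iter i Ub (base0 d) = rot (fnext (iter i Vs (iter (k.-1 - i) Us d))).
Proof.
move=> pd; elim: i => [|i IH] ik; first by rewrite subn0.
have e : k.-1 - i = (k.-1 - i.+1).+1 by move: ik; clear; lia.
have lt : k.-1 - i.+1 < k.-1 by move: ik; clear; lia.
rewrite iterS IH; last exact: ltnW.
rewrite e -UV_iter // -base_step; last exact: hexd_rev_UV.
by rewrite -iterS.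
Qed.

Lemma base_end d : pent (fc d) -> iter k.-1 Ub (base0 d) = rot (Sx (fnext d)).
Proof.
move=> pd; rewrite base_line // subnn /=; congr rot; rewrite /Sx.
by elim: k.-1 => //= n <-.
Qed.

Lemma rev_base0 d : rev (base0 d) = rot (Sx (fnext (opp d))).
Proof.
have rt c : rot c = fnext (rev c) by rewrite /fnext revK.
rewrite f_opp [RHS]rt -/(Px (phi d)) Px_phi fprevK /base0 rt.
by rewrite -{1}(revK (fnext (Sx d))) revK -{1}(revK (rev (fnext _))) dart_efe revK fnextK.
Qed.

Lemma typ_base0 d : pent (fc d) -> typ (base0 d) ((-1)%R, Posz k).
Proof.
move=> /typ_pent h; have := typ_rot (typ_next' (typ_Us_iter k.-1 h)); congr typ.
by rewrite /zr /zf /ze /=; congr pair; move: k0; clear; lia.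
Qed.

Lemma rev_base_line d i : pent (fc d) -> i <= k.-1 -> rev (iter i Ub (base0 d)) = iter i Us (rev (base0 d)).
Proof.
move=> pd; elim: i => // i IH ik.
have hx : hexd (iter i Ub (base0 d)).
  by apply: (typ_hex (typ_Ub_iter i (typ_base0 pd))); rewrite /=; apply: notin_L; move: ik; clear; lia.
by rewrite [iter i.+1 Ub _]iterS [RHS]iterS -IH ?(ltnW ik) // /Ub /Us !revK (hex_prev3 hx).
Qed.

(** The side facing [d], read backwards from the neighbouring disc, is the side facing [opp d]. Its
    two ends exchange roles, so applying [opp] twice returns to the start. *)
Lemma opp2 d : pent (fc d) -> opp (opp d) = d.
Proof.
move=> pd; have po := pent_opp pd.
have e1 : rev (rot (Sx (fnext d))) = base0 (opp d).
  rewrite -(base_end pd) rev_base_line // rev_base0 -(base_end po); exact: Ub_iterK.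
have e2 : rot (Sx (fnext (opp (opp d)))) = rot (Sx (fnext d)) by rewrite -rev_base0 -e1 revK.
apply: (can_inj (@fnextK M)); apply: (can_inj (Us_iterK k.-1)); exact: (can_inj (@rotK M)) e2.
Qed.

Lemma maut_opp g d : maut g -> g (opp d) = opp (g d).
Proof.
move=> mg; case: (mg) => _ gr.
have gU n a : g (iter n Us a) = iter n Us (g a).
  by elim: n => // n IH; rewrite !iterS -IH /Us !(maut_next _ mg) gr.
have gB n a : g (iter n Ub a) = iter n Ub (g a).
  by elim: n => // n IH; rewrite !iterS -IH /Ub gr !(maut_prev _ mg).
by rewrite /opp (maut_prev _ mg) /phi /Pb gB gr !(maut_prev _ mg) /Px gr gU.
Qed.

Lemma mrev_pent g d : mrev g -> pent (fc d) -> pent (fc (g d)).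
Proof.
move=> mg pd; apply/negPn/negP=> /hexd_size/prev6 h6.
have h5 : iter 5 (@fprev M) (g d) = g d.
  by rewrite -[RHS](congr1 g (pent5 pd)) /=; case: mg => _ h; rewrite !h.
move: h6; rewrite iterS h5 => h1; have := fnext_neq (g d); by rewrite -{1}h1 fprevK eqxx.
Qed.

(** A reflection conjugates the third-turn [phi] into its inverse; the identity follows by writing
    [phi] as [fnext] after [opp] and using that [opp] is an involution. *)
Lemma mrev_opp g d : mrev g -> pent (fc d) -> g (opp d) = fnext (opp (fprev (g d))).
Proof.
move=> mg pd; case: (mg) => gr gf.
have gS n a : pent (fc a) -> n <= k.-1 -> g (iter n Us a) = iter n Us (g a).
  move=> pa; elim: n => // n IH nk; have hx := @hexd_rev_UV 0 n _ (mrev_pent mg pa) nk.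
  by rewrite !iterS -IH ?(ltnW nk) // in hx *; rewrite /Us !gf gr -(hex_prev3 hx).
have gP a : pent (fc a) -> g (Px a) = Px (g a) by move=> pa; rewrite /Px gr /Sx gS.
have e1 : phi (g (phi d)) = g d.
  apply: (can_inj PxK); rewrite Px_phi -gP ?pent_phi // Px_phi.
  by rewrite !(mrev_prev _ mg) !fnextK gP.
have pg : pent (fc (fprev (g (opp d)))) by rewrite fc_fprev mrev_pent ?pent_opp.
have e2 : g (phi d) = fprev (g (opp d)) by rewrite -f_opp gf.
have e3 : fprev (g d) = opp (fprev (g (opp d))) by rewrite -e1 e2.
by rewrite e3 opp2 // fprevK.
Qed.

End Tiled.

(** * The icosahedral group *)

Section Icosahedral.
Local Open Scope group_scope.
Variable M : fmap.
Local Notation D := (dart M).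
Variable opp : D -> D.
Hypothesis pent_opp : forall d, pent (fc d) -> pent (fc (opp d)).
Hypothesis opp2 : forall d, pent (fc d) -> opp (opp d) = d.
Hypothesis opp3 : forall d, pent (fc d) -> fnext (opp (fnext (opp (fnext (opp d))))) = d.
Hypothesis rotE : forall d1 d2 : D, pent (fc d1) -> pent (fc d2) -> exists2 g, maut g & g d1 = d2.
Hypothesis refE : forall d1 d2 : D, pent (fc d1) -> pent (fc d2) -> exists2 g, mrev g & g d1 = d2.
Hypothesis maut_opp : forall (g : D -> D) d, maut g -> g (opp d) = opp (g d).
Hypothesis mrev_opp : forall (g : D -> D) d, mrev g -> pent (fc d) -> g (opp d) = fnext (opp (fprev (g d))).

Variables (gT : finGroupType) (a b c : gT).
Hypothesis a5 : a ^+ 5 = 1.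
Hypothesis b2 : b * b = 1.
Hypothesis ba3 : (b * a) ^+ 3 = 1.
Hypothesis b1 : b != 1.
Hypothesis ba1 : b * a != 1.
Hypothesis c2 : c * c = 1.
Hypothesis ac : a * c = c * a^-1.
Hypothesis bc : b * c = c * a^-1 * b * a.
Hypothesis gen : forall P : gT -> Prop, P 1 -> (forall g, P g -> P (g * a)) -> (forall g, P g -> P (g * b)) -> forall g, P g.
Hypothesis card60 : #|gT| = 60%N.
Hypothesis simG : simple [set: gT].

(** The Cayley map: darts are group elements, g and g b form an edge, and the cosets of [a] are
    faces of size 5. All 60 darts are at pentagons, so [product_graph] maps it to the pentagon darts
    with their icosahedral structure. *)
Lemma flags_ex : exists T : gT -> D, [/\ forall g, pent (fc (T g)), forall g, T (g * a) = fnext (T g) & forall g, T (g * b) = opp (T g)].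
Proof.
have [d0 pd0] : exists d : D, pent (fc d).
  have : 0 < #|[set d : D | pent (fc d)]| by rewrite card_pent_darts.
  by case/card_gt0P=> d; rewrite inE; exists d.
pose Th := {d : D | pent (fc d)}.
pose fT (x : Th) : Th := exist _ (fnext (val x)) (etrans (congr1 (@pent M) (fc_next (val x))) (valP x)).
pose oT (x : Th) : Th := exist _ (opp (val x)) (pent_opp (valP x)).
have ooT : involutive oT by move=> x; apply: val_inj; exact: opp2 (valP x).
have gen1 (P : gT -> Prop) x : P x -> (forall g, P g -> P (g * b)) -> (forall g, P g -> P (g * b * a)) -> forall g, P g.
  move=> Px Pb Pr g; have := @gen (fun g => P (x * g)); rewrite mulg1 => /(_ Px) h.
  have {}h g' : P (x * g').
    apply: h => g'' Pg; rewrite mulgA; last exact: Pb.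
    by have := Pr _ (Pb _ Pg); rewrite -(mulgA _ b b) b2 mulg1.
  by have := h (x^-1 * g); rewrite mulKVg.
have [] := @product_graph gT Th (fun g => g * b * a) (fun g => g * b) (fun x => fT (oT x)) oT xpredT 1 (exist _ d0 pd0)
  _ _ _ ooT _ _ gen1 _ (fun _ => erefl) (fun _ _ => True) I (fun _ _ _ => I) (fun _ _ _ => I).
- by move=> g; rewrite -!mulgA [a * _]mulgA; move: ba3; rewrite !expgS expg0 mulg1 -!mulgA => ->; rewrite mulg1.
- by move=> g; rewrite -mulgA b2 mulg1.
- by move=> x; apply: val_inj; exact: opp3 (valP x).
- by move=> g; rewrite -mulgA -{2}(mulg1 g) (inj_eq (mulgI g)).
- by move=> g; rewrite -{2}(mulg1 g) (inj_eq (mulgI g)).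
- by rewrite -card60 -cardsT; apply: eq_card => g; rewrite !inE.
- move=> g x _ _; split; first by rewrite /= -!(mulgA _ b b) b2 !mulg1 -!mulgA; move: a5; rewrite !expgS expg0 mulg1 => ->; rewrite mulg1.
  by rewrite /= !ooT; apply: val_inj; exact: pent5 (valP x).
- by [].
move=> T [_ h1 h2]; exists (fun g => val (T g)); split=> g; first exact: (valP (T g)).
  by have := h2 (g * b); rewrite -(mulgA g b b) b2 mulg1 => ->; rewrite h1 ooT.
by rewrite h1.
Qed.

Lemma maut_pent (g : D -> D) d : maut g -> pent (fc d) -> pent (fc (g d)).
Proof.
move=> mg pd; apply/negPn/negP=> /hexd_size h6.
have h5 : iter 5 (@fnext M) (g d) = g d.
  by rewrite -[RHS](congr1 g (pent5 pd)) /= !(maut_next _ mg).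
move: h6; rewrite /hexd iterS h5 => h1; have := fnext_neq (g d); by rewrite h1 eqxx.
Qed.

(** Through [T] the rotations act by left multiplication. The reflection taking [T 1] to [T c] acts
    by right multiplication by [c], so it commutes with all rotations: it is the central inversion.
    The relations [ac] and [bc] match the behaviour of reflections towards [fnext] and [opp]. *)
Theorem icosahedral : exists (psi : gT -> D -> D) (kap : D -> D),
  [/\ forall g, maut (psi g), mrev kap, forall g h x, psi (g * h) x = psi g (psi h x), forall g h, psi g =1 psi h -> g = h
    & [/\ forall x, kap (kap x) = x, forall g x, kap (psi g x) = psi g (kap x),
          forall g, maut g -> exists h, g =1 psi h & forall g, mrev g -> exists h, g =1 psi h \o kap]].
Proof.
have [T [pT Ta Tb]] := flags_ex.
have [psi hpsi] := fin_all_exists (fun g : gT => let: ex_intro2 u v w := rotE (pT 1) (pT g) in ex_intro (fun p : D -> D => maut p /\ p (T 1) = T g) u (conj v w)).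
have mpsi g : maut (psi g) by have [] := hpsi g.
have psi1 g : psi g (T 1) = T g by have [] := hpsi g.
have psiT g h : psi g (T h) = T (g * h).
  move: h; apply: gen => [|h IH|h IH]; first by rewrite psi1 mulg1.
    by rewrite mulgA !Ta (maut_next _ (mpsi g)) IH.
  by rewrite mulgA !Tb (maut_opp _ (mpsi g)) IH.
have psiM g h x : psi (g * h) x = psi g (psi h x).
  apply: (maut_eq (a := T 1) (mpsi _) (maut_comp (mpsi g) (mpsi h))).
  by rewrite /= psi1 (psi1 h) psiT.
have mid : maut (fun x : D => x) by split.
(* The elements acting trivially form a normal subgroup, which is not everything since [fnext] moves
   darts; simplicity makes it trivial. *)
have Tinj : injective T.
  pose K := [set g | T g == T 1].
  have Kid g x : g \in K -> psi g x = x.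
    by rewrite inE => /eqP e; apply: (maut_eq (a := T 1) (mpsi g) mid); rewrite psi1.
  have KP g : (forall x, psi g x = x) -> g \in K by move=> h; rewrite inE -psi1 h.
  have gK : group_set K.
    apply/group_setP; split; first by rewrite inE.
    by move=> x y xK yK; apply: KP => z; rewrite psiM !Kid.
  have nK : Group gK <| [set: gT].
    rewrite /normal subsetT; apply/subsetP=> x _; rewrite inE; apply/subsetP=> y /imsetP[g gK' ->].
    by apply: KP => z; rewrite /conjg psiM psiM (Kid g) // -psiM mulVg (Kid 1) // inE.
  have /simpleP[_ /(_ _ nK)[/= e|/= e]] := simG; last first.
    have : a \in K by rewrite e inE.
    by rewrite inE -{1}(mul1g a) Ta => /eqP h; have := fnext_neq (T 1); rewrite h eqxx.
  move=> g h eT; have : g^-1 * h \in K.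
    by rewrite inE -psiT -eT psiT mulVg.
  by rewrite e; move/set1P => h'; rewrite -[g]mulg1 -h' mulKVg.
have Tsurj d : pent (fc d) -> exists g, T g = d.
  move=> pd; have : T @: [set: gT] = [set d : D | pent (fc d)].
    apply/eqP; rewrite eqEcard card_imset // cardsT card60 card_pent_darts leqnn andbT.
    by apply/subsetP=> _ /imsetP[g _ ->]; rewrite inE.
  by move/setP/(_ d); rewrite inE pd => /imsetP[g _ ->]; exists g.
(* Sending [T 1] to [T c], rather than fixing it, selects the inversion among the reflections. *)
have [kap mk k1] := refE (pT 1) (pT c).
have kT h : kap (T h) = T (h * c).
  move: h; apply: gen => [|h IH|h IH]; first by rewrite k1 mul1g.
    rewrite Ta; case: (mk) => _ ->; rewrite IH -mulgA ac mulgA.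
    by apply: (can_inj (@fnextK M)); rewrite fprevK -Ta mulgKV.
  rewrite Tb mrev_opp // IH -mulgA bc !mulgA Ta Tb; congr (fnext (opp _)).
  by apply: (can_inj (@fnextK M)); rewrite fprevK -Ta mulgKV.
have kk x : kap (kap x) = x.
  by apply: (maut_eq (a := T 1) (mrev_mrev mk mk) mid); rewrite /= !kT mul1g c2.
exists psi, kap; split=> //.
  by move=> g h eq; apply: Tinj; have := eq (T 1); rewrite (psi1 g) (psi1 h).
have all g : maut g -> exists h, g =1 psi h.
  move=> mg; have [h eh] := Tsurj _ (maut_pent mg (pT 1)); exists h.
  by apply: (maut_eq (a := T 1) mg (mpsi h)); rewrite psi1.
split=> //.
  move=> g x; apply: (mrev_eq (a := T 1) (mrev_maut mk (mpsi g)) (maut_mrev (mpsi g) mk)).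
  by rewrite /= psi1 !kT psiT mul1g.
move=> g mg; have [h eh] := all _ (mrev_mrev mg mk); exists h => x /=.
by rewrite -eh /= kk.
Qed.

End Icosahedral.

(** * Generators of the alternating group of degree 5 *)

Section Alt5.
Local Open Scope group_scope.

Definition o5 n (h : n < 5) : 'I_5 := Ordinal h.
(** The permutations (0 1 2 3 4), (1 2)(3 4) and (0 1)(2 4), given by tables so that the relations
    can be computed: a fifth-turn about a vertex of the icosahedron, a half-turn about an edge, and
    a half-turn inverting the first. *)
Definition cy5 (i : 'I_5) : 'I_5 := nth (o5 (isT : 0 < 5)) [:: o5 (isT : 1 < 5); o5 (isT : 2 < 5); o5 (isT : 3 < 5); o5 (isT : 4 < 5); o5 (isT : 0 < 5)] i.
Definition be5 (i : 'I_5) : 'I_5 := nth (o5 (isT : 0 < 5)) [:: o5 (isT : 0 < 5); o5 (isT : 2 < 5); o5 (isT : 1 < 5); o5 (isT : 4 < 5); o5 (isT : 3 < 5)] i.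
Definition ga5 (i : 'I_5) : 'I_5 := nth (o5 (isT : 0 < 5)) [:: o5 (isT : 1 < 5); o5 (isT : 0 < 5); o5 (isT : 4 < 5); o5 (isT : 3 < 5); o5 (isT : 2 < 5)] i.

Ltac ord5 i := case: i => -[|[|[|[|[|?]]]]] ? //=; apply: val_inj.

Lemma cy5_inj : injective cy5.
Proof. by apply: (can_inj (g := fun i => cy5 (cy5 (cy5 (cy5 i))))) => i; ord5 i. Qed.
Lemma be5K : involutive be5. Proof. by move=> i; ord5 i. Qed.
Lemma ga5K : involutive ga5. Proof. by move=> i; ord5 i. Qed.

Definition al : {perm 'I_5} := perm cy5_inj.
Definition be : {perm 'I_5} := perm (inv_inj be5K).
Definition ga : {perm 'I_5} := perm (inv_inj ga5K).

Lemma al5 : al ^+ 5 = 1.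
Proof. by apply/permP=> i; rewrite !expgS expg0 mulg1 !permM !permE; ord5 i. Qed.
Lemma be2 : be * be = 1.
Proof. by apply/permP=> i; rewrite !permM !permE; ord5 i. Qed.
Lemma beal3 : (be * al) ^+ 3 = 1.
Proof. by apply/permP=> i; rewrite !expgS expg0 mulg1 !permM !permE; ord5 i. Qed.
Lemma ga2 : ga * ga = 1.
Proof. by apply/permP=> i; rewrite !permM !permE; ord5 i. Qed.
Lemma alga : al * ga = ga * al^-1.
Proof.
apply: (mulIg al); rewrite mulgKV.
by apply/permP=> i; rewrite !permM !permE; ord5 i.
Qed.
Lemma bega : be * ga = ga * al^-1 * be * al.
Proof.
have -> : al^-1 = al ^+ 4 by apply: (mulgI al); rewrite mulgV -expgS al5.
by apply/permP=> i; rewrite !expgS expg0 mulg1 !permM !permE; ord5 i.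
Qed.
Lemma be_neq1 : be != 1.
Proof. by apply/eqP=> /permP/(_ (o5 (isT : 1 < 5))); rewrite !permE => /(congr1 val). Qed.
Lemma al_neq1 : al != 1.
Proof. by apply/eqP=> /permP/(_ (o5 (isT : 1 < 5))); rewrite !permE => /(congr1 val). Qed.
Lemma beal_neq1 : be * al != 1.
Proof. by apply/eqP=> /permP/(_ (o5 (isT : 0 < 5))); rewrite permM !permE => /(congr1 val). Qed.

Lemma al_Alt : al \in 'Alt_('I_5).
Proof.
rewrite Alt_even; have := congr1 (@odd_perm _) al5; rewrite !expgS expg0 mulg1 !odd_permM odd_perm1.
by case: (odd_perm al).
Qed.
Lemma be_Alt : be \in 'Alt_('I_5).
Proof.
have h : be * al \in 'Alt_('I_5).
  rewrite Alt_even; have := congr1 (@odd_perm _) beal3; rewrite !expgS expg0 mulg1 !odd_permM odd_perm1.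
  by case: (odd_perm be (+) odd_perm al).
by rewrite -(mulgK al be) groupM ?groupV ?al_Alt.
Qed.
Lemma ga_Alt : ga \in 'Alt_('I_5).
Proof.
have -> : ga = tperm (o5 (isT : 0 < 5)) (o5 (isT : 1 < 5)) * tperm (o5 (isT : 2 < 5)) (o5 (isT : 4 < 5)).
  by apply/permP=> i; rewrite permM !permE; ord5 i.
by rewrite Alt_even odd_permM !odd_tperm.
Qed.

Lemma card_Alt5 : #|'Alt_('I_5)| = 60%N.
Proof. by have := @card_Alt 'I_5; rewrite card_ord => /(_ isT); rewrite -[5`!]/120%N; lia. Qed.

(** Elements of orders 2, 3 and 5 make 30 divide the order, and a subgroup of index 2 would be
    normal, against simplicity. *)
Lemma Alt5_gen : <<[set al; be]>> = 'Alt_('I_5).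
Proof.
pose H : {group {perm 'I_5}} := <<[set al; be]>>%G; change (H :=: 'Alt_('I_5)); have sH : H \subset 'Alt_('I_5).
  by rewrite gen_subG; apply/subsetP=> x /set2P[]->; [exact: al_Alt|exact: be_Alt].
have alH : al \in H by apply: mem_gen; rewrite !inE eqxx.
have beH : be \in H by apply: mem_gen; rewrite !inE eqxx orbT.
have dvd (x : {perm 'I_5}) n : prime n -> x \in H -> x ^+ n = 1 -> x != 1 -> n %| #|H|.
  by move=> pn xH xn x1; have := order_dvdG xH; rewrite (nt_prime_order pn xn x1).
have d5 := dvd al 5%N isT alH al5 al_neq1.
have d2 := dvd be 2%N isT beH be2 be_neq1.
have d3 := dvd (be * al) 3%N isT (groupM beH alH) beal3 beal_neq1.
have d60 : #|H| %| 60 by rewrite -card_Alt5 cardSg.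
have [e|e] : #|H| = 30%N \/ #|H| = 60%N.
  have : #|H| <= 60 by rewrite dvdn_leq.
  move: d60 d2 d3 d5 (cardG_gt0 H); move: #|H|; clear => n; lia.
  have nH : H <| 'Alt_('I_5).
    by apply: index2_normal => //; rewrite -divgS // card_Alt5 e.
  have /simpleP[_ /(_ _ nH)[h|h]] := simple_Alt5 (T := 'I_5) (ltac:(by rewrite card_ord)).
    by move: e; rewrite h cards1.
  by move: e; rewrite h card_Alt5.
by apply/eqP; rewrite eqEcard sH card_Alt5 e.
Qed.

End Alt5.

(** * The main theorem *)

Section Alt5Group.
Local Open Scope group_scope.
Local Notation G5 := ('Alt_('I_5)%G).
Definition A5T := subg_of G5.
Definition a5 : A5T := subg G5 al.
Definition b5 : A5T := subg G5 be.
Definition c5 : A5T := subg G5 ga.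

Lemma a5E : sgval a5 = al. Proof. by rewrite subgK ?al_Alt. Qed.
Lemma b5E : sgval b5 = be. Proof. by rewrite subgK ?be_Alt. Qed.
Lemma c5E : sgval c5 = ga. Proof. by rewrite subgK ?ga_Alt. Qed.

Lemma sgval_inj5 : injective (@sgval _ G5). Proof. exact: subg_inj. Qed.
Lemma sgvM (x y : A5T) : sgval (x * y) = sgval x * sgval y. Proof. by []. Qed.
Lemma sgvV (x : A5T) : sgval (x^-1) = (sgval x)^-1. Proof. by []. Qed.
Lemma sgvX (x : A5T) n : sgval (x ^+ n) = sgval x ^+ n.
Proof. by elim: n => // n IH; rewrite !expgS sgvM IH. Qed.

Lemma A5_gen (P : A5T -> Prop) : P 1 -> (forall g, P g -> P (g * a5)) -> (forall g, P g -> P (g * b5)) -> forall g, P g.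
Proof.
move=> P1 Pa Pb g.
have : sgval g \in <<[set al; be]>> by rewrite Alt5_gen subgP.
move=> /gen_prodgP[n [cc hc eg]].
suff [h eh Ph] : exists2 h : A5T, sgval h = \prod_i cc i & P h.
  by have -> // : g = h; apply: sgval_inj5; rewrite eg eh.
elim: n cc hc {eg} => [|n IH] cc hc; first by exists 1 => //; rewrite big_ord0.
have [|h eh Ph] := IH (fun i => cc (widen_ord (leqnSn n) i)); first by move=> i; apply: hc.
rewrite big_ord_recr /=; have /set2P[e|e] := hc ord_max; rewrite e.
  by exists (h * a5); [rewrite sgvM eh a5E|exact: Pa].
by exists (h * b5); [rewrite sgvM eh b5E|exact: Pb].
Qed.

Lemma card_A5T : #|{: A5T}| = 60%N.
Proof. by rewrite -card_Alt5 -cardsT; have := card_isog (isog_subg G5) => ->. Qed.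

Lemma simple_A5T : simple [set: A5T].
Proof. by rewrite -(isog_simple (isog_subg G5)) simple_Alt5 // card_ord. Qed.

Lemma a5_5 : a5 ^+ 5 = 1. Proof. by apply: sgval_inj5; rewrite sgvX a5E al5. Qed.
Lemma b5_2 : b5 * b5 = 1. Proof. by apply: sgval_inj5; rewrite sgvM b5E be2. Qed.
Lemma b5a5_3 : (b5 * a5) ^+ 3 = 1. Proof. by apply: sgval_inj5; rewrite sgvX sgvM b5E a5E beal3. Qed.
Lemma b5_neq1 : b5 != 1.
Proof. by apply: contra be_neq1 => /eqP e; rewrite -b5E e. Qed.
Lemma b5a5_neq1 : b5 * a5 != 1.
Proof. by apply: contra beal_neq1 => /eqP e; rewrite -b5E -a5E -sgvM e. Qed.
Lemma c5_2 : c5 * c5 = 1. Proof. by apply: sgval_inj5; rewrite sgvM c5E ga2. Qed.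
Lemma a5c5 : a5 * c5 = c5 * a5^-1.
Proof. by apply: sgval_inj5; rewrite !sgvM sgvV a5E c5E alga. Qed.
Lemma b5c5 : b5 * c5 = c5 * a5^-1 * b5 * a5.
Proof. by apply: sgval_inj5; rewrite !sgvM sgvV a5E b5E c5E bega. Qed.

End Alt5Group.

(** * Comparison with the square root of 12 n / 5 *)

Section Numbers.
Import Order.TTheory GRing.Theory Num.Theory.
Local Open Scope ring_scope.

Lemma sq_bound (t n : nat) : (t%:R <= sqrtC (12%:R / 5%:R * n%:R :> algC)) = (5 * t ^ 2 <= 12 * n)%N.
Proof.
have y0 : (0 : algC) <= 12%:R / 5%:R * n%:R by rewrite mulr_ge0 ?divr_ge0 ?ler0n.
have s0 : (0 : algC) <= sqrtC (12%:R / 5%:R * n%:R) by rewrite sqrtC_ge0.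
rewrite -(ler_pXn2r (n := 2)) ?nnegrE ?ler0n // sqrtCK.
rewrite -(ler_nat algC) -mulnn !natrM expr2 [12%:R / _ * _]mulrAC ler_pdivlMr ?ltr0n //.
by rewrite [X in X <= _]mulrC.
Qed.

Lemma sq_eq (t n : nat) : (t%:R = sqrtC (12%:R / 5%:R * n%:R :> algC)) <-> (5 * t ^ 2 = 12 * n)%N.
Proof.
have y0 : (0 : algC) <= 12%:R / 5%:R * n%:R by rewrite mulr_ge0 ?divr_ge0 ?ler0n.
have f0 : (5%:R : algC) != 0 by rewrite pnatr_eq0.
have key : (t%:R ^+ 2 = 12%:R / 5%:R * n%:R :> algC) <-> (5 * t ^ 2 = 12 * n)%N.
  split=> [e|/(congr1 (fun m => m%:R : algC))]; last first.
    by rewrite -mulnn !natrM => e; apply: (mulfI f0); rewrite expr2 e mulrA [5%:R * _]mulrC divfK.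
  by apply/eqP; rewrite -(eqr_nat algC) -mulnn !natrM -expr2 e mulrA [5%:R * _]mulrC divfK.
rewrite -key; split=> [->|e]; first by rewrite sqrtCK.
by rewrite -e sqrCK // ler0n.
Qed.

End Numbers.

Lemma orientation (M : fmap) (g g' : dart M -> dart M) : maut g -> mrev g' -> (forall a, rev (g' a) = g a) -> False.
Proof.
move=> [h1 _] [h2 h3] e; have [a _] := dart_ex M.
have := h1 a; rewrite -!e -{1}(revK a) -[rot (rev _)]/(fnext (rev a)) h3 h2 /fprev revK => e2.
by have := rot_neq (rot (rev (g' a))); rewrite -[rot (rot _)]/(rot' (rev (g' a))) e2 eqxx.
Qed.

(** * Automorphisms of a fullerene graph and of its map *)

Section Main.
Variables (V : finType) (adj : rel V).
Hypothesis irr : irreflexive adj.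
Hypothesis sym : symmetric adj.
Hypothesis cub : cubic adj.
Hypothesis con : connected_graph adj.
Hypothesis br : bridgeless adj.
Variable rho : {perm arc adj}.
Hypothesis rs : rotation_system rho.
Hypothesis eul : #|V| + #|faces rho| = #|edges adj| + 2.
Hypothesis fsz : forall a, face_size rho a = 5 \/ face_size rho a = 6.
Let M := the_map irr sym cub con rs eul fsz.
Local Notation D := (dart M).
Implicit Types (p q : {perm V}).

Lemma packing_bound : exists F : {set {set face M + edge M}}, [/\ 2 * tau_odd adj <= #|F|, 5 * #|F| ^ 2 <= 48 * #|V|,
  {in F, forall Z, good Z} & {in F &, forall Z1 Z2, Z1 != Z2 -> lam Z1 Z2 && nocom (@hs M) (@ht M) Z1 Z2}].
Proof.
have [S [F [e gF lF]]] := map_packing M; exists F; split=> //; first by rewrite -e; exact: tau_le.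
have [le _] := area gF lF (subxx F); apply: (leq_trans le).
by apply: leq_trans (leq_mul (KA_le F) (MA_le F)) _; rewrite mulnA.
Qed.

Lemma tau_bound : 5 * tau_odd adj ^ 2 <= 12 * #|V|.
Proof. have [F [h1 h2 _ _]] := packing_bound; move: h1 h2; clear; nia. Qed.

Lemma even_V : exists m, #|V| = 2 * m.
Proof.
have := card_dartV M; rewrite card_dartE; have -> : #|vert M| = #|V| by [].
move: #|edge M| => m h; exists (m - #|V|); move: h; clear; lia.
Qed.

(** Both 2 and 3 divide tau, so tau = 6 j and |V| = 15 j^2; a cubic graph has an even number of
    vertices, so j is even as well. *)
Lemma tau_tight : 5 * tau_odd adj ^ 2 = 12 * #|V| -> exists k, [/\ 0 < k, #|V| = 60 * k ^ 2 & tau_odd adj = 12 * k].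
Proof.
move=> e; have [m em] := even_V.
have n0 : 0 < #|V| by have [a _] := dart_ex M; apply/card_gt0P; exists (vt a).
have d2 : 2 %| tau_odd adj.
  have : 2 %| tau_odd adj ^ 2 by rewrite -(@Gauss_dvdr 2 5) // e -(mulnA 2 6) dvdn_mulr.
  by rewrite Euclid_dvdX // => /andP[].
have d3 : 3 %| tau_odd adj.
  have : 3 %| tau_odd adj ^ 2 by rewrite -(@Gauss_dvdr 3 5) // e -(mulnA 3 4) dvdn_mulr.
  by rewrite Euclid_dvdX // => /andP[].
have /dvdnP[j ej] : 6 %| tau_odd adj by rewrite (@Gauss_dvd 2 3) // d2.
have e2 : #|V| = 15 * j ^ 2 by move: e; rewrite ej; clear; nia.
have /dvdnP[k ek] : 2 %| j.
  have : 2 %| j ^ 2 by rewrite -(@Gauss_dvdr 2 15) // -e2 em dvdn_mulr.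
  by rewrite Euclid_dvdX // => /andP[].
have e3 : #|V| = 60 * k ^ 2 by rewrite e2 ek; clear; nia.
have k0 : 0 < k by move: n0; rewrite e3; case: (k).
by exists k; split=> //; rewrite ej ek; clear; lia.
Qed.

(** The action on darts; the default is returned only if the image is not an arc, never for
    automorphisms. *)
Definition pd p (a : arc adj) : arc adj := insubd a (p (val a).1, p (val a).2).

Lemma AutP p : reflect (forall u v, adj (p u) (p v) = adj u v) (p \in Aut_graph adj).
Proof.
rewrite inE; apply: (iffP forallP) => [h u v|h u]; first by have /forallP/(_ v)/eqP := h u.
by apply/forallP=> v; rewrite h.
Qed.

Lemma val_pd p a : p \in Aut_graph adj -> val (pd p a) = (p (val a).1, p (val a).2).
Proof. by move=> /AutP h; rewrite /pd val_insubd /= h (valP a). Qed.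

Lemma vtE (a : D) : vt a = (val a).1. Proof. by []. Qed.
Lemma revE (a : D) : val (rev a) = ((val a).2, (val a).1). Proof. exact: val_rev. Qed.

Lemma pd_rev p (a : D) : p \in Aut_graph adj -> pd p (rev a) = rev (pd p a : D).
Proof. by move=> h; apply: val_inj; rewrite val_pd // revE [RHS]revE val_pd. Qed.

Lemma pd_inj p : p \in Aut_graph adj -> injective (pd p).
Proof.
move=> h a b /(congr1 val); rewrite !val_pd // => -[/perm_inj e1 /perm_inj e2]; apply: val_inj.
by move: e1 e2; rewrite [val a]surjective_pairing [val b]surjective_pairing /= => -> ->.
Qed.

(** An orientation-reversing automorphism exchanges the two sides of darts, and composition with
    [rev] undoes this. *)
Lemma pd_sign p : p \in Aut_graph adj -> maut (pd p : D -> D) \/ mrev (fun a : D => rev (pd p a : D)).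
Proof.
move=> h; have [|||hs|hs] := @graph_aut_map_aut M (the_noloop br) (pd p).
- exact: pd_inj.
- by move=> a; exact: pd_rev.
- by move=> a c; rewrite !vtE !val_pd // (inj_eq perm_inj).
- by left; split=> // a; exact: pd_rev.
- right; split=> a; first by rewrite pd_rev.
  by rewrite /fnext hs pd_rev.
Qed.

Lemma pd_eq p q : p \in Aut_graph adj -> q \in Aut_graph adj -> pd p =1 pd q -> p = q.
Proof.
move=> hp hq e; apply/permP=> v; have [a ea] := src_surj cub v.
by have := congr1 val (e a); rewrite !val_pd // ea => -[].
Qed.

Lemma pd_comp p q : p \in Aut_graph adj -> q \in Aut_graph adj -> (p * q)%g \in Aut_graph adj /\ forall a, pd (p * q)%g a = pd q (pd p a).
Proof.
move=> hp hq; have hpq : (p * q)%g \in Aut_graph adj.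
  by apply/AutP=> u v; rewrite !permM; move/AutP: hq => ->; move/AutP: hp => ->.
by split=> // a; apply: val_inj; rewrite !val_pd // !permM.
Qed.

Lemma pd1 : (1%g : {perm V}) \in Aut_graph adj /\ forall a, pd 1%g a = a.
Proof.
have h : (1%g : {perm V}) \in Aut_graph adj by apply/AutP=> u v; rewrite !perm1.
by split=> // a; apply: val_inj; rewrite val_pd // !perm1; case: (val a).
Qed.

Lemma Aut_group_set : group_set (Aut_graph adj).
Proof.
apply/group_setP; split; first by have [] := pd1.
by move=> p q hp hq; have [] := pd_comp hp hq.
Qed.

Lemma aut_of_dart (g : D -> D) : injective g -> (forall a, g (rev a) = rev (g a)) ->
  (forall a b, vt a = vt b -> vt (g a) = vt (g b)) -> exists2 p, p \in Aut_graph adj & pd p =1 g.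
Proof.
move=> gi gr gv; have [dv hdv] := fin_all_exists (src_surj cub).
pose f (v : vert M) : vert M := vt (g (dv v)).
have fE (a : D) : f (vt a) = vt (g a) by apply: gv; rewrite vtE hdv.
have fi : injective f.
  move=> v w; have [a <-] := vt_surj (f := M) v; have [b <-] := vt_surj (f := M) w; rewrite !fE => e.
  have im : g @: [set c | vt c == vt a] = [set c | vt c == vt (g a)].
    apply/eqP; rewrite eqEcard card_imset // !card_vfiber leqnn andbT.
    by apply/subsetP=> y /imsetP[c]; rewrite !inE => /eqP hc ->; rewrite (gv _ _ hc).
  have : g b \in g @: [set c | vt c == vt a] by rewrite im inE e.
  by rewrite mem_imset // inE => /eqP.
have gE (a : D) : val (g a) = (f (val a).1, f (val a).2).
  have e1 : (val (g a)).1 = f (val a).1 by rewrite -vtE -fE.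
  have e2 : (val (g a)).2 = f (val a).2.
    by have := fE (rev a); rewrite gr !vtE !revE.
  by rewrite -e1 -e2; case: (val _).
have [g' gK g'K] := injF_bij gi.
exists (perm fi).
  apply/AutP=> u v; rewrite !permE; apply/idP/idP=> h.
    pose c : D := exist (fun x : V * V => adj x.1 x.2) (f u, f v) h.
    have := gE (g' c); rewrite g'K /= => -[/fi e1 /fi e2].
    by have := valP (g' c); rewrite /= -e1 -e2.
  pose c : D := exist (fun x : V * V => adj x.1 x.2) (u, v) h.
  by have := valP (g c); rewrite gE.
have hA : perm fi \in Aut_graph adj.
  apply/AutP=> u v; rewrite !permE; apply/idP/idP=> h.
    pose c : D := exist (fun x : V * V => adj x.1 x.2) (f u, f v) h.
    have := gE (g' c); rewrite g'K /= => -[/fi e1 /fi e2].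
    by have := valP (g' c); rewrite /= -e1 -e2.
  pose c : D := exist (fun x : V * V => adj x.1 x.2) (u, v) h.
  by have := valP (g c); rewrite gE.
by move=> a; apply: val_inj; rewrite val_pd // !permE -gE.
Qed.

Lemma maut_vt (g : D -> D) a b : maut g -> vt a = vt b -> vt (g a) = vt (g b).
Proof. by move=> [h _] /eqP; rewrite vt_eq => /or3P[] /eqP->; rewrite ?h ?vt_rot. Qed.

Lemma mrev_inj (g : D -> D) : mrev g -> injective g.
Proof. by move=> h x y e; apply: (maut_inj (mrev_mrev h h)); rewrite /= e. Qed.

Lemma mrev_vt (g : D -> D) a b : mrev g -> vt a = vt b -> vt (rev (g a)) = vt (rev (g b)).
Proof.
move=> [h1 h2]; have hr c : rev (g (rot c)) = rot' (rev (g c)).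
  by rewrite -{1}(revK c) -[rot _]/(fnext _) h2 h1 /fprev revK.
by move=> /eqP; rewrite vt_eq => /or3P[] /eqP->; rewrite ?hr /rot' ?vt_rot.
Qed.

Theorem icosahedral_isog k : 0 < k -> #|V| = 60 * k ^ 2 -> tau_odd adj = 12 * k -> Aut_graph adj \isog Ih.
Proof.
move=> k0 cV et; have [F [h1 h2 gF lF]] := packing_bound.
(* The packing is squeezed between 2 tau = 24 k and the area bound, so it is extremal. *)
have cF : #|F| = 24 * k.
  have : 5 * #|F| ^ 2 <= 5 * (24 * k) ^ 2 by apply: leq_trans h2 _; rewrite cV; clear; nia.
  by rewrite leq_pmul2l // leq_exp2r // => le; apply/eqP; rewrite eqn_leq le; move: h1; rewrite et; clear; lia.
have [Y [Yd Yc Yu]] := disc_decomposition gF lF k0 (cV : #|vert M| = _) cF.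
have tr := fun a z => @typ_rev M k Y k0 Yd Yc Yu a z; have tt := fun a z => @typ_rot M k k0 a z.
have tf := fun a z z' => @typ_fun M k Y k0 Yd Yu a z z'; have tp := fun a => @typ_pent M k k0 a.
have t0 := fun a z => @typ_zero M k Y k0 Yd a z.
have [|||||||psi [kap [mpsi mk psiM psiI [kk kpsi allm allr]]]] := @icosahedral M (opp k) _ _ _ _ _ _ _ A5T a5 b5 c5
  a5_5 b5_2 b5a5_3 b5_neq1 b5a5_neq1 c5_2 a5c5 b5c5 A5_gen card_A5T simple_A5T.
- by move=> d; exact: (pent_opp k0 tr tt tp t0).
- by move=> d; exact: (opp2 k0 tr tt tf tp t0).
- by move=> d pd0; rewrite !f_opp; exact: (phi3 k0 tr tt tf tp pd0).
- by move=> d1 d2; exact: (rotation_ex tr tt tf tp t0).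
- by move=> d1 d2; exact: (reflection_ex k0 tr tt tf tp t0).
- by move=> g d; exact: maut_opp.
- by move=> g d; exact: (mrev_opp k0 tr tt tf tp t0).
(* The boolean is the orientation sign; [rev] turns the inversion, which preserves the faces of
   darts, back into the action of a graph automorphism. *)
pose Phi (x : A5T * bool) (a : D) : D := if x.2 then rev (psi x.1 (kap a)) else psi x.1 a.
have psir g a : psi g (rev a) = rev (psi g a) by case: (mpsi g) => _.
have kr a : kap (rev a) = rev (kap a) by case: mk.
have PhiM x y a : Phi x (Phi y a) = Phi ((x.1 * y.1)%g, x.2 (+) y.2) a.
  case: x y => g [] [h []]; rewrite /Phi /= ?psiM ?kr ?psir ?revK ?kpsi ?kk //; exact: (@revK M).
have psi1 a : psi 1%g a = a by apply: (maut_inj (mpsi 1%g)); rewrite -psiM mulg1.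
have mpk g : mrev (psi g \o kap) := maut_mrev (mpsi g) mk.
have Phi_neq g h : ~ Phi (g, true) =1 Phi (h, false).
  by move=> e; exact: (orientation (mpsi h) (mpk g) e).
have PhiI x y : Phi x =1 Phi y -> x = y.
  case: x y => g [] [h []] e.
  - congr (_, _); apply: psiI => a; have := e (kap a); rewrite /Phi /= kk; exact: (can_inj (@revK M)).
  - by case: (@Phi_neq g h).
  - by case: (@Phi_neq h g) => a; rewrite e.
  - by congr (_, _); apply: psiI.
have exF p : exists x, p \in Aut_graph adj -> pd p =1 Phi x.
  have [hp|_] := boolP (p \in Aut_graph adj); last by exists (1%g, false).
  case: (pd_sign hp) => [/allm|/allr] [h eh]; first by exists (h, false).
  by exists (h, true) => _ a; apply: (can_inj (@revK M)); rewrite (eh a); apply/esym; exact: (@revK M).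
have [X hX] := fin_all_exists exF.
have surj x : exists2 p, p \in Aut_graph adj & pd p =1 Phi x.
  case: x => g [].
    apply: aut_of_dart.
    - by move=> a b /(can_inj (@revK M))/(mrev_inj (mpk g)).
    - by move=> a; rewrite /Phi /= kr psir.
    - by move=> a b; exact: mrev_vt (mpk g).
  apply: aut_of_dart; first exact: maut_inj (mpsi g).
    exact: psir.
  by move=> a b; exact: (maut_vt (mpsi g)).
pose sg (s : bool) : 'Z_2 := if s then Zp1 else Zp0.
have sgM s t : sg (s (+) t) = (sg s * sg t)%g by case: s; case: t; apply: val_inj.
(* Products of permutations are read from left to right, so [X] reverses products in its first
   component; the inverse corrects this. *)
pose f p : {perm 'I_5} * 'Z_2 := (sgval (X p).1^-1%g, sg (X p).2).
have XM p q : p \in Aut_graph adj -> q \in Aut_graph adj -> X (p * q)%g = (((X q).1 * (X p).1)%g, (X q).2 (+) (X p).2).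
  move=> hp hq; have [hpq e] := pd_comp hp hq; apply: PhiI => a.
  by rewrite -hX // e (hX _ hq) (hX _ hp) PhiM.
have X1 p : p \in Aut_graph adj -> X p = (1%g, false) -> p = 1%g.
  move=> hp e; have [h1' e1] := pd1; apply: pd_eq => // a; rewrite hX // e e1; exact: psi1.
have X11 : X 1%g = (1%g, false).
  by have [h1' e1] := pd1; apply: PhiI => a; rewrite -hX // e1; apply/esym/psi1.
apply/existsP; exists [ffun p => f p]; apply/andP; split.
  apply/forall_inP=> -[p q] /andP[/= hp hq]; rewrite !ffunE /f XM //=; apply/eqP.
  by congr pair; [rewrite invMg|rewrite addbC sgM].
apply/eqP/setP=> -[y t]; apply/imsetP/idP=> [[p]|].
  move=> /setD1P[p1 hp] ->; rewrite ffunE /f; apply/setD1P; split.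
    apply: contra p1 => /eqP[e1 e2]; apply/eqP; apply: X1 => //.
    case: (X p) e1 e2 => g [] //= e1 _; congr pair.
    by apply: invg_inj; rewrite invg1; apply: sgval_inj5.
  by rewrite /Ih in_setX subgP in_setT.
move=> /setD1P[ne]; rewrite /Ih in_setX => /andP[/= yA _].
have [p hp ep] := surj ((subg _ y)^-1%g, t != Zp0).
have Xp : X p = ((subg _ y)^-1%g, t != Zp0) by apply: PhiI => a; rewrite -hX // ep.
have fp : f p = (y, t).
  rewrite /f Xp /= invgK subgK //; congr pair; rewrite /sg.
  by case: t {ne Xp ep} => -[|[|t]] ht //=; apply: val_inj.
exists p; last by rewrite ffunE fp.
apply/setD1P; split=> //.
apply: contra ne => /eqP e; rewrite -fp e /f X11 [(_, _).1]/= invg1; exact: eqxx.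
Qed.

Lemma card_Ih : #|Ih| = 120.
Proof. by rewrite cardsX card_Alt5 cardsT card_ord. Qed.

(** An automorphism is determined by its sign and the image of one pentagon dart. There are 60 darts
    and two signs, so an order of 120 forces every combination to occur, which supplies all
    rotations and the reflection at [d0]. *)
Theorem icosahedral_tau k : 0 < k -> #|V| = 60 * k ^ 2 -> Aut_graph adj \isog Ih -> tau_odd adj = 12 * k.
Proof.
move=> k0 cV iso.
have c120 : #|Aut_graph adj| = 120.
  by have := @card_isog _ _ (Group Aut_group_set) (setX_group 'Alt_('I_5) [set: 'Z_2]) iso => /= ->; exact: card_Ih.
have [d0 pd0] : exists d : D, pent (fc d).
  have : 0 < #|[set d : D | pent (fc d)]| by rewrite card_pent_darts.
  by case/card_gt0P=> d; rewrite inE; exists d.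
have sgE p : exists s : bool, p \in Aut_graph adj -> if s then mrev (fun a : D => rev (pd p a : D)) else maut (pd p : D -> D).
  have [hp|_] := boolP (p \in Aut_graph adj); last by exists true.
  by case: (pd_sign hp) => h; [exists false|exists true].
have [s hs] := fin_all_exists sgE.
pose im p : D * bool := (if s p then rev (pd p d0 : D) else pd p d0, s p).
have inj : {in Aut_graph adj &, injective im}.
  move=> p q hp hq [e1 e2]; apply: pd_eq => // a; move: e1 (hs p hp) (hs q hq); rewrite e2.
  case: (s q) => e m1 m2; last exact: maut_eq m1 m2 e a.
  by apply: (can_inj (@revK M)); exact: (mrev_eq (a := d0) m1 m2 e a).
have onto (x : D * bool) : pent (fc x.1) -> exists2 p, p \in Aut_graph adj & im p = x.
  move=> px; have : im @: Aut_graph adj = setX [set d : D | pent (fc d)] [set: bool].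
    apply/eqP; rewrite eqEcard card_in_imset // c120 cardsX card_pent_darts cardsT card_bool leqnn andbT.
    apply/subsetP=> _ /imsetP[p hp ->]; rewrite !inE andbT /im /=; have := hs p hp.
    by case: (s p) => m; [exact: (mrev_pent m pd0)|exact: (maut_pent m pd0)].
  by move/setP/(_ x); rewrite !inE px => /imsetP[p hp ->]; exists p.
have H1 d : pent (fc d) -> exists2 g, maut g & g d0 = d.
  move=> pd1'; have [p hp] := onto (d, false) pd1'; rewrite /im => -[e es].
  by exists (pd p); have := hs p hp; rewrite es in e *.
have H2 : exists kap : D -> D, [/\ forall a, kap (rev a) = rev (kap a), forall a, kap (fnext a) = fprev (kap a) & kap d0 = d0].
  have [p hp] := onto (d0, true) pd0; rewrite /im => -[e es].
  by exists (fun a : D => rev (pd p a : D)); have := hs p hp; rewrite es in e * => -[q1 q2].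
have [S eS] := tau_ge irr sym cub con rs eul fsz.
have := @symmetric_lower_bound M k k0 cV d0 pd0 H1 H2 S; rewrite -eS => lo.
have hi : 5 * tau_odd adj ^ 2 <= 5 * (12 * k) ^ 2 by apply: leq_trans tau_bound _; rewrite cV; clear; nia.
by apply/eqP; rewrite eqn_leq; move: hi; rewrite leq_pmul2l // leq_exp2r // => ->; move: lo; clear; lia.
Qed.

End Main.

Import Order.TTheory GRing.Theory Num.Theory.
Local Open Scope ring_scope.

Theorem theorem1p1 (V : finType) (adj : rel V) :
  fullerene adj ->
  ((tau_odd adj)%:R <= sqrtC (12%:R / 5%:R * #|V|%:R :> algC)) /\
  ((tau_odd adj)%:R = sqrtC (12%:R / 5%:R * #|V|%:R :> algC) <->
     (exists k : nat, (0 < k)%N /\ #|V| = (60 * k ^ 2)%N) /\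
     (Aut_graph adj \isog Ih)).
Proof.
case=> -[irr sym] cub con br [rho [[rs eul] fsz]]; split.
  by rewrite sq_bound; exact: (tau_bound irr sym cub con rs eul fsz).
rewrite sq_eq; split=> [e|[[k [k0 cV]] iso]].
  have [k [k0 cV et]] := tau_tight irr sym cub con rs eul fsz e.
  by split; [exists k|exact: (icosahedral_isog irr sym cub con br rs eul fsz k0 cV et)].
rewrite (icosahedral_tau irr sym cub con br rs eul fsz k0 cV iso) cV; lia.
Qed.
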